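(* Let $m_1,m_2,m_3>0$ and $h>0$. Given two (distinct) points $q_0$ and $q_1$ in the Hill region $Q_h$, a JM minimizer exists for the fixed endpoint problem of minimizing $A_{JM}(\gamma)$ among all paths $\gamma$ lying in the Hill region and connecting $q_0$ to $q_1$. Any such minimizer is collision-free except possibly at its endpoints. If a minimizer does not touch the Hill boundary (except possibly at one endpoint), then after reparametrization it is a solution with energy $-h$.
   Context: Planar Newtonian three-body problem with positions $q_i\in\mathbb{C}$, center of mass at $0$, $r_{ij}=|q_i-q_j|$, $U=\sum_{i<j}m_im_j/r_{ij}$, equations $m_i\ddot q_i=\nabla_{q_i}U$. Set $\xi_1=q_2-q_1$, $\xi_2=q_3-\frac{m_1q_1+m_2q_2}{m_1+m_2}$, $\mu_1=\frac{m_1m_2}{m_1+m_2}$, $\mu_2=\frac{(m_1+m_2)m_3}{m_1+m_2+m_3}$, $\|\xi\|^2=\mu_1|\xi_1|^2+\mu_2|\xi_2|^2$, $r=\|\xi\|$. Configurations modulo translations and rotations are described by $r\ge0$ and the shape $[\xi_1,\xi_2]\in\mathbb{CP}^1$, with $r=0$ collapsed to one point, the triple collision; the points $q_0,q_1$ are points of this reduced space. The reduced (zero angular momentum) kinetic energy is $K_0=\frac12\dot r^2+\frac12r^2\frac{\mu_1\mu_2}{\|\xi\|^4}|\xi_1\dot\xi_2-\xi_2\dot\xi_1|^2$. Hill region: $Q_h=\{U\ge h\}$ (collisions included); Hill boundary: $\partial Q_h=\{U=h\}$. For a rectifiable curve $\gamma:[t_0,t_1]\to Q_h$ (rectifiable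 for the distance of the metric $2K_0$) the Jacobi–Maupertuis action is $A_{JM}(\gamma)=\int_{t_0}^{t_1}\sqrt{K_0}\sqrt{2(U-h)}\,dt$, independent of parametrization; curves are considered up to reparametrization. A JM minimizer is a rectifiable curve in $Q_h$ minimizing $A_{JM}$ among the competing rectifiable curves in $Q_h$. ''Solution'' means the projection to the reduced space of a zero angular momentum solution of Newton's equations of energy $-h$. *)

(* Defs.v *)
From HB Require Import structures.
From mathcomp Require Import all_boot all_order all_algebra.
From mathcomp Require Import generic_quotient.
From mathcomp Require Import complex.
From mathcomp Require Import all_classical all_reals all_analysis.

Set Implicit Arguments.
Unset Strict Implicit.
Unset Printing Implicit Defensive.

Import Order.TTheory GRing.Theory Num.Theory.
Import numFieldNormedType.Exports.
Import ComplexField Normc.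

Local Open Scope classical_set_scope.
Local Open Scope ring_scope.
Local Open Scope complex_scope.
Local Open Scope quotient_scope.

Local Notation Re := (@complex.Re _).
Local Notation Im := (@complex.Im _).

Definition b1 : 'I_3 := @Ordinal 3 0 isT.
Definition b2 : 'I_3 := @Ordinal 3 1 isT.
Definition b3 : 'I_3 := @Ordinal 3 2 isT.

Definition config (R : realType) := 'I_3 -> R[i].

Definition at_time (R : realType) (Q : 'I_3 -> R -> R[i]) (t : R) : config R :=
  fun i => Q i t.

Definition congruent (R : realType) (q q' : config R) : bool :=
  `[< exists u c : R[i], normc u = 1 /\ forall i, q' i = u * q i + c >].

Lemma congruent_refl (R : realType) : reflexive (@congruent R).
Proof.
move=> q; apply/asboolP; exists 1, 0; split; first exact: normc1.
by move=> i; rewrite mul1r addr0.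
Qed.

Lemma congruent_subsym (R : realType) (q q' : config R) :
  congruent q q' -> congruent q' q.
Proof.
move=> /asboolP[u [c [u1 qq']]].
have u0 : u != 0.
  by apply/eqP => u0; move: u1; rewrite u0 normc0 => /esym/eqP; rewrite oner_eq0.
apply/asboolP; exists u^-1, (- (u^-1 * c)); split.
  by rewrite normcV u1 invr1.
by move=> i; rewrite qq' mulrDr mulKf// addrK.
Qed.

Lemma congruent_sym (R : realType) : symmetric (@congruent R).
Proof. by move=> q q'; apply/idP/idP; exact: congruent_subsym. Qed.

Lemma congruent_trans (R : realType) : transitive (@congruent R).
Proof.
move=> y x z /asboolP[u [c [u1 xy]]] /asboolP[v [d [v1 yz]]].
apply/asboolP; exists (v * u), (v * c + d); split.
  by rewrite normcM u1 v1 mul1r.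
by move=> i; rewrite yz xy mulrDr mulrA addrA.
Qed.

Definition congruent_equiv (R : realType) : equiv_rel (config R) :=
  EquivRel (@congruent R) (@congruent_refl R) (@congruent_sym R)
    (@congruent_trans R).

(* Configurations modulo translations and rotations. In Jacobi coordinates this
   is C^2 modulo the unit circle, i.e. the pairs (r, [xi1, xi2]) with r = 0
   collapsed to one point. *)
Definition reduced (R : realType) := {eq_quot (congruent_equiv R)}.

Definition reduced_proj (R : realType) (q : config R) : reduced R := \pi_(reduced R) q.

(* The inverse of 0 in \bar R is +oo, so the potential is +oo exactly at
   collisions when the masses are positive. *)
Definition potential (R : realType) (m : 'I_3 -> R) (q : config R) : \bar R :=
  (\sum_(i < 3) \sum_(j < 3 | (i < j)%N)
     (m i * m j)%:E / (normc (q i - q j))%:E)%E.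

Definition collision (R : realType) (q : config R) : Prop :=
  exists i j : 'I_3, i != j /\ q i = q j.

(* potential and collision are constant on congruence classes. *)
Definition rpotential (R : realType) (m : 'I_3 -> R) (p : reduced R) : \bar R :=
  potential m (repr p).

Definition rcollision (R : realType) (p : reduced R) : Prop :=
  collision (repr p).

Definition hill_region (R : realType) (m : 'I_3 -> R) (h : R) : set (reduced R) :=
  [set p | (h%:E <= rpotential m p)%E].

Definition hill_boundary (R : realType) (m : 'I_3 -> R) (h : R) :
    set (reduced R) :=
  [set p | rpotential m p = h%:E].

Definition jacobi1 (R : realType) (q : config R) : R[i] := q b2 - q b1.

Definition jacobi2 (R : realType) (m : 'I_3 -> R) (q : config R) : R[i] :=
  q b3 - ((m b1)%:C * q b1 + (m b2)%:C * q b2) / (m b1 + m b2)%:C.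

Definition mu1 (R : realType) (m : 'I_3 -> R) : R :=
  m b1 * m b2 / (m b1 + m b2).

Definition mu2 (R : realType) (m : 'I_3 -> R) : R :=
  (m b1 + m b2) * m b3 / (m b1 + m b2 + m b3).

Definition config_norm (R : realType) (m : 'I_3 -> R) (q : config R) : R :=
  Num.sqrt (mu1 m * normc (jacobi1 q) ^+ 2 + mu2 m * normc (jacobi2 m q) ^+ 2).

Definition cderivable (R : realType) (f : R -> R[i]) (t : R) : Prop :=
  derivable (Re \o f) t 1 /\ derivable (Im \o f) t 1.

Definition cderive (R : realType) (f : R -> R[i]) (t : R) : R[i] :=
  derive1 (Re \o f) t +i* derive1 (Im \o f) t.

(* K_0 at time t along the projection of the curve Q. *)
Definition kinetic_lift (R : realType) (m : 'I_3 -> R)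
    (Q : 'I_3 -> R -> R[i]) (t : R) : R :=
  let r s := config_norm m (at_time Q s) in
  let xi1 s := jacobi1 (at_time Q s) in
  let xi2 s := jacobi2 m (at_time Q s) in
  2^-1 * (derive1 r t) ^+ 2 +
  2^-1 * (r t) ^+ 2 * (mu1 m * mu2 m / (r t) ^+ 4) *
    normc (xi1 t * cderive xi2 t - xi2 t * cderive xi1 t) ^+ 2.

(* K_0 at time t along a curve g of the reduced space: g is lifted near t to
   configurations depending differentiably on time at t. All such lifts give the
   same value; the value is 0 if there is none, which along an absolutely
   continuous curve happens only for t in a null set. *)
Definition kinetic (R : realType) (m : 'I_3 -> R) (g : R -> reduced R) (t : R) :
    R :=
  xget 0 [set k | exists Q : 'I_3 -> R -> R[i],
    [/\ (\forall s \near t, reduced_proj (at_time Q s) = g s),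
        (forall i, cderivable (Q i) t) &
        k = kinetic_lift m Q t]].

Definition C1_curve (R : realType) (Q : 'I_3 -> R -> R[i]) : Prop :=
  forall i, [/\ (forall t, cderivable (Q i) t),
    continuous (Re \o cderive (Q i)) &
    continuous (Im \o cderive (Q i))].

Definition metric_length (R : realType) (m : 'I_3 -> R)
    (Q : 'I_3 -> R -> R[i]) : \bar R :=
  (\int[lebesgue_measure]_(t in `[0%R, 1%R])
     (Num.sqrt (2 * kinetic_lift m Q t))%:E)%E.

Definition rdist (R : realType) (m : 'I_3 -> R) (p p' : reduced R) : R :=
  fine (ereal_inf [set l | exists Q : 'I_3 -> R -> R[i],
    [/\ C1_curve Q, reduced_proj (at_time Q 0) = p, reduced_proj (at_time Q 1) = p' &
        l = metric_length m Q]]).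

Definition abs_continuous (R : realType) (m : 'I_3 -> R) (g : R -> reduced R)
    (t0 t1 : R) : Prop :=
  forall e : R, 0 < e -> exists2 d : R, 0 < d &
    forall (n : nat) (a b : 'I_n -> R),
      (forall i, [/\ t0 <= a i, a i <= b i & b i <= t1]) ->
      (forall i j, i != j -> b i <= a j \/ b j <= a i) ->
      \sum_(i < n) (b i - a i) < d ->
      \sum_(i < n) rdist m (g (a i)) (g (b i)) < e.

(* Rectifiable curves from q0 to q1 in the Hill region. A curve is considered up
   to reparametrization and is represented by an absolutely continuous
   parametrization: such a parametrization has finite length, every rectifiable
   curve has one (arc length), and absolute continuity is what makes the
   integral defining the action independent of the parametrization (it would
   vanish along a Cantor-type parametrization). *)
Definition rectifiable_path (R : realType) (m : 'I_3 -> R) (h : R)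
    (q0 q1 : reduced R) (g : R -> reduced R) (t0 t1 : R) : Prop :=
  [/\ t0 < t1, abs_continuous m g t0 t1,
      (forall t, t0 <= t <= t1 -> hill_region m h (g t)),
      g t0 = q0 & g t1 = q1].

(* At collision times the integrand is +oo, unless K_0 = 0, where it is 0. *)
Definition JM_action (R : realType) (m : 'I_3 -> R) (h : R) (g : R -> reduced R)
    (t0 t1 : R) : \bar R :=
  (\int[lebesgue_measure]_(t in `[t0, t1])
     ((Num.sqrt (kinetic m g t))%:E *
      sqrte (2%:E * (rpotential m (g t) - h%:E))))%E.

Definition JM_minimizer (R : realType) (m : 'I_3 -> R) (h : R)
    (q0 q1 : reduced R) (g : R -> reduced R) (t0 t1 : R) : Prop :=
  rectifiable_path m h q0 q1 g t0 t1 /\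
  forall (k : R -> reduced R) (s0 s1 : R),
    rectifiable_path m h q0 q1 k s0 s1 ->
    (JM_action m h g t0 t1 <= JM_action m h k s0 s1)%E.

(* Parameters representing the initial (final) endpoint of a curve that may
   pause there. *)
Definition at_start (R : realType) (g : R -> reduced R) (t0 t1 t : R) : Prop :=
  forall s, t0 <= s <= t -> g s = g t0.

Definition at_end (R : realType) (g : R -> reduced R) (t0 t1 t : R) : Prop :=
  forall s, t <= s <= t1 -> g s = g t1.

Definition collision_free_inside (R : realType) (g : R -> reduced R)
    (t0 t1 : R) : Prop :=
  forall t, t0 <= t <= t1 -> rcollision (g t) ->
    at_start g t0 t1 t \/ at_end g t0 t1 t.

Definition avoids_hill_boundary (R : realType) (m : 'I_3 -> R) (h : R)
    (g : R -> reduced R) (t0 t1 : R) : Prop :=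
  (forall t, t0 <= t <= t1 -> hill_boundary m h (g t) -> at_start g t0 t1 t) \/
  (forall t, t0 <= t <= t1 -> hill_boundary m h (g t) -> at_end g t0 t1 t).

(* Complex vector of the partial derivatives of U in the coordinates of q i. *)
Definition grad_potential (R : realType) (m : 'I_3 -> R) (q : config R)
    (i : 'I_3) : R[i] :=
  let U z := fine (potential m (fun j => if j == i then q j + z else q j)) in
  derive1 (fun x : R => U (x +i* 0)) 0 +i* derive1 (fun y : R => U (0 +i* y)) 0.

(* l is the derivative at s of the restriction of f to J (one-sided at an
   endpoint of an interval J). *)
Definition deriv_within (R : realType) (J : set R) (f : R -> R[i]) (s : R)
    (l : R[i]) : Prop :=
  ((Re (f u) - Re (f s)) / (u - s) @[u --> within J s^']
     --> Re l) /\
  ((Im (f u) - Im (f s)) / (u - s) @[u --> within J s^']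
     --> Im l).

Definition newton_solution (R : realType) (m : 'I_3 -> R) (h : R) (J : set R)
    (Q : 'I_3 -> R -> R[i]) : Prop :=
  exists V A : 'I_3 -> R -> R[i], forall s, J s ->
    [/\ ~ collision (at_time Q s),
        (forall i, [/\ deriv_within J (Q i) s (V i s),
                       deriv_within J (V i) s (A i s) &
                       (m i)%:C * A i s = grad_potential m (at_time Q s) i]),
        \sum_(i < 3) (m i)%:C * Q i s = 0,
        \sum_(i < 3) m i * Im (conjc (Q i s) * V i s) = 0 &
        ((\sum_(i < 3) 2^-1 * m i * normc (V i s) ^+ 2)%R%:E
           - potential m (at_time Q s) = (- h)%:E)%E].

(* k is, on [s0, s1], the projection of a solution, which is continuous on
   [s0, s1] and solves Newton's equations there except at those of the endpoints
   s0, s1 that are collisions. *)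
Definition reduced_solution (R : realType) (m : 'I_3 -> R) (h : R)
    (k : R -> reduced R) (s0 s1 : R) : Prop :=
  exists Q : 'I_3 -> R -> R[i],
    [/\ (forall s, s0 <= s <= s1 -> k s = reduced_proj (at_time Q s)),
        (forall i, {within `[s0, s1], continuous (Re \o Q i)} /\
                   {within `[s0, s1], continuous (Im \o Q i)}),
        (forall s, s0 < s < s1 -> ~ collision (at_time Q s)) &
        newton_solution m h
          [set s | s0 <= s <= s1 /\ ~ collision (at_time Q s)] Q].

Definition reparametrization (R : realType) (g : R -> reduced R) (t0 t1 : R)
    (k : R -> reduced R) (s0 s1 : R) : Prop :=
  exists sigma : R -> R,
    [/\ {within `[t0, t1], continuous sigma},
        {in `[t0, t1] &, {homo sigma : t t' / t <= t'}},
        sigma t0 = s0, sigma t1 = s1 &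
        forall t, t0 <= t <= t1 -> g t = k (sigma t)].

(* Main.v *)
(* The action is the length for the metric (U - h) times that of the reduced
   space. Minimizing sequences with uniformly Lipschitz arc length parametrizations
   have convergent subsequences; they exist because a point near the Hill boundary
   is joined to it cheaply, and motion inside the boundary costs nothing. Collisions
   inside a minimizer are removed by explicit local competitors. Away from the
   boundary, reparametrize by time, ds = sqrt(2 (U - h)) dt: variations by hat
   functions give a second difference identity, hence Newton's equations; that length
   equals the integral of the speed gives energy -h and zero angular momentum. *)

From HB Require Import structures.
From mathcomp Require Import all_boot all_order all_algebra.
From mathcomp Require Import generic_quotient complex.
From mathcomp Require Import all_classical all_reals all_analysis.
From mathcomp Require Import measurable_realfun.
From mathcomp Require Import ring lra.
Require Import Defs.

Set Implicit Arguments.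
Unset Strict Implicit.
Unset Printing Implicit Defensive.

Import Order.TTheory GRing.Theory Num.Theory.
Import numFieldNormedType.Exports.
Import ComplexField Normc.

Local Open Scope classical_set_scope.
Local Open Scope ring_scope.
Local Open Scope complex_scope.
Local Open Scope quotient_scope.

Local Notation Re := (@complex.Re _).
Local Notation Im := (@complex.Im _).
Local Notation sqrt := Num.sqrt.

(* Forgets the hypotheses introduced after a marker of type True: lra is slow in
  large contexts. *)
Ltac only_lra := repeat match goal with H : ?P |- _ =>
 lazymatch P with True => fail 1 | _ => clear H end end; lra.
Ltac split_lra := apply/andP; split; lra.

(** * The Hermitian mass form on configurations and the distance between congruence classes *)

Section ConfigAlgebra.
Context {R : realType}.
Variable m : 'I_3 -> R.
Hypothesis m_gt0 : forall i, 0 < m i.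
Implicit Types q p : config R.

(** The conformal factor vanishes on the Hill boundary and is infinite at collisions, so bounded
    action does not bound length, and the action cannot be handled as an ordinary integral. Hence
    the length for the weight [om] is a supremum of lower sums, which needs only a lower
    semicontinuous weight. Dilating a configuration of size [r] to the boundary costs at most
    [r (U - h)^(3/2) / h]; read backwards, [om] is at least of the order of the cube root of the
    cost of leaving. This one estimate bounds the length of minimizing sequences and also shows that
    a solution reaches the boundary in finite time. Near an interior collision the minimizer would
    cost about [2 I sqrt t] on [[th - t, th + t]], so any competitor with a constant below 2
    suffices; at a binary collision it comes from Levi-Civita's substitution [xi_1 = z^2]. Curves
    are lifted to configurations by successive alignment, without differentiating them. Variations
    are tested in one fixed direction with piecewise affine amplitude, so Newton's equations appear
    without prior regularity. A lift with angular momentum would be strictly longer than its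
    projection. *)

Definition sepr q i j : R := Re (q i) - Re (q j).
Definition sepi q i j : R := Im (q i) - Im (q j).
Definition sep q i j : R := normc (q i - q j).

(** By Lagrange's identity the moment of inertia about the center of mass is the sum of [wgt i j]
    times the squared distance over the three pairs. These weights give a translation invariant form
    that treats the bodies symmetrically. *)
Definition wgt i j : R := m i * m j / (m b1 + m b2 + m b3).

(** [hre] and [him] are the real and imaginary parts of the Hermitian mass form, linear in the first
    argument. A velocity is orthogonal to rotations exactly when its [him] with the position
    vanishes. *)
Definition hre q p : R :=
 wgt b1 b2 * (sepr q b1 b2 * sepr p b1 b2 + sepi q b1 b2 * sepi p b1 b2) +
 wgt b1 b3 * (sepr q b1 b3 * sepr p b1 b3 + sepi q b1 b3 * sepi p b1 b3) +
 wgt b2 b3 * (sepr q b2 b3 * sepr p b2 b3 + sepi q b2 b3 * sepi p b2 b3).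

Definition him q p : R :=
 wgt b1 b2 * (sepi q b1 b2 * sepr p b1 b2 - sepr q b1 b2 * sepi p b1 b2) +
 wgt b1 b3 * (sepi q b1 b3 * sepr p b1 b3 - sepr q b1 b3 * sepi p b1 b3) +
 wgt b2 b3 * (sepi q b2 b3 * sepr p b2 b3 - sepr q b2 b3 * sepi p b2 b3).

Definition hnorm q : R := sqrt (hre q q).

Definition habs q p : R := sqrt (hre q p ^+ 2 + him q p ^+ 2).

Definition csub q p : config R := fun i => q i - p i.
Definition cadd q p : config R := fun i => q i + p i.
Definition cscale (a : R) q : config R := fun i => a%:C * q i.
Definition crot (u : R[i]) q : config R := fun i => u * q i.

(* The distance of the orbits of q and p under translations and rotations:
  the minimum over unit u of hnorm (q - u p). *)
Definition qdist q p : R := sqrt (hre q q + hre p p - 2 * habs q p).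

(** [wedr] and [wedi] are the real and imaginary parts of the complex determinant of [q] and [p] in
    the differences of bodies 1, 2 and 1, 3; [wwgt] is the Gram determinant of the mass form in
    these coordinates. *)
Definition wedr q p : R :=
 sepr q b1 b2 * sepr p b1 b3 - sepi q b1 b2 * sepi p b1 b3 -
 (sepr q b1 b3 * sepr p b1 b2 - sepi q b1 b3 * sepi p b1 b2).
Definition wedi q p : R :=
 sepr q b1 b2 * sepi p b1 b3 + sepi q b1 b2 * sepr p b1 b3 -
 (sepr q b1 b3 * sepi p b1 b2 + sepi q b1 b3 * sepr p b1 b2).
Definition wwgt : R :=
 wgt b1 b2 * wgt b1 b3 + wgt b1 b2 * wgt b2 b3 + wgt b1 b3 * wgt b2 b3.

Lemma normcsq (z : R[i]) : normc z ^+ 2 = Re z ^+ 2 + Im z ^+ 2.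
Proof. by case: z => a b /=; rewrite sqr_sqrtr// addr_ge0// sqr_ge0. Qed.

Lemma normc_ge0' (z : R[i]) : 0 <= normc z.
Proof. by case: z => a b; apply: sqrtr_ge0. Qed.

Lemma reB (x y : R[i]) : Re (x - y) = Re x - Re y. Proof. by case: x y => ? ? []. Qed.
Lemma imB (x y : R[i]) : Im (x - y) = Im x - Im y. Proof. by case: x y => ? ? []. Qed.
Lemma reD (x y : R[i]) : Re (x + y) = Re x + Re y. Proof. by case: x y => ? ? []. Qed.
Lemma imD (x y : R[i]) : Im (x + y) = Im x + Im y. Proof. by case: x y => ? ? []. Qed.
Lemma reM (x y : R[i]) : Re (x * y) = Re x * Re y - Im x * Im y.
Proof. by case: x y => ? ? []. Qed.
Lemma imM (x y : R[i]) : Im (x * y) = Re x * Im y + Im x * Re y.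
Proof. by case: x y => ? ? []. Qed.
Definition ReImE := (reB, imB, reD, imD, reM, imM).

Lemma wgt_gt0 i j : 0 < wgt i j.
Proof. by rewrite /wgt divr_gt0 ?mulr_gt0 ?addr_gt0. Qed.

Lemma wwgt_gt0 : 0 < wwgt.
Proof. by rewrite /wwgt !addr_gt0// mulr_gt0// wgt_gt0. Qed.

Lemma sepE q i j : sep q i j ^+ 2 = sepr q i j ^+ 2 + sepi q i j ^+ 2.
Proof. by rewrite /sep normcsq !ReImE. Qed.

Lemma sep_ge0 q i j : 0 <= sep q i j. Proof. exact: normc_ge0'. Qed.

Lemma sepC q i j : sep q i j = sep q j i.
Proof. by rewrite /sep -opprB normcN. Qed.

Lemma hre_sep q : hre q q = wgt b1 b2 * sep q b1 b2 ^+ 2 +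
 wgt b1 b3 * sep q b1 b3 ^+ 2 + wgt b2 b3 * sep q b2 b3 ^+ 2.
Proof. by rewrite /hre !sepE; ring. Qed.

Lemma hre_ge0 q : 0 <= hre q q.
Proof.
by rewrite hre_sep !addr_ge0// mulr_ge0 ?sqr_ge0// ltW// wgt_gt0.
Qed.

Lemma hnorm_sq q : hnorm q ^+ 2 = hre q q.
Proof. by rewrite sqr_sqrtr// hre_ge0. Qed.

Lemma hnorm_ge0 q : 0 <= hnorm q. Proof. exact: sqrtr_ge0. Qed.

Lemma habs_sq q p : habs q p ^+ 2 = hre q p ^+ 2 + him q p ^+ 2.
Proof. by rewrite sqr_sqrtr// addr_ge0// sqr_ge0. Qed.

Lemma habs_ge0 q p : 0 <= habs q p. Proof. exact: sqrtr_ge0. Qed.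

Lemma hreC q p : hre q p = hre p q. Proof. by rewrite /hre; ring. Qed.
Lemma himC q p : him q p = - him p q. Proof. by rewrite /him; ring. Qed.
Lemma habsC q p : habs q p = habs p q.
Proof. by rewrite /habs hreC himC sqrrN. Qed.

Lemma qdistC q p : qdist q p = qdist p q.
Proof. by rewrite /qdist habsC (addrC (hre q q)). Qed.

(** The Gram determinant identity in complex dimension two: the last term is the exact defect in the
    Cauchy-Schwarz inequality. *)
Lemma lagrange q p :
 hre q q * hre p p =
 hre q p ^+ 2 + him q p ^+ 2 + wwgt * (wedr q p ^+ 2 + wedi q p ^+ 2).
Proof. by rewrite /hre /him /wwgt /wedr /wedi /sepr /sepi; ring. Qed.

Lemma cauchy_schwarz q p : habs q p <= hnorm q * hnorm p.
Proof.
rewrite -(ler_pXn2r (n:=2)) ?nnegrE ?habs_ge0 ?mulr_ge0 ?hnorm_ge0//.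
rewrite habs_sq exprMn !hnorm_sq lagrange lerDl.
by rewrite mulr_ge0 ?(ltW wwgt_gt0)// addr_ge0// sqr_ge0.
Qed.

Lemma hre_le q p : hre q p <= hnorm q * hnorm p.
Proof.
apply: le_trans (cauchy_schwarz q p).
apply: (le_trans (ler_norm _)).
rewrite -(ler_pXn2r (n:=2)) ?nnegrE ?habs_ge0 ?normr_ge0//.
by rewrite habs_sq real_normK ?num_real// lerDl sqr_ge0.
Qed.

Lemma qdist_arg_ge q p : (hnorm q - hnorm p) ^+ 2 <= hre q q + hre p p - 2 * habs q p.
Proof.
have := cauchy_schwarz q p; rewrite -(hnorm_sq q) -(hnorm_sq p); nra.
Qed.

Lemma qdist_sq q p : qdist q p ^+ 2 = hre q q + hre p p - 2 * habs q p.
Proof. by rewrite sqr_sqrtr//; apply: le_trans (qdist_arg_ge q p); exact: sqr_ge0. Qed.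

Lemma qdist_ge0 q p : 0 <= qdist q p. Proof. exact: sqrtr_ge0. Qed.

Lemma ler_sqr2 (a b : R) : 0 <= b -> a ^+ 2 <= b ^+ 2 -> a <= b.
Proof.
by move=> b0 ab; rewrite leNgt; apply/negP => ba; move: ab; nra.
Qed.

Lemma hnorm_qdist q p : `|hnorm q - hnorm p| <= qdist q p.
Proof.
apply: ler_sqr2; first exact: qdist_ge0.
by rewrite real_normK ?num_real// qdist_sq qdist_arg_ge.
Qed.

Lemma hre_csub q p : hre (csub q p) (csub q p) = hre q q + hre p p - 2 * hre q p.
Proof. by rewrite /hre /csub /sepr /sepi !ReImE; ring. Qed.

Lemma hre_crot u q p :
 hre q (crot u p) = Re u * hre q p + Im u * him q p.
Proof. by rewrite /hre /him /crot /sepr /sepi !ReImE; ring. Qed.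

Lemma him_crot u q p :
 him q (crot u p) = Re u * him q p - Im u * hre q p.
Proof. by rewrite /hre /him /crot /sepr /sepi !ReImE; ring. Qed.

Lemma unit_sq (u : R[i]) : normc u = 1 -> Re u ^+ 2 + Im u ^+ 2 = 1.
Proof. by move=> u1; rewrite -normcsq u1 expr1n. Qed.

Lemma sq_unit (u : R[i]) : Re u ^+ 2 + Im u ^+ 2 = 1 -> normc u = 1.
Proof. by case: u => a b /= ->; rewrite sqrtr1. Qed.

Lemma hre_crot2 u q : normc u = 1 -> hre (crot u q) (crot u q) = hre q q.
Proof.
move=> /unit_sq u1.
transitivity ((Re u ^+ 2 + Im u ^+ 2) * hre q q); last by rewrite u1 mul1r.
by rewrite /hre /crot /sepr /sepi !ReImE; ring.
Qed.

Lemma habs_crot u q p : normc u = 1 -> habs q (crot u p) = habs q p.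
Proof.
move=> /unit_sq u1; rewrite /habs hre_crot him_crot; congr (sqrt _).
transitivity ((Re u ^+ 2 + Im u ^+ 2) * (hre q p ^+ 2 + him q p ^+ 2)).
 by ring.
by rewrite u1 mul1r.
Qed.

Lemma qdist_crot u q p : normc u = 1 -> qdist q (crot u p) = qdist q p.
Proof. by move=> u1; rewrite /qdist hre_crot2// habs_crot. Qed.

Lemma qdist_le_hnorm q p : qdist q p <= hnorm (csub q p).
Proof.
rewrite /qdist /hnorm hre_csub ler_wsqrtr// lerB// ler_pM2l//.
apply: (le_trans (ler_norm _)).
apply: ler_sqr2; first exact: habs_ge0.
by rewrite habs_sq real_normK ?num_real// lerDl sqr_ge0.
Qed.

(** Rotating by the phase of the Hermitian product turns [hre] into [habs], the largest value that a
    rotation can give. If the product vanishes, every rotation does. *)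
Lemma qdist_align q p : exists2 u : R[i], normc u = 1 &
 hnorm (csub q (crot u p)) = qdist q p.
Proof.
have [h0|h0] := eqVneq (habs q p) 0.
 exists 1; first exact: normc1.
 rewrite /hnorm hre_csub hre_crot2 ?normc1// hre_crot /qdist h0; congr (sqrt _).
 have /eqP := habs_sq q p; rewrite h0 expr0n /= eq_sym paddr_eq0 ?sqr_ge0// !sqrf_eq0.
 by move=> /andP[/eqP -> /eqP ->]; rewrite !(mulr0, addr0).
exists (hre q p / habs q p +i* (him q p / habs q p)).
 apply: sq_unit => /=.
 by rewrite !expr_div_n -mulrDl -habs_sq divff// sqrf_eq0.
rewrite /hnorm hre_csub hre_crot2; last first.
 by apply: sq_unit => /=; rewrite !expr_div_n -mulrDl -habs_sq divff// sqrf_eq0.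
rewrite hre_crot /qdist.
have -> : Re (hre q p / habs q p +i* (him q p / habs q p)) * hre q p +
  Im (hre q p / habs q p +i* (him q p / habs q p)) * him q p = habs q p.
 apply: (mulIf h0); rewrite -[RHS]expr2 habs_sq /=.
 by field.
by [].
Qed.

Lemma hnormD q p : hnorm (cadd q p) <= hnorm q + hnorm p.
Proof.
apply: ler_sqr2; first by rewrite addr_ge0 ?hnorm_ge0.
rewrite sqrrD !hnorm_sq.
suff -> : hre (cadd q p) (cadd q p) = hre q q + hre p p + 2 * hre q p.
 by have := hre_le q p; rewrite mulr2n; lra.
by rewrite /hre /cadd /sepr /sepi !ReImE; ring.
Qed.

Lemma hnorm_crot u q : normc u = 1 -> hnorm (crot u q) = hnorm q.
Proof. by move=> u1; rewrite /hnorm hre_crot2. Qed.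

Lemma hnorm_cscale a q : 0 <= a -> hnorm (cscale a q) = a * hnorm q.
Proof.
move=> a0; rewrite /hnorm.
suff -> : hre (cscale a q) (cscale a q) = a ^+ 2 * hre q q.
 by rewrite sqrtrM ?sqr_ge0// sqrtr_sqr ger0_norm.
by rewrite /hre /cscale /sepr /sepi !ReImE /=; ring.
Qed.

Lemma qdist_triangle q p r : qdist q r <= qdist q p + qdist p r.
Proof.
have [u u1 <-] := qdist_align q p.
have [v v1 <-] := qdist_align p r.
rewrite -(hnorm_crot (csub p _) u1).
apply: le_trans (hnormD _ _).
have -> : cadd (csub q (crot u p)) (crot u (csub p (crot v r))) =
     csub q (crot u (crot v r)).
 by apply/funext => i; rewrite /cadd /csub /crot; ring.
by rewrite -(qdist_crot q r v1) -(qdist_crot q _ u1) qdist_le_hnorm.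
Qed.

Lemma qdist_sym_diff q p r : `|qdist q p - qdist q r| <= qdist p r.
Proof.
have := qdist_triangle q p r; have := qdist_triangle q r p.
by rewrite (qdistC r p) ler_norml => ? ?; lra.
Qed.

Lemma hre_sep_le q : [/\ wgt b1 b2 * sep q b1 b2 ^+ 2 <= hre q q,
 wgt b1 b3 * sep q b1 b3 ^+ 2 <= hre q q & wgt b2 b3 * sep q b2 b3 ^+ 2 <= hre q q].
Proof.
rewrite hre_sep.
have k i j : 0 <= wgt i j * sep q i j ^+ 2.
 by rewrite mulr_ge0 ?sqr_ge0// ltW// wgt_gt0.
by have := k b1 b2; have := k b1 b3; have := k b2 b3; split; lra.
Qed.

Definition sepK : R :=
 (sqrt (wgt b1 b2))^-1 + (sqrt (wgt b1 b3))^-1 + (sqrt (wgt b2 b3))^-1.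

Lemma sepK_gt0 : 0 < sepK.
Proof. by rewrite /sepK !addr_gt0// invr_gt0 sqrtr_gt0 wgt_gt0. Qed.

Lemma sep_le_hnorm q i j : sep q i j <= sepK * hnorm q.
Proof.
have [k1 k2 k3] := hre_sep_le q.
have K w s : 0 < w -> 0 <= s -> w * s ^+ 2 <= hre q q -> s <= (sqrt w)^-1 * hnorm q.
 move=> w0 s0 ws; rewrite ler_pdivlMl ?sqrtr_gt0//.
 apply: ler_sqr2; first exact: hnorm_ge0.
 by rewrite exprMn sqr_sqrtr ?(ltW w0)// hnorm_sq.
have le w s : (sqrt w)^-1 <= sepK -> 0 < w -> 0 <= s -> w * s ^+ 2 <= hre q q -> s <= sepK * hnorm q.
 move=> wK w0 s0 ws; apply: (le_trans (K _ _ w0 s0 ws)).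
 by rewrite ler_wpM2r ?hnorm_ge0.
have p12 : 0 < (sqrt (wgt b1 b2))^-1 by rewrite invr_gt0 sqrtr_gt0 wgt_gt0.
have p13 : 0 < (sqrt (wgt b1 b3))^-1 by rewrite invr_gt0 sqrtr_gt0 wgt_gt0.
have p23 : 0 < (sqrt (wgt b2 b3))^-1 by rewrite invr_gt0 sqrtr_gt0 wgt_gt0.
have s12 : sep q b1 b2 <= sepK * hnorm q.
 by apply: (le _ _ _ (wgt_gt0 b1 b2) (sep_ge0 _ _ _) k1); rewrite /sepK; lra.
have s13 : sep q b1 b3 <= sepK * hnorm q.
 by apply: (le _ _ _ (wgt_gt0 b1 b3) (sep_ge0 _ _ _) k2); rewrite /sepK; lra.
have s23 : sep q b2 b3 <= sepK * hnorm q.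
 by apply: (le _ _ _ (wgt_gt0 b2 b3) (sep_ge0 _ _ _) k3); rewrite /sepK; lra.
have s0 k : sep q k k <= sepK * hnorm q.
 by rewrite /sep subrr normc0 mulr_ge0 ?hnorm_ge0// ltW// sepK_gt0.
have E (k : 'I_3) : [\/ k = b1, k = b2 | k = b3].
 case: k => -[|[|[|//]]] hk; [apply: Or31|apply: Or32|apply: Or33]; exact: val_inj.
by case: (E i) => ->; case: (E j) => ->; rewrite // sepC.
Qed.

Lemma qdist0_rot q p : qdist q p = 0 ->
 exists2 u : R[i], normc u = 1 & forall i j, q i - q j = u * p i - u * p j.
Proof.
move=> d0; have [u u1] := qdist_align q p; rewrite d0 => h0.
exists u => // i j.
have e k l : csub q (crot u p) k - csub q (crot u p) l = 0.
 apply/eq0_normc/eqP; rewrite eq_le normc_ge0' andbT.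
 by have := sep_le_hnorm (csub q (crot u p)) k l; rewrite h0 mulr0.
move: (e b1 b2) (e b1 b3) => e1 e2; rewrite /csub /crot in e1 e2.
have k1 : q b1 - u * p b1 = q b2 - u * p b2 by apply/eqP; rewrite -subr_eq0 e1.
have k2 : q b1 - u * p b1 = q b3 - u * p b3 by apply/eqP; rewrite -subr_eq0 e2.
have kk k : q k - u * p k = q b1 - u * p b1.
 case: k => -[|[|[|//]]] hk.
 - by congr (q _ - u * p _); apply: val_inj.
 - by rewrite k1; congr (q _ - u * p _); apply: val_inj.
 - by rewrite k2; congr (q _ - u * p _); apply: val_inj.
apply/eqP; rewrite -subr_eq0; apply/eqP.
transitivity ((q i - u * p i) - (q j - u * p j)); first by ring.
by rewrite !kk subrr.
Qed.

Lemma congruentP q p : reflect (exists2 u : R[i], normc u = 1 &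
 exists c, forall i, p i = u * q i + c) (congruent q p).
Proof.
apply: (iffP (asboolP _)) => [[u [c [u1 H]]]|[u u1 [c H]]].
 by exists u => //; exists c.
by exists u, c.
Qed.

Lemma qdist_eq0 q p : qdist q p = 0 -> congruent q p.
Proof.
rewrite qdistC => /qdist0_rot[u u1 H]; apply/congruentP; exists u => //.
exists (p b1 - u * q b1) => i; have := H i b1 => /eqP.
by rewrite subr_eq => /eqP ->; ring.
Qed.

Lemma ctrans_sepr q p c : (forall i, p i = q i + c) ->
 (forall i j, sepr p i j = sepr q i j) * (forall i j, sepi p i j = sepi q i j).
Proof. by move=> H; split=> i j; rewrite /sepr /sepi !H !ReImE; ring. Qed.

Lemma congruent_qdist q p r : congruent p r -> qdist q p = qdist q r.
Proof.
move=> /congruentP[u u1 [c H]].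
rewrite -(qdist_crot q p u1).
have [e1 e2] : (forall i j, sepr r i j = sepr (crot u p) i j) *
 (forall i j, sepi r i j = sepi (crot u p) i j) by apply: (ctrans_sepr H).
by rewrite /qdist /habs /hre /him !e1 !e2.
Qed.

Lemma congruent_sep q p i j : congruent q p -> sep p i j = sep q i j.
Proof.
move=> /congruentP[u u1 [c H]].
rewrite /sep !H (_ : _ - _ = u * (q i - q j)); last by ring.
by rewrite normcM u1 mul1r.
Qed.

Lemma config_normE q : config_norm m q = hnorm q.
Proof.
have m1 := m_gt0 b1; have m2 := m_gt0 b2; have m3 := m_gt0 b3.
rewrite /config_norm /hnorm; congr (sqrt _).
rewrite /jacobi1 /jacobi2 !normcsq.
have -> : ((m b1)%:C * q b1 + (m b2)%:C * q b2) / (m b1 + m b2)%:C =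
 ((m b1 / (m b1 + m b2))%:C * q b1 + (m b2 / (m b1 + m b2))%:C * q b2).
 by rewrite !rmorphM /= fmorphV mulrDl -!mulrA ![_^-1 * _]mulrC.
rewrite /hre /mu1 /mu2 /wgt /sepr /sepi !ReImE /=.
by field; apply/andP; split; apply: lt0r_neq0; rewrite ?addr_gt0.
Qed.

Lemma sep_qdist q p i j : `|sep q i j - sep p i j| <= sepK * qdist q p.
Proof.
have [u u1 <-] := qdist_align q p.
have <- : sep (crot u p) i j = sep p i j.
 by rewrite /sep /crot -mulrBr normcM u1 mul1r.
apply: le_trans (sep_le_hnorm _ i j).
have L (x y : R[i]) : `|normc x - normc y| <= normc (x - y).
 rewrite ler_norml lerBrDl lerBlDl.
 have := le_normcD (x - y) y; rewrite subrK => k1.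
 have := le_normcD (y - x) x; rewrite subrK -opprB normcN => k2.
 by split_lra.
by rewrite /sep /csub (_ : q i - _ - _ = (q i - q j) - (crot u p i - crot u p j)) ?L//; ring.
Qed.

End ConfigAlgebra.

Ltac config_ring := apply/funext => i; apply/eqP; rewrite eq_complex !ReImE /=;
 apply/andP; split; apply/eqP; ring.

(** * Derivatives of real functions of one variable *)

Section RealDerivatives.
Context {R : realType}.
Implicit Types (f g : R -> R) (t : R).

Lemma cvg_inv (T : Type) (F : set_system T) {FF : Filter F} (f : T -> R) (a : R) :
 f x @[x --> F] --> a -> a != 0 -> (f x)^-1 @[x --> F] --> a^-1.
Proof. by move=> fa a0; exact: (@cvgV _ _ F FF f a a0 fa). Qed.

Lemma cvg_scal (T : Type) (F : set_system T) {FF : Filter F} (f : T -> R) (k a : R) :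
 f x @[x --> F] --> a -> k * f x @[x --> F] --> k * a.
Proof. by move=> fa; apply: cvgM => //; exact: cvg_cst. Qed.

Lemma is_derive_sub f g t df dg : is_derive t 1 f df -> is_derive t 1 g dg ->
 is_derive t 1 (fun s => f s - g s) (df - dg).
Proof. exact: (@is_deriveB _ _ _ f g). Qed.

Lemma is_derive_add f g t df dg : is_derive t 1 f df -> is_derive t 1 g dg ->
 is_derive t 1 (fun s => f s + g s) (df + dg).
Proof. exact: (@is_deriveD _ _ _ f g). Qed.

Lemma is_derive_scal f (k : R) t df : is_derive t 1 f df ->
 is_derive t 1 (fun s => k * f s) (k * df).
Proof. exact: (@is_deriveZ _ _ _ f k). Qed.

Lemma is_derive_mul f g t df dg : is_derive t 1 f df -> is_derive t 1 g dg ->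
 is_derive t 1 (fun s => f s * g s) (f t * dg + g t * df).
Proof. exact: (@is_deriveM _ _ f g). Qed.

Lemma is_derive_derive1 f t df : is_derive t 1 f df -> derive1 f t = df.
Proof. by move=> H; rewrite derive1E derive_val. Qed.

Lemma derivable_is_derive f t : derivable f t 1 -> is_derive t 1 f (derive1 f t).
Proof. by move=> H; rewrite derive1E; apply: derivableP. Qed.

Lemma is_derive_derivable f t df : is_derive t 1 f df -> derivable f t 1.
Proof. by case. Qed.

Lemma is_derive_cvg f t df : is_derive t 1 f df -> f s @[s --> t] --> f t.
Proof.
move=> /is_derive_derivable/derivable1_diffP/differentiable_continuous.
by [].
Qed.

(** The slope over an interval containing [t] is a convex combination of the slopes from [t] to its
    two ends, and these converge by Caratheodory's criterion. *)
Lemma straddle_cvg f t df (u v : nat -> R) :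
 is_derive t 1 f df -> u n @[n --> \oo] --> t -> v n @[n --> \oo] --> t ->
 (forall n, u n <= t <= v n) -> (forall n, u n < v n) ->
 (f (v n) - f (u n)) / (v n - u n) @[n --> \oo] --> df.
Proof.
move=> /is_derive1_caratheodory[g [fg gc gt]] ut vt utv uv.
have gu : g (u n) @[n --> \oo] --> df by rewrite -gt; apply: (cvg_comp _ _ ut).
have gv : g (v n) @[n --> \oo] --> df by rewrite -gt; apply: (cvg_comp _ _ vt).
apply/cvgrPdist_le => e e0.
near=> n.
have uvn := uv n; have /andP[utn tvn] := utv n.
have d0 : v n - u n != 0 by rewrite subr_eq0 gt_eqF.
have -> : df - (f (v n) - f (u n)) / (v n - u n) =
 ((df - g (v n)) * (v n - t) + (df - g (u n)) * (t - u n)) / (v n - u n).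
 have -> : f (v n) - f (u n) = (f (v n) - f t) - (f (u n) - f t) by ring.
 rewrite !fg.
 by field.
rewrite normrM normfV (gtr0_norm (_ : 0 < v n - u n)) ?subr_gt0//.
rewrite ler_pdivrMr ?subr_gt0//.
apply: (le_trans (ler_normD _ _)); rewrite !normrM.
rewrite (ger0_norm (_ : 0 <= v n - t)) ?subr_ge0//.
rewrite (ger0_norm (_ : 0 <= t - u n)) ?subr_ge0//.
have k1 : `|df - g (v n)| <= e by near: n; apply: (cvgrPdist_le _ _).1 gv _ e0.
have k2 : `|df - g (u n)| <= e by near: n; apply: (cvgrPdist_le _ _).1 gu _ e0.
nra.
Unshelve. all: by end_near. Qed.

Lemma is_derive_sqrt (x : R) : 0 < x -> is_derive x 1 (@Num.sqrt R) (2 * sqrt x)^-1.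
Proof.
move=> x0; have s0 : 0 < sqrt x by rewrite sqrtr_gt0.
apply/is_derive1_caratheodory.
(* The second term is the slope for negative [z], where [sqrt] takes the default value 0. *)
exists (fun z => (sqrt z + sqrt x)^-1 *+ (0 <= z)%R + (sqrt x / (x - z)) *+ (z < 0)%R).
split.
- move=> z; case: ltrP => z0.
  rewrite mulr0n mulr1n add0r ltr0_sqrtr// sub0r.
  have : x - z != 0 by lra.
  by move=> ?; field.
 rewrite mulr0n mulr1n addr0.
 have sz : 0 <= sqrt z by exact: sqrtr_ge0.
 have -> : z - x = (sqrt z - sqrt x) * (sqrt z + sqrt x).
  by rewrite -subr_sqr !sqr_sqrtr// ltW.
 have : sqrt z + sqrt x != 0 by lra.
 by move=> ?; field.
- apply: (cvg_trans (G := (sqrt z + sqrt x)^-1 @[z --> x])).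
  apply: near_eq_cvg; near=> z.
  have z0 : 0 < z by near: z; apply: (cvgr_gt x) => //; exact: cvg_id.
  by rewrite (ltW z0) ltNge (ltW z0) mulr1n mulr0n addr0.
 rewrite (ltW x0) ltNge (ltW x0) mulr1n mulr0n addr0.
 apply: (@cvg_inv _ (nbhs x) _ (fun z => sqrt z + sqrt x)); last by lra.
 by apply: cvgD; [exact: sqrt_continuous|exact: cvg_cst].
- by rewrite (ltW x0) ltNge (ltW x0) mulr1n mulr0n addr0 mulr2n mulrDl !mul1r.
Unshelve. all: by end_near. Qed.

(** Meant for the norm at a triple collision: there it has its minimum 0, and its differentiability
    is not known. *)
Lemma derive1_min0 f t : (forall s, f t <= f s) -> derive1 f t = 0.
Proof.
move=> fmin; have [df|df] := pselect (derivable f t 1); last first.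
 (* Without a derivative, [derive1] is the limit of a divergent filter, whose default value is 0. *)
 rewrite /derive1.
 suff : lim (h^-1 *: (f (h + t) - f t) @[h --> 0^']) = point by [].
 apply: dvgP => H; apply: df; move: H; rewrite /derivable.
 suff -> : (fun h : R => h^-1 *: ((f \o shift t) (h *: (1 : R)) - f t)) =
  (fun h => h^-1 *: (f (h + t) - f t)) by [].
 by apply/funext => h /=; rewrite [_ *: 1]mulr1.
have /derivable_is_derive/is_derive1_caratheodory[g [fg gc <-]] := df.
apply/eqP; rewrite eq_le; apply/andP; split; rewrite leNgt; apply/negP => g0.
- have H : \forall z \near t, 0 < g z by apply: (@cvgr_gt _ _ (nbhs t) _ g (g t)).
 have [e e0 He] : exists2 e, 0 < e & forall z, `|t - z| < e -> 0 < g z.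
  by case: H => e e0 He; exists e => // z ze; apply: He.
 have := fg (t - e / 2); have := He (t - e / 2).
 have := fmin (t - e/2); rewrite (_ : t - (t - e / 2) = e / 2); last by ring.
 rewrite gtr0_norm ?divr_gt0// => k1 /(_ _) k2 k3.
 have : 0 < g (t - e / 2) by apply: k2; lra.
 by nra.
- have H : \forall z \near t, g z < 0 by apply: (@cvgr_lt _ _ (nbhs t) _ g (g t)).
 have [e e0 He] : exists2 e, 0 < e & forall z, `|t - z| < e -> g z < 0.
  by case: H => e e0 He; exists e => // z ze; apply: He.
 have := fg (t + e / 2); have := He (t + e / 2).
 have := fmin (t + e/2); rewrite (_ : t - (t + e / 2) = - (e / 2)); last by ring.
 rewrite normrN gtr0_norm ?divr_gt0// => k1 /(_ _) k2 k3.
 have : g (t + e / 2) < 0 by apply: k2; lra.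
 by nra.
Qed.

End RealDerivatives.

(** * The reduced kinetic energy as the metric speed of a differentiable lift *)

Section KineticAlongLift.
Context {R : realType}.
Variable m : 'I_3 -> R.
Hypothesis m_gt0 : forall i, 0 < m i.
Variables (Q : 'I_3 -> R -> R[i]) (t : R).
Hypothesis Qd : forall i, cderivable (Q i) t.

Let X s : config R := at_time Q s.
Let V : config R := fun i => cderive (Q i) t.

Lemma sepr_is_derive i j : is_derive t 1 (fun s => sepr (X s) i j) (sepr V i j).
Proof.
apply: is_derive_sub; [have [H _] := Qd i|have [H _] := Qd j];
 exact: derivable_is_derive.
Qed.

Lemma sepi_is_derive i j : is_derive t 1 (fun s => sepi (X s) i j) (sepi V i j).
Proof.
apply: is_derive_sub; [have [_ H] := Qd i|have [_ H] := Qd j];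
 exact: derivable_is_derive.
Qed.

Lemma hre_is_derive : is_derive t 1 (fun s => hre m (X s) (X s)) (2 * hre m (X t) V).
Proof.
have D i j : is_derive t 1 (fun s => wgt m i j * (sepr (X s) i j * sepr (X s) i j +
  sepi (X s) i j * sepi (X s) i j))
  (wgt m i j * ((sepr (X t) i j * sepr V i j + sepr (X t) i j * sepr V i j) +
  (sepi (X t) i j * sepi V i j + sepi (X t) i j * sepi V i j))).
 apply: is_derive_scal; apply: is_derive_add; apply: is_derive_mul;
  [exact: sepr_is_derive|exact: sepr_is_derive|exact: sepi_is_derive|exact: sepi_is_derive].
have := is_derive_add (is_derive_add (D b1 b2) (D b1 b3)) (D b2 b3).
by move=> H; apply: (is_derive_eq H); rewrite /hre; ring.
Qed.

Lemma cvg_sepr i j (u : nat -> R) : u n @[n --> \oo] --> t ->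
 sepr (X (u n)) i j @[n --> \oo] --> sepr (X t) i j.
Proof.
move=> ut; apply: (cvg_comp u (fun s => sepr (X s) i j) ut).
exact: is_derive_cvg (sepr_is_derive i j).
Qed.

Lemma cvg_sepi i j (u : nat -> R) : u n @[n --> \oo] --> t ->
 sepi (X (u n)) i j @[n --> \oo] --> sepi (X t) i j.
Proof.
move=> ut; apply: (cvg_comp u (fun s => sepi (X s) i j) ut).
exact: is_derive_cvg (sepi_is_derive i j).
Qed.

Lemma cvg_hre (u v : nat -> R) : u n @[n --> \oo] --> t -> v n @[n --> \oo] --> t ->
 hre m (X (u n)) (X (v n)) @[n --> \oo] --> hre m (X t) (X t).
Proof.
move=> ut vt; rewrite /hre.
have K i j : wgt m i j * (sepr (X (u n)) i j * sepr (X (v n)) i j +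
  sepi (X (u n)) i j * sepi (X (v n)) i j) @[n --> \oo] -->
  wgt m i j * (sepr (X t) i j * sepr (X t) i j + sepi (X t) i j * sepi (X t) i j).
 by apply: cvg_scal; apply: cvgD; apply: cvgM;
 [exact: cvg_sepr|exact: cvg_sepr|exact: cvg_sepi|exact: cvg_sepi].
by apply: cvgD; [apply: cvgD|]; exact: K.
Qed.

Lemma cvg_him (u v : nat -> R) : u n @[n --> \oo] --> t -> v n @[n --> \oo] --> t ->
 him m (X (u n)) (X (v n)) @[n --> \oo] --> him m (X t) (X t).
Proof.
move=> ut vt; rewrite /him.
have K i j : wgt m i j * (sepi (X (u n)) i j * sepr (X (v n)) i j -
  sepr (X (u n)) i j * sepi (X (v n)) i j) @[n --> \oo] -->
  wgt m i j * (sepi (X t) i j * sepr (X t) i j - sepr (X t) i j * sepi (X t) i j).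
 by apply: cvg_scal; apply: cvgB; apply: cvgM;
 [exact: cvg_sepi|exact: cvg_sepr|exact: cvg_sepr|exact: cvg_sepi].
by apply: cvgD; [apply: cvgD|]; exact: K.
Qed.

Lemma him0 (q : config R) : him m q q = 0.
Proof. by rewrite /him; ring. Qed.

(** By [lagrange] this is [hre v v - him q v ^+ 2 / hre q q]: twice the kinetic energy left when the
    rotational component of the velocity has been removed. *)
Definition kinE (q v : config R) : R :=
 (hre m q v ^+ 2 + wwgt m * (wedr q v ^+ 2 + wedi q v ^+ 2)) / hre m q q.

Lemma kinetic_lift0 : hnorm m (X t) = 0 -> kinetic_lift m Q t = 0.
Proof.
move=> h0; rewrite /kinetic_lift.
have -> : (fun s => config_norm m (at_time Q s)) = (fun s => hnorm m (X s)).
 by apply/funext => s; rewrite config_normE.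
rewrite derive1_min0; last by move=> s; rewrite h0 hnorm_ge0.
by rewrite config_normE// -/(X t) h0 !expr0n/= !(mulr0, mul0r) addr0.
Qed.

Lemma reZ (a : R) (z : R[i]) : Re (a%:C * z) = a * Re z.
Proof. by rewrite reM /= mul0r subr0. Qed.

Lemma imZ (a : R) (z : R[i]) : Im (a%:C * z) = a * Im z.
Proof. by rewrite imM /= mul0r addr0. Qed.

Lemma jacobi2E (q : config R) : jacobi2 m q =
 q b3 - ((m b1 / (m b1 + m b2))%:C * q b1 + (m b2 / (m b1 + m b2))%:C * q b2).
Proof.
by rewrite /jacobi2 !rmorphM /= fmorphV mulrDl -!mulrA ![_^-1 * _]mulrC.
Qed.

(** The Jacobi vectors are a linear image, of determinant 1, of [q b1 - q b2] and [q b1 - q b3], so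
    the two complex determinants agree. *)
Lemma wedge_jacobi (q v : config R) :
 jacobi1 q * jacobi2 m v - jacobi2 m q * jacobi1 v = wedr q v +i* wedi q v.
Proof.
have -> : wedr q v +i* wedi q v =
  (q b1 - q b2) * (v b1 - v b3) - (q b1 - q b3) * (v b1 - v b2).
 apply/eqP; rewrite eq_complex /= /wedr /wedi /sepr /sepi !ReImE.
 by apply/andP; split; apply/eqP; ring.
rewrite !jacobi2E /jacobi1.
have -> : (m b1 / (m b1 + m b2))%:C = 1 - (m b2 / (m b1 + m b2))%:C.
 rewrite -(rmorph1 (real_complex R)) -rmorphB /=; congr (_%:C).
 rewrite -[X in X - _](@divff _ (m b1 + m b2)) ?lt0r_neq0 ?addr_gt0//.
 by rewrite -mulrBl addrK.
move: (q b1) (q b2) (q b3) (v b1) (v b2) (v b3) (_ %:C) => q1 q2 q3 v1 v2 v3 c.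
by ring.
Qed.

Lemma mu_wwgt : mu1 m * mu2 m = wwgt m.
Proof.
have m1 := m_gt0 b1; have m2 := m_gt0 b2; have m3 := m_gt0 b3.
rewrite /mu1 /mu2 /wwgt /wgt; field.
by apply/andP; split; rewrite lt0r_neq0// ?addr_gt0.
Qed.

Lemma kinetic_lift_pos : 0 < hnorm m (X t) -> 2 * kinetic_lift m Q t = kinE (X t) V.
Proof.
move=> h0; rewrite /kinetic_lift.
have -> : (fun s => config_norm m (at_time Q s)) = (fun s => hnorm m (X s)).
 by apply/funext => s; rewrite config_normE.
have p0 : 0 < hre m (X t) (X t) by rewrite -hnorm_sq// exprn_gt0.
have Dr : is_derive t 1 (fun s => hnorm m (X s))
  ((2 * hnorm m (X t))^-1 * (2 * hre m (X t) V)).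
 exact: (@is_derive1_comp _ (@Num.sqrt R) (fun s => hre m (X s) (X s)) t _ _
  (is_derive_sqrt p0) hre_is_derive).
rewrite (is_derive_derive1 Dr) config_normE// -/(X t).
have -> : cderive (fun s => jacobi1 (X s)) t = jacobi1 V.
 rewrite /cderive; have := @sepr_is_derive b2 b1 => /is_derive_derive1.
 have := @sepi_is_derive b2 b1 => /is_derive_derive1.
 rewrite /jacobi1 /sepi /sepr => e1 e2.
 have -> : Re \o (fun s => X s b2 - X s b1) = (fun s => Re (X s b2) - Re (X s b1)).
  by apply/funext => s /=; rewrite ReImE.
 have -> : Im \o (fun s => X s b2 - X s b1) = (fun s => Im (X s b2) - Im (X s b1)).
  by apply/funext => s /=; rewrite ReImE.
 by rewrite e1 e2 -reB -imB; case: (_ - _).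
have -> : cderive (fun s => jacobi2 m (X s)) t = jacobi2 m V.
 have DR i : is_derive t 1 (fun s => Re (X s i)) (Re (V i)).
  by have [H _] := Qd i; exact: derivable_is_derive.
 have DI i : is_derive t 1 (fun s => Im (X s i)) (Im (V i)).
  by have [_ H] := Qd i; exact: derivable_is_derive.
 rewrite /cderive jacobi2E.
 set a := m b1 / _; set b := m b2 / _.
 have -> : Re \o (fun s => jacobi2 m (X s)) =
   (fun s => Re (X s b3) - (a * Re (X s b1) + b * Re (X s b2))).
  by apply/funext => s /=; rewrite jacobi2E -/a -/b !(reB, reD, reZ).
 have -> : Im \o (fun s => jacobi2 m (X s)) =
   (fun s => Im (X s b3) - (a * Im (X s b1) + b * Im (X s b2))).
  by apply/funext => s /=; rewrite jacobi2E -/a -/b !(imB, imD, imZ).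
 rewrite (is_derive_derive1 (is_derive_sub (DR b3)
   (is_derive_add (is_derive_scal a (DR b1)) (is_derive_scal b (DR b2))))).
 rewrite (is_derive_derive1 (is_derive_sub (DI b3)
   (is_derive_add (is_derive_scal a (DI b1)) (is_derive_scal b (DI b2))))).
 by apply/eqP; rewrite eq_complex !(reB, reD, reZ) !(imB, imD, imZ) /= !eqxx.
rewrite -!/(X t) wedge_jacobi normcsq /= mu_wwgt /kinE -hnorm_sq//.
by field; rewrite lt0r_neq0.
Qed.

(** The Cauchy-Schwarz defect [hnorm q * hnorm p - habs q p] is rewritten by [lagrange]. In this
    form each term is visibly of second order in the displacement, which makes division by the
    squared time possible. *)
Lemma qdist_sq_wed (q p : config R) : 0 < hnorm m q * hnorm m p + habs m q p ->
 qdist m q p ^+ 2 = (hnorm m q - hnorm m p) ^+ 2 +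
  2 * wwgt m * (wedr q p ^+ 2 + wedi q p ^+ 2) / (hnorm m q * hnorm m p + habs m q p).
Proof.
move=> d0; rewrite qdist_sq//.
have L : wwgt m * (wedr q p ^+ 2 + wedi q p ^+ 2) =
  (hnorm m q * hnorm m p - habs m q p) * (hnorm m q * hnorm m p + habs m q p).
 by rewrite -subr_sqr exprMn !hnorm_sq// lagrange// habs_sq//; ring.
rewrite -(mulrA 2 (wwgt m)) L -(hnorm_sq m_gt0 q) -(hnorm_sq m_gt0 p).
by field; rewrite lt0r_neq0.
Qed.

(** The radial and the shape term of [qdist_sq_wed] converge separately after division by the
    squared time: they are built from slopes over intervals straddling [t], and the denominator
    tends to twice the squared norm. *)
Lemma speed_cvg_pos (u v : nat -> R) : 0 < hnorm m (X t) ->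
 u n @[n --> \oo] --> t -> v n @[n --> \oo] --> t ->
 (forall n, u n <= t <= v n) -> (forall n, u n < v n) ->
 qdist m (X (u n)) (X (v n)) / (v n - u n) @[n --> \oo] -->
 sqrt (2 * kinetic_lift m Q t).
Proof.
move=> h0 ut vt utv uv.
have p0 : 0 < hre m (X t) (X t) by rewrite -hnorm_sq// exprn_gt0.
have dS (f : R -> R) df : is_derive t 1 f df ->
  (f (v n) - f (u n)) / (v n - u n) @[n --> \oo] --> df.
 by move=> ?; apply: straddle_cvg.
have nC (w : nat -> R) : w n @[n --> \oo] --> t ->
  hnorm m (X (w n)) @[n --> \oo] --> hnorm m (X t).
 by move=> wt; apply: (cvg_comp (fun n => hre m (X (w n)) (X (w n))) (@Num.sqrt R) (cvg_hre wt wt)); exact: sqrt_continuous.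
have aC : habs m (X (u n)) (X (v n)) @[n --> \oo] --> hnorm m (X t) ^+ 2.
 have -> : hnorm m (X t) ^+ 2 = sqrt (hre m (X t) (X t) * hre m (X t) (X t) + him m (X t) (X t) * him m (X t) (X t)).
  by rewrite him0 mulr0 addr0 -expr2 sqrtr_sqr hnorm_sq// ger0_norm ?hre_ge0.
 have -> : (fun n => habs m (X (u n)) (X (v n))) = (fun n =>
  sqrt (hre m (X (u n)) (X (v n)) * hre m (X (u n)) (X (v n)) +
   him m (X (u n)) (X (v n)) * him m (X (u n)) (X (v n)))) by [].
 apply: (cvg_comp (fun n => hre m (X (u n)) (X (v n)) * hre m (X (u n)) (X (v n)) +
   him m (X (u n)) (X (v n)) * him m (X (u n)) (X (v n)))); last exact: sqrt_continuous.
 by apply: cvgD; apply: cvgM; [exact: cvg_hre|exact: cvg_hre|exact: cvg_him|exact: cvg_him].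
have Dr : is_derive t 1 (fun s => hnorm m (X s))
  ((2 * hnorm m (X t))^-1 * (2 * hre m (X t) V)).
 exact: (@is_derive1_comp _ (@Num.sqrt R) (fun s => hre m (X s) (X s)) t _ _
  (is_derive_sqrt p0) hre_is_derive).
have rC := dS _ _ Dr.
have sR i j := dS _ _ (sepr_is_derive i j).
have sI i j := dS _ _ (sepi_is_derive i j).
pose D n := v n - u n.
have wR : wedr (X (u n)) (X (v n)) / D n @[n --> \oo] --> wedr (X t) V.
 have -> : (fun n => wedr (X (u n)) (X (v n)) / D n) = (fun n =>
   sepr (X (u n)) b1 b2 * ((sepr (X (v n)) b1 b3 - sepr (X (u n)) b1 b3) / D n) -
   sepi (X (u n)) b1 b2 * ((sepi (X (v n)) b1 b3 - sepi (X (u n)) b1 b3) / D n) -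
   (sepr (X (u n)) b1 b3 * ((sepr (X (v n)) b1 b2 - sepr (X (u n)) b1 b2) / D n) -
   sepi (X (u n)) b1 b3 * ((sepi (X (v n)) b1 b2 - sepi (X (u n)) b1 b2) / D n))).
  by apply/funext => n; rewrite /wedr; ring.
 by apply: cvgB; apply: cvgB; apply: cvgM; [exact: cvg_sepr|exact: sR|exact: cvg_sepi|exact: sI|
  exact: cvg_sepr|exact: sR|exact: cvg_sepi|exact: sI].
have wI : wedi (X (u n)) (X (v n)) / D n @[n --> \oo] --> wedi (X t) V.
 have -> : (fun n => wedi (X (u n)) (X (v n)) / D n) = (fun n =>
   sepr (X (u n)) b1 b2 * ((sepi (X (v n)) b1 b3 - sepi (X (u n)) b1 b3) / D n) +
   sepi (X (u n)) b1 b2 * ((sepr (X (v n)) b1 b3 - sepr (X (u n)) b1 b3) / D n) -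
   (sepr (X (u n)) b1 b3 * ((sepi (X (v n)) b1 b2 - sepi (X (u n)) b1 b2) / D n) +
   sepi (X (u n)) b1 b3 * ((sepr (X (v n)) b1 b2 - sepr (X (u n)) b1 b2) / D n))).
  by apply/funext => n; rewrite /wedi; ring.
 by apply: cvgB; apply: cvgD; apply: cvgM; [exact: cvg_sepr|exact: sI|exact: cvg_sepi|exact: sR|
  exact: cvg_sepr|exact: sI|exact: cvg_sepi|exact: sR].
pose den n := hnorm m (X (u n)) * hnorm m (X (v n)) + habs m (X (u n)) (X (v n)).
have denC : den n @[n --> \oo] --> hnorm m (X t) * hnorm m (X t) + hnorm m (X t) ^+ 2.
 by apply: cvgD => //; apply: cvgM; exact: nC.
have den0 : 0 < hnorm m (X t) * hnorm m (X t) + hnorm m (X t) ^+ 2.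
 by rewrite addr_gt0 ?mulr_gt0.
pose Y n := (hnorm m (X (v n)) - hnorm m (X (u n))) / D n *
  ((hnorm m (X (v n)) - hnorm m (X (u n))) / D n) +
  2 * wwgt m * (wedr (X (u n)) (X (v n)) / D n * (wedr (X (u n)) (X (v n)) / D n) +
   wedi (X (u n)) (X (v n)) / D n * (wedi (X (u n)) (X (v n)) / D n)) / den n.
have SC : Y n @[n --> \oo] --> 2 * kinetic_lift m Q t.
 rewrite kinetic_lift_pos//.
 have -> : kinE (X t) V = (2 * hnorm m (X t))^-1 * (2 * hre m (X t) V) *
   ((2 * hnorm m (X t))^-1 * (2 * hre m (X t) V)) +
   2 * wwgt m * (wedr (X t) V * wedr (X t) V + wedi (X t) V * wedi (X t) V) /
   (hnorm m (X t) * hnorm m (X t) + hnorm m (X t) ^+ 2).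
  by rewrite /kinE -hnorm_sq//; field; split_lra.
 apply: cvgD; first by apply: cvgM.
 apply: cvgM; last by apply: cvg_inv => //; lra.
 by apply: cvg_scal; apply: cvgD; apply: cvgM.
apply: (cvg_trans _ (cvg_comp _ _ SC (@sqrt_continuous R _))).
apply: near_eq_cvg; near=> n => /=.
have dn0 : 0 < den n by near: n; apply: (cvgr_gt _ denC).
have Dn0 : 0 < D n by rewrite subr_gt0.
apply: (@pexpIrn _ 2) => //; rewrite ?nnegrE ?sqrtr_ge0 ?divr_ge0 ?qdist_ge0 ?ltW//.
have -> : Y n = qdist m (X (u n)) (X (v n)) ^+ 2 / D n ^+ 2.
 rewrite /Y qdist_sq_wed//; rewrite -/(den n).
 by field; rewrite !lt0r_neq0.
by rewrite sqr_sqrtr ?divr_ge0 ?sqr_ge0// expr_div_n.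
Unshelve. all: by end_near. Qed.

(** A one-sided version that includes the triple collision. There [kinetic_lift] vanishes, and the
    alternative [c < 0] is what remains of the hypothesis. *)
Lemma speed_cvg_ge (u v : nat -> R) :
 u n @[n --> \oo] --> t -> v n @[n --> \oo] --> t ->
 (forall n, u n <= t <= v n) -> (forall n, u n < v n) ->
 forall c, c < sqrt (2 * kinetic_lift m Q t) ->
 \forall n \near \oo, c < qdist m (X (u n)) (X (v n)) / (v n - u n) \/ c < 0.
Proof.
move=> ut vt utv uv c.
have [h0|h0] := eqVneq (hnorm m (X t)) 0.
 rewrite kinetic_lift0// mulr0 sqrtr0 => c0.
 by apply: nearW; right.
move=> cs; have hp : 0 < hnorm m (X t) by rewrite lt0r h0 hnorm_ge0.
have := speed_cvg_pos hp ut vt utv uv => /cvgr_gt /(_ _ cs).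
by apply: filterS => n ?; left.
Qed.

End KineticAlongLift.

(** * Integrals of nonnegative functions as lower integrals *)

Section LowerIntegral.
Context {R : realType}.
Local Notation mu := (@lebesgue_measure R).
Local Open Scope ereal_scope.
Implicit Types (D : set R) (f g : R -> \bar R).

(* The integral of a nonnegative function is a supremum of integrals of simple
  functions, so that monotonicity and additivity in the domain hold for
  functions that are not measurable. *)
Lemma lower_le D f g : (forall x, D x -> 0 <= f x) ->
 (forall x, D x -> f x <= g x) -> \int[mu]_(x in D) f x <= \int[mu]_(x in D) g x.
Proof.
move=> f0 fg; rewrite !ge0_integralE//; last first.
 by move=> x Dx; apply: le_trans (fg _ Dx); exact: f0.
apply: ereal_sup_le => _ [h hf <-]; exists h => // x.
apply: (le_trans (hf x)); rewrite !patchE; case: ifPn => //; rewrite inE; exact: fg.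
Qed.

Lemma lower_subset D D' f : (forall x, D' x -> 0 <= f x) -> D `<=` D' ->
 \int[mu]_(x in D) f x <= \int[mu]_(x in D') f x.
Proof.
move=> f0 DD'; rewrite integral_mkcond [leRHS]integral_mkcond.
apply: lower_le => x _.
 by rewrite patchE; case: ifPn => //; rewrite inE => /DD'/f0.
rewrite !patchE; case: ifPn; rewrite ?inE => Dx.
 by rewrite mem_set//; exact: DD'.
by case: ifPn => //; rewrite inE => /f0.
Qed.

Import HBNNSimple.

(** A simple function below [f] on the union restricts to the two pieces, and simple functions below
    [f] on disjoint pieces add up to one on the union. Measurability is used for the two sets and
    the simple functions only. *)
Lemma lower_setU A B f : measurable A -> measurable B -> A `&` B = set0 ->
 (forall x, (A `|` B) x -> 0 <= f x) ->
 \int[mu]_(x in A `|` B) f x = \int[mu]_(x in A) f x + \int[mu]_(x in B) f x.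
Proof.
move=> mA mB AB f0.
have fA x : A x -> 0 <= f x by move=> Ax; apply: f0; left.
have fB x : B x -> 0 <= f x by move=> Bx; apply: f0; right.
apply/eqP; rewrite eq_le; apply/andP; split.
 rewrite [leLHS]ge0_integralE//; apply: ge_ereal_sup => _ [h hf <-].
 rewrite -integralT_nnsfun.
 have hAB x : ~ (A `|` B) x -> h x = 0%R.
  move=> nx; have := hf x; rewrite patchE memNset// lee_fin => h0.
  by apply/eqP; rewrite eq_le h0 /=.
 have -> : \int[mu]_x (h x)%:E = \int[mu]_(x in A `|` B) (h x)%:E.
  rewrite [RHS]integral_mkcond; apply: eq_integral => x _.
  rewrite patchE; case: ifPn => //; rewrite notin_setE => nx.
  by rewrite hAB.
 rewrite ge0_integral_setU//=; last 3 first.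
 - exact/measurable_EFinP/measurable_funTS.
 - by move=> x _; rewrite lee_fin.
 - by rewrite disj_set2E AB eqxx.
 apply: leeD.
 - apply: lower_le => x Ax; first by rewrite lee_fin.
  by have := hf x; rewrite patchE mem_set//; left.
 - apply: lower_le => x Ax; first by rewrite lee_fin.
  by have := hf x; rewrite patchE mem_set//; right.
rewrite [X in X + _]ge0_integralE// [X in _ + X]ge0_integralE//.
(* Sums of suprema in the extended reals: if the bound [z] is finite, all elements are finite and
   the usual subtraction argument applies. *)
have sup_add (S T : set (\bar R)) z : S !=set0 -> T !=set0 ->
  (forall x, S x -> 0 <= x) -> (forall x, T x -> 0 <= x) ->
  (forall x y, S x -> T y -> x + y <= z) -> ereal_sup S + ereal_sup T <= z.
 move=> [s0 Ss0] [t0 Tt0] S0 T0 H.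
 have z0 : 0 <= z by apply: le_trans (H _ _ Ss0 Tt0); apply: adde_ge0; [exact: S0|exact: T0].
 case: z z0 H => [z||]// z0 H; last by rewrite leey.
 have fS s : S s -> s \is a fin_num.
  move=> Ss; rewrite ge0_fin_numE ?S0//; apply: (le_lt_trans _ (ltry z)).
  by apply: le_trans (H _ _ Ss Tt0); rewrite leeDl// T0.
 have K s : S s -> ereal_sup T <= z%:E - s.
  by move=> Ss; apply: ge_ereal_sup => t Tt; rewrite leeBrDr ?fS// addeC; exact: H.
 have T0' : 0 <= ereal_sup T by apply: le_trans (T0 _ Tt0) _; exact: ereal_sup_ubound.
 have fT : ereal_sup T \is a fin_num.
  rewrite ge0_fin_numE//; apply: (le_lt_trans (K _ Ss0)).
  by have := fS _ Ss0; case: (s0) => // r _; rewrite -EFinB ltry.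
 rewrite -leeBrDr//; apply: ge_ereal_sup => s Ss.
 have := K _ Ss; rewrite leeBrDr ?fS// leeBrDr//.
 by rewrite addeC.
pose SS (D : set R) (g : R -> \bar R) : set (\bar R) := [set sintegral mu h | h in
  [set h : {nnsfun (measurableTypeR R) >-> R} | forall x, (h x)%:E <= (g \_ D) x]].
have hnonneg D g x : SS D g x -> 0 <= x.
 by move=> [h _ <-]; exact: (sintegral_ge0 mu h).
have hne D g : (forall x, D x -> 0 <= g x) -> SS D g !=set0.
 move=> g0; exists (sintegral mu nnsfun0); exists nnsfun0 => // x /=.
 by rewrite patchE; case: ifPn => //; rewrite inE => /g0.
apply: (sup_add (SS A f) (SS B f)); [exact: hne|exact: hne|exact: hnonneg|exact: hnonneg|].
move=> _ _ [h hf <-] [k kf <-].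
rewrite -!integralT_nnsfun -ge0_integralD//=; last 4 first.
- by move=> x _; rewrite lee_fin.
- exact/measurable_EFinP.
- by move=> x _; rewrite lee_fin.
- exact/measurable_EFinP.
rewrite [leRHS]integral_mkcond; apply: lower_le => x _.
 by rewrite adde_ge0// lee_fin.
have := hf x; have := kf x; rewrite !patchE.
have [Ax|Ax] := pselect (A x).
 rewrite (mem_set Ax) memNset; last by move=> Bx; have : (A `&` B) x by []; rewrite AB.
 rewrite mem_set; last by left.
 by move=> k0 hx; rewrite -[leRHS]adde0; apply: leeD.
rewrite (memNset Ax); have [Bx|Bx] := pselect (B x).
 rewrite (mem_set Bx) mem_set; last by right.
 by move=> k0 hx; rewrite -[leRHS]add0e; apply: leeD.
rewrite (memNset Bx) memNset; last by case.
by move=> k0 hx; rewrite -[leRHS]adde0; apply: leeD.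
Qed.

Lemma lower_null N f : measurable N -> mu N = 0 -> (forall x, N x -> 0 <= f x) ->
 \int[mu]_(x in N) f x = 0.
Proof.
move=> mN N0 f0; apply/eqP; rewrite eq_le integral_ge0// andbT.
apply: (@le_trans _ _ (\int[mu]_(x in N) (cst +oo) x)).
 by apply: lower_le => // x _; rewrite /= leey.
by rewrite integral_cst//; move: N0 => /= ->; rewrite mule0.
Qed.

Lemma lower_ae_le D f g (N : set R) : measurable D -> measurable N -> mu N = 0 ->
 (forall x, D x -> 0 <= f x) -> (forall x, D x -> 0 <= g x) ->
 (forall x, D x -> ~ N x -> f x <= g x) ->
 \int[mu]_(x in D) f x <= \int[mu]_(x in D) g x.
Proof.
move=> mD mN N0 f0 g0 fg.
have -> : D = (D `\` N) `|` (D `&` N) by rewrite setUC setUIDK.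
rewrite !lower_setU//; first last.
- by move=> x [[Dx _]|[Dx _]]; exact: f0.
- by apply/seteqP; split => x // -[[_ nx] [_ /nx]].
- exact: measurableI.
- exact: measurableD.
- by move=> x [[Dx _]|[Dx _]]; exact: g0.
- by apply/seteqP; split => x // -[[_ nx] [_ /nx]].
- exact: measurableI.
- exact: measurableD.
apply: leeD.
 by apply: lower_le => [x [Dx _]|x [Dx Nx]]; [exact: f0|exact: fg].
have n0 : mu (D `&` N) = 0.
 apply: (@subset_measure0 _ _ _ mu _ N) => //; first exact: measurableI.
rewrite !lower_null//; try exact: measurableI.
- by move=> x [Dx _]; exact: g0.
- by move=> x [Dx _]; exact: f0.
Qed.

End LowerIntegral.

(** * Densities of absolutely continuous monotone functions *)

Section MonotoneDensity.
Context {R : realType}.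
Local Notation mu := (@lebesgue_measure R).

Definition dyad (a b : R) (n i : nat) : R := a + (b - a) * i%:R / 2 ^+ n.

Lemma dyad0 a b n : dyad a b n 0 = a.
Proof. by rewrite /dyad mulr0 mul0r addr0. Qed.

Lemma dyad_max a b n : dyad a b n (2 ^ n) = b.
Proof.
rewrite /dyad natrX mulfK ?expf_neq0//; first by ring.
Qed.

Lemma dyad_step a b n i : dyad a b n i.+1 - dyad a b n i = (b - a) / 2 ^+ n.
Proof. by rewrite /dyad -natr1; ring. Qed.

Lemma dyad_le a b n i j : a <= b -> (i <= j)%N -> dyad a b n i <= dyad a b n j.
Proof.
move=> ab ij; rewrite /dyad lerD2l ler_pM2r ?invr_gt0 ?exprn_gt0//.
by rewrite ler_wpM2l ?subr_ge0// ler_nat.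
Qed.

Lemma dyad_in a b n i : a <= b -> (i <= 2 ^ n)%N -> a <= dyad a b n i <= b.
Proof.
move=> ab i2; apply/andP; split.
 by have := dyad_le n ab (leq0n i); rewrite dyad0.
by have := dyad_le n ab i2; rewrite dyad_max.
Qed.

Lemma dyad_half a b n i : dyad a b n.+1 i.*2 = dyad a b n i.
Proof.
rewrite /dyad -muln2 natrM exprS; congr (_ + _).
by field; rewrite expf_neq0.
Qed.

Lemma dyad_cell a b n x : a < b -> a < x <= b ->
 exists2 i : nat, (i < 2 ^ n)%N & dyad a b n i < x <= dyad a b n i.+1.
Proof.
move=> ab /andP[ax xb].
have ex : exists i, x <= dyad a b n i by exists (2 ^ n)%N; rewrite dyad_max.
case: (ex_minnP ex) => -[|i]; first by rewrite dyad0; move: ax; rewrite ltNge => /negP.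
move=> xi mini; exists i.
 rewrite ltnNge; apply/negP => k; have /mini : x <= dyad a b n (2 ^ n) by rewrite dyad_max.
 by rewrite leqNgt ltnS k.
rewrite xi andbT ltNge; apply/negP => /mini.
by rewrite ltnn.
Qed.

Lemma pow2_small (e : R) : 0 < e -> exists N, forall n, (N <= n)%N -> (2 ^+ n)^-1 < e.
Proof.
move=> e0; have := @cvg_geometric R 1 2^-1.
rewrite ger0_norm ?invr_ge0//.
move=> /(_ ltac:(by rewrite invf_lt1// ltr1n)) /cvgrPdist_lt /(_ _ e0) [N _ HN].
exists N => n Nn; have := HN n Nn; rewrite /geometric /= mul1r sub0r normrN exprVn ger0_norm//.
Qed.

Variables (a b : R) (G : R -> R).
Hypotheses (ab : a < b) (Gnd : {homo G : x y / x <= y}) (Gc : continuous G).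
Hypotheses (Ga : forall x, x <= a -> G x = 0) (Gb : forall x, b <= x -> G x = 1).

(** Absolute continuity tested on unions of dyadic cells of one level only; such unions exhaust the
    part of an open set in []a, b]] from inside. *)
Hypothesis Gac : forall e, 0 < e -> exists2 d, 0 < d &
 forall n (S : pred 'I_(2 ^ n)), \sum_(i | S i) ((b - a) / 2 ^+ n) < d ->
  \sum_(i | S i) (G (dyad a b n i.+1) - G (dyad a b n i)) < e.

Let Gr : right_continuous G.
Proof. by move=> x; apply: cvg_at_right_filter; exact: Gc. Qed.

Let Gny : G @ -oo --> (0 : R).
Proof.
apply: cvg_near_cst; near=> x; apply: Ga; near: x; by apply: nbhs_ninfty_le; exact: num_real.
Unshelve. all: by end_near. Qed.

Let Gy : G @ +oo --> (1 : R).
Proof.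
apply: cvg_near_cst; near=> x; apply: Gb; near: x; by apply: nbhs_pinfty_ge; exact: num_real.
Unshelve. all: by end_near. Qed.

Let F : cumulativeBounded (0 : R) (1 : R) :=
 HB.pack_for (cumulativeBounded (0 : R) (1 : R)) G
  (@isCumulative.Build _ _ _ G Gnd Gr) (@isCumulativeBounded.Build R 0 1 G Gny Gy).

Let nu : {finite_measure set (measurableTypeR R) -> \bar R} := lebesgue_stieltjes_measure F.

Let nuE x y : x <= y -> nu `]x, y]%classic = (G y - G x)%:E.
Proof.
move=> xy; rewrite /nu /= /lebesgue_stieltjes_measure /measure_extension.
by rewrite measurable_mu_extE/=; [rewrite wlength_itv_bnd|exact: is_ocitv].
Qed.

Let I n (i : nat) : set R := `]dyad a b n i, dyad a b n i.+1]%classic.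

Let Idisj n i j x : I n i x -> I n j x -> i = j.
Proof.
rewrite /I /= !in_itv /= => /andP[ix xi] /andP[jx xj].
have [ij|ji|//] := ltngtP i j.
 have := @dyad_le a b n i.+1 j (ltW ab) ij => k.
 by have := lt_le_trans jx xi; rewrite ltNge k.
have := @dyad_le a b n j.+1 i (ltW ab) ji => k.
by have := lt_le_trans ix xj; rewrite ltNge k.
Qed.

(** A null set lies in an open set of small measure. The dyadic cells contained in that open set
    form an increasing sequence of finite unions; [Gac] bounds the Stieltjes measure of each, hence
    of their union. *)
Let nu_dom : nu `<< mu.
Proof.
apply/null_content_dominatesP => A mA A0.
apply/eqP; rewrite eq_le measure_ge0 andbT.
apply/lee_addgt0Pr => e e0; rewrite add0e.
have [d d0 Hd] := Gac e0.
have mA' : measurable A by [].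
have [|U [oU AU muU]] := @lebesgue_regularity_outer R A d mA' _ d0.
 by rewrite A0.
have {muU}muU : (mu U < d%:E)%E.
 have mU : measurable U by exact: open_measurable.
 apply: le_lt_trans muU; rewrite -[leRHS]add0e -A0.
 have := @measureU2 _ _ _ mu A (U `\` A) mA' (measurableD mU mA').
 by rewrite setDUK.
have mU : measurable U by exact: open_measurable.
pose S n : pred 'I_(2 ^ n) := fun i => `[< I n i `<=` U >].
pose W n := \big[setU/set0]_(i < 2 ^ n | S n i) I n i.
have mI n i : measurable (I n i) by exact: measurable_itv.
have mW n : measurable (W n) by apply: bigsetU_measurable => i _; exact: mI.
have WP n x : W n x <-> exists2 i : 'I_(2 ^ n), S n i & I n i x.
 rewrite /W -bigcup_seq_cond; split => [[i /= /andP[_ Si] xi]|[i Si xi]]; exists i => //=.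
 by rewrite mem_index_enum.
have dstep n : 0 <= (b - a) / 2 ^+ n.
 by rewrite divr_ge0 ?exprn_ge0// subr_ge0 ltW.
have W_nd : nondecreasing_seq W.
 apply/nondecreasing_seqP => n; apply/subsetPset => x /WP[i /asboolP Si xi].
 have sub (j : nat) : (i.*2 <= j <= i.*2.+1)%N -> I n.+1 j `<=` I n i.
  move=> /andP[ij ji] y; rewrite /I /= !in_itv /= => /andP[y1 y2]; apply/andP; split.
   by apply: le_lt_trans y1; rewrite -dyad_half dyad_le// ltW.
  by apply: (le_trans y2); rewrite -(dyad_half a b n i.+1) doubleS; apply: dyad_le => //; exact: ltW.
 have i2 := ltn_ord i.
 have j2 (k : bool) : (k + i.*2 < 2 ^ n.+1)%N.
  by rewrite expnS mul2n; case: k => /=; rewrite ?add1n ?add0n -?doubleS ?ltn_double// ltn_Sdouble.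
 have [xm|xm] := leP x (dyad a b n.+1 i.*2.+1).
  apply/WP; exists (Ordinal (j2 false)).
   by apply/asboolP; apply: subset_trans Si; apply: sub => /=; rewrite add0n leqnn leqnSn.
  move: xi; rewrite /I /= !in_itv /= add0n dyad_half => /andP[-> _] /=.
  by [].
 apply/WP; exists (Ordinal (j2 true)).
  by apply/asboolP; apply: subset_trans Si; apply: sub => /=; rewrite add1n leqnn leqnSn.
 move: xi; rewrite /I /= !in_itv /= add1n xm /= => /andP[_].
 by rewrite -doubleS dyad_half.
have WU n : W n `<=` U by move=> x /WP[i /asboolP Si]; exact: Si.
have tI n : trivIset setT (fun i : 'I_(2 ^ n) => I n i).
 move=> i j _ _ [x [xi xj]]; apply: val_inj => /=; exact: Idisj xi xj.
have nuW n : (nu (W n) <= e%:E)%E.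
 rewrite measure_bigsetU_ord; [|exact: mI|exact: tI].
 rewrite (eq_bigr (fun i : 'I_(2 ^ n) => (G (dyad a b n i.+1) - G (dyad a b n i))%:E)); last first.
  by move=> i _; apply: nuE; apply: dyad_le => //; exact: ltW.
 rewrite sumEFin lee_fin ltW//; apply: Hd; rewrite -lte_fin; apply: le_lt_trans muU.
 apply: (@le_trans _ _ (mu (W n))); last by apply: le_measure; rewrite ?inE; [exact: mW|exact: mU|exact: WU].
 rewrite measure_bigsetU_ord; [|exact: mI|exact: tI].
 rewrite -sumEFin; apply: lee_sum => i _.
 suff <- : mu (I n i) = ((b - a) / 2 ^+ n)%:E by exact: lexx.
 rewrite /I lebesgue_measure_itv /= lte_fin -subr_gt0 dyad_step.
 by rewrite divr_gt0 ?exprn_gt0 ?subr_gt0// -EFinB dyad_step.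
have mWW : measurable (\bigcup_n W n) by apply: bigcup_measurable.
have nuWW : (nu (\bigcup_n W n) <= e%:E)%E.
 have C : nu (W n) @[n --> \oo] --> nu (\bigcup_n W n).
  exact: (@nondecreasing_cvg_mu _ _ _ nu W).
 rewrite -(cvg_lim _ C)//; apply: lime_le; first by apply/cvg_ex; exists (nu (\bigcup_n W n)).
 by apply: nearW.
(* The total mass is 1 and []a, b]] already carries all of it. *)
have nuC : nu (~` `]a, b]%classic) = 0%E.
 have mab : measurable (`]a, b]%classic : set (measurableTypeR R)) by exact: measurable_itv.
 have := @measureU _ _ _ nu _ _ mab (measurableC mab) (setICr _).
 rewrite setUv => H1.
 have T1 : nu setT = 1%E by exact: (@probability_setT _ _ _ (lebesgue_stieltjes_measure F)).
 have N1 : nu `]a, b]%classic = 1%:E by rewrite nuE ?(ltW ab)// (Gb (lexx b)) (Ga (lexx a)) subr0.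
 have H2 : (1%:E = 1%:E + nu (~` `]a, b]%classic))%E.
  by rewrite -[LHS]T1 -[X in _ = (X + _)%E]N1; exact: H1.
 have : (1%:E - 1%:E = 1%:E + nu (~` `]a, b]%classic) - 1%:E)%E by rewrite -H2.
 by rewrite addeAC subee// add0e => <-.
apply: (@le_trans _ _ (nu (\bigcup_n W n `|` ~` `]a, b]%classic))).
 rewrite le_measure ?inE//; first by apply: measurableU => //; exact: measurableC.
 move=> x Ax; have [xab|xab] := pselect (`]a, b]%classic x); last by right.
 left; have Ux := AU _ Ax.
 have : nbhs x U by apply: open_nbhs_nbhs.
 move=> /nbhs_ballP[r /= r0 xr].
 have [N HN] := @pow2_small (r / (b - a)) ltac:(by rewrite divr_gt0// subr_gt0).
 have [i i2 xi] := @dyad_cell a b N x ab xab.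
 exists N => //; apply/WP; exists (Ordinal i2) => //.
 apply/asboolP => y; rewrite /I /= in_itv /= => yi; apply: xr.
 have := HN N (leqnn N); rewrite ltr_pdivlMr ?subr_gt0// mulrC => K.
 have := dyad_step a b N i; rewrite /ball /= /I; move: xi yi => /andP[? ?] /andP[? ?] ?.
 by rewrite ltr_distl; split_lra.
rewrite (le_trans (measureU2 _ _ _))//; first exact: measurableC.
have nuC' : (nu (~` `]a, b]%classic) <= 0)%E by rewrite nuC.
by rewrite -[leRHS]adde0; apply: leeD; [exact: nuWW|exact: nuC'].
Qed.

(** Radon-Nikodym for the Stieltjes measure of [G], followed by Lebesgue's differentiation theorem
    for the density. *)
Lemma monotone_density : exists phi : R -> R, [/\ forall x, 0 <= phi x,
 mu.-integrable setT (EFin \o phi),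
 (forall x y, x <= y -> (\int[mu]_(t in `]x, y]) (phi t)%:E)%E = (G y - G x)%:E) &
 {ae mu, forall x, a < x -> is_derive x 1 G (phi x)}].
Proof.
have [f [f0 ff fi fE]] := radon_nikodym_sigma_finite nu_dom.
have fphi : EFin \o (fine \o f) = f by apply/funext => x /=; rewrite fineK.
have fE' x y : x <= y -> (\int[mu]_(t in `]x, y]) (fine (f t))%:E)%E = (G y - G x)%:E.
 move=> xy; rewrite -nuE// fE//.
 by apply: eq_integral => t _; rewrite fineK.
exists (fine \o f); split => //.
- by move=> x; exact: fine_ge0.
- by rewrite fphi.
have K y : mu.-integrable [set` Interval (BRight a) (BRight y)] (EFin \o (fine \o f)).
 by apply: (@integrableS _ _ _ _ setT) => //; rewrite fphi.
have L : locally_integrable [set: R] (fine \o f).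
 by apply: open_integrable_locally; [exact: openT|rewrite fphi].
have := FTC1 K L.
apply: filterS; first exact: (ae_filter_ringOfSetsType mu).
move=> x /= H ax; have [D1 D2] := H ax.
have -> : G = (fun x => (\int[mu]_(t in [set` Interval (BRight a) (BRight x)]) (fine \o f) t)%R).
 apply/funext => y; rewrite /Rintegral.
 have [ay|ya] := leP a y; first by rewrite fE'//= (Ga (lexx _)) subr0.
 rewrite set_itv_ge ?integral_set0 /= ?Ga// ?ltW//.
 by rewrite -leNgt bnd_simp ltW.
rewrite -D2; exact: derivable_is_derive.
Qed.

End MonotoneDensity.

Lemma is_derive_near (R : realType) (f g : R -> R) (t l : R) :
 (\forall s \near t, g s = f s) -> is_derive t 1 f l -> is_derive t 1 g l.
Proof.
by move=> fg H; apply: (near_eq_is_derive _ H); apply: filterS fg => s ->.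
Qed.

(** * Variation of absolutely continuous curves in a metric space *)

Section CurveVariation.
Context {R : realType} {T : Type}.
Variable d : T -> T -> R.
Hypotheses (d_ge0 : forall p q, 0 <= d p q) (dC : forall p q, d p q = d q p).
Hypotheses (dxx : forall p, d p p = 0) (d_tri : forall p q r, d p r <= d p q + d q r).
Local Notation mu := (@lebesgue_measure R).
Variables (g : R -> T) (t0 t1 : R).
Hypothesis t01 : t0 < t1.
Hypothesis gac : forall e : R, 0 < e -> exists2 d' : R, 0 < d' &
  forall (n : nat) (a b : 'I_n -> R),
   (forall i, [/\ t0 <= a i, a i <= b i & b i <= t1]) ->
   (forall i j, i != j -> b i <= a j \/ b j <= a i) ->
   \sum_(i < n) (b i - a i) < d' -> \sum_(i < n) d (g (a i)) (g (b i)) < e.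

(** Families are indexed by finite types, so that two families are concatenated by a sum type and a
    family is refined by a sigma type. *)
Definition nonoverlapping (c c' : R) (I : finType) (x y : I -> R) : Prop :=
 (forall i, [/\ c <= x i, x i <= y i & y i <= c']) /\
 (forall i j, i != j -> y i <= x j \/ y j <= x i).

Lemma gac_fin (e : R) : 0 < e -> exists2 d' : R, 0 < d' &
 forall (I : finType) (x y : I -> R), nonoverlapping t0 t1 x y ->
 \sum_i (y i - x i) < d' -> \sum_i d (g (x i)) (g (y i)) < e.
Proof.
move=> e0; have [d' d0 H] := gac e0; exists d' => // I x y [xy1 xy2] s.
have E (F : I -> R) : \sum_i F i = \sum_(k < #|I|) F (enum_val k).
 by transitivity (\sum_(i in I) F i); [apply: eq_bigl|rewrite big_enum_val].
rewrite E; apply: H => //.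
- by move=> i j ij; apply: xy2; apply: contra ij => /eqP/enum_val_inj ->.
- by move: s; rewrite E.
Qed.

Lemma sum_lengths_le (I : finType) (x y : I -> R) c c' : c <= c' ->
 nonoverlapping c c' x y -> \sum_i (y i - x i) <= c' - c.
Proof.
move=> cc [xy1 xy2].
pose X i : set R := `]x i, y i]%classic.
have mX i : measurable (X i) by exact: measurable_itv.
have L (u v : R) : u <= v -> mu `]u, v]%classic = (v - u)%:E.
 move=> uv; rewrite lebesgue_measure_itv /= lte_fin; case: ifPn => // vu.
 by have -> : u = v; [apply/eqP; rewrite eq_le uv leNgt vu|rewrite subrr].
have E (F : I -> R) : \sum_i F i = \sum_(k < #|I|) F (enum_val k).
 by transitivity (\sum_(i in I) F i); [apply: eq_bigl|rewrite big_enum_val].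
rewrite -lee_fin E -sumEFin -L//.
pose Y k := X (enum_val (A := I) k).
have tY : trivIset setT Y.
 move=> i j _ _ [z []]; rewrite /Y /X /= !in_itv /= => /andP[z1 z2] /andP[z3 z4].
 apply/eqP; apply/negP => /negP ij.
 have [k|k] := xy2 (enum_val i) (enum_val j) (contra (fun h => introT eqP (enum_val_inj (eqP h))) ij); lra.
have mY k : measurable (Y k) by exact: mX.
have := @measure_bigsetU_ord _ _ _ mu _ xpredT _ mY tY => H.
rewrite (eq_bigr (fun k => mu (Y k))); last first.
 by move=> k _; rewrite /Y /X L//; have [] := xy1 (enum_val k).
rewrite -H; apply: le_measure; rewrite ?inE.
- by apply: bigsetU_measurable => k _; exact: mY.
- exact: measurable_itv.
rewrite -bigcup_seq => z [k _]; rewrite /Y /X /= !in_itv /= => /andP[z1 z2].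
by have [] := xy1 (enum_val k); lra.
Qed.

Definition clampr c c' (t : R) : R := Num.max c (Num.min t c').

Lemma clampr_in c c' t : c <= c' -> c <= clampr c c' t <= c'.
Proof.
by move=> cc; rewrite /clampr le_max lexx /= ge_max cc ge_min lexx orbT.
Qed.

Lemma clampr_le c c' s t : s <= t -> clampr c c' s <= clampr c c' t.
Proof.
move=> st; rewrite /clampr ge_max !le_max lexx /=; apply/orP; right.
by rewrite le_min !ge_min st lexx !orbT.
Qed.

Lemma clampr_id c c' t : c <= t -> t <= c' -> clampr c c' t = t.
Proof. by move=> ct tc; rewrite /clampr (min_idPl tc) (max_idPr ct). Qed.

Lemma nonoverlapping_clamp (I : finType) (x y : I -> R) a b c c' :
 c <= c' -> nonoverlapping a b x y ->
 nonoverlapping c c' (fun i => clampr c c' (x i)) (fun i => clampr c c' (y i)).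
Proof.
move=> cc [H1 H2]; split => [i|i j ij].
 have [_ xy _] := H1 i; have /andP[? _] := clampr_in (x i) cc.
 by have /andP[_ ?] := clampr_in (y i) cc; split => //; exact: clampr_le.
by have [k|k] := H2 i j ij; [left|right]; exact: clampr_le.
Qed.

(** The intervals need not cover [[c, c']]; as distances are nonnegative, the supremum is still the
    usual variation. *)
Definition vsums c c' : set R := [set r | exists (I : finType) (x y : I -> R),
 nonoverlapping c c' x y /\ r = \sum_i d (g (x i)) (g (y i))].

Definition cvar c c' : R := sup (vsums c c').

Lemma vsums0 c c' : vsums c c' 0.
Proof.
exists 'I_0, (fun=> 0), (fun=> 0); split; last by rewrite big_ord0.
by split => -[].
Qed.

(** Cells shorter than the modulus of absolute continuity for 1 contribute at most 1 each. The
    triangle inequality splits an interval over the cells, its ends being clamped to each of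
    them. *)
Lemma vsums_bounded : exists M, forall r, vsums t0 t1 r -> r <= M.
Proof.
have [e0 He0 Hac] := gac_fin ltr01.
have t10 : 0 < t1 - t0 by rewrite subr_gt0.
have [N HN] := @pow2_small R (e0 / (t1 - t0)) ltac:(by rewrite divr_gt0).
have step : (t1 - t0) / 2 ^+ N < e0.
 by rewrite mulrC -ltr_pdivlMr//; exact: HN.
exists (2 ^ N)%:R => r [I [x [y [xy ->]]]].
pose c k := dyad t0 t1 N k.
have ck k : c k <= c k.+1 by apply: dyad_le => //; exact: ltW.
have key i : d (g (x i)) (g (y i)) <=
  \sum_(k < 2 ^ N) d (g (clampr (c k) (c k.+1) (x i))) (g (clampr (c k) (c k.+1) (y i))).
 have [xl xyi yl] := xy.1 i.
 suff H n : (n <= 2 ^ N)%N -> d (g (clampr t0 (c n) (x i))) (g (clampr t0 (c n) (y i))) <=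
   \sum_(k < n) d (g (clampr (c k) (c k.+1) (x i))) (g (clampr (c k) (c k.+1) (y i))).
  have := H _ (leqnn _); rewrite /c dyad_max !clampr_id//; lra.
 elim: n => [_|n IH n2].
  rewrite big_ord0 /c dyad0 /clampr.
  have -> : Num.max t0 (Num.min (x i) t0) = t0 by rewrite (max_idPl _)// ge_min lexx orbT.
  have -> : Num.max t0 (Num.min (y i) t0) = t0 by rewrite (max_idPl _)// ge_min lexx orbT.
  by rewrite dxx.
 rewrite big_ord_recr /=; apply: le_trans (lerD (IH (ltnW n2)) (lexx _)).
 have /andP[cn _] := @dyad_in _ t0 t1 N n (ltW t01) (ltnW n2); rewrite -/(c n) in cn.
 have cnn := ck n.
 have [xc|xc] := leP (x i) (c n); have [yc|yc] := leP (y i) (c n).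
 - rewrite !(clampr_id xl) ?(clampr_id (le_trans xl xyi)) //; try lra.
  by rewrite lerDl.
 - have -> : clampr t0 (c n) (y i) = c n.
   by rewrite /clampr (min_idPr (ltW yc)) (max_idPr cn).
  have -> : clampr (c n) (c n.+1) (x i) = c n.
   by rewrite /clampr (max_idPl _)// ge_min xc.
  have -> : clampr t0 (c n.+1) (x i) = x i by rewrite clampr_id//; lra.
  have -> : clampr t0 (c n) (x i) = x i by rewrite clampr_id//; lra.
  have -> : clampr t0 (c n.+1) (y i) = clampr (c n) (c n.+1) (y i).
   rewrite /clampr !(max_idPr _)// le_min; split_lra.
  exact: d_tri.
 - by lra.
 - have -> : clampr t0 (c n.+1) (y i) = clampr (c n) (c n.+1) (y i).
   rewrite /clampr !(max_idPr _)// le_min; split_lra.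
  have -> : clampr t0 (c n.+1) (x i) = clampr (c n) (c n.+1) (x i).
   rewrite /clampr !(max_idPr _)// le_min; split_lra.
  by rewrite lerDr.
apply: (le_trans (ler_sum _ (fun i _ => key i))).
rewrite exchange_big /= -[leRHS]mulr1 -mulr_natl.
have -> : ((2 ^ N)%:R * 1 : R) = \sum_(k < 2 ^ N) 1 by rewrite sumr_const card_ord mulr1.
rewrite mulr1; apply: ler_sum => k _.
apply/ltW; have /andP[c1 c2] := @dyad_in _ t0 t1 N k (ltW t01) (ltnW (ltn_ord k)).
have /andP[c3 c4] := @dyad_in _ t0 t1 N k.+1 (ltW t01) (ltn_ord k).
have no := nonoverlapping_clamp (ck k) xy.
apply: Hac.
 split=> [i|]; last exact: no.2.
 by have [? ? ?] := no.1 i; rewrite -/(c k) in c1 c2; rewrite -/(c k.+1) in c3 c4; split => //; lra.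
apply: le_lt_trans step; rewrite -(dyad_step t0 t1 N k).
exact: sum_lengths_le.
Qed.

Lemma vsums_sub c c' a b r : a <= c -> c' <= b -> vsums c c' r -> vsums a b r.
Proof.
move=> ac cb [I [x [y [[H1 H2] ->]]]]; exists I, x, y; split => //; split => // i.
by have [? ? ?] := H1 i; split => //; lra.
Qed.

Lemma vsums_ord c c' r : vsums c c' r -> exists n (x y : 'I_n -> R),
 nonoverlapping c c' x y /\ r = \sum_i d (g (x i)) (g (y i)).
Proof.
move=> [I [x [y [[H1 H2] ->]]]].
exists #|I|, (x \o enum_val), (y \o enum_val); split.
 split => [i|i j ij]; [exact: H1|apply: H2].
 by apply: contra ij => /eqP/enum_val_inj ->.
transitivity (\sum_(i in I) d (g (x i)) (g (y i))); first exact: eq_bigl.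
by rewrite big_enum_val.
Qed.

Lemma vsums_has_sup c c' : t0 <= c -> c' <= t1 -> has_sup (vsums c c').
Proof.
move=> tc ct; split; first by exists 0; exact: vsums0.
have [M HM] := vsums_bounded; exists M => r /(vsums_sub tc ct); exact: HM.
Qed.

Lemma cvar_ub c c' r : t0 <= c -> c' <= t1 -> vsums c c' r -> r <= cvar c c'.
Proof. by move=> tc ct; apply: ub_le_sup; have [] := vsums_has_sup tc ct. Qed.

Lemma cvar_ge0 c c' : t0 <= c -> c' <= t1 -> 0 <= cvar c c'.
Proof. by move=> tc ct; apply: cvar_ub => //; exact: vsums0. Qed.

Lemma cvar_le c c' M : (forall r, vsums c c' r -> r <= M) -> cvar c c' <= M.
Proof. by move=> H; apply: ge_sup => //; exists 0; exact: vsums0. Qed.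

Lemma cvar_dist c c' : t0 <= c -> c <= c' -> c' <= t1 -> d (g c) (g c') <= cvar c c'.
Proof.
move=> tc cc ct; apply: cvar_ub => //; exists 'I_1, (fun=> c), (fun=> c'); split.
 by split => [i|i j]; [split|rewrite !ord1 eqxx].
by rewrite big_ord1.
Qed.

Lemma cvar_split a c b : t0 <= a -> a <= c -> c <= b -> b <= t1 ->
 cvar a b = cvar a c + cvar c b.
Proof.
move=> ta ac cb bt; apply/eqP; rewrite eq_le; apply/andP; split.
 apply: cvar_le => _ [I [x [y [xy ->]]]].
 have no1 := nonoverlapping_clamp ac xy; have no2 := nonoverlapping_clamp cb xy.
 apply: (@le_trans _ _ (\sum_i d (g (clampr a c (x i))) (g (clampr a c (y i))) +
  \sum_i d (g (clampr c b (x i))) (g (clampr c b (y i))))); last first.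
  apply: lerD; apply: cvar_ub; rewrite ?(le_trans ta ac) ?(le_trans cb bt)//.
  - by do 3!eexists; split; [exact: no1|].
  - by do 3!eexists; split; [exact: no2|].
 rewrite -big_split /=; apply: ler_sum => i _.
 have [x1 x2 x3] := xy.1 i.
 have [xc|xc] := leP (x i) c; have [yc|yc] := leP (y i) c.
 - by rewrite !(@clampr_id a c) ?lerDl//; lra.
 - have -> : clampr a c (x i) = x i by rewrite clampr_id.
  have -> : clampr c b (y i) = y i by rewrite clampr_id//; lra.
  have -> : clampr a c (y i) = c by rewrite /clampr (min_idPr (ltW yc)) (max_idPr ac).
  have -> : clampr c b (x i) = c by rewrite /clampr (max_idPl _)// ge_min xc.
  exact: d_tri.
 - by lra.
 - by rewrite !(@clampr_id c b) ?lerDr//; lra.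
have H1 : cvar a c <= cvar a b - cvar c b.
 apply: cvar_le => r1 [I [x [y [xy ->]]]]; rewrite lerBrDr -lerBrDl.
 apply: cvar_le => r2 [J [x' [y' [xy' ->]]]]; rewrite lerBrDl.
 apply: cvar_ub => //.
 exists (I + J)%type, (fun k => match k with inl i => x i | inr j => x' j end),
  (fun k => match k with inl i => y i | inr j => y' j end); split; last first.
  by rewrite big_sumType.
 split=> [[i|j]|[i|i] [j|j] ij].
 - by have [? ? ?] := xy.1 i; split => //; lra.
 - by have [? ? ?] := xy'.1 j; split => //; lra.
 - by apply: xy.2; apply: contra ij => /eqP ->.
 - by left; have [? ? ?] := xy.1 i; have [? ? ?] := xy'.1 j; lra.
 - by right; have [? ? ?] := xy'.1 i; have [? ? ?] := xy.1 j; lra.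
 - by apply: xy'.2; apply: contra ij => /eqP ->.
lra.
Qed.

(** Nearly optimal families inside the given intervals are merged into one family over a sigma type,
    whose total length is no larger. *)
Lemma cvar_ac (e : R) : 0 < e -> exists2 d' : R, 0 < d' &
 forall (I : finType) (x y : I -> R), nonoverlapping t0 t1 x y ->
 \sum_i (y i - x i) < d' -> \sum_i cvar (x i) (y i) <= e.
Proof.
move=> e0; have [d' d0 H] := gac_fin e0; exists d' => // I x y xy s.
apply/ler_addgt0Pr => z z0.
(* The error is shared equally; the successor covers the empty family. *)
pose z' := z / (#|I|.+1)%:R.
have z'0 : 0 < z' by rewrite divr_gt0.
pose W := {n : nat & (('I_n -> R) * ('I_n -> R))%type}.
have /choice[w Hw] : forall i, exists w : W,
  nonoverlapping (x i) (y i) (projT2 w).1 (projT2 w).2 /\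
  cvar (x i) (y i) - z' < \sum_j d (g ((projT2 w).1 j)) (g ((projT2 w).2 j)).
 move=> i.
 have [x1 x2 x3] := xy.1 i.
 have [r /vsums_ord[n [x' [y' [no rE]]]] rz] := sup_adherent z'0 (vsums_has_sup x1 x3).
 by exists (existT _ n (x', y')); rewrite /= -rE.
pose J i := 'I_(projT1 (w i)).
pose X i (j : J i) : R := (projT2 (w i)).1 j.
pose Y i (j : J i) : R := (projT2 (w i)).2 j.
have no : nonoverlapping t0 t1 (fun k : {i : I & J i} => X (tag k) (tagged k)) (fun k => Y (tag k) (tagged k)).
 split=> [[i j]|[i j] [i' j'] ij] /=.
  have [x1 x2 x3] := xy.1 i; have [[k _] _] := Hw i; have [? ? ?] := k j.
  by split; rewrite /X /Y; lra.
 have [ii|ii] := eqVneq i i'.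
  move: ij; case: i' / ii j' => j' ij; have [[_ k] _] := Hw i; apply: k.
  by apply: contra ij => /eqP ->.
 have [[k _] _] := Hw i; have [? ? ?] := k j.
 have [[k' _] _] := Hw i'; have [? ? ?] := k' j'.
 by have [?|?] := xy.2 _ _ ii; [left|right]; rewrite /X /Y; lra.
have := H _ _ _ no.
have sigE (F : forall i, J i -> R) : \sum_(k : {i : I & J i}) F (tag k) (tagged k) = \sum_i \sum_j F i j.
 by rewrite (sig_big_dep (fun=> true) (fun _ _ => true)).
rewrite (sigE (fun i j => Y i j - X i j)) (sigE (fun i j => d (g (X i j)) (g (Y i j)))).
have L : \sum_i \sum_j (Y i j - X i j) < d'.
 apply: le_lt_trans s; apply: ler_sum => i _; apply: sum_lengths_le.
  by have [] := xy.1 i.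
 by have [] := Hw i.
move=> /(_ L) K.
apply: (@le_trans _ _ (\sum_i (\sum_j d (g (X i j)) (g (Y i j)) + z'))).
 by apply: ler_sum => i _; have [_] := Hw i; rewrite /X /Y; lra.
rewrite big_split /= sumr_const.
have : z' *+ #|I| <= z.
 rewrite /z' -mulr_natr -mulrA -[leRHS]mulr1 ler_wpM2l ?(ltW z0)// ler_pdivrMl// mulr1 ler_nat.
 by rewrite leqnSn.
by move: K; lra.
Qed.

Lemma cvarxx c : t0 <= c -> c <= t1 -> cvar c c = 0.
Proof. by move=> h1 h2; have := cvar_split h1 (lexx c) (lexx c) h2; lra. Qed.

Lemma cvar_small (e : R) : 0 < e -> exists2 d' : R, 0 < d' &
 forall x y, t0 <= x -> x <= y -> y <= t1 -> y - x < d' -> cvar x y <= e.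
Proof.
move=> e0; have [d' d0 H] := cvar_ac e0; exists d' => // x y tx xy yt xyd.
have := H 'I_1 (fun=> x) (fun=> y); rewrite !big_ord1; apply => //.
by split => [i|i j]; [split|rewrite !ord1 eqxx].
Qed.

Lemma null_setU (A B : set R) : measurable A -> measurable B ->
 mu A = 0%E -> mu B = 0%E -> mu (A `|` B) = 0%E.
Proof.
move=> mA mB A0 B0; apply/eqP; rewrite eq_le measure_ge0 andbT.
have := @measureU2 _ _ _ mu _ _ mA mB; move: A0 B0 => /= -> ->.
by rewrite adde0.
Qed.

(** [F] is extended by constants and normalized to increase from 0 to 1, so that [monotone_density]
    applies. A constant [F] cannot be normalized and has density 0. *)
Lemma ac_density (F : R -> R) (K : R) : 0 <= K ->
 (forall s t, t0 <= s -> s <= t -> t <= t1 -> 0 <= F t - F s <= K * cvar s t) ->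
 exists phi : R -> R, [/\ mu.-integrable setT (EFin \o phi),
  (forall x y, t0 <= x -> x <= y -> y <= t1 ->
   (\int[mu]_(t in `]x, y]) (phi t)%:E)%E = (F y - F x)%:E) &
  {ae mu, forall x, t0 < x -> x < t1 -> is_derive x 1 F (phi x)}].
Proof.
move=> K0 HF; pose Z := F t1 - F t0.
have c_in t := clampr_in t (ltW t01).
have c_id t : t0 <= t -> t <= t1 -> clampr t0 t1 t = t by exact: clampr_id.
have nearc x : t0 < x -> x < t1 -> \forall t \near x, clampr t0 t1 t = t.
 move=> x1 x2; have : x \in `]t0, t1[ by rewrite in_itv /= x1 x2.
 move=> /near_in_itvoo; apply: filterS => t; rewrite in_itv /= => /andP[? ?].
 by rewrite c_id// ltW.
have [Z0|Z0] := eqVneq Z 0.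
 have Fc t : t0 <= t -> t <= t1 -> F t = F t0.
  move=> h1 h2; have := HF _ _ (lexx _) h1 h2; have := HF _ _ h1 h2 (lexx _).
  by move: Z0; rewrite /Z; lra.
 exists (fun=> 0); split.
 - rewrite (_ : EFin \o _ = cst 0%E)//; exact: integrable0.
 - move=> x y tx xy yt; rewrite integral0_eq//.
  by rewrite !Fc ?subrr//; lra.
 - apply: aeW => x x1 x2.
  have D := @is_derive_cst _ _ _ (F t0) x 1.
  apply: (is_derive_near _ D).
  have : x \in `]t0, t1[ by rewrite in_itv /= x1 x2.
  move=> /near_in_itvoo; apply: filterS => t; rewrite in_itv /= => /andP[? ?].
  by rewrite Fc// ltW.
have Zp : 0 < Z.
 by rewrite lt_neqAle eq_sym Z0 /=; have := HF _ _ (lexx _) (ltW t01) (lexx _); rewrite /Z; lra.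
pose G t := (F (clampr t0 t1 t) - F t0) / Z.
have Gle s t : s <= t -> 0 <= G t - G s <= K / Z * cvar (clampr t0 t1 s) (clampr t0 t1 t).
 move=> st; rewrite /G -mulrBl (_ : _ - _ - _ = F (clampr t0 t1 t) - F (clampr t0 t1 s)); last by ring.
 have /andP[? ?] := c_in s; have /andP[? ?] := c_in t.
 have := HF (clampr t0 t1 s) (clampr t0 t1 t); have := @clampr_le t0 t1 _ _ st.
 move=> h1 h2; have /andP[h3 h4] := h2 ltac:(by []) ltac:(by []) ltac:(by []).
 rewrite divr_ge0 ?(ltW Zp)//= mulrAC ler_pM2r ?invr_gt0//.
have clip s t : s <= t -> clampr t0 t1 t - clampr t0 t1 s <= t - s.
 move=> st; rewrite /clampr; case: (leP t t1) => ?; case: (leP s t1) => ?;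
 rewrite ?(minElt, maxElt); case: ltP => ?; case: ltP => ?; lra.
have Gnd : {homo G : x y / x <= y} by move=> s t /Gle; lra.
have Gc : continuous G.
 move=> x; apply/cvgrPdist_le => e e0.
 have e0' : 0 < e * Z / (K + 1) by rewrite divr_gt0 ?mulr_gt0//; lra.
 have [d' d0 Hd] := cvar_small e0'.
 have KK : K / Z * (e * Z / (K + 1)) <= e.
  have -> : K / Z * (e * Z / (K + 1)) = e * (K / (K + 1)).
   by field; rewrite Z0 /= ; lra.
  rewrite -[leRHS]mulr1 ler_wpM2l ?(ltW e0)// ler_pdivrMr; lra.
 have key s t : s <= t -> t - s < d' -> G t - G s <= e.
  move=> st tsd; have /andP[_ h] := Gle _ _ st.
  apply: (le_trans h); apply: le_trans KK; rewrite ler_wpM2l ?divr_ge0 ?(ltW Zp)//.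
  have /andP[? ?] := c_in s; have /andP[? ?] := c_in t.
  by apply: Hd => //; [exact: clampr_le|have := clip _ _ st; lra].
 exists d' => // y /=; rewrite /ball /= ltr_distl => /andP[? ?].
 have [xy|yx] := leP x y.
  have := key _ _ xy; have /andP[? ?] := Gle _ _ xy.
  by rewrite distrC ger0_norm// => ->//; lra.
 have := key _ _ (ltW yx); have /andP[? ?] := Gle _ _ (ltW yx).
 by rewrite ger0_norm// => ->//; lra.
have Ga x : x <= t0 -> G x = 0.
 move=> xt; rewrite /G /clampr (max_idPl _) ?subrr ?mul0r//.
 by rewrite ge_min xt.
have Gb x : t1 <= x -> G x = 1.
 by move=> xt; rewrite /G /clampr (min_idPr xt) (max_idPr (ltW t01)) divff.
have Gac e : 0 < e -> exists2 d', 0 < d' & forall n (S : pred 'I_(2 ^ n)),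
  \sum_(i | S i) ((t1 - t0) / 2 ^+ n) < d' ->
  \sum_(i | S i) (G (dyad t0 t1 n i.+1) - G (dyad t0 t1 n i)) < e.
 move=> e0.
 have e0' : 0 < e * Z / (K + 1) by rewrite divr_gt0 ?mulr_gt0//; lra.
 have KK : K / Z * (e * Z / (K + 1)) < e.
  have -> : K / Z * (e * Z / (K + 1)) = e * (K / (K + 1)).
   by field; rewrite Z0 /= ; lra.
  rewrite -[ltRHS]mulr1 ltr_pM2l// ltr_pdivrMr; lra.
 have [d' d0 Hd] := cvar_ac e0'; exists d' => // n S Ss.
 pose x (i : 'I_(2 ^ n)) := dyad t0 t1 n i.
 pose y (i : 'I_(2 ^ n)) := if S i then dyad t0 t1 n i.+1 else dyad t0 t1 n i.
 have din k : (k <= 2 ^ n)%N -> t0 <= dyad t0 t1 n k <= t1.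
  by move=> ?; apply: dyad_in => //; exact: ltW.
 have dle k l : (k <= l)%N -> dyad t0 t1 n k <= dyad t0 t1 n l.
  by move=> ?; apply: dyad_le => //; exact: ltW.
 have no : nonoverlapping t0 t1 x y.
  split=> [i|i j ij].
   have /andP[? ?] := din i (ltnW (ltn_ord i)); have /andP[? ?] := din i.+1 (ltn_ord i).
   by rewrite /x /y; case: (S i); split => //; exact: dle.
  rewrite /x /y; have [h|h|h] := ltngtP i j.
  - by left; case: (S i); apply: dle => //; exact: ltnW.
  - by right; case: (S j); apply: dle => //; exact: ltnW.
  - by case/eqP: ij; exact: val_inj.
 have := Hd _ _ _ no.
 have -> : \sum_i (y i - x i) = \sum_(i | S i) ((t1 - t0) / 2 ^+ n).
  rewrite [RHS]big_mkcond; apply: eq_bigr => i _; rewrite /x /y.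
  by case: (S i); rewrite ?subrr// dyad_step.
 move=> /(_ Ss) H2; apply: le_lt_trans KK.
 apply: (@le_trans _ _ (K / Z * \sum_i cvar (x i) (y i))); last first.
  by rewrite ler_wpM2l// divr_ge0// ltW.
 rewrite big_mkcond mulr_sumr; apply: ler_sum => i _.
 have /andP[? ?] := din i (ltnW (ltn_ord i)); have /andP[? ?] := din i.+1 (ltn_ord i).
 rewrite /x /y; case: (S i); last by rewrite cvarxx// mulr0.
 have /andP[_] := Gle _ _ (dle _ _ (leqnSn i)).
 by rewrite !c_id.
have [phi [phi0 phii phiE phid]] := monotone_density t01 Gnd Gc Ga Gb Gac.
exists (fun x => Z * phi x); split.
- have := @integrableZl _ _ _ mu setT measurableT Z _ phii.
 by [].
- move=> x y tx xy yt.
 have -> : (\int[mu]_(t in `]x, y]) (Z * phi t)%:E = Z%:E * \int[mu]_(t in `]x, y]) (phi t)%:E)%E.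
  have mxy : measurable (`]x, y]%classic : set R) by exact: measurable_itv.
  have h0 t : (`]x, y]%classic : set R) t -> (0 <= (EFin \o phi) t)%E by move=> _; rewrite lee_fin.
  have h1 : measurable_fun `]x, y]%classic (EFin \o phi).
   by have /integrableP[h _] := phii; apply: (measurable_funS measurableT _ h).
  exact: (@ge0_integralZl_EFin _ _ _ mu _ mxy (EFin \o phi) h0 h1 Z (ltW Zp)).
 rewrite phiE// -EFinM; congr (_%:E); rewrite /G !c_id//; last 2 first.
 + by lra.
 + by lra.
 by field; rewrite Z0.
- move: phid; apply: filterS; first exact: (ae_filter_ringOfSetsType mu).
 move=> x h x1 x2; have D := is_derive_scal Z (h x1).
 have D2 := is_derive_add D (@is_derive_cst _ _ _ (F t0) x 1).
 rewrite addr0 in D2.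
 apply: (is_derive_near _ D2).
 have := nearc x x1 x2; apply: filterS => t ct.
 by rewrite /G ct mulrC mulfVK// subrK.
Qed.

(** [f] is the difference of [f + K * cvar t0] and [K * cvar t0], both monotone with increments
    controlled by the variation. *)
Lemma ac_diff (f : R -> R) (K : R) : 0 <= K ->
 (forall s t, t0 <= s -> s <= t -> t <= t1 -> `|f t - f s| <= K * d (g s) (g t)) ->
 exists psi : R -> R, [/\ mu.-integrable setT (EFin \o psi),
  (forall x y, t0 <= x -> x <= y -> y <= t1 ->
   (\int[mu]_(t in `]x, y]) (psi t)%:E)%E = (f y - f x)%:E) &
  {ae mu, forall x, t0 < x -> x < t1 -> is_derive x 1 f (psi x)}].
Proof.
move=> K0 Hf.
pose F2 t := K * cvar t0 t; pose F1 t := f t + F2 t.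
have vs s t : t0 <= s -> s <= t -> t <= t1 -> cvar t0 t - cvar t0 s = cvar s t.
 by move=> h1 h2 h3; rewrite (@cvar_split t0 s t)// addrC addKr.
have H2 s t : t0 <= s -> s <= t -> t <= t1 -> 0 <= F2 t - F2 s <= K * cvar s t.
 move=> h1 h2 h3; rewrite /F2 -mulrBr vs// lexx andbT mulr_ge0//.
 by rewrite cvar_ge0.
have H1 s t : t0 <= s -> s <= t -> t <= t1 -> 0 <= F1 t - F1 s <= (2 * K) * cvar s t.
 move=> h1 h2 h3; have h4 := Hf s t h1 h2 h3.
 have h5 : K * d (g s) (g t) <= K * cvar s t by rewrite ler_wpM2l// cvar_dist.
 have -> : F1 t - F1 s = (f t - f s) + K * cvar s t.
  by rewrite /F1 -(vs s t)// /F2; ring.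
 by move: h4; rewrite ler_norml => /andP[? ?]; lra.
have [p1 [i1 e1 d1]] := ac_density (mulr_ge0 (ler0n _ 2) K0) H1.
have [p2 [i2 e2 d2]] := ac_density K0 H2.
exists (fun t => p1 t - p2 t); split.
- have := @integrableB _ _ _ mu setT measurableT _ _ i1 i2; by [].
- move=> x y tx xy yt.
 have mxy : measurable (`]x, y]%classic : set R) by exact: measurable_itv.
 have j1 := @integrableS _ _ _ mu setT `]x, y]%classic _ measurableT mxy (@subsetT _ _) i1.
 have j2 := @integrableS _ _ _ mu setT `]x, y]%classic _ measurableT mxy (@subsetT _ _) i2.
 transitivity (\int[mu]_(t in `]x, y]) ((p1 t)%:E - (p2 t)%:E))%E.
  by apply: eq_integral => t _; rewrite EFinB.
 rewrite integralB//.
 have -> := e1 x y tx xy yt; have -> := e2 x y tx xy yt.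
 by rewrite -EFinB; congr (_%:E); rewrite /F1; ring.
- case: d1 => N1 [mN1 N10 s1]; case: d2 => N2 [mN2 N20 s2].
 exists (N1 `|` N2); split; [exact: measurableU|exact: null_setU|].
 move=> x nx; apply: contrapT => /not_orP[n1 n2]; apply: nx => x1 x2.
 have D1 : is_derive x 1 F1 (p1 x).
  by apply: contra_notP n1 => h; apply: s1 => /(_ x1 x2).
 have D2 : is_derive x 1 F2 (p2 x).
  by apply: contra_notP n2 => h; apply: s2 => /(_ x1 x2).
 have := is_derive_sub D1 D2.
 by have -> : (fun s => F1 s - F2 s) = f by apply/funext => s; rewrite /F1 addrK.
Qed.

(** The increment of [f] is the integral of its density, which is almost everywhere the derivative
    and so at most [S]. As [S] may fail to be measurable, the comparison is one of lower integrals
    off a null set. *)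
Lemma ac_bound (f : R -> R) (K : R) (S : R -> \bar R) x y : 0 <= K ->
 (forall s t, t0 <= s -> s <= t -> t <= t1 -> `|f t - f s| <= K * d (g s) (g t)) ->
 t0 <= x -> x <= y -> y <= t1 ->
 (forall t, x <= t <= y -> (0 <= S t)%E) ->
 {ae mu, forall t, t0 < t -> t < t1 -> forall l, is_derive t 1 f l -> (`|l|%:E <= S t)%E} ->
 ((f y - f x)%:E <= \int[mu]_(t in `[x, y]) S t)%E.
Proof.
move=> K0 Hf tx xy yt S0 aeS.
have [psi [psii psiE psid]] := ac_diff K0 Hf.
rewrite -psiE//.
apply: (@le_trans _ _ (\int[mu]_(t in `]x, y]) S t)%E); last first.
 apply: lower_subset; first by move=> t /=; rewrite in_itv /=; exact: S0.
 by move=> t /=; rewrite !in_itv /= => /andP[/ltW -> ->].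
apply: (@le_trans _ _ (\int[mu]_(t in `]x, y]) `|psi t|%:E)%E).
 have mxy : measurable (`]x, y]%classic : set R) by exact: measurable_itv.
 have j1 := @integrableS _ _ _ mu setT `]x, y]%classic _ measurableT mxy (@subsetT _ _) psii.
 apply: le_integral => //.
  have := integrable_abse j1; by [].
 by move=> t _; rewrite lee_fin ler_norm.
case: psid => N1 [mN1 N10 s1]; case: aeS => N2 [mN2 N20 s2].
(* The point [t1] joins the exceptional set because derivatives are known at interior points
   only. *)
apply: (@lower_ae_le _ _ _ _ ((N1 `|` N2) `|` [set t1])).
- exact: measurable_itv.
- by apply: measurableU; [exact: measurableU|exact: measurable_set1].
- apply: null_setU; [exact: measurableU|exact: measurable_set1|exact: null_setU|exact: lebesgue_measure_set1].
- by move=> t _; rewrite lee_fin.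
- by move=> t /=; rewrite in_itv /= => /andP[? ?]; apply: S0; split_lra.
move=> t /=; rewrite in_itv /= => /andP[xt ty] nt.
have h1 : t0 < t by lra.
have h2 : t < t1.
 rewrite lt_neqAle (le_trans ty yt) andbT; apply/eqP => tt; apply: nt; right; exact: tt.
have D : is_derive t 1 f (psi t).
 by apply: contra_notP nt => h; left; left; apply: s1 => /(_ h1 h2).
have : forall l, is_derive t 1 f l -> (`|l|%:E <= S t)%E.
 by apply: contra_notP nt => h; left; right; apply: s2 => /(_ h1 h2).
exact.
Qed.

End CurveVariation.

(** * The quotient distance, rotation invariants, and differentiable lifts *)

Section SpeedOfCurves.
Context {R : realType}.
Variable m : 'I_3 -> R.
Hypothesis m_gt0 : forall i, 0 < m i.
Local Notation proj := (@reduced_proj R).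

(** A closed formula for the distance that [rdist] defines as an infimum of lengths; [rdistE]
    identifies the two. *)
Definition rd (p p' : reduced R) : R := qdist m (repr p) (repr p').

Lemma proj_repr (p : reduced R) : proj (repr p) = p.
Proof. exact: reprK. Qed.

Lemma proj_congr (q q' : config R) : congruent q q' -> proj q = proj q'.
Proof. by move=> H; apply/eqmodP. Qed.

Lemma congr_proj (q q' : config R) : proj q = proj q' -> congruent q q'.
Proof. by move=> /eqmodP. Qed.

Lemma repr_proj (q : config R) : congruent (repr (proj q)) q.
Proof. by apply: congr_proj; rewrite proj_repr. Qed.

Lemma rd_proj (q q' : config R) : rd (proj q) (proj q') = qdist m q q'.
Proof.
rewrite /rd (congruent_qdist m _ (repr_proj q')) qdistC.
by rewrite (congruent_qdist m _ (repr_proj q)) qdistC.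
Qed.

Lemma rd_ge0 p p' : 0 <= rd p p'. Proof. exact: qdist_ge0. Qed.
Lemma rdC p p' : rd p p' = rd p' p. Proof. exact: qdistC. Qed.
Lemma rd_triangle p q r : rd p r <= rd p q + rd q r.
Proof. exact: qdist_triangle. Qed.

Lemma rd_eq0 p p' : rd p p' = 0 -> p = p'.
Proof.
by move=> /(qdist_eq0 m_gt0)/proj_congr; rewrite !proj_repr.
Qed.

Lemma qdistxx (q : config R) : qdist m q q = 0.
Proof.
rewrite /qdist.
have -> : habs m q q = hre m q q.
 by rewrite /habs him0 expr0n addr0 sqrtr_sqr ger0_norm// hre_ge0.
by rewrite (_ : _ - _ = 0) ?sqrtr0//; ring.
Qed.

Lemma rdxx p : rd p p = 0. Proof. exact: qdistxx. Qed.

Definition rsize (p : reduced R) : R := hnorm m (repr p).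

Lemma congruent_hnorm (q q' : config R) : congruent q q' -> hnorm m q = hnorm m q'.
Proof.
move=> c; rewrite /hnorm !hre_sep//.
by rewrite !(congruent_sep _ _ c).
Qed.

Lemma rsize_proj q : rsize (proj q) = hnorm m q.
Proof. exact: congruent_hnorm (repr_proj q). Qed.

Lemma rsize_rd p p' : `|rsize p - rsize p'| <= rd p p'.
Proof. exact: hnorm_qdist. Qed.

Lemma rsize_ge0 p : 0 <= rsize p. Proof. exact: hnorm_ge0. Qed.

Definition rsep i j (p : reduced R) : R := sep (repr p) i j.

Lemma rsep_proj i j q : rsep i j (proj q) = sep q i j.
Proof. by rewrite /rsep (congruent_sep _ _ (repr_proj q)). Qed.

Lemma rsep_rd i j p p' : `|rsep i j p - rsep i j p'| <= sepK m * rd p p'.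
Proof. exact: sep_qdist. Qed.

Lemma rsep_ge0 i j p : 0 <= rsep i j p. Proof. exact: sep_ge0. Qed.

Lemma rd_rsize0 p p' : rsize p = 0 -> rd p p' = rsize p'.
Proof.
move=> p0; rewrite /rd /qdist.
have h0 : hre m (repr p) (repr p) = 0 by rewrite -hnorm_sq// -/(rsize p) p0 expr0n.
have a0 : habs m (repr p) (repr p') = 0.
 apply/eqP; rewrite eq_le habs_ge0 andbT.
 by have := cauchy_schwarz m_gt0 (repr p) (repr p'); rewrite -/(rsize p) p0 mul0r.
by rewrite h0 a0 mulr0 subr0 add0r.
Qed.

(** The real and imaginary parts of [q_13] times the conjugate of [q_12], where [q_1j] is
    [q b1 - q bj]. These invariants and the distances from body 1 supply smooth coordinates for a
    lift. *)
Definition mixr (q : config R) : R :=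
 sepr q b1 b3 * sepr q b1 b2 + sepi q b1 b3 * sepi q b1 b2.
Definition mixi (q : config R) : R :=
 sepi q b1 b3 * sepr q b1 b2 - sepr q b1 b3 * sepi q b1 b2.

Lemma abs_sepr (q : config R) i j : `|sepr q i j| <= sep q i j.
Proof.
apply: ler_sqr2; first exact: sep_ge0.
by rewrite real_normK ?num_real// sepE lerDl sqr_ge0.
Qed.

Lemma abs_sepi (q : config R) i j : `|sepi q i j| <= sep q i j.
Proof.
apply: ler_sqr2; first exact: sep_ge0.
by rewrite real_normK ?num_real// sepE lerDr sqr_ge0.
Qed.

Lemma mix_congr (q q' : config R) : congruent q q' -> (mixr q' = mixr q) * (mixi q' = mixi q).
Proof.
move=> /congruentP[u u1 [c H]].
have [e1 e2] : (forall i j, sepr q' i j = sepr (crot u q) i j) *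
 (forall i j, sepi q' i j = sepi (crot u q) i j) by apply: (ctrans_sepr H).
have U := unit_sq u1.
split; rewrite /mixr /mixi !e1 !e2 /crot /sepr /sepi !ReImE.
 transitivity ((Re u ^+ 2 + Im u ^+ 2) * mixr q); last by rewrite U mul1r.
 by rewrite /mixr /sepr /sepi; ring.
transitivity ((Re u ^+ 2 + Im u ^+ 2) * mixi q); last by rewrite U mul1r.
by rewrite /mixi /sepr /sepi; ring.
Qed.

Lemma mix_rot (q q' : config R) : exists2 p, hnorm m (csub q p) = qdist m q q' &
 [/\ mixr p = mixr q', mixi p = mixi q' & hnorm m p = hnorm m q'].
Proof.
have [u u1 H] := qdist_align m q q'; exists (crot u q') => //.
have c : congruent q' (crot u q').
 by apply/congruentP; exists u => //; exists 0 => i; rewrite /crot addr0.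
by have [-> ->] := mix_congr c; split => //; rewrite hnorm_crot.
Qed.

Lemma mix_lip (q q' : config R) :
 (`|mixr q - mixr q'| <= 2 * sepK m ^+ 2 * (hnorm m q + hnorm m q') * qdist m q q') *
 (`|mixi q - mixi q'| <= 2 * sepK m ^+ 2 * (hnorm m q + hnorm m q') * qdist m q q').
Proof.
have [p <- [<- <- <-]] := mix_rot q q'.
have K0 := ltW (sepK_gt0 m_gt0).
set D := hnorm m (csub q p).
have D0 : 0 <= D by exact: hnorm_ge0.
have dr i j : sepr q i j - sepr p i j = sepr (csub q p) i j.
 by rewrite /sepr /csub !ReImE; ring.
have di i j : sepi q i j - sepi p i j = sepi (csub q p) i j.
 by rewrite /sepi /csub !ReImE; ring.
have B (x y : R) (X Y : R) : `|x| <= sepK m * X -> `|y| <= sepK m * Y ->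
  `|x * y| <= sepK m ^+ 2 * (X * Y).
 move=> hx hy; rewrite normrM (_ : _ ^+ 2 * _ = (sepK m * X) * (sepK m * Y)); last by ring.
 by apply: ler_pM.
have Sr (c : config R) i j : `|sepr c i j| <= sepK m * hnorm m c.
 by apply: (le_trans (abs_sepr _ _ _)); exact: sep_le_hnorm.
have Si (c : config R) i j : `|sepi c i j| <= sepK m * hnorm m c.
 by apply: (le_trans (abs_sepi _ _ _)); exact: sep_le_hnorm.
split.
- have -> : mixr q - mixr p = sepr (csub q p) b1 b3 * sepr q b1 b2 + sepr p b1 b3 * sepr (csub q p) b1 b2 +
   (sepi (csub q p) b1 b3 * sepi q b1 b2 + sepi p b1 b3 * sepi (csub q p) b1 b2).
  by rewrite -!dr -!di /mixr; ring.
 have h1 := B _ _ _ _ (Sr (csub q p) b1 b3) (Sr q b1 b2).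
 have h2 := B _ _ _ _ (Sr p b1 b3) (Sr (csub q p) b1 b2).
 have h3 := B _ _ _ _ (Si (csub q p) b1 b3) (Si q b1 b2).
 have h4 := B _ _ _ _ (Si p b1 b3) (Si (csub q p) b1 b2).
 apply: (le_trans (ler_normD _ _)).
 apply: (le_trans (lerD (ler_normD _ _) (ler_normD _ _))).
 by rewrite -/D in h1 h2 h3 h4; lra.
- have -> : mixi q - mixi p = sepi (csub q p) b1 b3 * sepr q b1 b2 + sepi p b1 b3 * sepr (csub q p) b1 b2 -
   (sepr (csub q p) b1 b3 * sepi q b1 b2 + sepr p b1 b3 * sepi (csub q p) b1 b2).
  by rewrite -!dr -!di /mixi; ring.
 have h1 := B _ _ _ _ (Si (csub q p) b1 b3) (Sr q b1 b2).
 have h2 := B _ _ _ _ (Si p b1 b3) (Sr (csub q p) b1 b2).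
 have h3 := B _ _ _ _ (Sr (csub q p) b1 b3) (Si q b1 b2).
 have h4 := B _ _ _ _ (Sr p b1 b3) (Si (csub q p) b1 b2).
 apply: (le_trans (ler_normB _ _)).
 apply: (le_trans (lerD (ler_normD _ _) (ler_normD _ _))).
 by rewrite -/D in h1 h2 h3 h4; lra.
Qed.

Lemma lim_le_seq (x y : nat -> R) (l s : R) : x n @[n --> \oo] --> l -> y n @[n --> \oo] --> s ->
 (forall n, x n <= y n) -> l <= s.
Proof.
move=> xl ys xy; rewrite -subr_le0.
apply: (@cvgr_to_le _ \oo _ R (fun n => x n - y n)); first exact: cvgB.
by apply: nearW => n; rewrite subr_le0.
Qed.

Lemma right_steps (t t' : R) : t < t' -> exists v : nat -> R, v n @[n --> \oo] --> t /\
 forall n, t < v n /\ v n <= t'.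
Proof.
move=> tt; have e0 : 0 < t' - t by rewrite subr_gt0.
exists (fun n => t + (t' - t) * harmonic n); split.
 rewrite -[X in _ --> X]addr0; apply: cvgD; first exact: cvg_cst.
 by rewrite -(mulr0 (t' - t)); apply: cvg_scal; exact: cvg_harmonic.
move=> n; rewrite ltrDl mulr_gt0//= ?invr_gt0//; split=> //.
by rewrite -lerBrDl -[leRHS]mulr1 ler_pM2l// invf_le1// ler1n.
Qed.

Definition is_lift (Q : 'I_3 -> R -> R[i]) (g : R -> reduced R) (t : R) :=
 (\forall s \near t, proj (at_time Q s) = g s) /\ (forall i, cderivable (Q i) t).

(** At a triple collision the distance from [g t] is the norm, whose derivative vanishes at its
    minimum 0. A function controlled by this distance therefore has derivative 0. *)
Lemma zero_speed_bound (g : R -> reduced R) (F : R -> R) (c t t' l : R) : t < t' ->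
 rsize (g t) = 0 -> derivable (rsize \o g) t 1 ->
 (forall s, t <= s <= t' -> `|F s - F t| <= c * rd (g t) (g s)) ->
 is_derive t 1 F l -> l = 0.
Proof.
move=> tt s0 sz HF DF.
have [v [vt vin]] := right_steps tt.
have ut : (fun n : nat => t) n @[n --> \oo] --> t by exact: cvg_cst.
have stl n := (vin n).1; have str n : t <= t <= v n by rewrite lexx ltW.
have C := straddle_cvg DF ut vt str stl.
have Cn : `|(F (v n) - F t) / (v n - t)| @[n --> \oo] --> `|l| by apply: cvg_norm.
have D0 : is_derive t 1 (rsize \o g) 0.
 have D := derivable_is_derive sz.
 have -> : 0 = derive1 (rsize \o g) t :> R.
  by rewrite derive1_min0// => s /=; rewrite s0 rsize_ge0.
 exact: D.
have C2 := straddle_cvg D0 ut vt str stl.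
have C3 : c * ((rsize (g (v n)) - rsize (g t)) / (v n - t)) @[n --> \oo] --> c * 0.
 by apply: cvg_scal; exact: C2.
have l0 : `|l| <= c * 0.
 apply: (lim_le_seq Cn C3) => n.
 rewrite normrM normfV (gtr0_norm (_ : 0 < v n - t)) ?subr_gt0// mulrA.
 rewrite ler_pM2r ?invr_gt0 ?subr_gt0//.
 rewrite (le_trans (HF _ _))//; first by rewrite (ltW (stl n)) (vin n).2.
 by rewrite rd_rsize0// s0 subr0.
by apply/eqP; rewrite -normr_le0; move: l0; rewrite mulr0.
Qed.

Lemma lift_speed_bound (g : R -> reduced R) Q (F : R -> R) (c t t' l : R) : t < t' ->
 is_lift Q g t -> 0 <= c ->
 (rsize (g t) = 0 -> derivable (rsize \o g) t 1) ->
 (forall s, t <= s <= t' -> `|F s - F t| <= c * rd (g t) (g s)) ->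
 is_derive t 1 F l -> `|l| <= c * sqrt (2 * kinetic_lift m Q t).
Proof.
move=> tt [nearQ dQ] c0 sz HF DF.
have [v [vt vin]] := right_steps tt.
have ut : (fun n : nat => t) n @[n --> \oo] --> t by exact: cvg_cst.
have stl n := (vin n).1; have str n : t <= t <= v n by rewrite lexx ltW.
have C := straddle_cvg DF ut vt str stl.
have Cn : `|(F (v n) - F t) / (v n - t)| @[n --> \oo] --> `|l| by apply: cvg_norm.
have B n : `|(F (v n) - F t) / (v n - t)| <= c * (rd (g t) (g (v n)) / (v n - t)).
 rewrite normrM normfV (gtr0_norm (_ : 0 < v n - t)) ?subr_gt0// mulrA.
 by rewrite ler_pM2r ?invr_gt0 ?subr_gt0// HF// (ltW (stl n)) (vin n).2.
have gt : g t = proj (at_time Q t) by rewrite (nbhs_singleton nearQ).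
have [s0|s0] := eqVneq (rsize (g t)) 0.
 rewrite (zero_speed_bound tt s0 (sz s0) HF DF) normr0.
 by rewrite mulr_ge0 ?sqrtr_ge0.
have hp : 0 < hnorm m (at_time Q t) by rewrite -rsize_proj -gt lt_neqAle eq_sym s0 rsize_ge0.
have C2 := speed_cvg_pos m_gt0 dQ hp ut vt str stl.
have C3 : rd (g t) (g (v n)) / (v n - t) @[n --> \oo] --> sqrt (2 * kinetic_lift m Q t).
 apply: cvg_trans C2; apply: near_eq_cvg.
 have := vt _ nearQ; rewrite near_simpl /= => nQ; near=> n.
 have <- : proj (at_time Q (v n)) = g (v n) by near: n.
 by rewrite gt rd_proj.
have C4 : c * (rd (g t) (g (v n)) / (v n - t)) @[n --> \oo] --> c * sqrt (2 * kinetic_lift m Q t).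
 by apply: cvg_scal; exact: C3.
exact: (lim_le_seq Cn C4).
Unshelve. all: by end_near.
Qed.

Lemma nearT_gt0 (f : R -> R) t : derivable f t 1 -> 0 < f t -> \forall s \near t, 0 < f s.
Proof.
move=> /derivable_is_derive/is_derive_cvg C ft.
by apply: (@cvgr_gt _ _ (nbhs t) _ f (f t)).
Qed.

Lemma derivable_div (f f' : R -> R) t : derivable f t 1 -> derivable f' t 1 -> 0 < f' t ->
 derivable (fun s => f s / f' s) t 1.
Proof.
move=> d1 d2 f0; have := derivableM d1 (derivableV (lt0r_neq0 f0) d2).
by [].
Qed.

(** Put body 1 at the origin and a body that does not collide with it on the negative real axis. The
    coordinates are then distances and quotients of invariants by a positive distance. If both
    distances from body 1 vanish, the collision is triple, which is excluded. *)
Lemma lift_exists (g : R -> reduced R) t : 0 < rsize (g t) ->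
 derivable (fun s => rsep b1 b2 (g s)) t 1 -> derivable (fun s => rsep b1 b3 (g s)) t 1 ->
 derivable (fun s => mixr (repr (g s))) t 1 -> derivable (fun s => mixi (repr (g s))) t 1 ->
 exists Q, is_lift Q g t.
Proof.
move=> s0 d12 d13 dr di.
pose A s := rsep b1 b2 (g s); pose B s := rsep b1 b3 (g s).
pose Pr s := mixr (repr (g s)); pose Pi s := mixi (repr (g s)).
have dN (f : R -> R) : derivable f t 1 -> derivable (fun s => - f s) t 1.
 by move=> df; have := derivableN df.
have d0 : derivable (fun _ : R => 0 : R) t 1 by exact: derivable_cst.
have key (q : config R) (u v : 'I_3) (a : R) : sep q b1 u = a -> 0 < a ->
 forall q' : config R, q' b1 = 0 ->
  (forall k, q' b1 - q' k = (q b1 - q k) * ((Re (q b1 - q u) / a) -i* (Im (q b1 - q u) / a))) ->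
  proj q' = proj q.
 move=> sa a0 q' q'1 H; apply/esym/proj_congr/congruentP.
 exists ((Re (q b1 - q u) / a) -i* (Im (q b1 - q u) / a)).
  apply: sq_unit => /=; rewrite sqrrN !expr_div_n -mulrDl -normcsq -/(sep q b1 u) sa divff//.
  by rewrite expf_neq0// lt0r_neq0.
 set w := _ -i* _; exists (- (w * q b1)) => k.
 have := H k; rewrite q'1 sub0r => /eqP; rewrite eqr_oppLR => /eqP ->.
 by rewrite -/w; ring.
have I3 (P : 'I_3 -> Prop) : P b1 -> P b2 -> P b3 -> forall k, P k.
 move=> p1 p2 p3 [[|[|[|//]]] hk].
 - by rewrite (_ : Ordinal hk = b1)//; apply: val_inj.
 - by rewrite (_ : Ordinal hk = b2)//; apply: val_inj.
 - by rewrite (_ : Ordinal hk = b3)//; apply: val_inj.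
have ctx (f f' : R -> R) (h : R -> R[i]) : derivable f t 1 -> derivable f' t 1 ->
  (forall s, h s = f s +i* f' s) -> cderivable h t.
 move=> h1 h2 hE; split.
  by rewrite (_ : _ \o _ = f)//; apply/funext => s /=; rewrite hE.
 by rewrite (_ : _ \o _ = f')//; apply/funext => s /=; rewrite hE.
have dA : derivable A t 1 := d12.
have dB : derivable B t 1 := d13.
have dPr : derivable Pr t 1 := dr.
have dPi : derivable Pi t 1 := di.
have d0c : cderivable (fun=> 0 : R[i]) t by apply: (ctx (fun=> 0) (fun=> 0)).
have [a0|a0] := ltP 0 (A t).
 exists (fun k s => if k == b1 then 0 else if k == b2 then (- A s) +i* 0
  else (- (Pr s / A s)) +i* (- (Pi s / A s))).
 split.
  apply: filterS (nearT_gt0 d12 a0) => s sA; rewrite -[g s in RHS]proj_repr.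
  apply: (@key _ b2 b3 (A s) erefl sA) => //.
  have sq : A s ^+ 2 = sepr (repr (g s)) b1 b2 ^+ 2 + sepi (repr (g s)) b1 b2 ^+ 2 by rewrite -sepE.
  apply: I3; rewrite /at_time /=.
  - by rewrite !subrr mul0r.
  - rewrite sub0r; apply/eqP; rewrite eq_complex !ReImE /= -!reB -!imB.
   rewrite !reB !imB -!/(sepr _ _ _) -!/(sepi _ _ _); apply/andP; split; apply/eqP.
    apply: (mulIf (lt0r_neq0 sA)) => /=; rewrite -/(A s); transitivity (A s ^+ 2); first by rewrite opprK.
    by rewrite sq; field; rewrite lt0r_neq0.
   by field; rewrite lt0r_neq0.
  - rewrite sub0r; apply/eqP; rewrite eq_complex !ReImE /=.
   rewrite -!/(sepr _ _ _) -!/(sepi _ _ _) /Pr /Pi /mixr /mixi; apply/andP; split; apply/eqP;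
   by field; rewrite lt0r_neq0.
 have q1 := dN _ (derivable_div dPr dA a0).
 have q2 := dN _ (derivable_div dPi dA a0).
 apply: I3 => /=; first exact: d0c.
  by refine (ctx _ _ _ (dN _ dA) d0 _).
 by refine (ctx _ _ _ q1 q2 _).
have [c0|c0] := ltP 0 (B t).
 exists (fun k s => if k == b1 then 0 else if k == b3 then (- B s) +i* 0
  else (- (Pr s / B s)) +i* (Pi s / B s)).
 split.
  apply: filterS (nearT_gt0 d13 c0) => s sB; rewrite -[g s in RHS]proj_repr.
  apply: (@key _ b3 b2 (B s) erefl sB) => //.
  have sq : B s ^+ 2 = sepr (repr (g s)) b1 b3 ^+ 2 + sepi (repr (g s)) b1 b3 ^+ 2 by rewrite -sepE.
  apply: I3; rewrite /at_time /=.
  - by rewrite !subrr mul0r.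
  - rewrite sub0r; apply/eqP; rewrite eq_complex !ReImE /=.
   rewrite -!/(sepr _ _ _) -!/(sepi _ _ _) /Pr /Pi /mixr /mixi; apply/andP; split; apply/eqP;
   by field; rewrite lt0r_neq0.
  - rewrite sub0r; apply/eqP; rewrite eq_complex !ReImE /=.
   rewrite -!/(sepr _ _ _) -!/(sepi _ _ _); apply/andP; split; apply/eqP.
    apply: (mulIf (lt0r_neq0 sB)) => /=; rewrite -/(B s); transitivity (B s ^+ 2); first by rewrite opprK.
    by rewrite sq; field; rewrite lt0r_neq0.
   by field; rewrite lt0r_neq0.
 have q1 := dN _ (derivable_div dPr dB c0).
 have q2 := derivable_div dPi dB c0.
 apply: I3 => /=; first exact: d0c.
  by refine (ctx _ _ _ q1 q2 _).
 by refine (ctx _ _ _ (dN _ dB) d0 _).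
have A0 : A t = 0 by apply/eqP; rewrite eq_le a0 rsep_ge0.
have B0 : B t = 0 by apply/eqP; rewrite eq_le c0 rsep_ge0.
have e2 := eq0_normc A0; have e3 := eq0_normc B0.
have C0 : sep (repr (g t)) b2 b3 = 0.
 rewrite /sep (_ : _ - _ = (repr (g t) b1 - repr (g t) b3) - (repr (g t) b1 - repr (g t) b2)); last by ring.
 by rewrite e2 e3 subrr normc0.
move: s0; rewrite /rsize /hnorm hre_sep// C0 -/(rsep b1 b2 (g t)) -/(A t) -/(rsep b1 b3 (g t)) -/(B t) A0 B0.
by rewrite expr0n /= !mulr0 !addr0 sqrtr0 ltxx.
Qed.

End SpeedOfCurves.

(** * The potential on the reduced space and the conformal factor *)

Section Potential.
Context {R : realType}.
Variable m : 'I_3 -> R.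
Hypothesis m_gt0 : forall i, 0 < m i.

Lemma ord3_ind (P : 'I_3 -> Prop) : P b1 -> P b2 -> P b3 -> forall k, P k.
Proof.
move=> p1 p2 p3 [[|[|[|//]]] hk].
- by rewrite (_ : Ordinal hk = b1)//; apply: val_inj.
- by rewrite (_ : Ordinal hk = b2)//; apply: val_inj.
- by rewrite (_ : Ordinal hk = b3)//; apply: val_inj.
Qed.

Definition noncol (p : reduced R) : Prop :=
 [/\ 0 < rsep b1 b2 p, 0 < rsep b1 b3 p & 0 < rsep b2 b3 p].

Definition Upot (p : reduced R) : R :=
 m b1 * m b2 / rsep b1 b2 p + m b1 * m b3 / rsep b1 b3 p + m b2 * m b3 / rsep b2 b3 p.

Definition pterm (c s : R) : \bar R := (c%:E / s%:E)%E.

Lemma ptermE c s : s != 0 -> pterm c s = (c / s)%:E.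
Proof. by move=> s0; rewrite /pterm inver (negbTE s0) -EFinM. Qed.

Lemma pterm0 c : 0 < c -> pterm c 0 = +oo%E.
Proof. by move=> c0; rewrite /pterm inver eqxx gt0_muley// lte_fin. Qed.

Lemma pterm_ge0 c s : 0 < c -> 0 <= s -> (0 <= pterm c s)%E.
Proof.
move=> c0; rewrite le_eqVlt => /orP[/eqP <-|s0]; first by rewrite pterm0.
by rewrite ptermE ?lt0r_neq0// lee_fin divr_ge0// ltW.
Qed.

Lemma rpotentialE p : rpotential m p = (pterm (m b1 * m b2) (rsep b1 b2 p) +
 pterm (m b1 * m b3) (rsep b1 b3 p) + pterm (m b2 * m b3) (rsep b2 b3 p))%E.
Proof.
have S3 (F : 'I_3 -> \bar R) : (\sum_(i < 3) F i = F b1 + F b2 + F b3)%E.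
 by rewrite !big_ord_recr big_ord0 /= add0e; congr (F _ + F _ + F _)%E; apply: val_inj.
rewrite /rpotential /potential S3.
have [e11 e12 e13] : [/\ (b1 < b1)%N = false, (b1 < b2)%N = true & (b1 < b3)%N = true] by [].
have [e21 e22 e23] : [/\ (b2 < b1)%N = false, (b2 < b2)%N = false & (b2 < b3)%N = true] by [].
have [e31 e32 e33] : [/\ (b3 < b1)%N = false, (b3 < b2)%N = false & (b3 < b3)%N = false] by [].
do 3![rewrite big_mkcond S3]; rewrite e11 e12 e13 e21 e22 e23 e31 e32 e33.
by rewrite !add0e !adde0.
Qed.

Lemma mm_gt0 i j : 0 < m i * m j. Proof. exact: mulr_gt0. Qed.

Lemma rpot_noncol p : noncol p -> rpotential m p = (Upot p)%:E.
Proof.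
move=> [h1 h2 h3]; rewrite rpotentialE !ptermE ?lt0r_neq0//.
Qed.

Lemma yadde (x : \bar R) : (0 <= x)%E -> (+oo + x = +oo)%E.
Proof. by case: x. Qed.

Lemma addye' (x : \bar R) : (0 <= x)%E -> (x + +oo = +oo)%E.
Proof. by case: x. Qed.

Lemma rpot_col p : ~ noncol p -> rpotential m p = +oo%E.
Proof.
rewrite rpotentialE => H.
have t12 := pterm_ge0 (mm_gt0 b1 b2) (rsep_ge0 b1 b2 p).
have t13 := pterm_ge0 (mm_gt0 b1 b3) (rsep_ge0 b1 b3 p).
have t23 := pterm_ge0 (mm_gt0 b2 b3) (rsep_ge0 b2 b3 p).
have [h1|h1] := ltP 0 (rsep b1 b2 p); last first.
 have e : rsep b1 b2 p = 0 by apply/eqP; rewrite eq_le h1 rsep_ge0.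
 by rewrite e pterm0 ?mm_gt0// (yadde t13) (yadde t23).
have [h2|h2] := ltP 0 (rsep b1 b3 p); last first.
 have e : rsep b1 b3 p = 0 by apply/eqP; rewrite eq_le h2 rsep_ge0.
 by rewrite e (pterm0 (mm_gt0 b1 b3)) (addye' t12) (yadde t23).
have [h3|h3] := ltP 0 (rsep b2 b3 p); first by case: H.
have e : rsep b2 b3 p = 0 by apply/eqP; rewrite eq_le h3 rsep_ge0.
by rewrite e (pterm0 (mm_gt0 b2 b3)) addye'// adde_ge0.
Qed.

Lemma rcollisionP p : rcollision p <-> ~ noncol p.
Proof.
split.
- move=> [i [j [ij /eqP e]]] [h1 h2 h3].
 have S : rsep i j p = 0 by rewrite /rsep /sep; move: e; rewrite -subr_eq0 => /eqP ->; exact: normc0.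
 have C a b : rsep a b p = rsep b a p by exact: sepC.
 move: i j ij {e} S; apply: ord3_ind; apply: ord3_ind => // _ S;
  first [by rewrite S ltxx in h1|by rewrite S ltxx in h2|by rewrite S ltxx in h3|
   by rewrite C S ltxx in h1|by rewrite C S ltxx in h2|by rewrite C S ltxx in h3].
- move=> H; have Z i j : i != j -> ~ (0 < rsep i j p) -> rcollision p.
  move=> ij s; exists i, j; split => //; apply/eqP; rewrite -subr_eq0; apply/eqP/eq0_normc.
  by apply/eqP; rewrite eq_le -/(sep _ _ _) sep_ge0 andbT leNgt; apply/negP.
 have [h1|/(Z b1 b2 isT)//] := pselect (0 < rsep b1 b2 p).
 have [h2|/(Z b1 b3 isT)//] := pselect (0 < rsep b1 b3 p).
 have [h3|/(Z b2 b3 isT)//] := pselect (0 < rsep b2 b3 p).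
 by case: H.
Qed.

Lemma Upot_ge0 p : 0 <= Upot p.
Proof. by rewrite /Upot !addr_ge0// divr_ge0 ?rsep_ge0// ltW// mm_gt0. Qed.

Lemma Upot_term p : [/\ m b1 * m b2 / rsep b1 b2 p <= Upot p,
 m b1 * m b3 / rsep b1 b3 p <= Upot p & m b2 * m b3 / rsep b2 b3 p <= Upot p].
Proof.
have t i j : 0 <= m i * m j / rsep i j p by rewrite divr_ge0 ?rsep_ge0// ltW// mm_gt0.
by have := t b1 b2; have := t b1 b3; have := t b2 b3; rewrite /Upot; split; lra.
Qed.

Lemma inv_close (s e : R) : 0 < s -> 0 < e -> exists2 d, 0 < d &
 forall s', `|s - s'| < d -> 0 < s' /\ `|s^-1 - s'^-1| < e.
Proof.
move=> s0 e0; have C := @inv_continuous R s (lt0r_neq0 s0).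
have [d1 /= d10 H1] := (cvgrPdist_lt _ _).1 C _ e0.
exists (Num.min d1 s); first by rewrite lt_min d10.
move=> s'; rewrite lt_min => /andP[h1 h2]; split.
 by move: h2; rewrite ltr_distl => /andP[]; lra.
by apply: H1; rewrite /ball_ /=.
Qed.

Lemma rsep_close i j p d : 0 < d -> exists2 e, 0 < e & forall p', rd m p p' < e ->
 `|rsep i j p - rsep i j p'| < d.
Proof.
move=> d0; have K0 := sepK_gt0 m_gt0.
exists (d / sepK m); first by rewrite divr_gt0.
move=> p'; rewrite ltr_pdivlMr// mulrC => h.
exact: le_lt_trans (rsep_rd m_gt0 i j p p') h.
Qed.

Lemma Upot_close p e : noncol p -> 0 < e -> exists2 d, 0 < d &
 forall p', rd m p p' < d -> noncol p' /\ `|Upot p - Upot p'| < e.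
Proof.
move=> [h1 h2 h3] e0.
have K i j : 0 < rsep i j p -> exists2 d, 0 < d & forall p', rd m p p' < d ->
  0 < rsep i j p' /\ `|m i * m j / rsep i j p - m i * m j / rsep i j p'| < e / 3.
 move=> s0; have M0 := mm_gt0 i j.
 have [d1 d10 H1] := @inv_close _ (e / 3 / (m i * m j)) s0 ltac:(by rewrite !divr_gt0).
 have [d d0 H] := @rsep_close i j p _ d10.
 exists d => // p' /H /H1 [sp hs]; split => //.
 rewrite -mulrBr normrM (gtr0_norm M0) mulrC -ltr_pdivlMr//.
have [d1 d10 H1] := K _ _ h1; have [d2 d20 H2] := K _ _ h2; have [d3 d30 H3] := K _ _ h3.
exists (Num.min d1 (Num.min d2 d3)); first by rewrite !lt_min d10 d20.
move=> p'; rewrite !lt_min => /andP[/H1[a1 k1] /andP[/H2[a2 k2] /H3[a3 k3]]].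
split => //; rewrite /Upot.
move: k1 k2 k3; rewrite !ltr_norml => /andP[? ?] /andP[? ?] /andP[? ?].
by split_lra.
Qed.

(** Off collisions the potential is continuous. At a collision a single term exceeds [y] nearby,
    since the vanishing distance is Lipschitz. *)
Lemma rpot_lsc p y : (y%:E < rpotential m p)%E -> exists2 d, 0 < d &
 forall p', rd m p p' < d -> (y%:E < rpotential m p')%E.
Proof.
have [nc|nc] := pselect (noncol p).
 rewrite rpot_noncol// lte_fin => yU.
 have [d d0 H] := @Upot_close p (Upot p - y) nc ltac:(by rewrite subr_gt0).
 exists d => // p' /H[nc']; rewrite rpot_noncol// lte_fin ltr_norml => /andP[_]; lra.
move=> _.
have K i j : rsep i j p = 0 -> exists2 d, 0 < d & forall p', rd m p p' < d -> noncol p' -> 0 < rsep i j p' -> y < m i * m j / rsep i j p'.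
 move=> s0; have M0 := mm_gt0 i j.
 (* At such a distance the term of the pair exceeds [|y| + 1]. *)
 have [d d0 H] := @rsep_close i j p (m i * m j / (`|y| + 1)) ltac:(by rewrite divr_gt0// ltr_wpDl).
 exists d => // p' /H; rewrite s0 sub0r normrN => + _ sp; rewrite (gtr0_norm sp) => hs.
 rewrite ltr_pdivlMr//; apply: (@le_lt_trans _ _ ((`|y| + 1) * rsep i j p')).
  by rewrite ler_wpM2r ?rsep_ge0// (le_trans (ler_norm _))// lerDl.
 by rewrite mulrC -ltr_pdivlMr// ltr_wpDl.
have [i [j [s0 tm]]] : exists i j, rsep i j p = 0 /\ forall p', noncol p' ->
  0 < rsep i j p' /\ m i * m j / rsep i j p' <= Upot p'.
 have Z i j : ~ (0 < rsep i j p) -> rsep i j p = 0.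
  by move=> s; apply/eqP; rewrite eq_le rsep_ge0 andbT leNgt; apply/negP.
 have [h1|/Z h1] := pselect (0 < rsep b1 b2 p); last first.
  by exists b1, b2; split => // p' [? ? ?]; split => //; have [] := Upot_term p'.
 have [h2|/Z h2] := pselect (0 < rsep b1 b3 p); last first.
  by exists b1, b3; split => // p' [? ? ?]; split => //; have [] := Upot_term p'.
 have [h3|/Z h3] := pselect (0 < rsep b2 b3 p); last first.
  by exists b2, b3; split => // p' [? ? ?]; split => //; have [] := Upot_term p'.
 by case: nc.
have [d d0 H] := K _ _ s0; exists d => // p' pd.
have [nc'|nc'] := pselect (noncol p'); last by rewrite rpot_col// ltry.
have [sp le] := tm _ nc'.
by rewrite rpot_noncol// lte_fin; apply: lt_le_trans le; exact: H.
Qed.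

Variable h : R.

(** The conformal factor: the integrand of the action is [om] times the metric speed, the square
    root of [2 K_0]. It is 0 on the Hill boundary and +oo at collisions. *)
Definition om (p : reduced R) : \bar R := sqrte (rpotential m p - h%:E).

Lemma om_noncol p : noncol p -> om p = (sqrt (Upot p - h))%:E.
Proof. by move=> nc; rewrite /om rpot_noncol. Qed.

Lemma om_col p : ~ noncol p -> om p = +oo%E.
Proof. by move=> nc; rewrite /om rpot_col. Qed.

Lemma om_ge0 p : (0 <= om p)%E. Proof. exact: sqrte_ge0. Qed.

Lemma om_lsc p y : (y%:E < om p)%E -> exists2 d, 0 < d &
 forall p', rd m p p' < d -> (y%:E < om p')%E.
Proof.
have [y0|y0] := ltP y 0.
 by move=> _; exists 1 => // p' _; apply: lt_le_trans (om_ge0 p'); rewrite lte_fin.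
have E p' : (y%:E < om p')%E = ((y ^+ 2 + h)%:E < rpotential m p')%E.
 have [nc|nc] := pselect (noncol p'); last by rewrite om_col// rpot_col// !ltry.
 rewrite om_noncol// rpot_noncol// !lte_fin.
 apply/idP/idP => H.
  have : 0 < sqrt (Upot p' - h) by lra.
  rewrite sqrtr_gt0 => H0; rewrite -ltrBrDr -[ltRHS]sqr_sqrtr ?(ltW H0)//.
  by rewrite ltr_pXn2r// nnegrE sqrtr_ge0.
 rewrite -(ger0_norm y0) -sqrtr_sqr ltr_sqrt; last by have := sqr_ge0 y; lra.
 by lra.
rewrite E => /rpot_lsc[d d0 H]; exists d => // p' /H.
by rewrite E.
Qed.

End Potential.

(** * Lifts at almost every time, and the distance as an infimum of lengths *)

Section JacobiMaupertuis.
Context {R : realType}.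
Variable m : 'I_3 -> R.
Hypothesis m_gt0 : forall i, 0 < m i.
Variable h : R.
Local Notation mu := (@lebesgue_measure R).
Local Notation proj := (@reduced_proj R).
Local Notation rd := (rd m).
Implicit Types g k : R -> reduced R.

Definition rd_ac g t0 t1 := forall e : R, 0 < e -> exists2 d' : R, 0 < d' &
  forall (n : nat) (a b : 'I_n -> R),
   (forall i, [/\ t0 <= a i, a i <= b i & b i <= t1]) ->
   (forall i j, i != j -> b i <= a j \/ b j <= a i) ->
   \sum_(i < n) (b i - a i) < d' -> \sum_(i < n) rd (g (a i)) (g (b i)) < e.

Lemma lip_ac g t0 t1 L : 0 <= L ->
 (forall s t, t0 <= s -> s <= t -> t <= t1 -> rd (g s) (g t) <= L * (t - s)) ->
 rd_ac g t0 t1.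
Proof.
move=> L0 H e e0; exists (e / (L + 1)); first by rewrite divr_gt0//; lra.
move=> n a b ab _ s.
apply: (@le_lt_trans _ _ (L * \sum_(i < n) (b i - a i))).
 rewrite mulr_sumr; apply: ler_sum => i _; have [? ? ?] := ab i; exact: H.
have [L00|Lp] := eqVneq L 0; first by rewrite L00 mul0r.
have {}Lp : 0 < L by rewrite lt0r Lp.
rewrite mulrC -ltr_pdivlMr//; apply: (lt_le_trans s).
by rewrite ler_pM2l// lef_pV2 ?posrE//; lra.
Qed.

Lemma c1_lip (f : R -> R) : (forall t, derivable f t 1) -> continuous (derive1 f) ->
 exists2 L, 0 <= L & forall s t, 0 <= s -> s <= t -> t <= 1 -> `|f t - f s| <= L * (t - s).
Proof.
move=> fd fc.
have cN : continuous (fun t => `|derive1 f t|).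
 by move=> t; apply: cvg_norm; exact: fc.
have [c _ Hc] := @EVT_max R (fun t => `|derive1 f t|) 0 1 ler01 ltac:(exact: continuous_subspaceT).
exists `|derive1 f c| => // s t s0 st t1.
have fdd (x : R) : x \in `]s, t[ -> is_derive x 1 f (derive1 f x).
 by move=> _; exact: derivable_is_derive.
have fcc : {within `[s, t], continuous f}.
 apply: continuous_subspaceT => x; exact: is_derive_cvg (derivable_is_derive (fd x)).
have [x xst ->] := MVT_segment st fdd fcc.
rewrite normrM (ger0_norm (_ : 0 <= t - s)) ?subr_ge0//.
rewrite ler_wpM2r ?subr_ge0//; apply: Hc.
by move: xst; rewrite !in_itv /= => /andP[? ?]; split_lra.
Qed.

(** Coordinates bounded by [B] make both components of every difference at most [2 B], and twice the
    square of [2 B] is [8 B^2]. *)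
Definition hK : R := sqrt (8 * (wgt m b1 b2 + wgt m b1 b3 + wgt m b2 b3)).

Lemma hnorm_le_coord (q : config R) B : 0 <= B ->
 (forall i, `|Re (q i)| <= B /\ `|Im (q i)| <= B) -> hnorm m q <= hK * B.
Proof.
move=> B0 H.
have w12 := wgt_gt0 m_gt0 b1 b2; have w13 := wgt_gt0 m_gt0 b1 b3; have w23 := wgt_gt0 m_gt0 b2 b3.
apply: ler_sqr2; first by rewrite mulr_ge0 ?sqrtr_ge0.
rewrite hnorm_sq// exprMn sqr_sqrtr; last by rewrite mulr_ge0// !addr_ge0// ltW.
have K i j : 0 < wgt m i j -> wgt m i j * (sepr q i j * sepr q i j + sepi q i j * sepi q i j) <= wgt m i j * (8 * B ^+ 2).
 move=> w0; rewrite ler_pM2l//.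
 have [] := H i; have [] := H j; rewrite !ler_norml => /andP[? ?] /andP[? ?] /andP[? ?] /andP[? ?].
 have S x : - (2 * B) <= x -> x <= 2 * B -> x * x <= 4 * B ^+ 2 by move=> ? ?; nra.
 have := S (sepr q i j); have := S (sepi q i j); rewrite /sepr /sepi => s1 s2.
 have := s1 ltac:(lra) ltac:(lra); have := s2 ltac:(lra) ltac:(lra); lra.
have := K _ _ w12; have := K _ _ w13; have := K _ _ w23; rewrite /hre; lra.
Qed.

Lemma c1_curve_lip Q : C1_curve Q -> exists2 L, 0 <= L &
 forall s t, 0 <= s -> s <= t -> t <= 1 -> hnorm m (csub (at_time Q s) (at_time Q t)) <= L * (t - s).
Proof.
move=> HQ.
have HL (i : 'I_3) : exists L, 0 <= L /\ forall s t, 0 <= s -> s <= t -> t <= 1 ->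
  `|Re (Q i t) - Re (Q i s)| <= L * (t - s) /\
  `|Im (Q i t) - Im (Q i s)| <= L * (t - s).
 have [d c1 c2] := HQ i.
 have [L1 L10 H1] := c1_lip (fun t => (d t).1) c1.
 have [L2 L20 H2] := c1_lip (fun t => (d t).2) c2.
 exists (L1 + L2); split; first exact: addr_ge0.
 move=> s t s0 st t1; have := H1 s t s0 st t1; have := H2 s t s0 st t1.
 have p1 : 0 <= L1 * (t - s) by rewrite mulr_ge0// subr_ge0.
 have p2 : 0 <= L2 * (t - s) by rewrite mulr_ge0// subr_ge0.
 by rewrite mulrDl /= => a b; split; lra.
have [L /all_and2[L0 H]] := choice HL.
exists (hK * (L b1 + L b2 + L b3)).
 by rewrite mulr_ge0 ?sqrtr_ge0// !addr_ge0.
move=> s t s0 st t1; rewrite -mulrA; apply: hnorm_le_coord.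
 by rewrite mulr_ge0 ?subr_ge0// !addr_ge0.
have T := subr_ge0 s t; have p i : 0 <= L i * (t - s) by rewrite mulr_ge0 ?L0// subr_ge0.
move: (p b1) (p b2) (p b3) => p1 p2 p3.
have E i : L i * (t - s) <= (L b1 + L b2 + L b3) * (t - s).
 by move: i; apply: ord3_ind; lra.
move=> i; have [a b] := H i s t s0 st t1; have e := E i.
rewrite /csub reB imB -(opprB (Re (at_time Q t i))) -(opprB (Im (at_time Q t i))) !normrN.
by split; apply: le_trans e.
Qed.

Section AlmostEverywhereLifts.
Variables (g : R -> reduced R) (t0 t1 : R).
Hypotheses (t01 : t0 < t1) (gac : rd_ac g t0 t1).

Let AD f K := ac_diff (@rd_ge0 R m) (rdxx m_gt0) (rd_triangle m_gt0) t01 gac (f := f) (K := K).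

Lemma ae_derivable (f : R -> R) K : 0 <= K ->
 (forall s t, t0 <= s -> s <= t -> t <= t1 -> `|f t - f s| <= K * rd (g s) (g t)) ->
 {ae mu, forall t, t0 < t -> t < t1 -> derivable f t 1}.
Proof.
move=> K0 Hf; have [psi [_ _]] := AD K0 Hf.
apply: filterS; first exact: (ae_filter_ringOfSetsType mu).
by move=> t H a b; apply: is_derive_derivable; exact: H.
Qed.

Lemma rsize_bounded : exists2 M, 0 <= M & forall t, t0 <= t -> t <= t1 -> rsize m (g t) <= M.
Proof.
have V := cvar_dist (@rd_ge0 R m) (rdxx m_gt0) (rd_triangle m_gt0) t01 gac.
have S := cvar_split (@rd_ge0 R m) (rdxx m_gt0) (rd_triangle m_gt0) t01 gac.
have P := cvar_ge0 (@rd_ge0 R m) (rdxx m_gt0) (rd_triangle m_gt0) t01 gac.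
exists (rsize m (g t0) + cvar rd g t0 t1).
 by rewrite addr_ge0 ?rsize_ge0// P.
move=> t a b; have := rsize_rd m_gt0 (g t0) (g t); rewrite ler_norml => /andP[k1 _].
have := V t0 t (lexx _) a b; have := S t0 t t1 (lexx _) a b (lexx _); have := P t t1 a (lexx _).
by lra.
Qed.

(** The norm and the four invariants used by [lift_exists] are Lipschitz for the distance along the
    bounded curve, hence differentiable almost everywhere. *)
Lemma ae_lift : {ae mu, forall t, t0 < t -> t < t1 -> derivable (rsize m \o g) t 1 /\
 (0 < rsize m (g t) -> exists Q, is_lift Q g t)}.
Proof.
have [M M0 HM] := rsize_bounded.
have K0 := ltW (sepK_gt0 m_gt0).
have a0 := @ae_derivable (rsize m \o g) 1 ler01.
have {a0}a0 := a0 (fun s t _ _ _ => ltac:(by rewrite mul1r /= rdC; exact: rsize_rd)).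
have a1 := @ae_derivable (fun s => rsep b1 b2 (g s)) _ K0
  (fun s t _ _ _ => ltac:(by rewrite rdC; exact: rsep_rd)).
have a2 := @ae_derivable (fun s => rsep b1 b3 (g s)) _ K0
  (fun s t _ _ _ => ltac:(by rewrite rdC; exact: rsep_rd)).
pose C := 2 * sepK m ^+ 2 * (M + M).
have C0 : 0 <= C by rewrite !mulr_ge0 ?sqr_ge0 ?addr_ge0.
have B s t : t0 <= s -> s <= t -> t <= t1 ->
  2 * sepK m ^+ 2 * (rsize m (g t) + rsize m (g s)) * rd (g t) (g s) <= C * rd (g s) (g t).
 move=> x y z; rewrite rdC ler_wpM2r ?rd_ge0// /C ler_wpM2l ?mulr_ge0 ?sqr_ge0//.
 by apply: lerD; apply: HM; lra.
have a3 := @ae_derivable (fun s => mixr (repr (g s))) _ C0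
  (fun s t x y z => le_trans (mix_lip m_gt0 (repr (g t)) (repr (g s))).1 (B s t x y z)).
have a4 := @ae_derivable (fun s => mixi (repr (g s))) _ C0
  (fun s t x y z => le_trans (mix_lip m_gt0 (repr (g t)) (repr (g s))).2 (B s t x y z)).
have F := ae_filter_ringOfSetsType mu.
have := @filterI _ _ F _ _ a0 (@filterI _ _ F _ _ a1 (@filterI _ _ F _ _ a2 (@filterI _ _ F _ _ a3 a4))).
apply: (@filterS _ _ F) => t [d0 [d1 [d2 [d3 d4]]]] x y; split; first exact: d0.
by move=> s0; apply: (lift_exists s0); [exact: d1|exact: d2|exact: d3|exact: d4].
Qed.

Definition speed k t : R := sqrt (2 * kinetic m k t).

(** [kinetic] selects a value by choice. It is enough that this value belongs to some lift, because
    the speed estimates hold for every lift. *)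
Lemma kinetic_lift_ex t : (exists Q, is_lift Q g t) ->
 exists2 Q, is_lift Q g t & kinetic m g t = kinetic_lift m Q t.
Proof.
move=> [Q [n d]]; rewrite /kinetic; set P := (X in xget _ X).
have Pk : P (kinetic_lift m Q t) by exists Q; split.
have [Q' [n' d' e]] := xgetPex 0 (ex_intro P _ Pk); by exists Q'.
Qed.

Lemma ae_speed_bound (F : R -> R) c : 0 <= c ->
 (forall s t, t0 <= s -> s <= t -> t <= t1 -> `|F t - F s| <= c * rd (g s) (g t)) ->
 {ae mu, forall t, t0 < t -> t < t1 -> forall l, is_derive t 1 F l -> `|l| <= c * speed g t}.
Proof.
move=> c0 HF; have := ae_lift.
apply: filterS; first exact: (ae_filter_ringOfSetsType mu).
move=> t H x y l D; have [rd1 rd2] := H x y.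
have HF' s : t <= s <= t1 -> `|F s - F t| <= c * rd (g t) (g s).
 by move=> /andP[? ?]; apply: HF => //; exact: ltW.
have [s0|s0] := eqVneq (rsize m (g t)) 0.
 by rewrite (zero_speed_bound m_gt0 y s0 rd1 HF' D) normr0 mulr_ge0 ?sqrtr_ge0.
have [|Q LQ kE] := @kinetic_lift_ex t; first by apply: rd2; rewrite lt0r s0 rsize_ge0.
rewrite /speed kE; exact: (lift_speed_bound m_gt0 y LQ c0 (fun=> rd1) HF' D).
Qed.

Lemma integral_speed_ge (S : R -> \bar R) x y c : t0 <= x -> x <= y -> y <= t1 -> 0 <= c ->
 (forall t, x <= t <= y -> (c%:E * (speed g t)%:E <= S t)%E) ->
 ((c * rd (g x) (g y))%:E <= \int[mu]_(t in `[x, y]) S t)%E.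
Proof.
move=> tx xy yt c0 HS.
pose F t := c * rd (g x) (g t).
have HF s t : t0 <= s -> s <= t -> t <= t1 -> `|F t - F s| <= c * rd (g s) (g t).
 move=> _ _ _; rewrite /F -mulrBr normrM ger0_norm// ler_wpM2l//.
 by rewrite (rdC m (g s)); exact: qdist_sym_diff.
have := ac_bound (@rd_ge0 R m) (rdxx m_gt0) (rd_triangle m_gt0) t01 gac
 (* Nothing is assumed on [S] outside [[x, y]]; the value +oo makes the almost everywhere bound
    trivial there. *)
 (f := F) (K := c) (S := fun t => if x <= t <= y then S t else +oo%E) c0 HF tx xy yt.
have -> : F y - F x = c * rd (g x) (g y) by rewrite /F (rdxx m_gt0) mulr0 subr0.
have -> : (\int[mu]_(t in `[x, y]) (if (x <= t <= y)%R then S t else +oo) =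
  \int[mu]_(t in `[x, y]) S t)%E.
 by apply: eq_integral => t; rewrite inE /= in_itv /= => ->.
apply.
- move=> t txy; rewrite txy; apply: le_trans (HS t txy).
 by rewrite mule_ge0// lee_fin// sqrtr_ge0.
- have := ae_speed_bound c0 HF.
 apply: filterS; first exact: (ae_filter_ringOfSetsType mu).
 move=> t H a b l D; have := H a b l D; case: ifPn => [txy|_ _]; last by rewrite leey.
 move=> hl; apply: le_trans (HS t txy); by rewrite -EFinM lee_fin.
Qed.

End AlmostEverywhereLifts.

Lemma kinetic_lift_le Q t : (forall i, cderivable (Q i) t) ->
 2 * kinetic_lift m Q t <= hre m (fun i => cderive (Q i) t) (fun i => cderive (Q i) t).
Proof.
move=> d; set V := fun i => _.
have [h0|h0] := eqVneq (hnorm m (at_time Q t)) 0.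
 by rewrite kinetic_lift0// mulr0 hre_ge0.
have hp : 0 < hnorm m (at_time Q t) by rewrite lt0r h0 hnorm_ge0.
rewrite kinetic_lift_pos// /kinE -/V ler_pdivrMr; last by rewrite -hnorm_sq// exprn_gt0.
rewrite [leRHS]mulrC lagrange//.
have := sqr_ge0 (him m (at_time Q t) V); lra.
Qed.

(** The straight segment to the aligned representative has constant velocity of norm [rd p p'], and
    dropping the rotational component can only lower the speed. *)
Lemma rdist_le p p' : exists2 l, (exists Q : 'I_3 -> R -> R[i],
  [/\ C1_curve Q, proj (at_time Q 0) = p, proj (at_time Q 1) = p' &
    l = metric_length m Q]) & (l <= (rd p p')%:E)%E.
Proof.
have [u u1 e] := qdist_align m (repr p) (repr p').
pose q := repr p; pose q' := crot u (repr p').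
pose Q (i : 'I_3) (t : R) : R[i] := (Re (q i) + t * (Re (q' i) - Re (q i))) +i*
 (Im (q i) + t * (Im (q' i) - Im (q i))).
have D (a b t : R) : is_derive t 1 (fun s => a + s * b) b.
 have := is_derive_add (@is_derive_cst _ _ _ a t 1)
  (is_derive_mul (is_derive_id t 1) (@is_derive_cst _ _ _ b t 1)).
 by move=> H; apply: (is_derive_eq H); rewrite mulr0 !add0r mulr1.
have QR i : Re \o Q i = (fun t => Re (q i) + t * (Re (q' i) - Re (q i))) by [].
have QI i : Im \o Q i = (fun t => Im (q i) + t * (Im (q' i) - Im (q i))) by [].
have Qd i t : cderivable (Q i) t.
 by split; [rewrite QR|rewrite QI]; apply: is_derive_derivable; exact: D.
have cd i t : cderive (Q i) t = q' i - q i.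
 rewrite /cderive QR QI (is_derive_derive1 (D _ _ _)) (is_derive_derive1 (D _ _ _)).
 by apply/eqP; rewrite eq_complex !ReImE !eqxx.
have C1 : C1_curve Q.
 move=> i; split; first exact: Qd.
  have -> : Re \o cderive (Q i) = fun=> Re (q' i - q i).
   by apply/funext => t; rewrite /comp (cd i t).
  by move=> t; exact: cvg_cst.
 have -> : Im \o cderive (Q i) = fun=> Im (q' i - q i).
  by apply/funext => t; rewrite /comp (cd i t).
 by move=> t; exact: cvg_cst.
exists (metric_length m Q).
 exists Q; split => //.
 - rewrite -[p]proj_repr; congr (proj _); apply/funext => i.
  by apply/eqP; rewrite eq_complex /= !mul0r !addr0 !eqxx.
 - transitivity (proj q').
   congr (proj _); apply/funext => i.
   by apply/eqP; rewrite eq_complex /= !mul1r !(addrC (Re (q i))) !(addrC (Im (q i))) !subrK !eqxx.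
  rewrite -[p']proj_repr; apply/esym/proj_congr/congruentP; exists u => //.
  by exists 0 => i; rewrite addr0.
have mI : measurable (`[0%R, 1%R]%classic : set R) by exact: measurable_itv.
rewrite /metric_length; apply: (@le_trans _ _ (\int[mu]_(t in `[0%R, 1%R]) (cst (rd p p')%:E) t)%E).
 apply: lower_le => t _; rewrite lee_fin ?sqrtr_ge0//.
 rewrite /rd -e /hnorm ler_wsqrtr//; apply: (le_trans (kinetic_lift_le _)) => //.
 have -> : (fun i => cderive (Q i) t) = (fun i => q' i - q i) by apply/funext => i; exact: cd.
 rewrite le_eqVlt; apply/orP; left; apply/eqP.
 by rewrite /hre /sepr /sepi /csub /q' !ReImE; ring.
have mE : mu `[0%R, 1%R]%classic = 1%:E.
 by rewrite lebesgue_measure_itv /= lte_fin ltr01 oppr0 adde0.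
have -> : (\int[mu]_(t in `[0%R, 1%R]) cst (rd p p')%:E t = (rd p p')%:E * mu `[0%R, 1%R]%classic)%E.
 exact: integral_cst.
by rewrite mE mule1; exact: lexx.
Qed.

(** Along a curve the distance from its starting point grows at most at the metric speed;
    integrating this with [ac_bound] gives the length. *)
Lemma rdist_ge Q : C1_curve Q ->
 ((rd (proj (at_time Q 0)) (proj (at_time Q 1)))%:E <= metric_length m Q)%E.
Proof.
move=> HQ; have [L L0 HL] := c1_curve_lip HQ.
pose g t := proj (at_time Q t).
have gac : rd_ac g 0 1.
 apply: (lip_ac L0) => s t s0 st t1; rewrite rd_proj; apply: le_trans (HL s t s0 st t1).
 exact: qdist_le_hnorm.
pose F t := rd (g 0) (g t).
have HF s t : 0 <= s -> s <= t -> t <= 1 -> `|F t - F s| <= 1 * rd (g s) (g t).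
 by move=> _ _ _; rewrite /F mul1r (rdC m (g s)); exact: qdist_sym_diff.
have := ac_bound (@rd_ge0 R m) (rdxx m_gt0) (rd_triangle m_gt0) ltr01 gac
 (f := F) (K := 1) (S := fun t => (sqrt (2 * kinetic_lift m Q t))%:E) ler01 HF (lexx _) ler01 (lexx _).
have -> : F 1 - F 0 = rd (g 0) (g 1) by rewrite /F (rdxx m_gt0) subr0.
apply.
 by move=> t _; rewrite lee_fin sqrtr_ge0.
have := ae_lift ltr01 gac.
apply: filterS; first exact: (ae_filter_ringOfSetsType mu).
move=> t H a b l D; have [r1 _] := H a b; rewrite lee_fin.
have LQ : is_lift Q g t by split; [exact: filterE|by move=> i; have [] := HQ i].
have := lift_speed_bound m_gt0 b LQ ler01 (fun=> r1) _ D; rewrite mul1r; apply.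
by move=> s /andP[? ?]; apply: HF => //; exact: ltW.
Qed.

Lemma rdistE p p' : rdist m p p' = rd p p'.
Proof.
rewrite /rdist; set S := (X in ereal_inf X).
suff -> : ereal_inf S = (rd p p')%:E by [].
apply/eqP; rewrite eq_le; apply/andP; split.
 have [l Sl le] := rdist_le p p'; apply: le_trans le; exact: ereal_inf_lbound.
apply: le_ereal_inf_tmp => l [Q [C1 <- <- ->]]; exact: rdist_ge.
Qed.

Lemma abs_continuousP g t0 t1 : abs_continuous m g t0 t1 <-> rd_ac g t0 t1.
Proof.
split=> H e e0; have [d d0 K] := H e e0; exists d => // n a b h1 h2 h3;
 have := K n a b h1 h2 h3; congr (_ < _); apply: eq_bigr => i _; by rewrite rdistE.
Qed.

End JacobiMaupertuis.

(** Compactness of [[a, b]] as an induction on intervals: the supremum of the [t] with [P a t]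
    satisfies it too and cannot lie below [b]. *)
Lemma tagged_induction (R : realType) (a b : R) (P : R -> R -> Prop) : a <= b ->
 (forall x y z, a <= x -> x <= y -> y <= z -> z <= b -> P x y -> P y z -> P x z) ->
 (forall s, a <= s -> s <= b -> exists2 e, 0 < e & forall x y : R, a <= x -> x <= s -> s <= y -> y <= b ->
   s - e < x -> y < s + e -> P x y) -> P a b.
Proof.
move=> ab tr loc.
pose S : set R := [set t | a <= t <= b /\ P a t].
have Sa : S a.
 split; first by rewrite lexx.
 by have [e e0 H] := loc a (lexx _) ab; apply: H => //; lra.
have hS : has_sup S by split; [exists a|exists b => t [/andP[]]].
have sup1 : a <= sup S by apply: ub_le_sup Sa; exact: hS.2.
have sup2 : sup S <= b by apply: ge_sup; [exists a|move=> t [/andP[]]].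
have [e e0 H] := loc _ sup1 sup2.
have [t [/andP[at' tb] Pt] ts] := sup_adherent e0 hS.
have tsup : t <= sup S by apply: ub_le_sup; [exact: hS.2|split => //; rewrite at'].
have Pas : P a (sup S).
 by apply: (tr a t (sup S)) => //; apply: H => //; lra.
pose y := Num.min b (sup S + e / 2).
have sy : sup S <= y by rewrite le_min sup2; lra.
have yb : y <= b by rewrite ge_min lexx.
have ye : y < sup S + e by rewrite gt_min; apply/orP; right; lra.
have Psy : P (sup S) y by apply: H => //; lra.
have Pay : P a y by apply: (tr a (sup S) y).
have Sy : S y by split => //; rewrite yb (le_trans sup1).
have : y <= sup S by apply: ub_le_sup Sy; exact: hS.2.
rewrite /y ge_min => /orP[bs|]; last by lra.
by have -> : b = sup S by apply/eqP; rewrite eq_le bs sup2.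
Qed.

Lemma lee_add_sup (R : realType) (S S' : set (\bar R)) (M : \bar R) : S 0%E -> S' 0%E ->
 (forall x, S x -> x \is a fin_num) -> (forall x, S' x -> x \is a fin_num) ->
 (forall x y, S x -> S' y -> (x + y <= M)%E) -> (ereal_sup S + ereal_sup S' <= M)%E.
Proof.
move=> S0 S0' fS fS' H; have [->|MT] := eqVneq M +oo%E; first by rewrite leey.
have M0 : (0 <= M)%E by have := H _ _ S0 S0'; rewrite adde0.
have fM : M \is a fin_num by rewrite ge0_fin_numE// ltey.
have s0 : (0 <= ereal_sup S)%E by exact: ereal_sup_ubound.
have sM : (ereal_sup S <= M)%E by apply: ge_ereal_sup => x Sx; have := H _ _ Sx S0'; rewrite adde0.
have fs : ereal_sup S \is a fin_num by rewrite ge0_fin_numE// (le_lt_trans sM)// ltey.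
rewrite addeC -leeBrDr//; apply: ge_ereal_sup => y Sy; rewrite leeBrDr// addeC.
by rewrite -leeBrDr ?fS'//; apply: ge_ereal_sup => x Sx; rewrite leeBrDr ?fS'//; exact: H.
Qed.

(** * Length of curves for a lower semicontinuous, possibly infinite, weight *)

Section WeightedLength.
Context {R : realType} {T : Type}.
Variable d : T -> T -> R.
Hypotheses (d_ge0 : forall p q, 0 <= d p q) (dC : forall p q, d p q = d q p).
Hypotheses (dxx : forall p, d p p = 0) (d_tri : forall p q r, d p r <= d p q + d q r).
Implicit Types (w : T -> \bar R) (g k : R -> T) (a b l : R).

(** The [c i] are finite lower bounds of the weight along whole cells, so infinite weights fit in
    and no infimum has to be attained. *)
Definition partition_of w g a b (n : nat) (x c : nat -> R) : Prop :=
 [/\ x 0%N = a, x n = b & forall i, (i < n)%N ->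
  [/\ x i <= x i.+1, 0 <= c i & forall t, x i <= t -> t <= x i.+1 -> ((c i)%:E <= w (g t))%E]].

Definition psum g n (x c : nat -> R) : R := \sum_(i < n) c i * d (g (x i)) (g (x i.+1)).

(* The length of g for the metric w * d, as a supremum of lower sums. *)
Definition wlen w g a b : \bar R :=
 ereal_sup [set r | exists n (x c : nat -> R), partition_of w g a b n x c /\ r = (psum g n x c)%:E].

Lemma part_mono w g a b n (x c : nat -> R) i j : partition_of w g a b n x c -> (i <= j)%N -> (j <= n)%N -> x i <= x j.
Proof.
move=> [_ _ H] + jn; elim: j jn => [|j IH] jn; first by rewrite leqn0 => /eqP ->.
rewrite leq_eqVlt => /orP[/eqP -> //|ij]; have [h _ _] := H j jn.
by apply: le_trans h; apply: IH => //; exact: ltnW.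
Qed.

Lemma part_in w g a b n (x c : nat -> R) i : partition_of w g a b n x c -> (i <= n)%N -> a <= x i /\ x i <= b.
Proof.
move=> P i_n; have [<- <- _] := P; split; [exact: part_mono P _ i_n|exact: part_mono P i_n _].
Qed.

Lemma wlen_ub w g a b n (x c : nat -> R) : partition_of w g a b n x c -> ((psum g n x c)%:E <= wlen w g a b)%E.
Proof. by move=> P; apply: ereal_sup_ubound; exists n, x, c. Qed.

Lemma wlen_le w g a b (M : \bar R) :
 (forall n x c, partition_of w g a b n x c -> ((psum g n x c)%:E <= M)%E) -> (wlen w g a b <= M)%E.
Proof. by move=> H; apply: ge_ereal_sup => _ [n [x [c [P ->]]]]; exact: H. Qed.

Lemma wlen_cell w g a b (c : R) : a <= b -> 0 <= c ->
 (forall t, a <= t -> t <= b -> (c%:E <= w (g t))%E) ->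
 ((c * d (g a) (g b))%:E <= wlen w g a b)%E.
Proof.
move=> ab c0 H.
pose x i : R := if i is 0%N then a else b.
have := @wlen_ub w g a b 1 x (fun=> c); rewrite /psum big_ord_recl big_ord0 addr0; apply.
by split => // -[|//] _; split.
Qed.

Lemma wlen_ge0 w g a b : a <= b -> (forall p, (0 <= w p)%E) -> (0 <= wlen w g a b)%E.
Proof.
move=> ab w0; have := @wlen_cell w g a b 0 ab (lexx _); rewrite mul0r; apply => t _ _; exact: w0.
Qed.

Lemma wlen_sup_ge w g a b (M : \bar R) n (x c : nat -> R) : partition_of w g a b n x c ->
 (M <= (psum g n x c)%:E)%E -> (M <= wlen w g a b)%E.
Proof. by move=> P h; apply: le_trans h _; exact: wlen_ub P. Qed.

Lemma wlen_cat_ge w g a b e : a <= b -> b <= e -> (forall p, (0 <= w p)%E) ->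
 (wlen w g a b + wlen w g b e <= wlen w g a e)%E.
Proof.
move=> ab be w0.
have K n x c n' x' c' : partition_of w g a b n x c -> partition_of w g b e n' x' c' ->
  ((psum g n x c)%:E + (psum g n' x' c')%:E <= wlen w g a e)%E.
 move=> [xa xb H] [xa' xb' H'].
 pose y i := if (i <= n)%N then x i else x' (i - n)%N.
 pose z i := if (i < n)%N then c i else c' (i - n)%N.
 have y2 i : y (n + i)%N = x' i.
  rewrite /y; case: ifPn => h; last by rewrite addKn.
  have -> : i = 0%N by move: h; rewrite -{2}(addn0 n) leq_add2l leqn0 => /eqP.
  by rewrite addn0 xb xa'.
 have z2 i : z (n + i)%N = c' i by rewrite /z ltnNge leq_addr /= addKn.
 apply: (@wlen_sup_ge _ _ _ _ _ (n + n') y z).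
  split; first by rewrite /y leq0n.
  - by rewrite y2.
  - move=> i i_n; have [ln|ln] := ltnP i n.
    by rewrite /y /z ln (ltnW ln); exact: H.
   rewrite -(subnKC ln) -addnS !y2 z2; apply: H'.
   by rewrite -(ltn_add2l n) subnKC.
 rewrite -EFinD lee_fin /psum big_split_ord /= le_eqVlt; apply/orP; left; apply/eqP.
 congr (_ + _); apply: eq_bigr => i _.
  by rewrite /z ltn_ord /y ltn_ord (ltnW (ltn_ord i)).
 by rewrite -addnS !y2 z2.
have Z u v : u <= v -> exists n x c, partition_of w g u v n x c /\ 0%E = (psum g n x c)%:E.
 move=> uv; exists 1%N, (fun i => if i is 0%N then u else v), (fun=> 0); split.
  by split => // -[|//] _; split => // t _ _; exact: w0.
 by rewrite /psum big_ord_recl big_ord0 mul0r addr0.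
apply: lee_add_sup.
- exact: Z.
- exact: Z.
- by move=> _ [n [x [c [_ ->]]]].
- by move=> _ [n [x [c [_ ->]]]].
by move=> _ _ [n [x [c [P ->]]]] [n' [x' [c' [P' ->]]]]; exact: K P P'.
Qed.

Lemma wlen_cat_le w g a b e : a <= b -> b <= e -> (forall p, (0 <= w p)%E) ->
 (wlen w g a e <= wlen w g a b + wlen w g b e)%E.
Proof.
move=> ab be w0; apply: wlen_le => n x c P.
pose y1 i := Num.min (x i) b; pose y2 i := Num.max (x i) b.
(* A cell that collapses to [b] on one side gets height 0, as the weight at [b] need not reach
   [c i]. *)
pose c1 i := if y1 i < y1 i.+1 then c i else 0.
pose c2 i := if y2 i < y2 i.+1 then c i else 0.
have [xa xe H] := P.
have P1 : partition_of w g a b n y1 c1.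
 split; [by rewrite /y1 xa min_l|by rewrite /y1 xe min_r|move=> i i_n].
 have [h1 h2 h3] := H i i_n; split.
 - by rewrite /y1 le_min !ge_min h1 lexx !orbT.
 - by rewrite /c1; case: ifP.
 - move=> t t1 t2; rewrite /c1; case: ifPn => // lt; apply: h3.
   by move: t1 lt; rewrite /y1 ge_min lt_min !gt_min ltxx orbF => /orP[//|bt] /andP[_ ?]; lra.
  by apply: (le_trans t2); rewrite /y1 ge_min lexx.
have P2 : partition_of w g b e n y2 c2.
 split; [by rewrite /y2 xa max_r|by rewrite /y2 xe max_l|move=> i i_n].
 have [h1 h2 h3] := H i i_n; split.
 - by rewrite /y2 ge_max !le_max h1 lexx !orbT.
 - by rewrite /c2; case: ifP.
 - move=> t t1 t2; rewrite /c2; case: ifPn => // lt; apply: h3.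
   by apply: le_trans t1; rewrite /y2 le_max lexx.
  by move: t2 lt; rewrite /y2 le_max gt_max !lt_max ltxx orbF => /orP[//|bt] /andP[_ ?]; lra.
apply: (@le_trans _ _ ((psum g n y1 c1)%:E + (psum g n y2 c2)%:E)%E); last first.
 by apply: leeD; exact: wlen_ub.
rewrite -EFinD lee_fin /psum -big_split /=; apply: ler_sum => i _.
have [h1 h2 _] := H i (ltn_ord i).
have [e1|lt] := eqVneq (x i) (x i.+1).
 rewrite -e1 dxx mulr0 addr_ge0 ?mulr_ge0 ?d_ge0//.
  by rewrite /c1; case: ifP.
 by rewrite /c2; case: ifP.
have {}lt : x i < x i.+1 by rewrite lt_neqAle lt.
have c20 : 0 <= c2 i by rewrite /c2; case: ifP.
have c10 : 0 <= c1 i by rewrite /c1; case: ifP.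
have [l1|l1] := leP (x i.+1) b.
 have -> : c1 i = c i by rewrite /c1 /y1 (min_l l1) min_l ?(le_trans h1)// lt.
 by rewrite /y1 (min_l l1) (min_l (le_trans h1 l1)) lerDl mulr_ge0.
have [l2|l2] := leP b (x i).
 have -> : c2 i = c i by rewrite /c2 /y2 (max_l l2) max_l ?(le_trans l2)// lt.
 by rewrite /y2 (max_l l2) (max_l (le_trans l2 h1)) lerDr mulr_ge0.
have -> : c1 i = c i by rewrite /c1 /y1 (min_l (ltW l2)) (min_r (ltW l1)) l2.
have -> : c2 i = c i by rewrite /c2 /y2 (max_r (ltW l2)) (max_l (ltW l1)) l1.
rewrite /y1 /y2 (min_l (ltW l2)) (min_r (ltW l1)) (max_r (ltW l2)) (max_l (ltW l1)).
by rewrite -mulrDr ler_wpM2l.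
Qed.

Lemma wlenD w g a b e : a <= b -> b <= e -> (forall p, (0 <= w p)%E) ->
 (wlen w g a e = wlen w g a b + wlen w g b e)%E.
Proof. by move=> ab be w0; apply/eqP; rewrite eq_le wlen_cat_le// wlen_cat_ge. Qed.

Lemma wlenxx w g a : wlen w g a a = 0%E.
Proof.
apply/eqP; rewrite eq_le; apply/andP; split.
 apply: wlen_le => n x c P; rewrite /psum big1// => i _.
 have [a1 a2] := part_in P (ltnW (ltn_ord i)); have [b1 b2] := part_in P (ltn_ord i).
 have -> : x i = a by apply/eqP; rewrite eq_le a2.
 have -> : x i.+1 = a by apply/eqP; rewrite eq_le b2.
 by rewrite dxx mulr0.
apply: (@wlen_sup_ge _ _ _ _ _ 0 (fun=> a) (fun=> 0)); first by split.
by rewrite /psum big_ord0.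
Qed.

(** Curves may pause, so [phi] is only monotone and onto. Partitions are carried over by [phi] in
    one direction and by a right inverse of it in the other. *)
Lemma wlen_reparam w g k (phi : R -> R) a b : a <= b ->
 (forall t, a <= t -> t <= b -> g t = k (phi t)) ->
 (forall s t, a <= s -> s <= t -> t <= b -> phi s <= phi t) ->
 (forall y, phi a <= y -> y <= phi b -> exists2 t, a <= t <= b & phi t = y) ->
 (forall p, (0 <= w p)%E) -> wlen w g a b = wlen w k (phi a) (phi b).
Proof.
move=> ab gk nd surj w0; apply/eqP; rewrite eq_le; apply/andP; split; apply: wlen_le => n x c P.
 have [xa xb H] := P.
 have X i : (i <= n)%N -> a <= x i /\ x i <= b by move=> h; exact: part_in P h.
 apply: (@wlen_sup_ge _ _ _ _ _ n (phi \o x) c); last first.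
  rewrite lee_fin le_eqVlt; apply/orP; left; apply/eqP; apply: eq_bigr => i _ /=.
  have [? ?] := X i (ltnW (ltn_ord i)); have [? ?] := X i.+1 (ltn_ord i).
  by rewrite -!gk.
 split; [by rewrite /= xa|by rewrite /= xb|move=> i i_n /=].
 have [h1 h2 h3] := H i i_n; have [u1 u2] := X i (ltnW i_n); have [v1 v2] := X i.+1 i_n.
 split => //; first exact: nd.
 move=> y y1 y2; have [t /andP[ta tb] ty] := surj y (le_trans (nd _ _ (lexx _) u1 u2) y1) (le_trans y2 (nd _ _ v1 v2 (lexx _))).
 have [t1|t1] := leP (x i) t; last first.
  have -> : y = phi (x i) by apply/eqP; rewrite eq_le y1 -ty nd// ltW.
  by rewrite -gk//; exact: h3.
 have [t2|t2] := leP t (x i.+1); last first.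
  have -> : y = phi (x i.+1) by apply/eqP; rewrite eq_le y2 -ty nd// ltW.
  by rewrite -gk//; exact: h3.
 by rewrite -ty -gk//; exact: h3.
have [xa xb H] := P.
have X i : (i <= n)%N -> phi a <= x i /\ x i <= phi b by move=> h; exact: part_in P h.
(* The right inverse is normalized to send the ends to [a] and [b], as a partition must start and
   end exactly there. *)
have : forall y, exists t, phi a <= y -> y <= phi b ->
  [/\ a <= t <= b, phi t = y, y = phi a -> t = a & y = phi b -> y <> phi a -> t = b].
 move=> y; have [/andP[y1 y2]|ny] := boolP (phi a <= y <= phi b); last first.
  by exists a => y1 y2; move: ny; rewrite y1 y2.
 have [t t1 t2] := surj y y1 y2.
 have [ya|ya] := eqVneq y (phi a).
  by exists a => _ _; split; [rewrite lexx|rewrite ya| |rewrite ya => _ []].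
 have [yb|yb] := eqVneq y (phi b).
  exists b => _ _; split; [by rewrite lexx ab|by rewrite yb| |by []].
  by move=> e; move: ya; rewrite e eqxx.
 exists t => _ _; split; [exact: t1|exact: t2| |].
  by move=> e; move: ya; rewrite e eqxx.
 by move=> e; move: yb; rewrite e eqxx.
move=> /choice[psi Hpsi].
have [pab|pab] := eqVneq (phi a) (phi b).
 have -> : psum k n x c = 0.
  rewrite /psum big1// => i _.
  have [a1 a2] := X i (ltnW (ltn_ord i)); have [b1 b2] := X i.+1 (ltn_ord i).
  rewrite (_ : x i = x i.+1) ?dxx ?mulr0//.
  by apply/eqP; rewrite eq_le (le_trans a2) -?pab//= (le_trans b2)// -pab.
 exact: wlen_ge0.
have pab' : phi b <> phi a by move=> e; move: pab; rewrite e eqxx.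
apply: (@wlen_sup_ge _ _ _ _ _ n (psi \o x) c); last first.
 rewrite lee_fin le_eqVlt; apply/orP; left; apply/eqP; apply: eq_bigr => i _ /=.
 have [a1 a2] := X i (ltnW (ltn_ord i)); have [c1 c2] := X i.+1 (ltn_ord i).
 have [/andP[? ?] e1 _ _] := Hpsi _ a1 a2; have [/andP[? ?] e2 _ _] := Hpsi _ c1 c2.
 by rewrite !gk// e1 e2.
split.
- rewrite /= xa; have [_ _ -> //] := Hpsi (phi a) (lexx _) (nd _ _ (lexx _) ab (lexx _)).
- rewrite /= xb; have [_ _ _ -> //] := Hpsi (phi b) (nd _ _ (lexx _) ab (lexx _)) (lexx _).
move=> i i_n /=; have [h1 h2 h3] := H i i_n; have [u1 u2] := X i (ltnW i_n); have [v1 v2] := X i.+1 i_n.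
have [/andP[p1 p2] e1 _ _] := Hpsi _ u1 u2; have [/andP[p3 p4] e2 _ _] := Hpsi _ v1 v2.
split => //.
 have [//|lt] := leP (psi (x i)) (psi (x i.+1)).
 have : phi (psi (x i.+1)) <= phi (psi (x i)) by apply: nd => //; exact: ltW.
 rewrite e1 e2 => le; have ee : x i = x i.+1 by apply/eqP; rewrite eq_le h1.
 by move: lt; rewrite ee ltxx.
move=> t ta tb; rewrite gk ?(le_trans p1)// ?(le_trans tb)//; apply: h3.
 by rewrite -e1; apply: nd => //; exact: le_trans tb _.
by rewrite -e2; apply: nd => //; exact: le_trans ta.
Qed.

Lemma wlen_ext w g k a b : a <= b -> (forall t, a <= t -> t <= b -> g t = k t) ->
 (forall p, (0 <= w p)%E) -> wlen w g a b = wlen w k a b.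
Proof.
move=> ab gk w0; apply: (@wlen_reparam w g k id) => //.
by move=> y ya yb; exists y => //; rewrite ya.
Qed.

Lemma wlen_rev_le w g a b : (wlen w g a b <= wlen w (fun t => g (- t)%R) (- b) (- a))%E.
Proof.
apply: wlen_le => n x c P; have [xa xb H] := P.
apply: (@wlen_sup_ge _ _ _ _ _ n (fun i => - x (n - i)%N) (fun i => c (n - i.+1)%N)).
 split; [by rewrite subn0 xb|by rewrite subnn xa|move=> i i_n].
 have i_n' : (n - i.+1 < n)%N by rewrite ltn_subrL (leq_trans _ i_n).
 have [h1 h2 h3] := H _ i_n'; have e : (n - i.+1).+1 = (n - i)%N by rewrite -subSn// subSS.
 rewrite e in h1 h3; split => //; first by rewrite lerN2.
 by move=> t ta tb; apply: h3; lra.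
rewrite lee_fin le_eqVlt; apply/orP; left; apply/eqP; rewrite /psum (reindex_inj rev_ord_inj) /=.
apply: eq_bigr => i _; have e : (n - i.+1).+1 = (n - i)%N by rewrite -subSn ?subSS.
by rewrite e !opprK dC.
Qed.

Lemma wlen_rev w g a b : wlen w (fun t => g (- t)) (- b) (- a) = wlen w g a b.
Proof.
apply/eqP; rewrite eq_le wlen_rev_le andbT.
have := wlen_rev_le w (fun t => g (- t)) (- b) (- a); rewrite !opprK.
by have -> : (fun t => g (- - t)) = g by apply/funext => t; rewrite opprK.
Qed.

Lemma wlen_primitive w g (Psi : R -> R) a b : a <= b -> (forall p, (0 <= w p)%E) ->
 (forall s, a <= s -> s <= b -> exists2 e, 0 < e & forall x y : R, a <= x -> x <= s -> s <= y -> y <= b ->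
   s - e < x -> y < s + e -> (wlen w g x y <= (Psi y - Psi x)%:E)%E) ->
 (wlen w g a b <= (Psi b - Psi a)%:E)%E.
Proof.
move=> ab w0; apply: (@tagged_induction R a b (fun x y => (wlen w g x y <= (Psi y - Psi x)%:E)%E) ab).
move=> x y z _ xy yz _ h1 h2; rewrite (wlenD g xy yz w0).
have -> : Psi z - Psi x = (Psi y - Psi x) + (Psi z - Psi y) by lra.
by rewrite EFinD; exact: leeD.
Qed.

Lemma wlen_ge_primitive w g (Psi : R -> R) a b : a <= b -> (forall p, (0 <= w p)%E) ->
 (forall s, a <= s -> s <= b -> exists2 e, 0 < e & forall x y : R, a <= x -> x <= s -> s <= y -> y <= b ->
   s - e < x -> y < s + e -> ((Psi y - Psi x)%:E <= wlen w g x y)%E) ->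
 ((Psi b - Psi a)%:E <= wlen w g a b)%E.
Proof.
move=> ab w0; apply: (@tagged_induction R a b (fun x y => ((Psi y - Psi x)%:E <= wlen w g x y)%E) ab).
move=> x y z _ xy yz _ h1 h2; rewrite (wlenD g xy yz w0).
have -> : Psi z - Psi x = (Psi y - Psi x) + (Psi z - Psi y) by lra.
by rewrite EFinD; exact: leeD.
Qed.

Definition one_weight : T -> \bar R := fun=> 1%E.
Local Notation len := (wlen one_weight).

Lemma wlen_scale_ge w g a b (c : R) l : a <= b -> 0 <= c -> len g a b = l%:E -> (forall p, (0 <= w p)%E) ->
 (forall t, a <= t -> t <= b -> (c%:E <= w (g t))%E) -> ((c * l)%:E <= wlen w g a b)%E.
Proof.
move=> ab c0 gl w0 H; have W0 : (0 <= wlen w g a b)%E by exact: wlen_ge0.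
have [->|cp] := eqVneq c 0; first by rewrite mul0r.
have {}cp : 0 < c by rewrite lt0r cp.
case E : (wlen w g a b) => [r| |]; [|by rewrite leey|by move: W0; rewrite E].
rewrite lee_fin mulrC -ler_pdivlMr// -lee_fin -gl; apply: wlen_le => n x c' P.
have [xa xb K] := P.
rewrite lee_fin ler_pdivlMr// mulrC -lee_fin -E.
apply: (@wlen_sup_ge _ _ _ _ _ n x (fun i => c * c' i)).
 split => // i i_n; have [h1 h2 h3] := K i i_n; split => //; first exact: mulr_ge0.
 move=> t t1 t2; have [x1 _] := part_in P (ltnW i_n); have [_ x2] := part_in P i_n.
 apply: le_trans (H t (le_trans x1 t1) (le_trans t2 x2)).
 by rewrite lee_fin -[leRHS]mulr1 ler_wpM2l// -lee_fin; exact: h3 t1 t2.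
rewrite lee_fin le_eqVlt; apply/orP; left; apply/eqP; rewrite /psum mulr_sumr.
by apply: eq_bigr => i _; rewrite mulrA.
Qed.

Lemma wlen_scale_le w g a b (c : R) l : a <= b -> 0 <= c -> len g a b = l%:E ->
 (forall t, a <= t -> t <= b -> (w (g t) <= c%:E)%E) -> (wlen w g a b <= (c * l)%:E)%E.
Proof.
move=> ab c0 gl H; apply: wlen_le => n x c' P; have [xa xb K] := P.
apply: (@le_trans _ _ (c * psum g n x (fun=> 1))%:E); last first.
 rewrite lee_fin ler_wpM2l// -lee_fin -gl; apply: wlen_ub; split => // i i_n.
 by have [h1 h2 h3] := K i i_n.
rewrite lee_fin /psum mulr_sumr; apply: ler_sum => i _.
have [h1 h2 h3] := K i (ltn_ord i); rewrite mul1r ler_wpM2r//.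
have [x1 x2] := part_in P (ltnW (ltn_ord i)).
by rewrite -lee_fin; apply: le_trans (h3 _ (lexx _) h1) (H _ x1 x2).
Qed.

Definition lsc_weight w := forall p (y : R), (y%:E < w p)%E -> exists2 e, 0 < e &
 forall p', d p p' < e -> (y%:E < w p')%E.

(** Lower semicontinuity together with the common Lipschitz constant makes the bound hold on an
    interval around each point, for almost all [i] of the filter; [tagged_induction] joins these
    intervals. *)
Lemma weight_cell_lim (I : Type) (F : set_system I) (FF : Filter F) w (gs : I -> R -> T) g a b c c' :
 lsc_weight w -> a <= b ->
 (forall i s t, s <= t -> d (gs i s) (gs i t) <= t - s) ->
 (forall t e, a <= t -> t <= b -> 0 < e -> F [set i | d (gs i t) (g t) < e]) ->
 c' < c -> (forall t, a <= t -> t <= b -> (c%:E <= w (g t))%E) ->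
 F [set i | forall t, a <= t -> t <= b -> (c'%:E <= w (gs i t))%E].
Proof.
move=> lw ab lip cv cc H.
apply: (@tagged_induction R a b (fun x y => F [set i | forall t, x <= t -> t <= y -> (c'%:E <= w (gs i t))%E]) ab).
 move=> x y z _ xy yz _ f1 f2; apply: filterS (filterI f1 f2) => i [k1 k2] t t1 t2.
 by have [ty|/ltW ty] := leP t y; [exact: k1|exact: k2].
move=> s sa sb; have [|e e0 K] := lw (g s) c'; first by apply: lt_le_trans (H s sa sb); rewrite lte_fin.
exists (e / 2); first by rewrite divr_gt0.
have e20 : 0 < e / 2 by rewrite divr_gt0.
move=> x y _ xs sy _ xe ye; have := cv s (e / 2) sa sb e20; apply: filterS => i /= ds t t1 t2.
apply/ltW/K; apply: (le_lt_trans (d_tri _ (gs i s) _)); rewrite (dC (g s)).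
have : d (gs i s) (gs i t) < e / 2.
 have [st|/ltW ts] := leP s t; first by apply: (le_lt_trans (lip i s t st)); lra.
 by rewrite dC; apply: (le_lt_trans (lip i t s ts)); lra.
lra.
Qed.

(** Each lower sum of the limit persists along the filter with a small loss: heights by
    [weight_cell_lim], distances by pointwise convergence. The filter is arbitrary so that limits
    can be taken along an ultrafilter. *)
Lemma wlen_lsc (I : Type) (F : set_system I) (FF : ProperFilter F) w (gs : I -> R -> T) g a b (M : R) :
 lsc_weight w -> (forall p, (0 <= w p)%E) -> a <= b ->
 (forall i s t, s <= t -> d (gs i s) (gs i t) <= t - s) ->
 (forall t e, a <= t -> t <= b -> 0 < e -> F [set i | d (gs i t) (g t) < e]) ->
 (forall e, 0 < e -> F [set i | (wlen w (gs i) a b <= (M + e)%:E)%E]) ->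
 (wlen w g a b <= M%:E)%E.
Proof.
move=> lw w0 ab lip cv bd; apply: wlen_le => n x c P; have [xa xb H] := P.
have cell x0 y0 c0 e : a <= x0 -> x0 <= y0 -> y0 <= b -> 0 <= c0 -> 0 < e ->
  (forall t, x0 <= t -> t <= y0 -> (c0%:E <= w (g t))%E) ->
  F [set i | ((c0 * d (g x0) (g y0))%:E <= wlen w (gs i) x0 y0 + e%:E)%E].
 move=> ax xy yb c00 e0 K; have [->|cp] := eqVneq c0 0.
  rewrite mul0r; apply: filterE => i /=; apply: adde_ge0; last by rewrite lee_fin ltW.
  exact: wlen_ge0.
 have {}cp : 0 < c0 by rewrite lt0r cp.
 set D := d (g x0) (g y0); have D0 : 0 <= D by exact: d_ge0.
 (* Lowering the height by [eta] and losing [eta] in the distance costs at most [eta (c0 + D)]. *)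
 pose eta := Num.min c0 (e / (c0 + D + 1)).
 have q0 : 0 < c0 + D + 1 by lra.
 have eta0 : 0 < eta by rewrite lt_min cp divr_gt0.
 have etac : eta <= c0 by rewrite ge_min lexx.
 have etae : eta * (c0 + D + 1) <= e by rewrite -ler_pdivlMr// ge_min lexx orbT.
 have cv' t e' : x0 <= t -> t <= y0 -> 0 < e' -> F [set i | d (gs i t) (g t) < e'].
  by move=> t1 t2 e'0; apply: cv => //; [exact: le_trans ax _|exact: le_trans t2 _].
 have f1 := @weight_cell_lim I F _ w gs g x0 y0 c0 (c0 - eta) lw xy lip cv' ltac:(lra) K.
 have e20 : 0 < eta / 2 by rewrite divr_gt0.
 have f2 := cv' x0 (eta / 2) (lexx _) xy e20; have f3 := cv' y0 (eta / 2) xy (lexx _) e20.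
 apply: filterS (filterI f1 (filterI f2 f3)) => i [/= k1 [k2 k3]].
 have ce0 : 0 <= c0 - eta by rewrite subr_ge0.
 apply: (le_trans _ (leeD (wlen_cell xy ce0 k1) (lexx e%:E))).
 rewrite -EFinD lee_fin; set D' := d (gs i x0) (gs i y0).
 have DD : D <= D' + eta.
  have := d_tri (g x0) (gs i x0) (g y0); have := d_tri (gs i x0) (gs i y0) (g y0).
  rewrite (dC (g x0) (gs i x0)) -/D -/D'; move: k2 k3 => /=; lra.
 have : (c0 - eta) * D <= (c0 - eta) * (D' + eta) by rewrite ler_wpM2l.
 have : 0 <= eta * eta by rewrite mulr_ge0// ltW.
 nra.
have main j : (j <= n)%N -> forall e, 0 < e ->
  F [set i | ((\sum_(l < j) c l * d (g (x l)) (g (x l.+1)))%:E <= wlen w (gs i) a (x j) + e%:E)%E].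
 elim: j => [|j IH] jn e e0.
  by apply: filterE => i /=; rewrite big_ord0 xa wlenxx add0e lee_fin ltW.
 have [h1 h2 h3] := H j jn; have [x1 x2] := part_in P (ltnW jn); have [x3 x4] := part_in P jn.
 have e20 : 0 < e / 2 by rewrite divr_gt0.
 have f1 := IH (ltnW jn) _ e20; have f2 := cell _ _ _ _ x1 h1 x4 h2 e20 h3.
 apply: filterS (filterI f1 f2) => i [/= k1 k2].
 rewrite big_ord_recr /= EFinD (wlenD (gs i) x1 h1 w0).
 have -> : (wlen w (gs i) a (x j) + wlen w (gs i) (x j) (x j.+1) + e%:E =
   (wlen w (gs i) a (x j) + (e / 2)%:E) + (wlen w (gs i) (x j) (x j.+1) + (e / 2)%:E))%E.
  by rewrite addeACA -EFinD -splitr.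
 exact: leeD.
apply/lee_addgt0Pr => e e0; have e20 : 0 < e / 2 by rewrite divr_gt0.
have [i [/= k1 k2]] := filter_ex (filterI (main n (leqnn n) _ e20) (bd _ e20)).
apply: (le_trans k1); rewrite xb [e in leRHS]splitr.
by apply: (le_trans (leeD k2 (lexx _))); rewrite -!EFinD lee_fin; lra.
Qed.

End WeightedLength.

Lemma JM_integrand (R : realType) (k : R) (x : \bar R) :
 ((sqrt k)%:E * sqrte (2%:E * x) = (sqrt (2 * k))%:E * sqrte x)%E.
Proof.
rewrite sqrteM ?lee_fin// muleA sqrtrM// EFinM; congr (_ * _)%E.
by rewrite muleC.
Qed.

Lemma limn_einfE (R : realType) (u : nat -> \bar R) : limn_einf u = ereal_sup (range (einfs u)).
Proof. by rewrite limn_einf_lim; apply/cvg_lim => //; exact: cvg_einfs_sup. Qed.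

Lemma indic_ge0 (R : realType) (A : set R) (t : R) : 0 <= (\1_A t : R).
Proof. by rewrite indicE ler0n. Qed.

(** * The Jacobi-Maupertuis action equals the weighted length *)

Section ActionAsLength.
Context {R : realType}.
Variable m : 'I_3 -> R.
Hypothesis m_gt0 : forall i, 0 < m i.
Variable h : R.
Local Notation mu := (@lebesgue_measure R).
Local Notation rd := (rd m).
Local Notation om := (om m h).
Implicit Types g k : R -> reduced R.

Let rd0 := @rd_ge0 R m.
Let rdC' := rdC m.
Let rdx := rdxx m_gt0.
Let rdt := rd_triangle m_gt0.

Lemma om_ge0' p : (0 <= om p)%E.
Proof. exact: om_ge0. Qed.

Definition JMw g a b : \bar R := (\int[mu]_(t in `[a, b]) ((speed m g t)%:E * om (g t)))%E.

Lemma JM_actionE g t0 t1 : JM_action m h g t0 t1 = JMw g t0 t1.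
Proof. by apply: eq_integral => t _; rewrite JM_integrand. Qed.

Lemma JMi_ge0 g t : (0 <= (speed m g t)%:E * om (g t))%E.
Proof. by apply: mule_ge0; [rewrite lee_fin sqrtr_ge0|exact: om_ge0']. Qed.

Lemma JMw_cat g a b c : a <= b -> b <= c -> (JMw g a c = JMw g a b + JMw g b c)%E.
Proof.
move=> ab bc; rewrite /JMw.
have mab : measurable (`[a, b]%classic : set R) by exact: measurable_itv.
have mbc : measurable (`]b, c]%classic : set R) by exact: measurable_itv.
have m1 : measurable (`[b, b]%classic : set R) by exact: measurable_itv.
have -> : `[a, c]%classic = `[a, b]%classic `|` `]b, c]%classic :> set R.
 apply/seteqP; split => t /=; rewrite !in_itv /=.
  by move=> /andP[at' tc]; have [tb|bt] := leP t b; [left; rewrite at'|right; rewrite ?bt].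
 by move=> [/andP[at' tb]|/andP[bt tc]]; split_lra.
have -> : (\int[mu]_(t in `[b, c]) ((speed m g t)%:E * om (g t)) =
  \int[mu]_(t in `]b, c]) ((speed m g t)%:E * om (g t)))%E.
 have -> : `[b, c]%classic = `[b, b]%classic `|` `]b, c]%classic :> set R.
  apply/seteqP; split => t /=; rewrite !in_itv /=.
   move=> /andP[at' tc]; have [tb|bt] := leP t b; last by right.
   by left; rewrite at'.
  by move=> [/andP[at' tb]|/andP[bt tc]]; split_lra.
 rewrite (lower_setU m1 mbc).
 - rewrite lower_null ?add0e//.
   by rewrite lebesgue_measure_itv /= lte_fin ltxx.
  by move=> t _; exact: JMi_ge0.
 - by apply/seteqP; split => t //= []; rewrite !in_itv /= => /andP[? ?] /andP[? ?]; lra.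
 - by move=> t _; exact: JMi_ge0.
apply: (lower_setU mab mbc).
- by apply/seteqP; split => t //= []; rewrite !in_itv /= => /andP[? ?] /andP[? ?]; lra.
- by move=> t _; exact: JMi_ge0.
Qed.

Lemma JMw_ge0 g a b : (0 <= JMw g a b)%E.
Proof. by apply: integral_ge0 => t _; exact: JMi_ge0. Qed.

Variables (g : R -> reduced R) (t0 t1 : R).
Hypotheses (t01 : t0 < t1) (gac : rd_ac m g t0 t1).

Lemma rd_ac_cont (e : R) : 0 < e -> exists2 e', 0 < e' & forall x y, t0 <= x -> x <= y -> y <= t1 ->
 y - x < e' -> rd (g x) (g y) < e.
Proof.
move=> e0; have e20 : 0 < e / 2 by rewrite divr_gt0.
have [e' e'0 H] := cvar_small rd0 rdx rdt t01 gac e20.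
exists e' => // x y tx xy yt /(H x y tx xy yt) K.
have := cvar_dist rd0 rdx rdt t01 gac tx xy yt; lra.
Qed.

Lemma wlen_le_JM : (wlen rd om g t0 t1 <= JMw g t0 t1)%E.
Proof.
apply: wlen_le => n x c P; have [xa xb H] := P.
suff main j : (j <= n)%N -> ((\sum_(l < j) c l * rd (g (x l)) (g (x l.+1)))%:E <= JMw g t0 (x j))%E.
 by rewrite -[t1]xb; exact: main.
elim: j => [|j IH] jn; first by rewrite big_ord0 JMw_ge0.
have [h1 h2 h3] := H j jn; have [x1 x2] := part_in P (ltnW jn); have [x3 x4] := part_in P jn.
rewrite big_ord_recr /= EFinD (JMw_cat g x1 h1); apply: leeD; first exact: IH (ltnW jn).
apply: (integral_speed_ge m_gt0 t01 gac x1 h1 x4 h2) => t /andP[ta tb].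
by rewrite muleC; apply: lee_wpmul2l; [rewrite lee_fin sqrtr_ge0|exact: h3].
Qed.

Let cell n i : set R := `]dyad t0 t1 n i, dyad t0 t1 n i.+1]%classic.
(** The infimum over a cell may be infinite, for instance when the curve rests at a collision; the
    cap [n] keeps it finite and grows with the level. *)
Let cinf n i : R := fine (Order.min n%:R%:E
 (ereal_inf [set om (g t) | t in `[dyad t0 t1 n i, dyad t0 t1 n i.+1]])).
(** The value of the dyadic step function on a cell: height times mean metric speed, so that its
    integral over the cell is a term of a lower sum. *)
Let slope n i : R := cinf n i * rd (g (dyad t0 t1 n i)) (g (dyad t0 t1 n i.+1)) / ((t1 - t0) / 2 ^+ n).
Let step n (t : R) : \bar R := \sum_(i < 2 ^ n) ((slope n i)%:E * (\1_(cell n i) t)%:E)%E.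

Let cinfP n i : 0 <= cinf n i /\
 (forall t, dyad t0 t1 n i <= t -> t <= dyad t0 t1 n i.+1 -> ((cinf n i)%:E <= om (g t))%E) /\
 (forall c : R, c <= n%:R ->
   (forall t : R, dyad t0 t1 n i <= t -> t <= dyad t0 t1 n i.+1 -> (c%:E <= om (g t))%E) -> c <= cinf n i).
Proof.
set S := [set om (g t) | t in `[dyad t0 t1 n i, dyad t0 t1 n i.+1]].
have S0 : (0 <= ereal_inf S)%E by apply: le_ereal_inf_tmp => _ [t _ <-]; exact: om_ge0'.
set M : \bar R := Order.min n%:R%:E (ereal_inf S).
have M0 : (0 <= M)%E by rewrite le_min S0 lee_fin ler0n.
have fM : M \is a fin_num by rewrite ge0_fin_numE// gt_min ltry.
have cE : (cinf n i)%:E = M by rewrite /cinf -/S -/M fineK.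
split; first by rewrite -lee_fin cE.
split.
 move=> t ta tb; rewrite cE /M ge_min; apply/orP; right; apply: ereal_inf_lbound.
 by exists t => //=; rewrite in_itv /= ta.
move=> c cn H; rewrite -lee_fin cE le_min lee_fin cn /=.
apply: le_ereal_inf_tmp => y [t /=]; rewrite in_itv /= => /andP[ta tb] <-; exact: H.
Qed.

Let len_gt0 n : 0 < (t1 - t0) / 2 ^+ n.
Proof. by rewrite divr_gt0 ?subr_gt0// exprn_gt0. Qed.

Let slope_ge0 n i : 0 <= slope n i.
Proof. have [c0 _] := cinfP n i; rewrite /slope; apply: divr_ge0; last exact: ltW.
by apply: mulr_ge0; [|exact: rd0].
Qed.

Let mcell n i : measurable (cell n i).
Proof. exact: measurable_itv. Qed.

Let mterm n i (D : set R) : measurable_fun D (fun t => ((slope n i)%:E * (\1_(cell n i) t)%:E)%E).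
Proof.
apply/measurable_EFinP/measurable_funM; first exact: measurable_cst.
exact: measurable_indic.
Qed.

Let term_ge0 n i (t : R) : (0 <= (slope n i)%:E * (\1_(cell n i) t)%:E)%E.
Proof. by rewrite -EFinM lee_fin mulr_ge0// indic_ge0. Qed.

Let step_int n : (\int[mu]_(t in `[t0, t1]) step n t <= wlen rd om g t0 t1)%E.
Proof.
have mD : measurable (`[t0, t1]%classic : set R) by exact: measurable_itv.
have P : partition_of om g t0 t1 (2 ^ n) (dyad t0 t1 n) (cinf n).
 split; [exact: dyad0|exact: dyad_max|move=> i i_n].
 have [c0 [c1 _]] := cinfP n i; split => //; exact: dyad_le (ltW t01) _.
apply: (le_trans _ (wlen_ub rd P)).
have -> : (\int[mu]_(t in `[t0, t1]) step n t)%E =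
  \sum_(i < 2 ^ n) (\int[mu]_(t in `[t0, t1]) ((slope n i)%:E * (\1_(cell n i) t)%:E))%E.
 apply: (ge0_integral_sum mu mD (f := fun (i : 'I_(2 ^ n)) t => ((slope n i)%:E * (\1_(cell n i) t)%:E)%E)).
  by move=> i; exact: mterm.
 by move=> i t _; exact: term_ge0.
rewrite /psum -sumEFin; apply: lee_sum => i _.
have mI : measurable_fun `[t0, t1] (fun t : R => (\1_(cell n i) t : R)%:E).
 by apply/measurable_EFinP; exact: measurable_indic.
rewrite (ge0_integralZl_EFin mu mD _ mI (slope_ge0 n i)); last first.
 by move=> t _; rewrite lee_fin indic_ge0.
have -> : (\int[mu]_(t in `[t0, t1]) (\1_(cell n i) t)%:E = mu (cell n i `&` `[t0, t1]))%E.
 exact: (integral_indic mu mD (mcell n i)).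
apply: (@le_trans _ _ ((slope n i)%:E * ((t1 - t0) / 2 ^+ n)%:E)%E).
 apply: lee_wpmul2l; first by rewrite lee_fin.
 apply: (@le_trans _ _ (mu (cell n i))).
  have mm : measurable (cell n i `&` `[t0, t1]%classic) by exact: measurableI.
  by apply: le_measure => [||? []//]; rewrite inE//; exact: mcell.
 rewrite /cell lebesgue_measure_itv /= lte_fin.
 case: ifPn => _; last by rewrite lee_fin ltW.
 by rewrite -EFinD lee_fin dyad_step.
by rewrite -EFinM lee_fin /slope divfK// gt_eqF.
Qed.

Let step_cell n i t : (i < 2 ^ n)%N -> cell n i t -> step n t = (slope n i)%:E.
Proof.
move=> i_n ct; rewrite /step (bigD1 (Ordinal i_n)) //= big1 ?adde0.
 by rewrite indicE mem_set// mule1.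
move=> j ji; rewrite indicE memNset ?mule0// => cj; move/eqP: ji; apply; apply: val_inj => /=.
move: ct cj; rewrite /cell /= !in_itv /= => /andP[a1 a2] /andP[c1 c2].
have [ij|ij|//] := ltngtP (val j) i.
- by exfalso; have := @dyad_le R t0 t1 n _ _ (ltW t01) ij; lra.
- by exfalso; have := @dyad_le R t0 t1 n _ _ (ltW t01) ij; lra.
Qed.

(** Over the cells containing [t] the mean speeds converge to the speed at [t], and the heights
    eventually exceed any number below [om (g t)] by lower semicontinuity. *)
Let step_liminf t : t0 < t -> t < t1 -> (derivable (rsize m \o g) t 1 /\
  (0 < rsize m (g t) -> exists Q, is_lift Q g t)) ->
 ((speed m g t)%:E * om (g t) <= limn_einf (fun n => step n t))%E.
Proof.
move=> a1 a2 [_ HL].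
have St n : (0 <= step n t)%E by apply: sume_ge0 => i _; exact: term_ge0.
set z := limn_einf _.
have zN N y : (forall n, (N <= n)%N -> (y <= step n t)%E) -> (y <= z)%E.
 move=> H; rewrite /z limn_einfE.
 apply: (@le_trans _ _ (einfs (fun n => step n t) N)); last by apply: ereal_sup_ubound; exists N.
 by apply: le_ereal_inf_tmp => _ [n /= Nn <-]; exact: H.
have z0 : (0 <= z)%E by apply: (zN 0%N).
have sp0 : 0 <= speed m g t by exact: sqrtr_ge0.
have [->|s0] := eqVneq (speed m g t) 0; first by rewrite mul0e.
have {}s0 : 0 < speed m g t by rewrite lt0r s0.
have [Q LQ kE] : exists2 Q, is_lift Q g t & kinetic m g t = kinetic_lift m Q t.
 have [ex|nex] := pselect (exists Q, is_lift Q g t); first exact: kinetic_lift_ex.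
 move: s0; rewrite /speed /kinetic xgetPN ?mulr0 ?sqrtr0 ?ltxx// => k [Q [H1 H2 _]].
 by apply: nex; exists Q.
rewrite leNgt; apply/negP => zlt.
have fz : z \is a fin_num by rewrite ge0_fin_numE// (lt_le_trans zlt)// leey.
have [r rE] : exists r, z = r%:E by exists (fine z); rewrite fineK.
rewrite rE in zlt z0.
set v0 := speed m g t in s0 sp0 zlt *.
(* If [r] were below speed times [om], there would be [c] below [om] and [v] below the speed with
   [v * c] still above [r]. *)
have [c [c0 rc co]] : exists c, [/\ 0 < c, r / v0 < c & (c%:E < om (g t))%E].
 have r0 : 0 <= r by rewrite -lee_fin.
 case E : (om (g t)) => [x| |].
 - move: zlt; rewrite E -EFinM lte_fin => {}zlt.
  have q1 : r / v0 < x by rewrite ltr_pdivrMr// mulrC.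
  have q0 : 0 <= r / v0 by rewrite divr_ge0.
  by exists ((x + r / v0) / 2); rewrite lte_fin; split; lra.
 - exists (r / v0 + 1); have q0 : 0 <= r / v0 by rewrite divr_ge0.
  by rewrite ltry; split => //; lra.
 - by have := om_ge0' (g t); rewrite E.
have rv : r / c < v0 by rewrite ltr_pdivrMr// mulrC -ltr_pdivrMr.
pose v := (v0 + r / c) / 2.
have vv : v < v0 by rewrite /v; lra.
have cv : r < v * c by rewrite -ltr_pdivrMr// /v; lra.
have v0' : 0 <= v by rewrite /v; have : 0 <= r / c by [rewrite divr_ge0 ?(ltW c0)// -lee_fin]; lra.
have [e e0 He] := om_lsc m_gt0 co.
have [e' e'0 He'] := rd_ac_cont e0.
have : forall n, exists i : nat, (i < 2 ^ n)%N /\ dyad t0 t1 n i < t <= dyad t0 t1 n i.+1.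
 by move=> n; have [|i i1 i2] := @dyad_cell R t0 t1 n t t01; [rewrite a1 ltW|exists i].
move=> /choice[I HI].
pose u n := dyad t0 t1 n (I n); pose w n := dyad t0 t1 n (I n).+1.
have uw n : w n - u n = (t1 - t0) / 2 ^+ n by exact: dyad_step.
have small (e1 : R) : 0 < e1 -> exists N, forall n, (N <= n)%N -> w n - u n < e1.
 move=> e10; have [N HN] := @pow2_small R (e1 / (t1 - t0)) ltac:(by rewrite divr_gt0 ?subr_gt0).
 by exists N => n /HN; rewrite uw ltr_pdivlMr ?subr_gt0// mulrC.
have uc : u n @[n --> \oo] --> t.
 apply/cvgrPdist_lt => e1 e10; have [N HN] := small e1 e10; exists N => // n /= Nn.
 have := HN n Nn; have [_] := HI n; rewrite -/(u n) -/(w n) => /andP[i1 i2] i3.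
 by rewrite ger0_norm; move: i1 i2 i3; move: (u n) (w n) => *; lra.
have wc : w n @[n --> \oo] --> t.
 apply/cvgrPdist_lt => e1 e10; have [N HN] := small e1 e10; exists N => // n /= Nn.
 have := HN n Nn; have [_] := HI n; rewrite -/(u n) -/(w n) => /andP[i1 i2] i3.
 by rewrite ler0_norm; move: i1 i2 i3; move: (u n) (w n) => *; lra.
have [LQ1 LQ2] := LQ.
have := speed_cvg_ge m_gt0 LQ2 uc wc _ _ (c := v); rewrite -kE -/(speed m g t) -/v0 => K.
have {K} K := K (fun n => ltac:(by have [_ /andP[/ltW -> ->]] := HI n))
 (fun n => ltac:(by rewrite -subr_gt0 uw)) vv.
have near_u : \forall n \near \oo, reduced_proj (at_time Q (u n)) = g (u n) by exact: uc LQ1.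
have near_w : \forall n \near \oo, reduced_proj (at_time Q (w n)) = g (w n) by exact: wc LQ1.
have [N1 _ HN1] := filterI K (filterI near_u near_w).
have [N2 HN2] := small e' e'0.
have [N3' HN3] : exists N, c <= N%:R by exists (Num.truncn c).+1; exact/ltW/truncnS_gt.
pose N := maxn N1 (maxn N2 N3').
have : ((v * c)%:E <= z)%E.
 apply: (zN N) => n; rewrite !geq_max => /and3P[n1 n2 n3].
 have [i_n /andP[ti1 ti2]] := HI n.
 rewrite (@step_cell n (I n)) ?/cell /= ?in_itv /= ?ti1//.
 have [k1 [/= k2 k3]] := HN1 n n1.
 have {k1} k1 : v <= rd (g (u n)) (g (w n)) / (w n - u n).
  by case: k1 => [k1|k1]; [rewrite -k2 -k3 rd_proj// ltW|lra].
 rewrite lee_fin /slope -/(u n) -/(w n) -uw mulrC -mulrA; apply: ler_pM => //; first exact: ltW.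
 have [_ [_ +]] := cinfP n (I n); apply.
  by apply: (le_trans HN3); rewrite ler_nat.
 move=> s s1 s2; apply/ltW/He.
 have := HN2 n n2; have [st|ts] := leP s t => lt.
  rewrite rdC'; apply: He' => //.
  - by apply: le_trans s1; have /andP[] := dyad_in (ltW t01) (ltnW i_n).
  - exact: ltW.
  - by rewrite /u /w in lt *; lra.
 apply: He' => //.
 - exact: ltW.
 - exact: ltW.
 - by apply: (le_trans s2); have /andP[] := dyad_in (ltW t01) i_n.
 - by rewrite /u /w in lt *; lra.
by rewrite rE lee_fin; lra.
Qed.

(** Fatou's lemma: the dyadic step functions integrate to at most the weighted length, and their
    lower limit dominates the integrand almost everywhere. *)
Lemma JM_le_wlen : (JMw g t0 t1 <= wlen rd om g t0 t1)%E.
Proof.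
have mD : measurable (`[t0, t1]%classic : set R) by exact: measurable_itv.
have St n t : (0 <= step n t)%E by apply: sume_ge0 => i _; exact: term_ge0.
apply: (@le_trans _ _ (\int[mu]_(t in `[t0, t1]) limn_einf (fun n => step n t))%E).
 have [N0 [mN0 N00 sub]] := ae_lift m_gt0 t01 gac.
 pose N1 : set R := `[t0, t0]%classic `|` `[t1, t1]%classic.
 have mI (a : R) : measurable (`[a, a]%classic : set R) by exact: measurable_itv.
 have I0 (a : R) : mu `[a, a]%classic = 0%E by rewrite lebesgue_measure_itv /= lte_fin ltxx.
 have mN1 : measurable N1 by exact: measurableU.
 have N10 : mu N1 = 0%E by apply: null_setU; [exact: mI|exact: mI|exact: I0|exact: I0].
 have mN : measurable (N0 `|` N1) by exact: measurableU.
 have N0' : mu (N0 `|` N1) = 0%E by apply: null_setU.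
 apply: (lower_ae_le mD mN N0').
 - by move=> t _; exact: JMi_ge0.
 - move=> t _; rewrite limn_einfE.
  apply: (@le_trans _ _ (einfs (fun n => step n t) 0)); last by apply: ereal_sup_ubound; exists 0%N.
  by apply: le_ereal_inf_tmp => _ [n _ <-].
 - move=> t /=; rewrite in_itv /= => /andP[a1 a2] nN.
  have b1 : t0 < t.
   rewrite lt_neqAle a1 andbT; apply/eqP => e; apply: nN; right; left.
   by rewrite /= in_itv /= e lexx.
  have b2 : t < t1.
   rewrite lt_neqAle a2 andbT; apply/eqP => e; apply: nN; right; right.
   by rewrite /= in_itv /= e lexx.
  apply: step_liminf => //; apply: contrapT => bad; apply: nN; left; apply: sub => /= K.
  exact: bad (K b1 b2).
apply: (@le_trans _ _ (limn_einf (fun n => \int[mu]_(t in `[t0, t1]) step n t)%E)).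
 apply: (fatou mu mD); last by [].
 move=> n; apply: emeasurable_sum.
 by move=> i; exact: mterm.
rewrite limn_einfE; apply: ge_ereal_sup => _ [n _ <-].
apply: le_trans (step_int n); apply: ereal_inf_lbound; exists n => //=.
Qed.

Lemma JM_action_wlen : JM_action m h g t0 t1 = wlen rd om g t0 t1.
Proof. by apply/eqP; rewrite JM_actionE eq_le JM_le_wlen wlen_le_JM. Qed.

Lemma one_weight_le_cvar x y : t0 <= x -> x <= y -> y <= t1 ->
 (wlen rd one_weight g x y <= (cvar rd g x y)%:E)%E.
Proof.
move=> tx xy yt; apply: wlen_le => n z c P; have [za zb H] := P.
rewrite lee_fin; apply: (@le_trans _ _ (\sum_(i < n) rd (g (z i)) (g (z i.+1)))).
 apply: ler_sum => i _; have [h1 h2 h3] := H i (ltn_ord i).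
 by rewrite -[leRHS]mul1r ler_wpM2r ?rd0// -lee_fin; exact: h3 (lexx _) h1.
apply: (cvar_ub rd0 rdx rdt t01 gac tx yt); exists 'I_n, (fun i : 'I_n => z i), (fun i : 'I_n => z i.+1); split => //; split.
 move=> i; have [h1 h2 h3] := H i (ltn_ord i).
 by have [? _] := part_in P (ltnW (ltn_ord i)); have [_ ?] := part_in P (ltn_ord i).
move=> i j ij; have [lt|lt|e] := ltngtP (val i) (val j).
- by left; apply: part_mono P lt (ltnW (ltn_ord j)).
- by right; apply: part_mono P lt (ltnW (ltn_ord i)).
- by move: ij; rewrite (val_inj e) eqxx.
Qed.

End ActionAsLength.

(** * Ultrafilter limits and two elementary estimates *)

Lemma ultra_lim (R : realType) (I : Type) (F : set_system I) (UF : UltraFilter F) (f : I -> R) (B : R) :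
 F [set i | `|f i| <= B] -> exists l, forall e, 0 < e -> F [set i | `|f i - l| < e].
Proof.
move=> FB; have FF : ProperFilter F := @ultra_proper _ _ UF.
pose S : set R := [set x | F [set i | x <= f i]].
have hS : has_sup S.
 split; first by exists (- B); apply: filterS FB => i /=; rewrite ler_norml => /andP[].
 exists B => x Sx; have [i [/= h1 h2]] := filter_ex (filterI Sx FB).
 by apply: (le_trans h1); move: h2; rewrite ler_norml => /andP[].
exists (sup S) => e e0.
have [x Sx lx] := sup_adherent e0 hS.
have nS : ~ S (sup S + e / 2).
 by move=> /(ub_le_sup hS.2); have : 0 < e / 2 by [rewrite divr_gt0]; lra.
have FC : F (~` [set i | sup S + e / 2 <= f i]) by case: (in_ultra_setVsetC [set i | sup S + e / 2 <= f i] UF).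
apply: filterS (filterI Sx FC) => i [/= h1 /negP]; rewrite -ltNge => h2.
by rewrite ltr_norml; split_lra.
Qed.

(** A nonprincipal ultrafilter replaces diagonal subsequences: the limits at all times exist
    simultaneously. *)
Lemma ultra_nat : exists2 F : set_system nat, UltraFilter F & forall N, F [set n | (N <= n)%N].
Proof.
have [F [UF sF]] := @ultraFilterLemma nat \oo _; exists F => // N.
by apply: sF; exists N.
Qed.

Lemma mvt_nondecreasing (R : realType) (G g : R -> R) (x y : R) : x <= y ->
 {within `[x, y], continuous G} -> (forall t : R, x < t -> t < y -> is_derive t 1 G (g t)) ->
 (forall t, x < t -> t < y -> 0 <= g t) -> G x <= G y.
Proof.
move=> xy Gc Gd g0; have [->//|nxy] := eqVneq x y.
have lt : x < y by rewrite lt_neqAle nxy.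
have Gd' (t : R) : t \in `]x, y[ -> is_derive t 1 G (g t).
 by rewrite in_itv /= => /andP[? ?]; exact: Gd.
have [t] := MVT lt Gd' Gc; rewrite in_itv /= => /andP[xt ty] E.
by rewrite -subr_ge0 E mulr_ge0 ?g0// subr_ge0.
Qed.

Lemma continuous_derivable (R : realType) (f df : R -> R) (a b : R) :
 (forall t : R, is_derive t 1 f (df t)) -> {within `[a, b], continuous f}.
Proof. by move=> H; apply: continuous_subspaceT => t; exact: is_derive_cvg (H t). Qed.

(* Among the three unit numbers conj(w1) w^j, w a cube root of unity, at most one
  is bad for each of the second and third pairs, and none for the first. *)
Lemma three_angles (R : realType) (a b n : 'I_3 -> R) : (forall k, 0 <= n k) ->
 (forall k, a k ^+ 2 + b k ^+ 2 = n k ^+ 2) ->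
 exists c s : R, c ^+ 2 + s ^+ 2 = 1 /\ forall k, - (n k / 2) <= c * a k - s * b k.
Proof.
move=> n0 abn; pose q : R := sqrt 3.
have q2 : q ^+ 2 = 3 by rewrite sqr_sqrtr.
have q0 : 0 < q by rewrite sqrtr_gt0.
have [c [s [cs A]]] : exists c s : R, c ^+ 2 + s ^+ 2 = 1 /\ (c * a b1 - s * b b1 = n b1 /\ c * b b1 + s * a b1 = 0).
 have [n10|n10] := eqVneq (n b1) 0.
  exists 1, 0; have := abn b1; rewrite n10 expr0n /= => e.
  have a0 : a b1 = 0 by apply/eqP; rewrite -sqrf_eq0; apply/eqP; have := sqr_ge0 (a b1); have := sqr_ge0 (b b1); lra.
  have b0 : b b1 = 0 by apply/eqP; rewrite -sqrf_eq0; apply/eqP; have := sqr_ge0 (a b1); have := sqr_ge0 (b b1); lra.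
  by rewrite a0 b0; split; [ring|split; ring].
 exists (a b1 / n b1), (- (b b1 / n b1)); have := abn b1 => e.
 split; first by rewrite sqrrN !expr_div_n -mulrDl e divff// sqrf_eq0.
 split; last by ring.
 have -> : a b1 / n b1 * a b1 - - (b b1 / n b1) * b b1 = (a b1 ^+ 2 + b b1 ^+ 2) / n b1 by ring.
 by rewrite e expr2 mulfK.
pose X k := c * a k - s * b k; pose Y k := c * b k + s * a k.
have XY k : X k ^+ 2 + Y k ^+ 2 = n k ^+ 2.
 by rewrite -abn -[RHS]mul1r -cs /X /Y; ring.
have [X1 Y1] : X b1 = n b1 /\ Y b1 = 0 by [].
(* The bad angles, with cosine below -1/2, form an open arc of 120 degrees, so two rotations by 120
   degrees cannot both be bad. *)
have bad (x y k : R) : 0 <= k -> x ^+ 2 + y ^+ 2 = k ^+ 2 -> x < - (k / 2) -> k <= x + q * y -> False.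
 move=> k0 e x1 y1.
 have l : 0 < k - x by lra.
 have : (k - x) ^+ 2 <= (q * y) ^+ 2 by rewrite ler_pXn2r// ?nnegrE; lra.
 rewrite exprMn q2 => l2.
 have : (k - x) * (k - x) <= (k - x) * (3 * (k + x)) by move: l2 e; rewrite !expr2; nra.
 rewrite ler_pM2l//; lra.
pose P (c' s' : R) k := - (n k / 2) <= c' * X k - s' * Y k.
have Pex k : [\/ P 1 0 k /\ P (- (1 / 2)) (q / 2) k, P 1 0 k /\ P (- (1 / 2)) (- (q / 2)) k |
  P (- (1 / 2)) (q / 2) k /\ P (- (1 / 2)) (- (q / 2)) k].
 rewrite /P; set x := X k; set y := Y k; have nk := n0 k; have e := XY k; rewrite -/x -/y in e.
 have [h1|h1] := leP (- (n k / 2)) (1 * x - 0 * y); have [h2|h2] := leP (- (n k / 2)) (- (1 / 2) * x - q / 2 * y);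
 have [h3|h3] := leP (- (n k / 2)) (- (1 / 2) * x - - (q / 2) * y); try by [apply: Or31|apply: Or32|apply: Or33].
 - exfalso; apply: (bad (- (1 / 2) * x - q / 2 * y) (q / 2 * x - 1 / 2 * y) (n k) nk) => //.
   by rewrite -e; have -> : (- (1 / 2) * x - q / 2 * y) ^+ 2 + (q / 2 * x - 1 / 2 * y) ^+ 2 = (1 + q ^+ 2) / 4 * (x ^+ 2 + y ^+ 2) by [field]; rewrite q2; field.
  have -> : - (1 / 2) * x - q / 2 * y + q * (q / 2 * x - 1 / 2 * y) = (q ^+ 2 - 1) / 2 * x - q * y by field.
  rewrite q2; lra.
 - exfalso; apply: (bad x (- y) (n k) nk) => //; rewrite ?sqrrN//; lra.
 - by exfalso; apply: (bad x y (n k) nk) => //; lra.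
 - by exfalso; apply: (bad x y (n k) nk) => //; lra.
pose good := exists c s : R, c ^+ 2 + s ^+ 2 = 1 /\ forall k, - (n k / 2) <= c * a k - s * b k.
have rot c' s' : c' ^+ 2 + s' ^+ 2 = 1 -> (forall k, P c' s' k) ->
  good.
 move=> cs' H; exists (c' * c - s' * s), (c' * s + s' * c); split.
  by rewrite -[RHS]mul1r -{1}cs' -cs; ring.
 by move=> k; apply: (le_trans (H k)); rewrite /X /Y le_eqVlt; apply/orP; left; apply/eqP; ring.
have cs1 : (- (1 / 2)) ^+ 2 + (q / 2) ^+ 2 = 1 :> R by rewrite expr_div_n q2; field.
have cs2 : (- (1 / 2)) ^+ 2 + (- (q / 2)) ^+ 2 = 1 :> R by rewrite (sqrrN (q / 2)) cs1.
have P1 : [/\ P 1 0 b1, P (- (1 / 2)) (q / 2) b1 & P (- (1 / 2)) (- (q / 2)) b1].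
 by rewrite /P X1 Y1; have := n0 b1; split; lra.
have [P11 P12 P13] := P1.
have r1 : P 1 0 b2 -> P 1 0 b3 -> good.
 by move=> p2 p3; apply: (rot 1 0); [ring|exact: ord3_ind].
have r2 : P (- (1 / 2)) (q / 2) b2 -> P (- (1 / 2)) (q / 2) b3 -> good.
 by move=> p2 p3; apply: (rot _ _ cs1); exact: ord3_ind.
have r3 : P (- (1 / 2)) (- (q / 2)) b2 -> P (- (1 / 2)) (- (q / 2)) b3 -> good.
 by move=> p2 p3; apply: (rot _ _ cs2); exact: ord3_ind.
by rewrite -/good; case: (Pex b2) => -[? ?]; case: (Pex b3) => -[? ?]; auto.
Qed.

(* A path whose speed in the metric om^2 ds^2 is controlled from below by the
  remaining cost to the power 1/3 has bounded length: the remaining cost drops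
  from e 8^-n to e 8^-(n+1) within length 2 (e / b) 4^-n. *)
Lemma stage_bound (R : realType) (Phi : R -> R) (L e b h r : R) : 0 < e -> 0 < b -> 0 < h -> 0 <= r ->
 Phi 0 = 0 -> (forall s t, 0 <= s -> s <= t -> t <= L -> Phi s <= Phi t) ->
 (forall s t c, 0 <= s -> s <= t -> t <= L -> 0 <= c -> c ^+ 3 * (r + t) <= h * (e - Phi t) ->
   c * (t - s) <= Phi t - Phi s) ->
 b ^+ 3 * (r + 3 * e / b) <= h * e ->
 forall t, 0 <= t -> t <= L -> Phi t < e -> t <= 3 * e / b.
Proof.
move=> e0 b0 h0 r0 P0 Pnd H bT t t0 tL Pt; set T := 3 * e / b in bT *.
rewrite leNgt; apply/negP => Tt.
have T0 : 0 < T by rewrite /T divr_gt0// mulr_gt0.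
have TL : T <= L by exact: le_trans (ltW Tt) tL.
have PT : Phi T < e by apply: le_lt_trans Pt; apply: Pnd => //; exact: ltW.
(* The sum of the stage lengths [2 (e / b) 4^-j] over [j < n]; it stays below [8/3 (e / b)], which
   is less than [T]. *)
pose B n : R := 8 / 3 * (e / b) * (1 - (4 ^+ n)^-1).
have p8 n : 0 < (8 ^+ n : R)^-1 by rewrite invr_gt0 exprn_gt0.
have p4 n : 0 < (4 ^+ n : R)^-1 by rewrite invr_gt0 exprn_gt0.
have eb : 0 < e / b by rewrite divr_gt0.
have main n : forall s, 0 <= s -> s <= T -> e * (8 ^+ n)^-1 <= e - Phi s -> s <= B n.
 elim: n => [|n IH] s s0 sT es.
  rewrite /B expr0 invr1 subrr mulr0; move: es; rewrite expr0 invr1 mulr1 => es.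
  have := H 0 s b (lexx _) s0 (le_trans sT TL) (ltW b0) _; rewrite P0 !subr0 => K.
  have {}K : b * s <= Phi s.
   apply: K; apply: (@le_trans _ _ (h * e)); last by rewrite ler_pM2l.
   by apply: le_trans bT; rewrite ler_wpM2l ?exprn_ge0 ?(ltW b0)// lerD2l.
  have : b * s <= b * 0 by rewrite mulr0; lra.
  by rewrite ler_pM2l.
 have [//|sB] := leP s (B n.+1); exfalso.
 have BB : B n.+1 = B n + 2 * (e / b) * (4 ^+ n)^-1.
  by rewrite /B exprS invfM; field; rewrite ?gt_eqF ?exprn_gt0.
 have Bn0 : 0 <= B n.
  have : (4 ^+ n : R)^-1 <= 1 by rewrite invf_le1 ?exprn_gt0// exprn_ege1// ler1n.
  by move=> ?; rewrite mulr_ge0 ?subr_ge0// mulr_ge0 ?divr_ge0// ltW.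
 have sn : B n < s by rewrite (lt_trans _ sB)// BB ltrDl mulr_gt0// mulr_gt0.
 pose u := (B n + (s - 2 * (e / b) * (4 ^+ n)^-1)) / 2.
 have un : B n < u by rewrite /u; lra.
 have us : u < s by rewrite /u; have : 0 < 2 * (e / b) * (4 ^+ n)^-1 by [rewrite mulr_gt0// mulr_gt0]; lra.
 have Pu : e - Phi u < e * (8 ^+ n)^-1.
  by rewrite ltNge; apply/negP => /(IH u) K; have := K ltac:(lra) ltac:(lra); lra.
 (* Its cube is [b^3 8^-(n+1)], matching the fraction of the cost that remains at least until the
    end of the stage. *)
 pose c := b * (2 ^+ n.+1)^-1.
 have c0 : 0 < c by rewrite mulr_gt0// invr_gt0 exprn_gt0.
 have c3 : c ^+ 3 = b ^+ 3 * (8 ^+ n.+1)^-1.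
  rewrite /c exprMn exprVn -exprM mulnC exprM; congr (_ * (_ ^+ _)^-1); ring.
 have K : c * (s - u) <= Phi s - Phi u.
  apply: H; [lra|exact: ltW|exact: le_trans sT TL|exact: ltW|].
  apply: (@le_trans _ _ (h * (e * (8 ^+ n.+1)^-1))); last by rewrite ler_pM2l.
  rewrite c3 mulrAC mulrA ler_pM2r//; apply: le_trans bT.
  by rewrite ler_wpM2l ?exprn_ge0 ?(ltW b0)// lerD2l.
 have K2 : c * (s - u) < e * (8 ^+ n)^-1.
  apply: (le_lt_trans K); have : 0 < e * (8 ^+ n.+1)^-1 by rewrite mulr_gt0.
  by lra.
 have K3 : c * (2 * (e / b) * (4 ^+ n)^-1) = e * (8 ^+ n)^-1.
  rewrite /c; have -> : (8 : R) ^+ n = 2 ^+ n * 4 ^+ n by rewrite -exprMn; congr (_ ^+ _); ring.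
  by rewrite exprS; field; rewrite ?gt_eqF ?exprn_gt0.
 have : c * (2 * (e / b) * (4 ^+ n)^-1) < c * (s - u).
  by rewrite ltr_pM2l// /u BB in sB *; lra.
 by rewrite K3; lra.
have [n Hn] : exists n, e * (8 ^+ n)^-1 <= e - Phi T.
 have [N HN] := @pow2_small R ((e - Phi T) / e) ltac:(by rewrite divr_gt0// subr_gt0).
 exists N; have := HN N (leqnn N); rewrite ltr_pdivlMr// mulrC => K.
 apply: le_trans (ltW K); rewrite ler_pM2l// lef_pV2 ?posrE ?exprn_gt0//.
 by apply: lerXn2r; rewrite ?nnegrE; lra.
have := main n T (ltW T0) (lexx _) Hn.
rewrite /B /T; have := p4 n; have -> : 3 * e / b = 3 * (e / b) by rewrite mulrA.
by nra.
Qed.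

(** * Paths of bounded length and cost, and their limits *)

Section Paths.
Context {R : realType}.
Variable m : 'I_3 -> R.
Hypothesis m_gt0 : forall i, 0 < m i.
Variable h : R.
Hypothesis h_gt0 : 0 < h.
Local Notation proj := (@reduced_proj R).
Local Notation rd := (rd m).
Local Notation om := (om m h).
Local Notation hill := (hill_region m h).
Local Notation len := (wlen rd one_weight).
Local Notation W := (wlen rd om).
Local Notation hre := (hre m).
Local Notation hnorm := (hnorm m).

Let rd0 := @rd_ge0 R m.
Let rdC' := rdC m.
Let rdx := rdxx m_gt0.
Let rdt := rd_triangle m_gt0.
Let om0 := @om_ge0' R m h.

Implicit Types (g k : R -> reduced R) (p : reduced R).

(** With body 1 moved to the origin, a bound on the size bounds all coordinates, which then converge
    along the ultrafilter. *)
Lemma point_ultra_lim (I : Type) (F : set_system I) (UF : UltraFilter F) (ps : I -> reduced R) (B : R) :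
 F [set i | rsize m (ps i) <= B] -> exists p, forall e, 0 < e -> F [set i | rd (ps i) p < e].
Proof.
move=> FB; have FF : ProperFilter F := @ultra_proper _ _ UF.
pose q i : config R := fun j => repr (ps i) j - repr (ps i) b1.
have pq i : proj (q i) = ps i.
 rewrite -[ps i]proj_repr; apply/esym/proj_congr/asboolP; exists 1, (- repr (ps i) b1).
 by split; [exact: normc1|move=> j; rewrite mul1r].
have Kp := sepK_gt0 m_gt0.
have HB j : F [set i | `|Re (q i j)| <= sepK m * B] /\ F [set i | `|Im (q i j)| <= sepK m * B].
 split; apply: filterS FB => i /= hB; rewrite /q ?reB ?imB.
  apply: (le_trans (abs_sepr (repr (ps i)) j b1)); apply: (le_trans (sep_le_hnorm m_gt0 _ _ _)).
  by rewrite ler_pM2l.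
 apply: (le_trans (abs_sepi (repr (ps i)) j b1)); apply: (le_trans (sep_le_hnorm m_gt0 _ _ _)).
 by rewrite ler_pM2l.
have /choice[lr Hlr] : forall j, exists l, forall e, 0 < e -> F [set i | `|Re (q i j) - l| < e].
 by move=> j; exact: ultra_lim (HB j).1.
have /choice[li Hli] : forall j, exists l, forall e, 0 < e -> F [set i | `|Im (q i j) - l| < e].
 by move=> j; exact: ultra_lim (HB j).2.
pose L : config R := fun j => lr j +i* li j.
exists (proj L) => e e0.
have hK0 : 0 <= hK m by exact: sqrtr_ge0.
pose e' := e / (hK m + 1).
have e'0 : 0 < e' by rewrite divr_gt0//; lra.
have FA j : F [set i | `|Re (q i j) - lr j| < e' /\ `|Im (q i j) - li j| < e'].
 by apply: filterS (filterI (Hlr j _ e'0) (Hli j _ e'0)).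
apply: filterS (filterI (FA b1) (filterI (FA b2) (FA b3))) => i [h1 [h2 h3]] /=.
rewrite -(pq i) rd_proj; apply: (@le_lt_trans _ _ (hnorm (csub (q i) L))).
 exact: qdist_le_hnorm.
apply: (@le_lt_trans _ _ (hK m * e')).
 apply: (hnorm_le_coord m_gt0 (ltW e'0)) => j; rewrite /csub reB imB.
 by move: j; apply: ord3_ind; split; apply/ltW; [exact: h1.1|exact: h1.2|exact: h2.1|exact: h2.2|exact: h3.1|exact: h3.2].
by rewrite /e' mulrA ltr_pdivrMr; [nra|lra].
Qed.

Lemma hill_closed p : (forall e, 0 < e -> exists2 p', rd p p' < e & hill p') -> hill p.
Proof.
move=> H; rewrite /hill_region /= leNgt; apply/negP => lt.
have [nc|nc] := pselect (noncol p); last by move: lt; rewrite (rpot_col m_gt0 nc).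
move: lt; rewrite (rpot_noncol m nc) lte_fin => lt.
have [e e0 He] := Upot_close m_gt0 nc (e := h - Upot m p) ltac:(by rewrite subr_gt0).
have [p' /He[nc' K]] := H e e0.
rewrite /hill_region /= (rpot_noncol m nc') lee_fin; move: K; rewrite ltr_norml => /andP[]; lra.
Qed.

Lemma om_lsc_weight : lsc_weight rd om.
Proof. by move=> p y; exact: om_lsc. Qed.

Definition lip1 k := forall s t, s <= t -> rd (k s) (k t) <= t - s.

(** A 1-Lipschitz path run in time [L] at cost at most [M]. Waiting is allowed, so [L] is only an
    upper bound for the length, and paths of different lengths can be given a common time. *)
Definition gpath p p' (L M : R) : Prop := exists k, [/\ lip1 k, k 0 = p, k L = p',
 (forall t, 0 <= t -> t <= L -> hill (k t)) & (W k 0 L <= M%:E)%E].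

Lemma gpath_le p p' L M M' : M <= M' -> gpath p p' L M -> gpath p p' L M'.
Proof.
by move=> MM [k [h1 h2 h3 h4 h5]]; exists k; split => //; apply: (le_trans h5); rewrite lee_fin.
Qed.

Lemma gpath_ge0 p p' L M : 0 <= L -> gpath p p' L M -> 0 <= M.
Proof.
by move=> L0 [k [_ _ _ _ h5]]; rewrite -lee_fin; apply: le_trans h5; exact: wlen_ge0.
Qed.

(** Arzela-Ascoli along an ultrafilter, combined with lower semicontinuity of the cost. The relation
    [S] carries what is known about the varying endpoints over to the limit. *)
Lemma gpath_lim p L M (S : R -> set (reduced R)) : 0 <= L ->
 (forall e, 0 < e -> exists2 p', S e p' & gpath p p' L (M + e)) ->
 exists2 p', gpath p p' L M & forall e, 0 < e ->
  exists e' p'', [/\ 0 < e', e' < e, S e' p'' & rd p'' p' < e].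
Proof.
move=> L0 H.
have hp n : 0 < (harmonic n : R) by rewrite /harmonic /= invr_gt0.
have /choice[ps Hps] : forall n, exists p', S (harmonic n) p' /\ gpath p p' L (M + harmonic n).
 by move=> n; have [p' ? ?] := H _ (hp n); exists p'.
have /choice[ks Hks] := fun n => (Hps n).2.
have [F UF FN] := ultra_nat; have FF : ProperFilter F := @ultra_proper _ _ UF.
have small (e : R) : 0 < e -> F [set n | harmonic n < e].
 move=> e0; have [N _ HN] := cvgr_lt 0 (@cvg_harmonic R) e e0.
 by apply: filterS (FN N) => n /= Nn; exact: HN.
have lip n : lip1 (ks n) by have [] := Hks n.
have /choice[k Hk] : forall t, exists q, forall e, 0 < e -> F [set n | rd (ks n t) q < e].
 move=> t; apply: (point_ultra_lim UF (B := rsize m p + `|t|)); apply: filterE => n /=.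
 have [_ k0 _ _ _] := Hks n.
 have := rsize_rd m_gt0 (ks n t) p; rewrite ler_norml -k0 => /andP[_].
 have : rd (ks n t) (ks n 0) <= `|t|.
  have [t0|/ltW t0] := leP t 0.
   by apply: (le_trans (lip n _ _ t0)); rewrite ler0_norm//; lra.
  by rewrite rdC'; apply: (le_trans (lip n _ _ t0)); rewrite ger0_norm//; lra.
 lra.
have kc t q : (forall n, ks n t = q) -> k t = q.
 move=> e; apply: (rd_eq0 m_gt0); apply/eqP; rewrite eq_le rd0 andbT.
 apply/ler_addgt0Pr => e0 e00; rewrite add0r.
 by have [n] := filter_ex (Hk t e0 e00); rewrite /= e rdC' => /ltW.
have klip : lip1 k.
 move=> s t st; apply/ler_addgt0Pr => e e0; have e20 : 0 < e / 2 by rewrite divr_gt0.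
 have [n [/= n1 n2]] := filter_ex (filterI (Hk s _ e20) (Hk t _ e20)).
 have := lip n s t st; have := rdt (k s) (ks n s) (k t); have := rdt (ks n s) (ks n t) (k t).
 rewrite (rdC' (k s) (ks n s)); lra.
exists (k L).
 exists k; split => //.
 - by apply: kc => n; have [] := Hks n.
 - move=> t t0 tL; apply: hill_closed => e e0; have [n /= n1] := filter_ex (Hk t e e0).
  by exists (ks n t); [rewrite rdC'|have [_ _ _ + _] := Hks n; exact].
 - apply: (wlen_lsc rd0 rdC' rdx rdt FF (gs := ks) om_lsc_weight om0 L0).
  + by move=> n s t; exact: lip.
  + by move=> t e _ _; exact: Hk.
  + move=> e e0; apply: filterS (small e e0) => n /= ne; have [_ _ _ _ le] := Hks n.
   by apply: (le_trans le); rewrite lee_fin lerD2l ltW.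
move=> e e0; have [n [/= n1 n2]] := filter_ex (filterI (Hk L e e0) (small e e0)).
have [_ _ kL _ _] := Hks n; exists (harmonic n), (ps n); split => //; last by rewrite -kL.
by have [] := Hps n.
Qed.

Lemma wlen_const w p a b : (forall q, (0 <= w q)%E) -> a <= b -> wlen rd w (fun=> p) a b = 0%E.
Proof.
move=> w0 ab; apply/eqP; rewrite eq_le (wlen_ge0 rd (fun=> p) ab w0) andbT; apply: wlen_le => n x c _.
by rewrite /psum big1// => i _; rewrite rdx mulr0.
Qed.

Lemma gpath_refl p L : 0 <= L -> hill p -> gpath p p L 0.
Proof.
move=> L0 hp; exists (fun=> p); split => //; last by rewrite (wlen_const _ om0).
by move=> s t st; rewrite rdx subr_ge0.
Qed.

Lemma wlen_shift k a b s : a <= b -> W (fun t => k (t + s)) a b = W k (a + s) (b + s).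
Proof.
move=> ab; apply: (wlen_reparam rdx (phi := fun t => t + s) ab _ _ _ om0) => //.
- by move=> ? ? _ ? _; rewrite lerD2r.
- by move=> y y1 y2; exists (y - s); [split_lra|rewrite subrK].
Qed.

Lemma gpath_cat p q r L L' M M' : 0 <= L -> 0 <= L' ->
 gpath p q L M -> gpath q r L' M' -> gpath p r (L + L') (M + M').
Proof.
move=> L0 L'0 [k [k1 k2 k3 k4 k5]] [k' [k1' k2' k3' k4' k5']].
pose g t := if t <= L then k t else k' (t + (- L)).
have gL t : L <= t -> g t = k' (t + (- L)).
 move=> Lt; rewrite /g; case: ifPn => // tL.
 have -> : t = L by apply/eqP; rewrite eq_le tL.
 by rewrite subrr k3 k2'.
exists g; split.
- move=> s t st; have [tL|/ltW Lt] := leP t L.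
  by rewrite /g tL (le_trans st tL); exact: k1.
 have [sL|/ltW Ls] := leP s L; last by rewrite !gL//; apply: (le_trans (k1' _ _ _)); lra.
 have e1 : g s = k s by rewrite /g sL.
 rewrite e1 gL//; apply: (le_trans (rdt _ (k L) _)).
 have := k1 s L sL; have := k1' 0 (t + (- L)) ltac:(lra); rewrite k3 k2'; lra.
- by rewrite /g L0.
- by rewrite gL ?lerDl// addrC addKr.
- move=> t t0 tL; have [tL'|/ltW Lt] := leP t L; first by rewrite /g tL'; exact: k4.
 by rewrite gL//; apply: k4'; lra.
- have LL : L <= L + L' by lra.
 rewrite (wlenD rd0 rdx rdt g L0 LL om0) EFinD; apply: leeD.
  by rewrite (wlen_ext rdx (k := k) L0)// => t _ tL; rewrite /g tL.
 rewrite (wlen_ext rdx (k := fun t => k' (t + (- L)))) ?lerDl//; last by move=> t Lt _; exact: gL.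
 by rewrite wlen_shift ?lerDl// subrr addrAC subrr add0r.
Qed.

Lemma gpath_longer p p' L L' M : 0 <= L -> L <= L' -> hill p' -> gpath p p' L M -> gpath p p' L' M.
Proof.
move=> L0 LL hp H; rewrite -[L'](subrK L) addrC -[M]addr0.
by apply: (gpath_cat _ _ H); [|lra|apply: gpath_refl; [lra|]].
Qed.

Lemma gpath_sym p q L M : 0 <= L -> gpath p q L M -> gpath q p L M.
Proof.
move=> L0 [k [k1 k2 k3 k4 k5]]; exists (fun t => k (- (t + (- L)))); split.
- move=> s t st; rewrite rdC'; apply: (le_trans (k1 _ _ _)); lra.
- by rewrite add0r opprK.
- by rewrite subrr oppr0.
- by move=> t t0 tL; apply: k4; lra.
- rewrite (wlen_shift (fun t => k (- t)) (- L) L0) add0r subrr -oppr0.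
 by rewrite (wlen_rev rdC').
Qed.

Lemma gpath_sub k L s t M : lip1 k -> (forall t, 0 <= t -> t <= L -> hill (k t)) -> 0 <= s -> s <= t -> t <= L ->
 (W k s t <= M%:E)%E -> gpath (k s) (k t) (t - s) M.
Proof.
move=> k1 k4 s0 st tL le; exists (fun x => k (x + s)); split.
- by move=> x y xy; apply: (le_trans (k1 _ _ _)); lra.
- by rewrite add0r.
- by rewrite subrK.
- by move=> x x0 xs; apply: k4; lra.
- by rewrite wlen_shift ?subr_ge0// add0r subrK.
Qed.

Definition arc k L := [/\ 0 <= L, lip1 k & forall a b, 0 <= a -> a <= b -> b <= L -> len k a b = (b - a)%:E].

Lemma arc_ge k L a b c : arc k L -> 0 <= a -> a <= b -> b <= L -> 0 <= c ->
 (forall t, a <= t -> t <= b -> (c%:E <= om (k t))%E) -> ((c * (b - a))%:E <= W k a b)%E.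
Proof. by move=> [_ _ A] a0 ab bL c0 H; apply: (wlen_scale_ge ab c0 (A a b a0 ab bL) om0). Qed.

Lemma arc_le k L a b c : arc k L -> 0 <= a -> a <= b -> b <= L -> 0 <= c ->
 (forall t, a <= t -> t <= b -> (om (k t) <= c%:E)%E) -> (W k a b <= (c * (b - a))%:E)%E.
Proof. by move=> [_ _ A] a0 ab bL c0 H; apply: (wlen_scale_le rd0 ab c0 (A a b a0 ab bL)). Qed.

(** The length [l] from [t0] is continuous by absolute continuity, and [g] is constant wherever [l]
    is. Hence [g] factors through [l]; clamping extends the factor to the whole line. *)
Lemma arc_of_ac g t0 t1 : t0 < t1 -> rd_ac m g t0 t1 -> exists k L (l : R -> R),
 [/\ arc k L, (forall t, t0 <= t -> t <= t1 -> g t = k (l t)),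
   (forall s t, t0 <= s -> s <= t -> t <= t1 -> l s <= l t), l t0 = 0 & l t1 = L] /\
 {within `[t0, t1], continuous l} /\ W g t0 t1 = W k 0 L.
Proof.
have mark : True by [].
move=> t01 gac.
have one0 (p : reduced R) : (0 <= one_weight (R := R) p)%E by rewrite /one_weight.
have fin s t : t0 <= s -> s <= t -> t <= t1 -> len g s t \is a fin_num.
 move=> ts st tt; rewrite ge0_fin_numE; last exact: wlen_ge0.
 by apply: (le_lt_trans (one_weight_le_cvar m_gt0 t01 gac ts st tt)); rewrite ltry.
pose l t := fine (len g t0 t).
have lE s t : t0 <= s -> s <= t -> t <= t1 -> len g s t = (l t - l s)%:E.
 move=> ts st tt; have tt0 := le_trans ts st; have st1 := le_trans st tt.
 have f1 : len g t0 t \is a fin_num by exact: fin.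
 have f2 : len g t0 s \is a fin_num by exact: fin.
 by rewrite EFinB /l !fineK// (wlenD rd0 rdx rdt g ts st one0) [X in (X - _)%E]addeC addeK.
have lnd s t : t0 <= s -> s <= t -> t <= t1 -> l s <= l t.
 by move=> ts st tt; rewrite -subr_ge0 -lee_fin -lE//; exact: wlen_ge0.
have l0 : l t0 = 0 by rewrite /l (wlenxx rdx).
have gl s t : t0 <= s -> s <= t -> t <= t1 -> rd (g s) (g t) <= l t - l s.
 move=> ts st tt; rewrite -lee_fin -lE//.
 by have := @wlen_cell R _ rd one_weight g s t 1 st ler01; rewrite mul1r; apply.
have lc : {within `[t0, t1], continuous l}.
 apply/(continuous_within_itvP _ t01).
 have sm e : 0 < e -> exists2 e', 0 < e' & forall x y, t0 <= x -> x <= y -> y <= t1 -> y - x < e' -> l y - l x < e.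
  move=> e0; have e20 : 0 < e / 2 by rewrite divr_gt0.
  have [e' e'0 H] := cvar_small rd0 rdx rdt t01 gac e20.
  exists e' => // x y tx xy yt yx; have := H x y tx xy yt yx.
  have := one_weight_le_cvar m_gt0 t01 gac tx xy yt; rewrite lE// lee_fin; lra.
 split.
 - move=> x; rewrite in_itv /= => /andP[tx xt]; apply/cvgrPdist_lt => e e0.
  have [e' e'0 H] := sm e e0.
  have e3 : 0 < Num.min e' (Num.min (x - t0) (t1 - x)) by rewrite !lt_min e'0 !subr_gt0 tx.
  near=> y.
  have : `|x - y| < Num.min e' (Num.min (x - t0) (t1 - x)).
   by near: y; apply/nbhs_ballP; exists (Num.min e' (Num.min (x - t0) (t1 - x))).
  rewrite !lt_min => /and3P[yx y1 y2].
  have ty : t0 < y by move: y1; rewrite ltr_norml => /andP[]; lra.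
  have yt : y < t1 by move: y2; rewrite ltr_norml => /andP[]; lra.
  have [xy|/ltW xy] := leP x y.
   rewrite distrC ger0_norm ?subr_ge0 ?lnd// ?(ltW tx)// ?(ltW yt)//; apply: H; rewrite ?(ltW tx)// ?(ltW yt)//.
   by move: yx; rewrite distrC ger0_norm ?subr_ge0.
  rewrite ger0_norm ?subr_ge0 ?lnd// ?(ltW ty)// ?(ltW xt)//; apply: H; rewrite ?(ltW ty)// ?(ltW xt)//.
  by move: yx; rewrite ger0_norm ?subr_ge0.
 - apply/cvgrPdist_lt => e e0; have [e' e'0 H] := sm e e0; near=> y.
  have ty : t0 < y by near: y; exact: nbhs_right_gt.
  have yt : y < t1 by near: y; exact: nbhs_right_lt.
  have yx : y < t0 + e' by near: y; apply: nbhs_right_lt; rewrite ltrDl.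
  rewrite distrC ger0_norm ?subr_ge0 ?lnd// ?(ltW ty)// ?(ltW yt)//.
  by apply: H; rewrite ?(ltW ty)// ?(ltW yt)//; lra.
 - apply/cvgrPdist_lt => e e0; have [e' e'0 H] := sm e e0; near=> y.
  have ty : t0 < y by near: y; exact: nbhs_left_gt.
  have yt : y < t1 by near: y; exact: nbhs_left_lt.
  have yx : t1 - e' < y by near: y; apply: nbhs_left_gt; rewrite gtrBl.
  rewrite ger0_norm ?subr_ge0 ?lnd// ?(ltW ty)// ?(ltW yt)//.
  by apply: H; rewrite ?(ltW ty)// ?(ltW yt)//; lra.
have L0 : 0 <= l t1 by rewrite -l0; apply: lnd => //; exact: ltW.
have surj y : exists t, 0 <= y -> y <= l t1 -> t0 <= t <= t1 /\ l t = y.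
 have [/andP[y0 yL]|ny] := boolP (0 <= y <= l t1); last first.
  by exists 0 => y0 yL; move: ny; rewrite y0 yL.
 have [|t] := IVT (ltW t01) lc (v := y); first by rewrite l0 min_l// max_r// y0.
 by rewrite in_itv /= => ? ?; exists t.
have /choice[psi Hpsi] := surj.
pose k y := g (psi (clampr 0 (l t1) y)).
have same s t : t0 <= s <= t1 -> t0 <= t <= t1 -> rd (g s) (g t) <= `|l s - l t|.
 move=> /andP[s1 s2] /andP[u1 u2]; have [st|/ltW ts] := leP s t.
  by rewrite distrC; apply: (le_trans (gl s t s1 st u2)); exact: ler_norm.
 by rewrite rdC'; apply: (le_trans (gl t s u1 ts s2)); exact: ler_norm.
have kl t : t0 <= t -> t <= t1 -> g t = k (l t).
 move=> tt tt1; have a1 : 0 <= l t by rewrite -l0; exact: lnd.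
 have a2 : l t <= l t1 by exact: lnd.
 have [r1 r2] := Hpsi _ a1 a2.
 rewrite /k clampr_id//; apply: (rd_eq0 m_gt0); apply/eqP; rewrite eq_le rd0 andbT.
 by apply: (le_trans (same t _ _ r1)); rewrite ?r2 ?subrr ?normr0// tt tt1.
have klip : lip1 k.
 move=> s t st; have /andP[a1 a2] := clampr_in s L0; have /andP[c1 c2] := clampr_in t L0.
 have [r1 r2] := Hpsi _ a1 a2; have [r3 r4] := Hpsi _ c1 c2.
 apply: (le_trans (same _ _ r1 r3)); rewrite r2 r4 distrC ger0_norm; last by rewrite subr_ge0 clampr_le.
 rewrite /clampr /Num.max /Num.min; move: L0 st; case: ifPn; case: ifPn; case: ifPn; case: ifPn; only_lra.
have rep w s t : (forall p, (0 <= w p)%E) -> t0 <= s -> s <= t -> t <= t1 -> wlen rd w g s t = wlen rd w k (l s) (l t).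
 move=> w0 ts st tt; apply: (wlen_reparam rdx st _ _ _ w0).
 - by move=> x sx xt; apply: kl; [exact: le_trans sx|exact: le_trans tt].
 - by move=> x y sx xy yt; apply: lnd => //; [exact: le_trans sx|exact: le_trans tt].
 - move=> y y1 y2.
  have z1 : 0 <= y by apply: le_trans y1; rewrite -l0; apply: lnd => //; exact: le_trans st tt.
  have z2 : y <= l t1 by apply: (le_trans y2); apply: lnd => //; exact: le_trans ts st.
  have [/andP[r1 r2] r3] := Hpsi y z1 z2.
  have [rs|/ltW sr] := leP (psi y) s.
   exists s; first by rewrite lexx st.
   by apply/eqP; rewrite eq_le y1 -r3 lnd// (le_trans st tt).
  have [rt|/ltW tr] := leP (psi y) t; first by exists (psi y); rewrite ?sr.
  exists t; first by rewrite lexx st.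
  by apply/eqP; rewrite eq_le y2 -{1}r3 lnd// (le_trans ts st).
exists k, (l t1), l; split.
 split => //; split => // a b a0 ab bL.
 have [/andP[r1 r2] r3] := Hpsi a a0 (le_trans ab bL).
 have [/andP[u1 u2] u3] := Hpsi b (le_trans a0 ab) bL.
 have [rs|/ltW sr] := leP (psi a) (psi b).
  by rewrite -r3 -u3 -rep// lE.
 have ee : a = b by apply/eqP; rewrite eq_le ab -r3 -u3 lnd.
 by rewrite ee (wlenxx rdx) subrr.
by split => //; rewrite -l0; apply: rep => //; exact: ltW.
Unshelve. all: by end_near. Qed.

Lemma lip1_ac k a b : lip1 k -> rd_ac m k a b.
Proof. by move=> H; apply: (@lip_ac R m k a b 1) => // s t _ st _; rewrite mul1r; exact: H. Qed.

Lemma gpath_arc p p' L M : 0 <= L -> hill p' -> gpath p p' L M ->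
 exists k L', [/\ arc k L', k 0 = p, k L' = p', (forall t, 0 <= t -> t <= L' -> hill (k t)) & (W k 0 L' <= M%:E)%E].
Proof.
move=> L0 hp' P0; have L1 : 0 < L + 1 by lra.
have LL1 : L <= L + 1 by lra.
have [k [k1 k2 k3 k4 k5]] := gpath_longer L0 LL1 hp' P0.
have [g [L' [l [[A E nd l0 lL] [lc WE]]]]] := arc_of_ac L1 (@lip1_ac k 0 (L + 1) k1).
exists g, L'; split => //.
- by rewrite -l0 -E// ltW.
- by rewrite -lL -E// ltW.
- move=> t t0 tL; have [|s] := IVT (ltW L1) lc (v := t).
  by rewrite l0 lL min_l ?max_r ?t0//; apply: (le_trans t0).
 by rewrite in_itv /= => /andP[s0 sL] <-; rewrite -E//; exact: k4.
- by rewrite -WE.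
Qed.

(** * Explicit paths: dilation to the boundary, motion inside the boundary, escape from a
    collision *)

Section Competitors.
Implicit Types (q : config R).

Lemma gpath_of_lip g a b C M : a <= b -> 0 < C ->
 (forall s t, a <= s -> s <= t -> t <= b -> rd (g s) (g t) <= C * (t - s)) ->
 (forall t, a <= t -> t <= b -> hill (g t)) -> (W g a b <= M%:E)%E ->
 gpath (g a) (g b) (C * (b - a)) M.
Proof.
have mark : True by [].
move=> ab C0 lip hl le; pose f x := a + x / C.
have f0 : f 0 = a by rewrite /f mul0r addr0.
have fb : f (C * (b - a)) = b by rewrite /f (mulrC C) mulfK ?gt_eqF// addrC subrK.
have fnd x y : x <= y -> f x <= f y by move=> xy; rewrite lerD2l ler_pM2r ?invr_gt0.
exists (fun x => g (clampr a b (f x))); split.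
- move=> s t st; have /andP[a1 a2] := clampr_in (f s) ab; have /andP[c1 c2] := clampr_in (f t) ab.
 apply: (le_trans (lip _ _ a1 (clampr_le _ _ (fnd _ _ st)) c2)).
 rewrite mulrC -ler_pdivlMr// mulrBl.
 have : f t - f s = t / C - s / C by rewrite /f; lra.
 have := fnd _ _ st; move: (f s) (f t) => u v uv <-.
 by rewrite /clampr /Num.max /Num.min; move: uv ab; case: ifPn; case: ifPn; case: ifPn; case: ifPn; only_lra.
- by rewrite f0 clampr_id.
- by rewrite fb clampr_id.
- by move=> t _ _; have /andP[? ?] := clampr_in (f t) ab; exact: hl.
- have L0 : 0 <= C * (b - a) by rewrite mulr_ge0 ?subr_ge0// ltW.
 have -> : W (fun x => g (clampr a b (f x))) 0 (C * (b - a)) = W g (f 0) (f (C * (b - a))).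
  apply: (wlen_reparam rdx L0 _ _ _ om0).
  + by move=> t t1 t2; have := fnd _ _ t1; have := fnd _ _ t2; rewrite f0 fb => ? ?; rewrite clampr_id.
  + by move=> s t _ st _; exact: fnd.
  + move=> y; rewrite f0 fb => y1 y2; exists (C * (y - a)).
    by rewrite mulr_ge0 ?subr_ge0 ?(ltW C0)//= ler_pM2l// lerD2r.
   by rewrite /f (mulrC C) mulfK ?gt_eqF// addrC subrK.
 by rewrite f0 fb.
Qed.

Lemma hreDl q q' d : hre (cadd q q') d = hre q d + hre q' d.
Proof. by rewrite /hre /sepr /sepi /cadd !reD !imD; ring. Qed.

Lemma hreZl c q d : hre (cscale c q) d = c * hre q d.
Proof. by rewrite /hre /sepr /sepi /cscale !reM !imM /=; ring. Qed.

Lemma hreBl q q' d : hre (csub q q') d = hre q d - hre q' d.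
Proof. by rewrite /hre /sepr /sepi /csub !reB !imB; ring. Qed.

(** On each cell the component of [Q] along the chord is compared with [Phi] by the mean value
    theorem. This bounds the chord through the speed while only scalar functions are
    differentiated. *)
Lemma wlen_smooth (Q V : R -> config R) (Phi phi : R -> R) a b : a <= b ->
 (forall d, {within `[a, b], continuous (fun s => hre (Q s) d)}) ->
 (forall d (t : R), a < t -> t < b -> is_derive t 1 (fun s => hre (Q s) d) (hre (V t) d)) ->
 {within `[a, b], continuous Phi} -> (forall t : R, a < t -> t < b -> is_derive t 1 Phi (phi t)) ->
 (forall t, a < t -> t < b -> exists2 c, (om (proj (Q t)) <= c%:E)%E & c * hnorm (V t) <= phi t) ->
 (W (fun t => proj (Q t)) a b <= (Phi b - Phi a)%:E)%E.
Proof.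
move=> ab Qc Qd Pc Pd H; apply: wlen_le => n x c P; have [xa xb K] := P.
have cell i : (i < n)%N -> c i * rd (proj (Q (x i))) (proj (Q (x i.+1))) <= Phi (x i.+1) - Phi (x i).
 move=> i_n; have [h1 h2 h3] := K i i_n; have [a1 a2] := part_in P (ltnW i_n); have [c1 c2] := part_in P i_n.
 set y := x i in h1 h3 a1 a2 *; set z := x i.+1 in h1 h3 c1 c2 *.
 have sub : `[y, z] `<=` `[a, b].
  by move=> t /=; rewrite !in_itv /= => /andP[? ?]; split_lra.
 have phic t : y < t -> t < z -> c i * hnorm (V t) <= phi t.
  move=> yt tz; have [|e e1 e2] := H t _ (lt_le_trans tz c2); first exact: le_lt_trans yt.
  apply: le_trans e2; rewrite ler_wpM2r ?hnorm_ge0// -lee_fin; apply: le_trans e1.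
  by apply: h3; exact: ltW.
 have phi0 t : y < t -> t < z -> 0 <= phi t.
  by move=> yt tz; apply: le_trans (phic t yt tz); rewrite mulr_ge0 ?hnorm_ge0.
 have dPhi t : y < t -> t < z -> is_derive t 1 Phi (phi t).
  by move=> yt tz; apply: Pd; [exact: le_lt_trans yt|exact: lt_le_trans c2].
 have cPhi : {within `[y, z], continuous Phi} by exact: continuous_subspaceW Pc.
 pose D := csub (Q z) (Q y).
 have [D0|D0] := eqVneq (hnorm D) 0.
  apply: (@le_trans _ _ 0); last by rewrite subr_ge0; exact: mvt_nondecreasing h1 cPhi dPhi phi0.
  rewrite rd_proj qdistC; have := qdist_le_hnorm m (Q z) (Q y); rewrite -/D D0 => le.
  by rewrite mulr_ge0_le0.
 have Dp : 0 < hnorm D by rewrite lt0r D0 hnorm_ge0.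
 have : hnorm D * Phi y - c i * hre (Q y) D <= hnorm D * Phi z - c i * hre (Q z) D.
  apply: (@mvt_nondecreasing R (fun s => hnorm D * Phi s - c i * hre (Q s) D) (fun t => hnorm D * phi t - c i * hre (V t) D) y z h1).
  - have cQ : {within `[y, z], continuous (fun s => hre (Q s) D)} by exact: continuous_subspaceW (Qc D).
   move=> t; apply: cvgB; apply: cvgM; [exact: cvg_cst|exact: cPhi|exact: cvg_cst|exact: cQ].
  - move=> t yt tz; apply: is_derive_sub; apply: is_derive_scal; first exact: dPhi.
   by apply: Qd; [exact: le_lt_trans yt|exact: lt_le_trans c2].
  - move=> t yt tz; rewrite subr_ge0.
   apply: (@le_trans _ _ (c i * (hnorm (V t) * hnorm D))); first by rewrite ler_wpM2l// hre_le.
   have -> : c i * (hnorm (V t) * hnorm D) = hnorm D * (c i * hnorm (V t)) by ring.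
   by rewrite ler_wpM2l ?hnorm_ge0// phic.
 have E : hre (Q z) D - hre (Q y) D = hnorm D ^+ 2 by rewrite hnorm_sq// /D -hreBl.
 move=> F; have {}F : hnorm D * (c i * hnorm D) <= hnorm D * (Phi z - Phi y).
  have -> : hnorm D * (c i * hnorm D) = c i * hnorm D ^+ 2 by ring.
  by rewrite -E; lra.
 rewrite ler_pM2l// in F; apply: le_trans F; rewrite ler_wpM2l// rd_proj qdistC; exact: qdist_le_hnorm.
rewrite lee_fin -xa -xb /psum.
have : forall j, (j <= n)%N -> \sum_(i < j) c i * rd (proj (Q (x i))) (proj (Q (x i.+1))) <= Phi (x j) - Phi (x 0%N).
 elim => [|j IH] jn; first by rewrite big_ord0 subrr.
 by rewrite big_ord_recr /=; have := IH (ltnW jn); have := cell j jn; lra.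
by move=> /(_ n (leqnn n)).
Qed.

(** Quadratic curves cover rays, segments, the escape from a collision and, in Jacobi vectors,
    squares of affine functions. *)
Definition qcurve q0 q1 q2 (s : R) : config R := cadd q0 (cadd (cscale s q1) (cscale (s ^+ 2) q2)).

Lemma qcurve0 q0 q1 q2 : qcurve q0 q1 q2 0 = q0.
Proof.
apply/funext => i; rewrite /qcurve /cadd /cscale expr0n /=.
by apply/eqP; rewrite eq_complex !reD !imD !reM !imM /= !mul0r !subr0 !addr0 !eqxx.
Qed.

Lemma hnormN q q' : hnorm (csub q q') = hnorm (csub q' q).
Proof. by congr (sqrt _); rewrite /hre /sepr /sepi /csub !reB !imB; ring. Qed.

Lemma gpath_qcurve q0 q1 q2 b (Phi phi : R -> R) : 0 <= b -> b <= 1 ->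
 (forall t, 0 <= t -> t <= b -> hill (proj (qcurve q0 q1 q2 t))) ->
 {within `[0, b], continuous Phi} -> (forall t : R, 0 < t -> t < b -> is_derive t 1 Phi (phi t)) ->
 (forall t, 0 < t -> t < b -> exists2 c, (om (proj (qcurve q0 q1 q2 t)) <= c%:E)%E &
   c * hnorm (cadd q1 (cscale (2 * t) q2)) <= phi t) ->
 exists2 L, 0 <= L & gpath (proj q0) (proj (qcurve q0 q1 q2 b)) L (Phi b - Phi 0).
Proof.
move=> b0 b1 hl Pc Pd H.
pose C := hnorm q1 + 2 * hnorm q2 + 1.
have C0 : 0 < C by rewrite /C; have := hnorm_ge0 m q1; have := hnorm_ge0 m q2; lra.
exists (C * (b - 0)); first by rewrite subr0 mulr_ge0// ltW.
have dQ d (t : R) : is_derive t 1 (fun s => hre (qcurve q0 q1 q2 s) d) (hre (cadd q1 (cscale (2 * t) q2)) d).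
 have -> : (fun s => hre (qcurve q0 q1 q2 s) d) = (fun s => hre q0 d + (hre q1 d * s + hre q2 d * (s * s))).
  by apply/funext => s; rewrite /qcurve !hreDl !hreZl expr2; ring.
 have D1 := is_derive_scal (hre q1 d) (is_derive_id t (1 : R)).
 have D2 := is_derive_scal (hre q2 d) (is_derive_mul (is_derive_id t (1 : R)) (is_derive_id t (1 : R))).
 have D3 := is_derive_add (is_derive_cst (hre q0 d) t (1 : R)) (is_derive_add D1 D2).
 by apply: (is_derive_eq D3); rewrite hreDl hreZl; ring.
rewrite -{1}(qcurve0 q0 q1 q2); apply: (gpath_of_lip (g := fun t => proj (qcurve q0 q1 q2 t)) b0 C0) => //.
 move=> s t s0 st tb; rewrite rd_proj qdistC; apply: (@le_trans _ _ (hnorm (csub (qcurve q0 q1 q2 t) (qcurve q0 q1 q2 s)))).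
  exact: qdist_le_hnorm.
 have -> : csub (qcurve q0 q1 q2 t) (qcurve q0 q1 q2 s) = cscale (t - s) (cadd q1 (cscale (s + t) q2)).
  rewrite /qcurve /csub /cadd /cscale; config_ring.
 rewrite hnorm_cscale ?subr_ge0// mulrC ler_wpM2r ?subr_ge0//.
 apply: (le_trans (hnormD m_gt0 _ _)); rewrite hnorm_cscale; last by lra.
 have : (s + t) * hnorm q2 <= 2 * hnorm q2 by rewrite ler_wpM2r ?hnorm_ge0//; lra.
 rewrite /C; lra.
apply: (wlen_smooth (V := fun t => cadd q1 (cscale (2 * t) q2)) (phi := phi)) => //.
by move=> d; apply: (continuous_derivable (df := fun t => hre (cadd q1 (cscale (2 * t) q2)) d)) => t; exact: dQ.
Qed.

Lemma rsep_cscale i j c q : 0 <= c -> rsep i j (proj (cscale c q)) = c * rsep i j (proj q).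
Proof.
move=> c0; rewrite !rsep_proj; apply/eqP; rewrite -(eqrXn2 (n := 2))// ?mulr_ge0 ?sep_ge0//.
by rewrite exprMn !sepE /sepr /sepi /cscale !reM !imM /=; apply/eqP; ring.
Qed.

Lemma noncol_cscale c q : 0 < c -> noncol (proj q) -> noncol (proj (cscale c q)).
Proof.
by move=> c0 [h1 h2 h3]; split; rewrite rsep_cscale ?(ltW c0)// mulr_gt0.
Qed.

Lemma Upot_cscale c q : 0 < c -> Upot m (proj (cscale c q)) = Upot m (proj q) / c.
Proof.
move=> c0; rewrite /Upot !rsep_cscale ?(ltW c0)//.
have E x y : x / (c * y) = x / y / c by rewrite invfM; ring.
by rewrite !E; ring.
Qed.

Lemma hill_noncol p : noncol p -> hill p <-> h <= Upot m p.
Proof. by move=> nc; rewrite /hill_region /= (rpot_noncol m nc) lee_fin. Qed.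

Lemma bdry_noncol p : noncol p -> hill_boundary m h p <-> Upot m p = h.
Proof.
by move=> nc; rewrite /hill_boundary /= (rpot_noncol m nc); split=> [[]|->].
Qed.

Lemma bdryP p : hill_boundary m h p -> noncol p /\ Upot m p = h.
Proof.
move=> hb; have nc : noncol p.
 by apply: contrapT => nc; move: hb; rewrite /hill_boundary /= (rpot_col m_gt0 nc).
by split => //; apply/bdry_noncol.
Qed.

Lemma bdry_hill p : hill_boundary m h p -> hill p.
Proof. by rewrite /hill_boundary /hill_region /= => ->. Qed.

Definition omr p : R := sqrt (Upot m p - h).

(** Dilation by [U / h] lowers the potential exactly to [h]. Along the ray [om] decreases, and the
    ray has length [r (U - h) / h], where [r] is the size of [p]. *)
Lemma radial_exit p : noncol p -> hill p -> exists p' L,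
 [/\ hill_boundary m h p', 0 <= L & gpath p p' L (rsize m p * omr p ^+ 3 / h)].
Proof.
move=> nc hp; have U_ge : h <= Upot m p by apply/hill_noncol.
set U := Upot m p in U_ge *; pose lam := U / h.
have lam1 : 1 <= lam by rewrite ler_pdivlMr// mul1r.
pose q := repr p; have pq : proj q = p by exact: proj_repr.
pose z : config R := fun=> 0.
have cE s : proj (qcurve q (cscale (lam - 1) q) z s) = proj (cscale (1 + s * (lam - 1)) q).
 congr (proj _); apply/funext => i; apply/eqP; rewrite eq_complex /qcurve /cadd /cscale /z.
 rewrite !ReImE /=; apply/andP; split; apply/eqP; ring.
have pos s : 0 <= s -> 0 < 1 + s * (lam - 1).
 by move=> s0; have : 0 <= s * (lam - 1) by [rewrite mulr_ge0// subr_ge0]; lra.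
have ncs s : 0 <= s -> noncol (proj (qcurve q (cscale (lam - 1) q) z s)).
 by move=> s0; rewrite cE; apply: noncol_cscale; [exact: pos|rewrite pq].
have Us s : 0 <= s -> Upot m (proj (qcurve q (cscale (lam - 1) q) z s)) = U / (1 + s * (lam - 1)).
 by move=> s0; rewrite cE Upot_cscale ?pos// pq.
have [s s0 s1| | |t t0 t1|L L0 HL] := @gpath_qcurve q (cscale (lam - 1) q) z 1
  (fun s => (rsize m p * omr p * (lam - 1)) * s) (fun=> rsize m p * omr p * (lam - 1)) ler01 (lexx _).
- apply/hill_noncol; first exact: ncs.
 rewrite Us// ler_pdivlMr ?pos//.
 have e : h * lam = U by rewrite /lam mulrC divfK// gt_eqF.
 have : h * (s * (lam - 1)) <= h * (lam - 1) by rewrite ler_pM2l// ler_piMl// subr_ge0.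
 by move: e; lra.
- have := @continuous_derivable R (fun s => (rsize m p * omr p * (lam - 1)) * s) (fun=> rsize m p * omr p * (lam - 1)).
 by apply => t; apply: (is_derive_eq (is_derive_scal _ (is_derive_id t (1 : R)))); rewrite mulr1.
- by move=> t _ _; apply: (is_derive_eq (is_derive_scal _ (is_derive_id t (1 : R)))); rewrite mulr1.
- exists (omr p).
  rewrite om_noncol; last by apply: ncs; exact: ltW.
  rewrite lee_fin ler_wsqrtr// lerD2r Us ?(ltW t0)// ler_pdivrMr ?pos ?(ltW t0)//.
  rewrite -/U mulrDr mulr1 lerDl; apply: mulr_ge0; first exact: le_trans (ltW h_gt0) U_ge.
  by rewrite mulr_ge0 ?subr_ge0// ltW.
 have -> : hnorm (cadd (cscale (lam - 1) q) (cscale (2 * t) z)) = (lam - 1) * rsize m p.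
  rewrite -[rsize m p]/(hnorm q) -hnorm_cscale ?subr_ge0//; congr (hnorm _).
  rewrite /cadd /cscale /z; config_ring.
 by rewrite le_eqVlt; apply/orP; left; apply/eqP; ring.
exists (proj (qcurve q (cscale (lam - 1) q) z 1)), L; split => //.
 apply/bdry_noncol; first exact: ncs.
 rewrite Us// mul1r addrC subrK /lam invf_div mulrC divfK// gt_eqF//; exact: lt_le_trans U_ge.
rewrite pq in HL; have -> // : rsize m p * omr p ^+ 3 / h =
 rsize m p * omr p * (lam - 1) * 1 - rsize m p * omr p * (lam - 1) * 0.
have o2 : omr p ^+ 2 = U - h by rewrite sqr_sqrtr// subr_ge0.
rewrite mulr1 mulr0 subr0 exprSr o2 /lam.
by field; rewrite gt_eqF.
Qed.

Definition dotp q q' i j : R := sepr q i j * sepr q' i j + sepi q i j * sepi q' i j.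

(** One rotation makes all three angles between corresponding sides at most 120 degrees, so that the
    segment between the two configurations does not run into collisions. *)
Lemma good_rotation q q' : exists2 u, normc u = 1 &
 [/\ - (sep q b1 b2 * sep q' b1 b2 / 2) <= dotp q (crot u q') b1 b2,
   - (sep q b1 b3 * sep q' b1 b3 / 2) <= dotp q (crot u q') b1 b3 &
   - (sep q b2 b3 * sep q' b2 b3 / 2) <= dotp q (crot u q') b2 b3].
Proof.
pose I (k : 'I_3) : 'I_3 := if k == b3 then b2 else b1.
pose J (k : 'I_3) : 'I_3 := if k == b1 then b2 else b3.
have [||c [s [cs H]]] := @three_angles R (fun k : 'I_3 => dotp q q' (I k) (J k))
  (fun k : 'I_3 => sepr q (I k) (J k) * sepi q' (I k) (J k) - sepi q (I k) (J k) * sepr q' (I k) (J k))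
  (fun k : 'I_3 => sep q (I k) (J k) * sep q' (I k) (J k)).
- by move=> k; rewrite mulr_ge0 ?sep_ge0.
- by move=> k; rewrite exprMn !sepE /dotp; ring.
exists (c +i* s); first by apply: sq_unit.
have E i j : dotp q (crot (c +i* s) q') i j = c * dotp q q' i j -
  s * (sepr q i j * sepi q' i j - sepi q i j * sepr q' i j).
 by rewrite /dotp /crot /sepr /sepi !ReImE /=; ring.
by rewrite !E; split; [have := H b1|have := H b2|have := H b3].
Qed.

(** The straight segment whose collisions the preceding rotation prevents: with angles of at most
    120 degrees an interpolated side is at least half as long as the interpolated length. *)
Definition segm q q' (s : R) := cadd q (cscale s (csub q' q)).

Lemma segm_sep q q' i j s : 0 <= s -> s <= 1 -> - (sep q i j * sep q' i j / 2) <= dotp q q' i j ->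
 (1 - s) * sep q i j + s * sep q' i j <= 2 * sep (segm q q' s) i j.
Proof.
move=> s0 s1 dd; set x := sep q i j in dd *; set y := sep q' i j in dd *.
apply: ler_sqr2; first by rewrite mulr_ge0// sep_ge0.
have ex : sepr q i j ^+ 2 + sepi q i j ^+ 2 = x ^+ 2 by rewrite -sepE.
have ey : sepr q' i j ^+ 2 + sepi q' i j ^+ 2 = y ^+ 2 by rewrite -sepE.
have -> : (2 * sep (segm q q' s) i j) ^+ 2 =
  4 * ((1 - s) ^+ 2 * x ^+ 2 + s ^+ 2 * y ^+ 2 + 2 * (s * (1 - s) * dotp q q' i j)).
 rewrite exprMn sepE -ex -ey /dotp.
 have -> : sepr (segm q q' s) i j = (1 - s) * sepr q i j + s * sepr q' i j.
  by rewrite /segm /cadd /cscale /csub /sepr !ReImE /=; ring.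
 have -> : sepi (segm q q' s) i j = (1 - s) * sepi q i j + s * sepi q' i j.
  by rewrite /segm /cadd /cscale /csub /sepi !ReImE /=; ring.
 by ring.
have t0 : 0 <= s * (1 - s) by rewrite mulr_ge0// subr_ge0.
have := ler_wpM2l t0 dd; have := sqr_ge0 ((1 - s) * x - s * y).
move: (s * (1 - s) * dotp q q' i j) => SD; nra.
Qed.

Lemma segm_diff q q' s t : csub (segm q q' s) (segm q q' t) = cscale (s - t) (csub q' q).
Proof.
rewrite /segm /csub /cadd /cscale; config_ring.
Qed.

Lemma inv_lip (sg x y : R) : 0 < sg -> sg <= x -> sg <= y -> `|x^-1 - y^-1| <= `|x - y| / sg ^+ 2.
Proof.
move=> s0 sx sy; have x0 := lt_le_trans s0 sx; have y0 := lt_le_trans s0 sy.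
have -> : x^-1 - y^-1 = (y - x) / (x * y) by field; rewrite !gt_eqF.
rewrite normrM distrC ler_wpM2l// ger0_norm; last by rewrite invr_ge0 mulr_ge0 ?ltW.
by rewrite lef_pV2 ?posrE ?exprn_gt0 ?mulr_gt0// expr2 ler_pM// ltW.
Qed.

Definition mmsum : R := m b1 * m b2 + m b1 * m b3 + m b2 * m b3.

Lemma mmsum_gt0 : 0 < mmsum.
Proof. by rewrite !addr_gt0 ?mulr_gt0. Qed.

Definition sep_above (sg : R) p := [/\ sg <= rsep b1 b2 p, sg <= rsep b1 b3 p & sg <= rsep b2 b3 p].

Lemma sep_above_noncol sg p : 0 < sg -> sep_above sg p -> noncol p.
Proof. by move=> s0 [h1 h2 h3]; split; exact: lt_le_trans s0 _. Qed.

Lemma Upot_above sg p : 0 < sg -> sep_above sg p -> Upot m p <= mmsum / sg.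
Proof.
move=> s0 [h1 h2 h3]; rewrite /Upot /mmsum !mulrDl.
have E c x : 0 < c -> sg <= x -> c / x <= c / sg.
 by move=> c0 sx; rewrite ler_pM2l// lef_pV2 ?posrE// (lt_le_trans s0).
by rewrite !lerD// E// mulr_gt0.
Qed.

Lemma Upot_lip sg p p' : 0 < sg -> sep_above sg p -> sep_above sg p' ->
 `|Upot m p - Upot m p'| <= mmsum * sepK m / sg ^+ 2 * rd p p'.
Proof.
move=> s0 [h1 h2 h3] [h1' h2' h3'].
have E c i j : 0 < c -> sg <= rsep i j p -> sg <= rsep i j p' ->
  `|c / rsep i j p - c / rsep i j p'| <= c * (sepK m / sg ^+ 2 * rd p p').
 move=> c0 x y; rewrite -mulrBr normrM gtr0_norm// ler_pM2l//.
 apply: (le_trans (inv_lip s0 x y)); rewrite mulrAC ler_wpM2r ?invr_ge0 ?sqr_ge0//.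
 exact: rsep_rd.
have := E _ _ _ (mulr_gt0 (m_gt0 b1) (m_gt0 b2)) h1 h1'.
have := E _ _ _ (mulr_gt0 (m_gt0 b1) (m_gt0 b3)) h2 h2'.
have := E _ _ _ (mulr_gt0 (m_gt0 b2) (m_gt0 b3)) h3 h3'.
rewrite /Upot /mmsum !ler_norml => /andP[? ?] /andP[? ?] /andP[? ?].
have -> : (m b1 * m b2 + m b1 * m b3 + m b2 * m b3) * sepK m / sg ^+ 2 * rd p p' =
 m b1 * m b2 * (sepK m / sg ^+ 2 * rd p p') + m b1 * m b3 * (sepK m / sg ^+ 2 * rd p p') +
 m b2 * m b3 * (sepK m / sg ^+ 2 * rd p p') by ring.
by split_lra.
Qed.

Lemma om_bdry p : hill_boundary m h p -> om p = 0%E.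
Proof. by move=> /bdryP[nc e]; rewrite (om_noncol m h nc) e subrr sqrtr0. Qed.

Lemma csub_cscale x y q q' : csub (cscale x q) (cscale y q') =
 cadd (cscale x (csub q q')) (csub (cscale x q') (cscale y q')).
Proof.
rewrite /csub /cadd /cscale; config_ring.
Qed.

Lemma cscaleB x y q : csub (cscale x q) (cscale y q) = cscale (x - y) q.
Proof.
rewrite /csub /cscale; config_ring.
Qed.

Lemma hnormZ c q : hnorm (cscale c q) = `|c| * hnorm q.
Proof.
have [c0|/ltW c0] := leP 0 c; first by rewrite hnorm_cscale// ger0_norm.
have -> : hnorm (cscale c q) = hnorm (cscale (- c) q).
 by congr (sqrt _); rewrite /hre /sepr /sepi /cscale !ReImE /=; ring.
by rewrite hnorm_cscale ?ler0_norm ?oppr_ge0.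
Qed.

Lemma cscale1 q : cscale 1 q = q.
Proof.
rewrite /cscale; config_ring.
Qed.

(** Rescaling each point of a collision free segment by [U / h] moves it onto the boundary. The
    scale is Lipschitz because the segment keeps away from collisions, and [om] vanishes on the
    boundary. *)
Lemma boundary_run p p' : hill_boundary m h p -> hill_boundary m h p' ->
 exists2 L, 0 <= L & gpath p p' L 0.
Proof.
move=> hp hp'; have [[s12 s13 s23] Up] := bdryP hp; have [[s12' s13' s23'] Up'] := bdryP hp'.
pose a := repr p; have [u u1 [d12 d13 d23]] := good_rotation a (repr p').
pose b := crot u (repr p').
have pa : proj a = p by exact: proj_repr.
have pb : proj b = p'.
 rewrite -[p']proj_repr; apply/esym/proj_congr/congruentP; exists u => //.
 by exists 0 => i; rewrite addr0.
have sb i j : sep b i j = rsep i j p' by rewrite -pb rsep_proj.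
pose Z := segm a b.
pose mn i j := Num.min (rsep i j p) (rsep i j p').
pose sg := Num.min (mn b1 b2) (Num.min (mn b1 b3) (mn b2 b3)) / 2.
have sg0 : 0 < sg by rewrite divr_gt0// /mn !lt_min s12 s13 s23 s12' s13' s23'.
have sZ i j s : 0 <= s -> s <= 1 -> 2 * sg <= mn i j -> - (sep a i j * sep (repr p') i j / 2) <= dotp a b i j ->
  sg <= rsep i j (proj (Z s)).
 move=> s0 s1; rewrite -[sep (repr p') i j]/(rsep i j p') -sb rsep_proj /mn le_min => /andP[m1 m2] dd.
 have K := segm_sep s0 s1 dd; rewrite sb -[sep a i j]/(rsep i j p) -/Z in K.
 by have := ler_wpM2l s0 m2; have := ler_wpM2l (ltac:(rewrite subr_ge0; exact: s1) : 0 <= 1 - s) m1; lra.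
have two : 2 * sg = Num.min (mn b1 b2) (Num.min (mn b1 b3) (mn b2 b3)) by rewrite /sg mulrC divfK.
have aZ s : 0 <= s -> s <= 1 -> sep_above sg (proj (Z s)).
 have M2 : Num.min (mn b1 b3) (mn b2 b3) <= mn b1 b3 by rewrite ge_min lexx.
 have M3 : Num.min (mn b1 b3) (mn b2 b3) <= mn b2 b3 by rewrite ge_min lexx orbT.
 move=> s0 s1; split; [apply: (sZ _ _ _ s0 s1 _ d12)|apply: (sZ _ _ _ s0 s1 _ d13)|apply: (sZ _ _ _ s0 s1 _ d23)].
 - by rewrite two ge_min lexx.
 - by rewrite two ge_min M2 orbT.
 - by rewrite two ge_min M3 orbT.
have nZ s : 0 <= s -> s <= 1 -> noncol (proj (Z s)).
 by move=> s0 s1; apply: sep_above_noncol sg0 _; exact: aZ.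
pose lam s := Upot m (proj (Z s)) / h.
pose D := hnorm (csub b a); have D0 : 0 <= D by exact: hnorm_ge0.
pose M := hnorm a + D; have M0 : 0 <= M by rewrite addr_ge0 ?hnorm_ge0.
have lam0 s : 0 <= s -> s <= 1 -> 0 < lam s.
 move=> s0 s1; rewrite divr_gt0//; have [T _ _] := Upot_term m_gt0 (proj (Z s)).
 by apply: lt_le_trans T; have [? _ _] := nZ s s0 s1; rewrite divr_gt0 ?mulr_gt0.
have lamM s : 0 <= s -> s <= 1 -> lam s <= mmsum / sg / h.
 by move=> s0 s1; rewrite ler_pM2r ?invr_gt0//; apply: Upot_above sg0 (aZ s s0 s1).
pose C := mmsum * sepK m / sg ^+ 2.
have C0 : 0 <= C.
 by rewrite mulr_ge0 ?invr_ge0 ?sqr_ge0// mulr_ge0// ?(ltW mmsum_gt0)// ltW// sepK_gt0.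
have dZ s t : s <= t -> rd (proj (Z s)) (proj (Z t)) <= (t - s) * D.
 move=> st; rewrite rd_proj qdistC; apply: (@le_trans _ _ (hnorm (csub (Z t) (Z s)))); first exact: qdist_le_hnorm.
 by rewrite segm_diff hnorm_cscale ?subr_ge0.
have lamL s t : 0 <= s -> s <= t -> t <= 1 -> `|lam t - lam s| <= C * D / h * (t - s).
 move=> s0 st t1; rewrite /lam -mulrBl normrM (gtr0_norm (_ : 0 < h^-1)) ?invr_gt0//.
 have -> : C * D / h * (t - s) = C * (D * (t - s)) / h by ring.
 rewrite ler_pM2r ?invr_gt0//.
 rewrite distrC; apply: (le_trans (Upot_lip sg0 (aZ s s0 (le_trans st t1)) (aZ t (le_trans s0 st) t1))).
 by rewrite -/C ler_wpM2l// [leRHS]mulrC dZ.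
pose g s := proj (cscale (lam s) (Z s)).
pose K := mmsum / sg / h * D + C * D / h * M + 1.
have K0 : 0 < K.
 have ms := mmsum_gt0; have : 0 <= mmsum / sg / h * D by rewrite !mulr_ge0 ?invr_ge0// ltW.
 have : 0 <= C * D / h * M by apply: mulr_ge0 => //; apply: divr_ge0; [exact: mulr_ge0|exact: ltW].
 by rewrite /K; lra.
have ng s : 0 <= s -> s <= 1 -> noncol (g s).
 by move=> s0 s1; apply: noncol_cscale; [exact: lam0|exact: nZ].
have Ug s : 0 <= s -> s <= 1 -> hill_boundary m h (g s).
 move=> s0 s1; apply/bdry_noncol; first exact: ng.
 rewrite /g Upot_cscale ?lam0// /lam invf_div mulrCA divff ?mulr1// gt_eqF//.
 by have := lam0 s s0 s1; rewrite /lam pmulr_lgt0 ?invr_gt0.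
have g0 : g 0 = p.
 rewrite /g /lam; have -> : Z 0 = a.
  by apply/funext => i; apply/eqP; rewrite eq_complex /Z /segm /cadd /cscale !ReImE /= !mul0r !subr0 !addr0 !eqxx.
 rewrite pa Up divff ?gt_eqF//; by rewrite cscale1.
have g1 : g 1 = p'.
 rewrite /g /lam; have -> : Z 1 = b.
  rewrite /Z /segm /cadd /cscale /csub; config_ring.
 rewrite pb Up' divff ?gt_eqF//; by rewrite cscale1.
exists (K * (1 - 0)); first by rewrite subr0 mulr1 ltW.
rewrite -g0 -g1; apply: gpath_of_lip => //.
- move=> s t s0 st t1.
 have s1 := le_trans st t1; have t0 := le_trans s0 st.
 rewrite rd_proj qdistC; apply: (@le_trans _ _ (hnorm (csub (cscale (lam t) (Z t)) (cscale (lam s) (Z s))))).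
  exact: qdist_le_hnorm.
 rewrite csub_cscale.
 apply: (le_trans (hnormD m_gt0 _ _)).
 have l0 := lam0 t t0 t1.
 rewrite hnorm_cscale ?(ltW l0)// segm_diff hnorm_cscale ?subr_ge0// -/D.
 have H2 : hnorm (csub (cscale (lam t) (Z s)) (cscale (lam s) (Z s))) <= C * D / h * (t - s) * M.
  have NZ : hnorm (Z s) <= M.
   apply: (le_trans (hnormD m_gt0 _ _)); rewrite lerD2l hnorm_cscale// -/D -[leRHS]mul1r.
   by rewrite ler_wpM2r.
  by rewrite cscaleB hnormZ; apply: ler_pM => //; [exact: hnorm_ge0|exact: lamL].
 have H1 : lam t * ((t - s) * D) <= mmsum / sg / h * ((t - s) * D).
  by rewrite ler_wpM2r ?lamM// mulr_ge0// subr_ge0.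
 have -> : K * (t - s) = mmsum / sg / h * ((t - s) * D) + C * D / h * (t - s) * M + (t - s).
  by rewrite /K; ring.
 by move: H1 H2; move: (mmsum / sg / h * _) (C * D / h * (t - s) * M) => *; lra.
- by move=> t t0 t1; apply: bdry_hill; exact: Ug.
apply: wlen_le => n x c P; have [_ _ H] := P; rewrite lee_fin /psum big1// => i _.
have [h1 h2 h3] := H i (ltn_ord i); have [y1 y2] := part_in P (ltnW (ltn_ord i)).
have := h3 _ (lexx _) h1; rewrite om_bdry; last exact: Ug.
by rewrite lee_fin => c0; have -> : c i = 0 by [apply/eqP; rewrite eq_le c0 h2]; rewrite mul0r.
Qed.

(** Displace the bodies by [s^2] times distinct real numbers. Every distance is then at least a
    constant times [s^2], so [om] is at most of order [1 / s], while the speed is of order [s]: the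
    cost is finite. *)
Lemma collision_escape p : ~ noncol p -> exists p' L M,
 [/\ noncol p', hill p', 0 <= L & gpath p p' L M].
Proof.
move=> np; pose a := repr p; have pa : proj a = p by exact: proj_repr.
(* The distinct positions 0, 1, 2 separate any colliding pair. *)
pose e : config R := fun i => (i : nat)%:R +i* 0.
pose z : config R := fun=> 0.
have N0 := hnorm_ge0 m e; set N := hnorm e in N0.
have Kp := sepK_gt0 m_gt0.
have dQ s : 0 <= s -> rd p (proj (qcurve a z e s)) <= s ^+ 2 * N.
 move=> s0; rewrite -{1}pa rd_proj qdistC; apply: (@le_trans _ _ (hnorm (csub (qcurve a z e s) a))); first exact: qdist_le_hnorm.
 rewrite -hnorm_cscale ?sqr_ge0// le_eqVlt; apply/orP; left; apply/eqP; congr (hnorm _).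
 rewrite /qcurve /csub /cadd /cscale /z; config_ring.
have [dl dl0 Hdl] : exists2 d, 0 < d & forall p', rd p p' < d -> (h%:E < rpotential m p')%E.
 by apply: rpot_lsc => //; rewrite rpot_col// ltry.
have pair i j : sepr e i j != 0 -> exists c b, [/\ 0 < c, 0 < b & forall s, 0 <= s -> s <= b -> s <= 1 ->
  c * s ^+ 2 <= rsep i j (proj (qcurve a z e s))].
 move=> eij; have [z0|z0] := eqVneq (rsep i j p) 0.
  exists (`|sepr e i j|), 1; split => //; first by rewrite normr_gt0.
  move=> s s0 _ _; rewrite rsep_proj.
  have [er ei] : sepr a i j = 0 /\ sepi a i j = 0.
   move: z0; rewrite -pa rsep_proj => z0; have := sepE a i j; rewrite z0 expr0n /= => E.
   by split; apply/eqP; rewrite -sqrf_eq0; apply/eqP; have := sqr_ge0 (sepr a i j); have := sqr_ge0 (sepi a i j); lra.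
  apply: ler_sqr2; first exact: sep_ge0.
  rewrite sepE exprMn real_normK ?num_real//.
  have -> : sepr (qcurve a z e s) i j = s ^+ 2 * sepr e i j.
   rewrite -[RHS]add0r -er; rewrite /sepr /qcurve /cadd /cscale /z !ReImE /=; ring.
  by rewrite [in leRHS]exprMn [leLHS]mulrC lerDl sqr_ge0.
 have zp : 0 < rsep i j p by rewrite lt0r z0 rsep_ge0.
 exists (rsep i j p / 2), (rsep i j p / (2 * (sepK m * N + 1))).
 have q0 : 0 < sepK m * N + 1 by have : 0 <= sepK m * N by [rewrite mulr_ge0// ltW]; lra.
 split; [by rewrite divr_gt0|by rewrite divr_gt0// mulr_gt0|move=> s s0 sb s1].
 have := rsep_rd m_gt0 i j p (proj (qcurve a z e s)); rewrite ler_norml => /andP[_ k1].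
 have k2 : sepK m * rd p (proj (qcurve a z e s)) <= sepK m * (s ^+ 2 * N) by rewrite ler_pM2l// dQ.
 have ss : s ^+ 2 <= s by rewrite expr2 -[leRHS]mulr1 ler_wpM2l.
 have k3 : s * (2 * (sepK m * N + 1)) <= rsep i j p by rewrite -ler_pdivlMr// mulr_gt0.
 have k4 : sepK m * N * s ^+ 2 <= sepK m * N * s by rewrite ler_wpM2l// mulr_ge0// ltW.
 have k5 : rsep i j p / 2 * s ^+ 2 <= rsep i j p / 2 * 1 by rewrite ler_wpM2l ?(le_trans ss)// divr_ge0 ?ltW.
 have k6 : 0 <= s ^+ 2 := sqr_ge0 s.
 nra.
have [c1 [d1 [c10 d10 H1]]] := pair b1 b2 ltac:(by rewrite /sepr /e /= subr_eq0 eqr_nat).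
have [c2 [d2 [c20 d20 H2]]] := pair b1 b3 ltac:(by rewrite /sepr /e /= subr_eq0 eqr_nat).
have [c3 [d3 [c30 d30 H3]]] := pair b2 b3 ltac:(by rewrite /sepr /e /= subr_eq0 eqr_nat).
pose c := Num.min c1 (Num.min c2 c3).
have c0 : 0 < c by rewrite !lt_min c10 c20 c30.
pose b := Num.min 1 (Num.min (dl / (N + 1)) (Num.min d1 (Num.min d2 d3))).
have b0 : 0 < b by rewrite !lt_min ltr01 divr_gt0 ?d10 ?d20 ?d30//; lra.
have : b <= b by []; rewrite {2}/b !le_min => /and5P[bb1 bdl bd1 bd2 bd3].
have ab s : 0 < s -> s <= b -> sep_above (c * s ^+ 2) (proj (qcurve a z e s)).
 move=> s0 sb; have s1 := le_trans sb bb1; have S := sqr_ge0 s.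
 split; [apply: le_trans (H1 s (ltW s0) (le_trans sb bd1) s1)|apply: le_trans (H2 s (ltW s0) (le_trans sb bd2) s1)|
  apply: le_trans (H3 s (ltW s0) (le_trans sb bd3) s1)]; by rewrite ler_wpM2r// !ge_min lexx ?orbT.
have hl s : 0 <= s -> s <= b -> hill (proj (qcurve a z e s)).
 move=> s0 sb; rewrite /hill_region /=; apply/ltW/Hdl.
 apply: (le_lt_trans (dQ s s0)); have N1 : 0 < N + 1 by lra.
 have : s * (N + 1) <= dl by rewrite -ler_pdivlMr// (le_trans sb).
 have ss : s ^+ 2 * N <= s * N.
  by rewrite ler_wpM2r// expr2 -[leRHS]mulr1 ler_wpM2l// (le_trans sb).
 have [s00|s00] := eqVneq s 0; first by move=> _; rewrite s00 expr0n /= mul0r.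
 have : 0 < s by rewrite lt0r s00.
 by lra.
have cs s : 0 < s -> 0 < c * s ^+ 2 by move=> s0; rewrite mulr_gt0 ?exprn_gt0.
pose C := sqrt (mmsum / c).
have id1 (k t : R) : is_derive t 1 (fun s => k * s) k.
 by apply: (is_derive_eq (is_derive_scal k (is_derive_id t (1 : R)))); rewrite mulr1.
have Hc : {within `[0, b], continuous (fun s => 2 * C * N * s)}.
 by apply: (@continuous_derivable R _ (fun=> 2 * C * N)) => t; exact: id1.
have He t : 0 < t -> t < b -> exists2 c, (om (proj (qcurve a z e t)) <= c%:E)%E &
  c * hnorm (cadd z (cscale (2 * t) e)) <= 2 * C * N.
 move=> t0 tb.
 have nt := sep_above_noncol (cs t t0) (ab t t0 (ltW tb)).
 exists (C / t).
  rewrite (om_noncol m h nt) lee_fin ler_pdivlMr//.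
  apply: ler_sqr2; first exact: sqrtr_ge0.
  have U0 : 0 <= Upot m (proj (qcurve a z e t)) - h.
   by rewrite subr_ge0; apply/hill_noncol => //; apply: hl; exact: ltW.
  rewrite exprMn !sqr_sqrtr//; last by rewrite divr_ge0// ltW// mmsum_gt0.
  have := Upot_above (cs t t0) (ab t t0 (ltW tb)); rewrite ler_pdivlMr ?cs// => K.
  rewrite ler_pdivlMr//; have S := sqr_ge0 t.
  have : 0 <= h * (c * t ^+ 2) by rewrite mulr_ge0 ?ltW ?cs.
  by nra.
 have -> : hnorm (cadd z (cscale (2 * t) e)) = 2 * t * N.
  rewrite -hnorm_cscale; last by rewrite mulr_ge0// ltW.
  congr (hnorm _); rewrite /cadd /cscale /z; config_ring.
 rewrite le_eqVlt; apply/orP; left; apply/eqP; field; exact: lt0r_neq0.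
have [L L0 HL] := @gpath_qcurve a z e b (fun s => 2 * C * N * s) (fun=> 2 * C * N) (ltW b0) bb1 hl Hc (fun t _ _ => id1 _ t) He.
rewrite pa in HL; exists (proj (qcurve a z e b)), L, (2 * C * N * b - 2 * C * N * 0); split => //.
 exact: sep_above_noncol (cs b b0) (ab b b0 (lexx _)).
by apply: hl => //; exact: ltW.
Qed.

Lemma exit_exists p : hill p -> exists p' L M, [/\ hill_boundary m h p', 0 <= L & gpath p p' L M].
Proof.
move=> hp; have [nc|nc] := pselect (noncol p).
 by have [p' [L [? ? ?]]] := radial_exit nc hp; exists p', L, (rsize m p * omr p ^+ 3 / h).
have [q [L [M [nq hq L0 PM]]]] := collision_escape nc.
have [p' [L' [? ? PM']]] := radial_exit nq hq.
exists p', (L + L'), (M + rsize m q * omr q ^+ 3 / h); split => //; first exact: addr_ge0.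
by apply: gpath_cat PM PM'.
Qed.

End Competitors.

(** * Existence of cheapest exits and of cheapest paths *)

Section Existence.
Definition exits p (M : R) := exists p' L, [/\ hill_boundary m h p', 0 <= L & gpath p p' L M].

Lemma exits_ge0 p M : exits p M -> 0 <= M.
Proof. by move=> [p' [L [_ L0 H]]]; exact: gpath_ge0 H. Qed.

Lemma exits_cat p q L M M' : 0 <= L -> gpath p q L M -> exits q M' -> exits p (M + M').
Proof.
move=> L0 H [p' [L' [? ? H']]]; exists p', (L + L'); split => //; first exact: addr_ge0.
exact: gpath_cat H H'.
Qed.

(** The converse reading of [radial_exit]: where every exit costs at least [E], the cube of [om]
    times the size is at least [h E]. *)
Lemma om_lower p (B E c : R) : hill p -> 0 <= c -> rsize m p <= B -> c ^+ 3 * B <= h * E ->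
 (forall M, exits p M -> E <= M) -> (c%:E <= om p)%E.
Proof.
move=> hp c0 rB cB H; have [nc|nc] := pselect (noncol p); last by rewrite om_col// leey.
have [p' [L [? ? P']]] := radial_exit nc hp.
have le : E <= rsize m p * omr p ^+ 3 / h by apply: H; exists p', L.
rewrite (om_noncol m h nc) lee_fin leNgt; apply/negP => lt.
have r0 : 0 < rsize m p.
 have [s12 _ _] := nc; rewrite lt0r rsize_ge0 andbT; apply/eqP => e.
 have := sep_le_hnorm m_gt0 (repr p) b1 b2; rewrite -/(rsize m p) e mulr0 leNgt.
 by rewrite -[sep _ _ _]/(rsep b1 b2 p) s12.
have B0 : 0 < B by exact: lt_le_trans r0 rB.
have l3 : omr p ^+ 3 < c ^+ 3 by rewrite ltrXn2r// ?nnegrE ?sqrtr_ge0.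
have : rsize m p * omr p ^+ 3 <= B * omr p ^+ 3 by rewrite ler_wpM2r// exprn_ge0// sqrtr_ge0.
have : B * omr p ^+ 3 < B * c ^+ 3 by rewrite ltr_pM2l.
move: le; rewrite ler_pdivlMr//; lra.
Qed.

(** Off the boundary [om] exceeds a positive constant on a ball, and leaving this ball costs at
    least the constant times the distance covered in it. *)
Lemma boundary_of_small_exits p : hill p ->
 (forall e, 0 < e -> exists2 q, rd p q < e & exists2 M, M < e & exits q M) -> hill_boundary m h p.
Proof.
move=> hp H; apply: contrapT => nb.
have [c c0 cp] : exists2 c : R, 0 < c & (c%:E < om p)%E.
 have [nc|nc] := pselect (noncol p); last by exists 1; rewrite // om_col// ltry.
 have Uh : h < Upot m p.
  rewrite lt_neqAle; apply/andP; split; last exact/hill_noncol.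
  by apply/eqP => e; apply: nb; apply/bdry_noncol.
 exists (omr p / 2); rewrite ?divr_gt0 ?sqrtr_gt0 ?subr_gt0//.
 rewrite (om_noncol m h nc) lte_fin -/(omr p).
 by have : 0 < omr p by [rewrite sqrtr_gt0 subr_gt0]; lra.
have [d d0 Hd] := om_lsc m_gt0 cp.
pose e := Num.min (d / 2) (c * (d / 2)).
have d20 : 0 < d / 2 by rewrite divr_gt0.
have e0 : 0 < e by rewrite lt_min d20 mulr_gt0.
have [q pq [M Me [p' [L [bp' L0 Q]]]]] := H e e0.
have hp' := bdry_hill bp'.
have [k [L' [A k0 kL hk WM]]] := gpath_arc L0 hp' Q.
have [L'0 klip _] := A.
have e1 : e <= d / 2 by rewrite ge_min lexx.
have e2 : e <= c * (d / 2) by rewrite ge_min lexx orbT.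
have near t : 0 <= t -> t <= d / 2 -> (c%:E < om (k t))%E.
 move=> t0 t1; apply: Hd; have := rdt p (k 0) (k t); have := klip 0 t t0; rewrite k0; lra.
have dL : d / 2 < L'.
 rewrite ltNge; apply/negP => le; have := near L' L'0 le.
 by rewrite kL om_bdry// lte_fin ltNge ltW.
have le := arc_ge A (lexx 0) (ltW d20) (ltW dL) (ltW c0) (fun t a b => ltW (near t a b)).
have W0 : (0 <= W k (d / 2) L')%E by apply: wlen_ge0 => //; exact: ltW.
have WE := wlenD rd0 rdx rdt k (ltW d20) (ltW dL) om0.
have : ((c * (d / 2))%:E <= M%:E)%E.
 apply: le_trans WM; rewrite WE -[X in (X <= _)%E]adde0; apply: leeD => //.
 by move: le; rewrite subr0.
by rewrite lee_fin; lra.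
Qed.

Lemma size_along k p t : lip1 k -> k 0 = p -> 0 <= t -> rsize m (k t) <= rsize m p + t.
Proof.
move=> kl k0 t0; have := rsize_rd m_gt0 (k t) p; rewrite ler_norml => /andP[_].
by have := kl 0 t t0; rewrite k0 (rdC' p); lra.
Qed.

Lemma wlen_fin k L M s t : (W k 0 L <= M%:E)%E -> 0 <= s -> s <= t -> t <= L -> W k s t \is a fin_num.
Proof.
move=> WM s0 st tL; have t0 := le_trans s0 st.
rewrite ge0_fin_numE; last exact: wlen_ge0.
apply: (@le_lt_trans _ _ (W k 0 L)); last by apply: (le_lt_trans WM); rewrite ltry.
rewrite (wlenD rd0 rdx rdt k t0 tL om0) (wlenD rd0 rdx rdt k s0 st om0).
apply: (@le_trans _ _ (W k 0 s + W k s t)%E); last by rewrite leeDl// wlen_ge0.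
by rewrite leeDr// wlen_ge0.
Qed.

(** Nearly cheapest exits may be very long near their end, where [om] is small. They are cut when
    the remaining cost becomes small: the initial parts have length at most [T] by [stage_bound],
    and their limit ends on the boundary by [boundary_of_small_exits]. *)
Lemma exit_attained p : hill p -> exists2 e, exits p e & forall M, exits p M -> e <= M.
Proof.
have mark : True by [].
move=> hp; pose S : set R := [set M | exits p M].
have hS : has_inf S.
 have [p' [L [M [? ? ?]]]] := exit_exists hp.
 by split; [exists M, p', L|exists 0 => M' /exits_ge0].
pose e := inf S.
have elb M : exits p M -> e <= M by move=> HM; apply: ge_inf => //; exact: hS.2.
have e_ge0 : 0 <= e by apply: lb_le_inf; [exact: hS.1|move=> M /exits_ge0].
have approx d : 0 < d -> exists2 M, exits p M & M < e + d.
 by move=> d0; have [M] := inf_adherent d0 hS; exists M.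
exists e => //.
have [e00|e00] := eqVneq e 0.
 have bp : hill_boundary m h p.
  apply: boundary_of_small_exits => // d d0; exists p; first by rewrite rdx.
  by have [M ? Md] := approx d d0; exists M => //; rewrite -[d]add0r -e00.
 by exists p, 0; split => //; rewrite e00; exact: gpath_refl.
have {e00}e0 : 0 < e by rewrite lt0r e00.
set r := rsize m p; have r0 : 0 <= r by exact: rsize_ge0.
have re : 0 < r + 3 * e by lra.
(* [b <= 1] and [b (r + 3 e) <= h e] together give the condition [b^3 (r + 3 e / b) <= h e] of
   [stage_bound]. *)
pose b := Num.min 1 (h * e / (r + 3 * e)).
have b0 : 0 < b by rewrite lt_min ltr01 divr_gt0// mulr_gt0.
have b1 : b <= 1 by rewrite ge_min lexx.
have bh : b * (r + 3 * e) <= h * e by rewrite -ler_pdivlMr// ge_min lexx orbT.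
have bT : b ^+ 3 * (r + 3 * e / b) <= h * e.
 have -> : b ^+ 3 * (r + 3 * e / b) = b * (b ^+ 2 * r + b * (3 * e)) by field; rewrite gt_eqF.
 apply: le_trans bh; rewrite ler_pM2l//.
 have : b ^+ 2 <= 1 by rewrite expr_le1// ltW.
 move=> b2; have := ler_wpM2r r0 b2; have := ler_wpM2r (ltac:(lra) : 0 <= 3 * e) b1; lra.
set T := 3 * e / b in bT.
have T0 : 0 <= T by rewrite /T divr_ge0 ?mulr_ge0// ltW.
(* Continuity of the cost along the path is not at hand. So the point [q] of the cut, up to which
   the length is controlled, is kept apart from a nearby point [q'] from which the exit is cheap. *)
pose near (d : R) : set (reduced R) := [set q | exists2 q', rd q q' < d & exists2 M, M <= 2 * d & exits q' M].
have [d d0|p' Hp' lim] := @gpath_lim p T e near T0; last first.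
 exists p', T; split => //.
 have hp' : hill p' by have [k [_ _ <- hk _]] := Hp'; apply: hk.
 apply: boundary_of_small_exits => // d d0.
 have [d' [q [d'0 d'd [q' qq' [M Md Mq']] qp']]] := lim (d / 4) ltac:(by rewrite divr_gt0).
 exists q'; last by exists M => //; lra.
 by have := rdt p' q q'; rewrite (rdC' p' q); lra.
pose dd := Num.min d (e / 2).
have dd0 : 0 < dd by rewrite lt_min d0 divr_gt0.
have ddd : dd <= d by rewrite ge_min lexx.
have dde : dd <= e / 2 by rewrite ge_min lexx orbT.
have [M [p1 [L1 [bp1 L10 P1]]] Me] := approx dd dd0.
have hp1 := bdry_hill bp1.
have [k [L [A k0 kL hk WM]]] := gpath_arc L10 hp1 P1.
have [L0 klip _] := A.
pose Phi t := fine (W k 0 t).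
have PhiE s t : 0 <= s -> s <= t -> t <= L -> W k s t = (Phi t - Phi s)%:E.
 move=> s0 st tL.
 have f1 := wlen_fin WM (lexx 0) (le_trans s0 st) tL; have f2 := wlen_fin WM (lexx 0) s0 (le_trans st tL).
 rewrite EFinB !fineK// (wlenD rd0 rdx rdt k s0 st om0) [X in (X - _)%E]addeC addeK//.
have Phi0 : Phi 0 = 0 by rewrite /Phi (wlenxx rdx).
have Phind s t : 0 <= s -> s <= t -> t <= L -> Phi s <= Phi t.
 by move=> s0 st tL; rewrite -subr_ge0 -lee_fin -PhiE//; exact: wlen_ge0.
have PL : Phi L <= M by rewrite -lee_fin -[Phi L]subr0 -Phi0 -PhiE.
have lower t : 0 <= t -> t <= L -> forall M', exits (k t) M' -> e - Phi t <= M'.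
 move=> t0 tL M' EM'; rewrite lerBlDl; apply: elb.
 apply: (exits_cat t0 _ EM'); rewrite -{1}k0 -{2}[t]subr0.
 by apply: (gpath_sub (L := L)) => //; rewrite PhiE// Phi0 subr0.
have bound t : 0 <= t -> t <= L -> Phi t < e -> t <= T.
 apply: (stage_bound e0 b0 h_gt0 r0 Phi0 Phind _ bT) => s t' c s0 st tL c0 cl.
 have := arc_ge A s0 st tL c0; rewrite PhiE// lee_fin; apply => x sx xt.
 have x0 := le_trans s0 sx; have xL := le_trans xt tL.
 apply: (@om_lower _ (r + t') (e - Phi t')); rewrite //; first exact: hk.
  by apply: (le_trans (size_along klip k0 x0)); rewrite lerD2l.
 move=> M' /(lower x x0 xL) le; apply: le_trans le; rewrite lerD2l lerN2; exact: Phind.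
pose S1 : set R := [set t | 0 <= t <= L /\ Phi t <= e - dd].
have S10 : S1 0 by split; rewrite ?lexx// Phi0; lra.
have hS1 : has_sup S1 by split; [exists 0|exists L => t [/andP[]]].
have dd20 : 0 < dd / 2 by rewrite divr_gt0.
have [s1 [/andP[s10 s1L] Ps1] s1s] := sup_adherent dd20 hS1.
have supL : sup S1 <= L by apply: ge_sup; [exists 0|move=> t [/andP[]]].
have s1T : s1 <= T by apply: bound => //; lra.
exists (k s1); last first.
 apply: (gpath_longer s10 s1T); first exact: hk.
 have : gpath (k 0) (k s1) (s1 - 0) (e + d).
  by apply: (gpath_sub (L := L)) => //; rewrite PhiE// Phi0 subr0 lee_fin; lra.
 by rewrite subr0 k0.
have s1sup : s1 <= sup S1 by apply: ub_le_sup; [exact: hS1.2|split => //; rewrite s10].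
have [lt|ge] := ltP (sup S1) L; last first.
 exists (k L).
  by apply: (le_lt_trans (klip s1 L s1L)); lra.
 exists 0; first by lra.
 by rewrite kL; exists p1, 0; split => //; exact: gpath_refl.
pose s2 := Num.min L (sup S1 + dd / 4).
have dd40 : 0 < dd / 4 by rewrite divr_gt0.
have s2L : s2 <= L by rewrite ge_min lexx.
have s2s : sup S1 < s2 by rewrite lt_min lt ltrDl.
have s2d : s2 <= sup S1 + dd / 4 by rewrite ge_min lexx orbT.
have s12 := le_trans s1sup (ltW s2s).
have s20 := le_trans s10 s12.
exists (k s2).
 by apply: (le_lt_trans (klip s1 s2 s12)); lra.
have nS : e - dd < Phi s2.
 rewrite ltNge; apply/negP => le; have : s2 <= sup S1.
  by apply: ub_le_sup; [exact: hS1.2|split => //; rewrite s20].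
 by lra.
exists (M - Phi s2); first by lra.
exists p1, (L - s2); split; rewrite ?subr_ge0// -kL.
apply: (gpath_sub (L := L)) => //.
by rewrite PhiE// lee_fin; lra.
Qed.

(** Passing through the boundary costs [e0 + e1]. If that is not the infimum, it is worse by some
    [eta > 0]; then from any point of a nearly minimal path an exit costs at least [eta / 4], since
    two such exits would give a route through the boundary. Hence [om] is bounded below along these
    paths and their length is bounded. *)
Lemma minimal_gpath p q : hill p -> hill q -> exists M L, [/\ 0 <= L, gpath p q L M &
 forall L' M', 0 <= L' -> gpath p q L' M' -> M <= M'].
Proof.
move=> hp hq; have [e0 [p0 [L0 [bp0 L00 P0]]] le0] := exit_attained hp.
have [e1 [p1 [L1 [bp1 L10 P1]]] le1] := exit_attained hq.
have [L2 L20 P2] := boundary_run bp0 bp1.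
have P3 : gpath p q (L0 + (L2 + L1)) (e0 + (0 + e1)).
 apply: (gpath_cat L00 _ P0); first exact: addr_ge0.
 apply: (gpath_cat L20 L10 P2); exact: gpath_sym.
rewrite add0r in P3.
have L30 : 0 <= L0 + (L2 + L1) by rewrite !addr_ge0.
pose S : set R := [set M | exists2 L, 0 <= L & gpath p q L M].
have hS : has_inf S.
 by split; [exists (e0 + e1), (L0 + (L2 + L1))|exists 0 => M [L Lp /gpath_ge0]; exact].
pose e := inf S.
have elb L M : 0 <= L -> gpath p q L M -> e <= M.
 by move=> Lp HM; apply: ge_inf; [exact: hS.2|exists L].
have e_ge0 : 0 <= e by apply: lb_le_inf; [exact: hS.1|move=> M [L Lp /gpath_ge0]; exact].
have := elb _ _ L30 P3; rewrite le_eqVlt => /orP[/eqP ee|lt].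
 by exists (e0 + e1), (L0 + (L2 + L1)); split => // L' M' a b; rewrite -ee; exact: elb a b.
pose eta := e0 + e1 - e; have eta0 : 0 < eta by rewrite subr_gt0.
set r := rsize m p; have r0 : 0 <= r by exact: rsize_ge0.
pose K := e + eta + 1; have K0 : 0 < K by rewrite /K; lra.
have rK : 0 < r + K by lra.
have he : 0 < h * (eta / 4) by rewrite mulr_gt0// divr_gt0.
(* A lower bound for [om] on a time interval of length [T = K / b], which a longer path would cross
   at cost [K], more than its total. *)
pose b := Num.min 1 (h * (eta / 4) / (r + K)).
have b0 : 0 < b by rewrite lt_min ltr01 divr_gt0.
have b1 : b <= 1 by rewrite ge_min lexx.
have bh : b * (r + K) <= h * (eta / 4) by rewrite -ler_pdivlMr// ge_min lexx orbT.
have bT : b ^+ 3 * (r + K / b) <= h * (eta / 4).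
 have -> : b ^+ 3 * (r + K / b) = b * (b ^+ 2 * r + b * K) by field; rewrite gt_eqF.
 apply: le_trans bh; rewrite ler_pM2l//.
 have : b ^+ 2 <= 1 by rewrite expr_le1// ltW.
 move=> b2; have := ler_wpM2r r0 b2; have := ler_wpM2r (ltW K0) b1; lra.
set T := K / b in bT; have T0 : 0 <= T by rewrite /T divr_ge0// ltW.
have [d d0|p' Hp' lim] := @gpath_lim p T e (fun _ => [set q]) T0; last first.
 have qp' : q = p'.
  apply: (rd_eq0 m_gt0); apply/eqP; rewrite eq_le rd0 andbT; apply/ler_addgt0Pr => d d0.
  by have [d' [_ [_ _ -> ]]] := lim d d0; rewrite add0r => /ltW.
 by exists e, T; rewrite qp'; split => // L' M' a c; apply: (elb _ _ a); rewrite qp'.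
exists q => //.
pose dd := Num.min d (eta / 2).
have dd0 : 0 < dd by rewrite lt_min d0 divr_gt0.
have ddd : dd <= d by rewrite ge_min lexx.
have dde : dd <= eta / 2 by rewrite ge_min lexx orbT.
have [M [L' L'0 P'] Me] := inf_adherent dd0 hS; rewrite -/e in Me.
have [k [L [A k0 kL hk WM]]] := gpath_arc L'0 hq P'.
have [Lp klip _] := A.
have LT : L <= T.
 rewrite leNgt; apply/negP => TL.
 have WE := wlenD rd0 rdx rdt k T0 (ltW TL) om0.
 have om_ge t : 0 <= t -> t <= T -> (b%:E <= om (k t))%E.
  move=> t0 tT; have tL : t <= L by lra.
  apply: (@om_lower _ (r + T) (eta / 4)) => //; [exact: hk|exact: ltW| |].
   by apply: (le_trans (size_along klip k0 t0)); rewrite lerD2l.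
  move=> M' EM'.
  have f1 := wlen_fin WM (lexx 0) t0 tL; have f2 := wlen_fin WM t0 tL (lexx L).
  have c1 : e0 <= fine (W k 0 t) + M'.
   apply: le0; apply: (exits_cat t0 _ EM').
   have : gpath (k 0) (k t) (t - 0) (fine (W k 0 t)).
    by apply: (gpath_sub (L := L)) => //; rewrite fineK.
   by rewrite k0 subr0.
  have c2 : e1 <= fine (W k t L) + M'.
   apply: le1; have tL0 : 0 <= L - t by rewrite subr_ge0.
   apply: (exits_cat tL0 _ EM'); apply: gpath_sym => //; rewrite -kL.
   by apply: (gpath_sub (L := L)) => //; rewrite fineK.
  have : fine (W k 0 t) + fine (W k t L) <= M.
   by rewrite -lee_fin EFinD !fineK// -(wlenD rd0 rdx rdt k t0 tL om0).
  by rewrite /eta in dde *; lra.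
 have := arc_ge A (lexx 0) T0 (ltW TL) (ltW b0) om_ge.
 rewrite subr0 /T mulrC divfK ?gt_eqF// => le.
 have W0 : (0 <= W k T L)%E by apply: wlen_ge0 => //; exact: ltW.
 have : (K%:E <= M%:E)%E.
  by apply: le_trans WM; rewrite WE -[X in (X <= _)%E]adde0; exact: leeD.
 by rewrite lee_fin /K; lra.
apply: (gpath_longer Lp LT) => //; exists k; split => //.
by apply: (le_trans WM); rewrite lee_fin; lra.
Qed.

End Existence.

(** * A collision inside a minimizer contradicts a cheap competitor *)

Section InteriorCollision.
Implicit Types (q : reduced R).

Variables (k : R -> reduced R) (L th t0 : R).
Hypotheses (A : arc k L) (t00 : 0 < t0) (tl : 0 <= th - t0) (tr : th + t0 <= L).

Let klip : lip1 k. Proof. by have [] := A. Qed.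

Lemma om_lsc_along s (c : R) : (c%:E < om (k s))%E -> exists2 e, 0 < e &
 forall x, s - e < x -> x < s + e -> (c%:E < om (k x))%E.
Proof.
move=> cs; have [e e0 H] := om_lsc m_gt0 cs; exists e => // x x1 x2; apply: H.
have [sx|/ltW xs] := leP s x; first by apply: (le_lt_trans (klip sx)); lra.
by rewrite rdC'; apply: (le_lt_trans (klip xs)); lra.
Qed.

(** Lower semicontinuity propagates strict bounds only; the factor 99/100 buys strictness, and a
    height 0 holds anyway. Infinite weights are replaced by [I]. *)
Lemma lower_near s (I : R) : 0 < I -> (I%:E <= om (k (th - s)) + om (k (th + s)))%E ->
 exists ca cb, [/\ 0 <= ca, 0 <= cb, 99 / 100 * I <= ca + cb & exists2 e, 0 < e &
  forall x, s - e < x -> x < s + e -> (ca%:E <= om (k (th - x)))%E /\ (cb%:E <= om (k (th + x)))%E].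
Proof.
move=> I0 HI.
have [ca [cb [ca0 cb0 cI Ha Hb]]] : exists ca cb, [/\ 0 <= ca, 0 <= cb, 99 / 100 * I <= ca + cb,
  ca = 0 \/ (ca%:E < om (k (th - s)))%E & cb = 0 \/ (cb%:E < om (k (th + s)))%E].
 have o1 := om0 (k (th - s)); have o2 := om0 (k (th + s)).
 case E1 : (om (k (th - s))) HI o1 => [x| |]; case E2 : (om (k (th + s))) o2 => [y| |] //= o2 HI o1.
 - rewrite !lee_fin in HI o1 o2; exists (99 / 100 * x), (99 / 100 * y).
  rewrite !lte_fin; split; [lra|lra|lra| |].
   by have [->|x0] := eqVneq x 0; [left; lra|right; have : 0 < x by [rewrite lt0r x0 o1]; lra].
  by have [->|x0] := eqVneq y 0; [left; lra|right; have : 0 < y by [rewrite lt0r x0 o2]; lra].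
 - by exists 0, I; split; [|exact: ltW|lra|left|right; rewrite ltry].
 - by exists I, 0; split; [exact: ltW| |lra|right; rewrite ltry|left].
 - by exists I, 0; split; [exact: ltW| |lra|right; rewrite ltry|left].
exists ca, cb; split => //.
have [e1 e10 H1] : exists2 e, 0 < e & forall x, s - e < x -> x < s + e -> (ca%:E <= om (k (th - x)))%E.
 case: Ha => [->|Ha]; first by exists 1 => // x _ _; exact: om0.
 by have [e e0 H] := om_lsc_along Ha; exists e => // x x1 x2; apply/ltW/H; lra.
have [e2 e20 H2] : exists2 e, 0 < e & forall x, s - e < x -> x < s + e -> (cb%:E <= om (k (th + x)))%E.
 case: Hb => [->|Hb]; first by exists 1 => // x _ _; exact: om0.
 by have [e e0 H] := om_lsc_along Hb; exists e => // x x1 x2; apply/ltW/H; lra.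
exists (Num.min e1 e2); first by rewrite lt_min e10.
have m1 : Num.min e1 e2 <= e1 by rewrite ge_min lexx.
have m2 : Num.min e1 e2 <= e2 by rewrite ge_min lexx orbT.
by move=> x x1 x2; split; [apply: H1|apply: H2]; lra.
Qed.

(** [2 I sqrt s] is a primitive of [I / sqrt s]. Losing 99/100 from [lower_near], 99/100 from the
    variation of [sqrt] and 1/100 of [sqrt t] below the cutoff leaves [2 (99/100)^3], which exceeds
    97/50. *)
Lemma growth (I : R) : 0 < I ->
 (forall s, 0 < s -> s <= t0 -> ((I / sqrt s)%:E <= om (k (th - s)) + om (k (th + s)))%E) ->
 forall t, 0 < t -> t <= t0 -> ((97 / 50 * I * sqrt t)%:E <= W k (th - t) (th + t))%E.
Proof.
have mark : True by [].
move=> I0 HI t t_gt0 tt.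
(* The cutoff avoids the collision at [s = 0]; its square root is a hundredth of [sqrt t]. *)
pose u := t / 100 / 100; have u0 : 0 < u by rewrite !divr_gt0.
have ut : u <= t by rewrite /u; lra.
have squ : sqrt u = sqrt t / 100.
 have -> : u = t * (100^-1) ^+ 2 by rewrite /u; field.
 by rewrite sqrtrM ?(ltW t_gt0)// sqrtr_sqr ger0_norm// invr_ge0.
have sq0 (s : R) : 0 < s -> 0 < sqrt s by move=> s0; rewrite sqrtr_gt0.
pose P (x y : R) := ((2 * (99 / 100 * (99 / 100)) * I * (sqrt y - sqrt x))%:E <=
 W k (th - y) (th - x) + W k (th + x) (th + y))%E.
have Pall : P u t.
 apply: (@tagged_induction R u t P ut).
  move=> x y z ux xy yz zt; rewrite /P => h1 h2.
  rewrite (@wlenD _ _ _ rd0 rdx rdt om k (th - z) (th - y) (th - x)) ?lerD2l ?lerN2//.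
  rewrite (@wlenD _ _ _ rd0 rdx rdt om k (th + x) (th + y) (th + z)) ?lerD2l//.
  apply: le_trans (_ : ((2 * (99 / 100 * (99 / 100)) * I * (sqrt z - sqrt y))%:E + (2 * (99 / 100 * (99 / 100)) * I * (sqrt y - sqrt x))%:E <= _)%E).
   by rewrite -EFinD lee_fin le_eqVlt; apply/orP; left; apply/eqP; ring.
  apply: (le_trans (leeD h2 h1)); rewrite addeACA; apply: leeD => //.
  by rewrite addeC.
 move=> s us st; have s0 : 0 < s by lra.
 have Is : 0 < I / sqrt s by rewrite divr_gt0// sq0.
 have [ca [cb [ca0 cb0 cI [e e0 He]]]] := lower_near Is (HI s s0 (le_trans st tt)).
 exists (Num.min e (s / 100)); first by rewrite lt_min e0 divr_gt0.
 have m1 : Num.min e (s / 100) <= e by rewrite ge_min lexx.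
 have m2 : Num.min e (s / 100) <= s / 100 by rewrite ge_min lexx orbT.
 move=> x y ux xs sy yt xe ye; have x0 : 0 < x by lra.
 have xy := le_trans xs sy.
 have xs' : 99 / 100 * sqrt s <= sqrt x.
  apply: ler_sqr2; first exact: sqrtr_ge0.
  rewrite exprMn !sqr_sqrtr ?(ltW x0) ?(ltW s0)// expr2; move: xe m2 s0; only_lra.
 have l1 : ((ca * (y - x))%:E <= W k (th - y) (th - x))%E.
  have -> : y - x = (th - x) - (th - y) by ring.
  have a1 : 0 <= th - y by have := tl; move: yt tt; only_lra.
  have a2 : th - y <= th - x by rewrite lerD2l lerN2.
  have a3 : th - x <= L by have := tr; have := t00; move: x0; only_lra.
  apply: (arc_ge A a1 a2 a3 ca0) => z z1 z2.
  have [||+ _] := He (th - z); first by move: z2 xe m1; only_lra.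
   by move: z1 ye m1; only_lra.
  by rewrite subKr.
 have l2 : ((cb * (y - x))%:E <= W k (th + x) (th + y))%E.
  have -> : y - x = (th + y) - (th + x) by ring.
  have a1 : 0 <= th + x by have := tl; have := t00; move: x0; only_lra.
  have a2 : th + x <= th + y by rewrite lerD2l.
  have a3 : th + y <= L by have := tr; move: yt tt; only_lra.
  apply: (arc_ge A a1 a2 a3 cb0) => z z1 z2.
  have [||_] := He (z - th); first by move: z1 xe m1; only_lra.
   by move: z2 ye m1; only_lra.
  by rewrite addrC subrK.
 rewrite /P; apply: (le_trans _ (leeD l1 l2)); rewrite -EFinD lee_fin -mulrDl.
 have sx := sq0 x x0; have ss := sq0 s s0; have sy' : sqrt x <= sqrt y by rewrite ler_wsqrtr.
 apply: (@le_trans _ _ (99 / 100 * (I / sqrt s) * (y - x))); last first.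
  by rewrite ler_wpM2r// subr_ge0.
 have E : y - x = (sqrt y - sqrt x) * (sqrt y + sqrt x).
  by rewrite -subr_sqr !sqr_sqrtr// ltW//; exact: lt_le_trans xy.
 rewrite E; have D0 : 0 <= sqrt y - sqrt x by rewrite subr_ge0.
 move: (sqrt y - sqrt x) D0 => D D0.
 have -> : 99 / 100 * (I / sqrt s) * (D * (sqrt y + sqrt x)) =
   I * D * (99 / 100 * (sqrt y + sqrt x) / sqrt s) by field; rewrite gt_eqF.
 have -> : 2 * (99 / 100 * (99 / 100)) * I * D = I * D * (2 * (99 / 100 * (99 / 100))) by ring.
 rewrite ler_wpM2l// ?mulr_ge0 ?(ltW I0)// ler_pdivlMr//; move: xs' sy'; only_lra.
apply: le_trans (_ : ((2 * (99 / 100 * (99 / 100)) * I * (sqrt t - sqrt u))%:E <= _)%E).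
 rewrite lee_fin squ; have := mulr_gt0 I0 (sq0 t t_gt0); lra.
apply: (le_trans Pall).
rewrite (@wlenD _ _ _ rd0 rdx rdt om k (th - t) (th - u) (th + t)) ?lerD2l ?lerN2//; last by lra.
rewrite (@wlenD _ _ _ rd0 rdx rdt om k (th - u) (th + u) (th + t)) ?lerD2l//; last by lra.
apply: leeD => //; rewrite leeDr// wlen_ge0//; lra.
Qed.

Hypothesis fin : W k (th - t0) (th + t0) \is a fin_num.
Hypothesis minimal : forall t M L', 0 <= t -> t <= t0 -> 0 <= L' ->
 gpath (k (th - t)) (k (th + t)) L' M -> (W k (th - t) (th + t) <= M%:E)%E.
Hypothesis cheap : forall t, 0 < t -> t <= t0 -> noncol (k (th - t)) -> noncol (k (th + t)) ->
 exists2 L', 0 <= L' & gpath (k (th - t)) (k (th + t)) L' (19 / 10 * t * (omr (k (th - t)) + omr (k (th + t)))).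

(* The infimum I of sqrt t (om (k (th - t)) + om (k (th + t))) is positive, since
  the potential is at least of order 1 / t. Integrating, the action over
  [th - t, th + t] is at least about 2 I sqrt t, whereas a competitor costs at most
  1.9 t (om (k (th - t)) + om (k (th + t))), which gets close to 1.9 I sqrt t. *)
Lemma collision_contradiction (c : R) : 0 < c ->
 (forall s, 0 < s -> s <= t0 -> ((c / sqrt s)%:E <= om (k (th - s)) + om (k (th + s)))%E) -> False.
Proof.
have mark : True by [].
move=> c0 Hc.
pose S : set R := [set I | 0 < I /\
 forall s, 0 < s -> s <= t0 -> ((I / sqrt s)%:E <= om (k (th - s)) + om (k (th + s)))%E].
have Sc : S c by [].
have hS : has_sup S.
 split; first by exists c.
 exists (fine (W k (th - t0) (th + t0)) / (97 / 50 * sqrt t0)) => I [I0 HI].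
 rewrite ler_pdivlMr; last by rewrite mulr_gt0 ?sqrtr_gt0//; lra.
 have := growth I0 HI t00 (lexx t0); rewrite -{1}(fineK fin) lee_fin; lra.
have cI : c <= sup S by apply: ub_le_sup Sc; exact: hS.2.
have I0 : 0 < sup S by exact: lt_le_trans cI.
have e0 : 0 < sup S / 200 by apply: divr_gt0 I0 _; rewrite ltr0n.
have [I [Ip HI] lI] := sup_adherent e0 hS.
(* [I] exceeds 199/200 of the supremum, while the bound with [J] fails at some [t]. The
   contradiction is [97/50 * 199 > 19/10 * 201]. *)
pose J := sup S * (201 / 200); have J0 : 0 < J by apply: mulr_gt0 I0 _; rewrite divr_gt0 ?ltr0n.
have nJ : ~ S J by move=> /(ub_le_sup hS.2); rewrite /J; lra.
have [t [t1 t2 lt]] : exists t, [/\ 0 < t, t <= t0 & (om (k (th - t)) + om (k (th + t)) < (J / sqrt t)%:E)%E].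
 apply: contrapT => no; apply: nJ; split => // s s1 s2; rewrite leNgt; apply/negP => lt.
 by apply: no; exists s.
have nc1 : noncol (k (th - t)).
 apply: contrapT => nc; move: lt; rewrite (om_col m_gt0 h nc) ltNge => /negP; apply.
 by rewrite addye ?leey// gt_eqF// (lt_le_trans _ (om0 _))// ltNyr.
have nc2 : noncol (k (th + t)).
 apply: contrapT => nc; move: lt; rewrite (om_col m_gt0 h nc) ltNge => /negP; apply.
 by rewrite addey ?leey// gt_eqF// (lt_le_trans _ (om0 _))// ltNyr.
have [L' L'0 P] := cheap t1 t2 nc1 nc2.
have := minimal (ltW t1) t2 L'0 P; have := growth Ip HI t1 t2.
move: lt; rewrite (om_noncol m h nc1) (om_noncol m h nc2) -EFinD lte_fin => lt g1 g2.
have : 97 / 50 * I * sqrt t <= 19 / 10 * t * (omr (k (th - t)) + omr (k (th + t))).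
 by rewrite -lee_fin; exact: le_trans g1 g2.
have st : 0 < sqrt t by rewrite sqrtr_gt0.
move: lt; rewrite ltr_pdivlMr// => lt.
have tE : t = sqrt t * sqrt t by rewrite -expr2 sqr_sqrtr// ltW.
rewrite -/(omr (k (th - t))) -/(omr (k (th + t))) in lt *.
move: (omr (k (th - t)) + omr (k (th + t))) lt => D lt.
have -> : 19 / 10 * t * D = 19 / 10 * (D * sqrt t) * sqrt t by rewrite {1}tE; ring.
rewrite ler_pM2r//; rewrite /J in lt; lra.
Qed.

End InteriorCollision.

(** * The competitor near a triple collision *)

Section TripleCollision.
Implicit Types (q : reduced R).

Lemma om_large (c s : R) q : 0 < c -> 0 < s -> noncol q -> c / s <= Upot m q -> s <= c / (2 * h) ->
 sqrt (c / 2) / sqrt s <= omr q.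
Proof.
move=> c0 s0 nc cU sh; apply: ler_sqr2; first exact: sqrtr_ge0.
have cs : 2 * h <= c / s by rewrite ler_pdivlMr// mulrC -ler_pdivlMr// mulr_gt0.
rewrite expr_div_n !sqr_sqrtr ?(ltW s0) ?divr_ge0 ?(ltW c0)//; last by have := h_gt0; lra.
have -> : c / 2 / s = (c / s) / 2 by rewrite mulrAC.
have := h_gt0; lra.
Qed.

(** Within distance [s] of a collision the colliding pair is at most [sepK * s] apart, so the
    potential is at least a constant over [s]; for small [s] half of it absorbs [h]. *)
Lemma collision_om p : ~ noncol p -> exists c d, [/\ 0 < c, 0 < d &
 forall q s, 0 < s -> s <= d -> rd p q <= s -> ((c / sqrt s)%:E <= om q)%E].
Proof.
move=> np; have Kp := sepK_gt0 m_gt0.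
have pair i j (g : R) : 0 < g -> rsep i j p = 0 -> (forall q, noncol q -> 0 < rsep i j q /\ g / rsep i j q <= Upot m q) ->
 exists c d, [/\ 0 < c, 0 < d & forall q s, 0 < s -> s <= d -> rd p q <= s -> ((c / sqrt s)%:E <= om q)%E].
 move=> g0 z H; have gK : 0 < g / sepK m by rewrite divr_gt0.
 exists (sqrt (g / sepK m / 2)), (g / sepK m / (2 * h)); split.
 - by rewrite sqrtr_gt0 divr_gt0.
 - by rewrite divr_gt0// mulr_gt0.
 move=> q s s0 sd ds; have [nc|nc] := pselect (noncol q); last by rewrite om_col// leey.
 rewrite (om_noncol m h nc) lee_fin; apply: om_large => //.
 have [q0 le] := H q nc; apply: le_trans le.
 rewrite -mulrA -invfM ler_pM2l// lef_pV2 ?posrE ?mulr_gt0//.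
 have := rsep_rd m_gt0 i j p q; rewrite z sub0r normrN ger0_norm ?rsep_ge0// => le.
 by apply: (le_trans le); rewrite ler_pM2l.
have [z12|n12] := eqVneq (rsep b1 b2 p) 0.
 by apply: (pair b1 b2 (m b1 * m b2)) => //; [rewrite mulr_gt0|move=> q [? _ _]; have [? _ _] := Upot_term m_gt0 q].
have [z13|n13] := eqVneq (rsep b1 b3 p) 0.
 by apply: (pair b1 b3 (m b1 * m b3)) => //; [rewrite mulr_gt0|move=> q [_ ? _]; have [_ ? _] := Upot_term m_gt0 q].
have [z23|n23] := eqVneq (rsep b2 b3 p) 0.
 by apply: (pair b2 b3 (m b2 * m b3)) => //; [rewrite mulr_gt0|move=> q [_ _ ?]; have [_ _ ?] := Upot_term m_gt0 q].
by exfalso; apply: np; split; rewrite lt0r ?n12 ?n13 ?n23 rsep_ge0.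
Qed.

Lemma inv_convex (x y s : R) : 0 < x -> 0 < y -> 0 <= s -> s <= 1 ->
 0 < (1 - s) * x + s * y /\ ((1 - s) * x + s * y)^-1 <= (1 - s) / x + s / y.
Proof.
move=> x0 y0 s0 s1; have l0 : 0 < (1 - s) * x + s * y.
 have [->|sn] := eqVneq s 0; first by lra.
 have sp : 0 < s by rewrite lt0r sn.
 by have := mulr_gt0 sp y0; have : 0 <= (1 - s) * x by [rewrite mulr_ge0 ?subr_ge0// ltW]; lra.
split => //; rewrite -[leLHS]mul1r ler_pdivrMr//.
have -> : ((1 - s) / x + s / y) * ((1 - s) * x + s * y) = 1 + s * (1 - s) * (x - y) ^+ 2 / (x * y).
 by field; rewrite !gt_eqF.
rewrite lerDl; apply: divr_ge0; last by rewrite ltW// mulr_gt0.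
by apply: mulr_ge0; [rewrite mulr_ge0// subr_ge0|exact: sqr_ge0].
Qed.

Lemma gpath_segm (a b : config R) (Phi phi : R -> R) :
 (forall t, 0 <= t -> t <= 1 -> hill (proj (segm a b t))) ->
 (forall t : R, is_derive t 1 Phi (phi t)) ->
 (forall t, 0 < t -> t < 1 -> exists2 c, (om (proj (segm a b t)) <= c%:E)%E & c * hnorm (csub b a) <= phi t) ->
 exists2 L, 0 <= L & gpath (proj a) (proj b) L (Phi 1 - Phi 0).
Proof.
move=> hl Pd H; pose z : config R := fun=> 0.
have E t : qcurve a (csub b a) z t = segm a b t.
 rewrite /qcurve /segm /csub /cadd /cscale /z; config_ring.
have EV t : cadd (csub b a) (cscale (2 * t) z) = csub b a.
 rewrite /csub /cadd /cscale /z; config_ring.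
have E1 : segm a b 1 = b.
 rewrite /segm /csub /cadd /cscale; config_ring.
rewrite -E1 -E; apply: (@gpath_qcurve a (csub b a) z 1 Phi phi ler01 (lexx _)).
- by move=> t t0 t1; rewrite E; exact: hl.
- exact: continuous_derivable Pd.
- by move=> t t0 t1; rewrite E EV; exact: H.
Qed.

(** A segment between well rotated representatives. Its squared length is at most [3 t^2], and the
    potential along it is at most twice the interpolated one. The arithmetic-geometric mean
    inequality with weight [kap] replaces the square root by a quadratic primitive. *)
Lemma triple_competitor p : rsize m p = 0 -> exists2 d, 0 < d & forall a b t, 0 < t -> t <= d ->
 rd p a <= t -> rd p b <= t -> noncol a -> noncol b ->
 exists2 L, 0 <= L & gpath a b L (19 / 10 * t * (omr a + omr b)).
Proof.
have mark : True by [].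
move=> p0; have Kp := sepK_gt0 m_gt0.
pose g := m b1 * m b2; have g0 : 0 < g by rewrite mulr_gt0.
(* Sizes up to [3 t] then force a potential of at least [11 h], so that [sqrt U] is at most 21/20 of
   [omr]. *)
exists (g / (33 * sepK m * h)); first by rewrite divr_gt0// !mulr_gt0.
move=> a b t t0 td; rewrite !rd_rsize0// => ra rb na nb.
have big q : noncol q -> rsize m q <= 3 * t -> 11 * h <= Upot m q.
 move=> [s12 _ _] rq; have [T _ _] := Upot_term m_gt0 q; apply: le_trans T.
 rewrite ler_pdivlMr//.
 have : rsep b1 b2 q <= sepK m * (3 * t).
  by apply: (le_trans (sep_le_hnorm m_gt0 (repr q) b1 b2)); rewrite ler_pM2l.
 move: td; rewrite ler_pdivlMr ?mulr_gt0// -/g => td le.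
 have : 11 * h * rsep b1 b2 q <= 11 * h * (sepK m * (3 * t)) by rewrite ler_wpM2l// mulr_ge0// ltW.
 lra.
have bigA : 11 * h <= Upot m a by apply: big => //; lra.
have bigB : 11 * h <= Upot m b by apply: big => //; lra.
have hp := h_gt0.
have UA0 : 0 < Upot m a by lra.
have UB0 : 0 < Upot m b by lra.
pose x := sqrt (Upot m a); pose y := sqrt (Upot m b).
have x0 : 0 < x by rewrite sqrtr_gt0.
have y0 : 0 < y by rewrite sqrtr_gt0.
have xo q : 11 * h <= Upot m q -> sqrt (Upot m q) <= 21 / 20 * omr q.
 move=> U11; apply: ler_sqr2; first by rewrite mulr_ge0 ?sqrtr_ge0.
 by rewrite exprMn !sqr_sqrtr; lra.
pose qa := repr a; have [u u1 [d12 d13 d23]] := good_rotation qa (repr b).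
pose qb := crot u (repr b).
have pa : proj qa = a by exact: proj_repr.
have pb : proj qb = b.
 rewrite -[b in RHS]proj_repr; apply/esym/proj_congr/congruentP; exists u => //.
 by exists 0 => i; rewrite addr0.
have sb i j : sep qb i j = rsep i j b by rewrite -pb rsep_proj.
have sb' i j : sep (repr b) i j = sep qb i j by rewrite sb.
rewrite !sb' in d12 d13 d23.
pose D := hnorm (csub qb qa); have D0 : 0 <= D by exact: hnorm_ge0.
have nb2 : hnorm qb = rsize m b by rewrite -pb rsize_proj.
(* The rotation makes [hre qa qb] at least minus a quarter of the sum of the squared norms, so the
   squared distance is at most 3/2 of that sum. *)
have D2 : D ^+ 2 <= 3 * t ^+ 2.
 have na2 : hre qa qa <= t ^+ 2.
  by rewrite -hnorm_sq// ler_pXn2r// ?nnegrE ?hnorm_ge0// ltW.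
 have nb3 : hre qb qb <= t ^+ 2.
  by rewrite -hnorm_sq// ler_pXn2r// ?nnegrE ?hnorm_ge0 ?(ltW t0)// nb2.
 rewrite /D hnorm_sq// hre_csub (hreC m qb qa).
 have hE : hre qa qb = wgt m b1 b2 * dotp qa qb b1 b2 + wgt m b1 b3 * dotp qa qb b1 b3 + wgt m b2 b3 * dotp qa qb b2 b3 by [].
 have w12 := wgt_gt0 m_gt0 b1 b2; have w13 := wgt_gt0 m_gt0 b1 b3; have w23 := wgt_gt0 m_gt0 b2 b3.
 have K (w X Y dp : R) : 0 < w -> - (X * Y / 2) <= dp -> - (w * X ^+ 2 + w * Y ^+ 2) <= 4 * (w * dp).
  move=> w0 le; have : w * (- (X * Y / 2)) <= w * dp by rewrite ler_pM2l.
  have : 0 <= w * (X - Y) ^+ 2 by apply: mulr_ge0; [exact: ltW|exact: sqr_ge0].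
  by lra.
 have := K _ _ _ _ w12 d12; have := K _ _ _ _ w13 d13; have := K _ _ _ _ w23 d23.
 move: na2 nb3; rewrite !hre_sep hE; only_lra.
have Dt : D <= 2 * t.
 by apply: ler_sqr2; [rewrite mulr_ge0// ltW|rewrite exprMn; have := sqr_ge0 t; lra].
(* The factor 2 is lost in [segm_sep]; the interpolation is the convexity of the inverse. *)
pose UU (s : R) := 2 * ((1 - s) * Upot m a + s * Upot m b).
have sepZ i j s : 0 <= s -> s <= 1 -> 0 < rsep i j a -> 0 < rsep i j b ->
  - (sep qa i j * sep qb i j / 2) <= dotp qa qb i j ->
  0 < rsep i j (proj (segm qa qb s)) /\
  (rsep i j (proj (segm qa qb s)))^-1 <= 2 * ((1 - s) / rsep i j a + s / rsep i j b).
 move=> s0 s1 sa0 sb0 dd; have := segm_sep s0 s1 dd; rewrite sb -[sep qa i j]/(rsep i j a) rsep_proj => le.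
 have [l0 lV] := inv_convex sa0 sb0 s0 s1.
 have Z0 : 0 < sep (segm qa qb s) i j by move: l0 le; only_lra.
 split => //; have : (2 * sep (segm qa qb s) i j)^-1 <= ((1 - s) * rsep i j a + s * rsep i j b)^-1.
  by rewrite lef_pV2 ?posrE// mulr_gt0.
 by rewrite invfM; move: lV; only_lra.
have [a12 a13 a23] := na; have [c12 c13 c23] := nb.
have ncZ s : 0 <= s -> s <= 1 -> noncol (proj (segm qa qb s)).
 by move=> s0 s1; split; [have [] := sepZ b1 b2 s s0 s1 a12 c12 d12|have [] := sepZ b1 b3 s s0 s1 a13 c13 d13|
  have [] := sepZ b2 b3 s s0 s1 a23 c23 d23].
have UZ s : 0 <= s -> s <= 1 -> Upot m (proj (segm qa qb s)) <= UU s.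
 move=> s0 s1; have [_ k1] := sepZ b1 b2 s s0 s1 a12 c12 d12.
 have [_ k2] := sepZ b1 b3 s s0 s1 a13 c13 d13; have [_ k3] := sepZ b2 b3 s s0 s1 a23 c23 d23.
 have K i j X Y : X <= Y -> m i * m j * X <= m i * m j * Y by move=> ?; rewrite ler_pM2l// mulr_gt0.
 have := K b1 b2 _ _ k1; have := K b1 b3 _ _ k2; have := K b2 b3 _ _ k3.
 by rewrite /UU /Upot; only_lra.
have hZ s : 0 <= s -> s <= 1 -> hill (proj (segm qa qb s)).
 move=> s0 s1; apply/hill_noncol; first exact: ncZ.
 have : 11 * h <= Upot m (proj (segm qa qb s)); last by have := h_gt0; only_lra.
 apply: big; first exact: ncZ.
 rewrite rsize_proj; apply: (le_trans (hnormD m_gt0 _ _)); rewrite hnorm_cscale// -/D.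
 have : s * D <= 1 * D by rewrite ler_wpM2r.
 have : hnorm qa <= t by [].
 by move: Dt; only_lra.
(* The best weight has [sqrt 3] for 9/5. The total is [(5/3 + 9/5) / 2 * 21/20 = 91/50], below
   19/10. *)
pose kap := (x + y) / (9 / 5 * t).
have kap0 : 0 < kap by rewrite divr_gt0 ?addr_gt0 ?mulr_gt0.
pose phi (s : R) := (kap * D ^+ 2 + UU s / kap) / 2.
pose Phi (s : R) := (kap * D ^+ 2) / 2 * s + (Upot m a / kap * s + (Upot m b - Upot m a) / kap / 2 * (s * s)).
have dPhi (s : R) : is_derive s 1 Phi (phi s).
 have id1 := is_derive_id s (1 : R).
 have D1 := is_derive_scal ((kap * D ^+ 2) / 2) id1.
 have D2' := is_derive_scal (Upot m a / kap) id1.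
 have D3 := is_derive_scal ((Upot m b - Upot m a) / kap / 2) (is_derive_mul id1 id1).
 have DD := is_derive_add D1 (is_derive_add D2' D3).
 by apply: (is_derive_eq DD); rewrite /phi /UU; field; rewrite gt_eqF.
have [|L L0 HL] := @gpath_segm qa qb Phi phi hZ dPhi.
 move=> s s0 s1; have nz := ncZ s (ltW s0) (ltW s1).
 have US := UZ s (ltW s0) (ltW s1).
 have UU0 : 0 <= UU s by apply: le_trans US; exact: Upot_ge0.
 exists (sqrt (UU s)).
  by rewrite (om_noncol m h nz) lee_fin ler_wsqrtr//; have := h_gt0; move: US; only_lra.
 rewrite -/D /phi; have e : sqrt (UU s) ^+ 2 = UU s by rewrite sqr_sqrtr.
 have e1 : UU s / kap * kap = UU s by rewrite divfK// gt_eqF.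
 have F := sqr_ge0 (kap * D - sqrt (UU s)).
 rewrite -(ler_pM2r kap0).
 have -> : (kap * D ^+ 2 + UU s / kap) / 2 * kap = (kap ^+ 2 * D ^+ 2 + UU s) / 2 by rewrite -{2}e1; field; rewrite gt_eqF.
 by move: F; rewrite -{3}e; only_lra.
rewrite pa pb in HL; exists L => //; apply: gpath_le HL.
have -> : Phi 1 - Phi 0 = (kap * D ^+ 2 + (Upot m a + Upot m b) / kap) / 2 by rewrite /Phi; field; rewrite gt_eqF.
have k1 : kap * D ^+ 2 <= 5 / 3 * t * (x + y).
 apply: (@le_trans _ _ (kap * (3 * t ^+ 2))); first by rewrite ler_pM2l.
 by rewrite le_eqVlt; apply/orP; left; apply/eqP; rewrite /kap; field; rewrite gt_eqF.
have k2 : (Upot m a + Upot m b) / kap <= 9 / 5 * t * (x + y).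
 rewrite ler_pdivrMr//.
 have -> : 9 / 5 * t * (x + y) * kap = (x + y) ^+ 2 by rewrite /kap; field; rewrite gt_eqF.
 have -> : Upot m a = x ^+ 2 by rewrite sqr_sqrtr// ltW.
 have -> : Upot m b = y ^+ 2 by rewrite sqr_sqrtr// ltW.
 have := mulr_gt0 x0 y0; only_lra.
have := xo a bigA; have := xo b bigB; rewrite -/x -/y => yo xo'.
have : t * (x + y) <= t * (21 / 20 * (omr a + omr b)) by rewrite ler_pM2l//; move: yo xo'; only_lra.
have : 0 <= t * (omr a + omr b) by rewrite mulr_ge0 ?(ltW t0)// addr_ge0// sqrtr_ge0.
by move: k1 k2; only_lra.
Qed.

End TripleCollision.

(** * The competitor near a binary collision *)

Section BinaryCollision.
Implicit Types (q : config R) (z w x y : R[i]).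

Lemma normc_subsq z w : (normc z - normc w) ^+ 2 <= normc (z - w) ^+ 2.
Proof.
rewrite sqrrB !normcsq reB imB.
have H : Re z * Re w + Im z * Im w <= normc z * normc w.
 apply: ler_sqr2; first by rewrite mulr_ge0// normc_ge0'.
 by rewrite exprMn !normcsq; have := sqr_ge0 (Re z * Im w - Im z * Re w); nra.
lra.
Qed.

Inductive pair_third : 'I_3 -> 'I_3 -> 'I_3 -> Prop :=
| pair123 : pair_third b1 b2 b3 | pair132 : pair_third b1 b3 b2 | pair231 : pair_third b2 b3 b1.

(** [jmu], [jnu] and [jy] are the two reduced masses and the second Jacobi vector adapted to the
    pair [i], [j] and the third body [l]. *)
Definition jmu i j : R := m i * m j / (m i + m j).
Definition jnu i j l : R := (m i + m j) * m l / (m i + m j + m l).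
Definition jy i j l q : R[i] := q l - ((m i / (m i + m j))%:C * q i + (m j / (m i + m j))%:C * q j).

Lemma jmu_gt0 i j : 0 < jmu i j. Proof. by rewrite divr_gt0 ?mulr_gt0 ?addr_gt0. Qed.
Lemma jnu_gt0 i j l : 0 < jnu i j l. Proof. by rewrite divr_gt0 ?mulr_gt0 ?addr_gt0. Qed.

Lemma hre_jacobi i j l q : pair_third i j l ->
 hre q q = jmu i j * normc (q i - q j) ^+ 2 + jnu i j l * normc (jy i j l q) ^+ 2.
Proof.
have g1 := m_gt0 b1; have g2 := m_gt0 b2; have g3 := m_gt0 b3.
by case; rewrite !normcsq /hre /wgt /jmu /jnu /jy /sepr /sepi !ReImE /=; field;
 repeat (apply/andP; split); rewrite gt_eqF//; lra.
Qed.

(** Even after the best alignment each Jacobi vector moves by at least the change of its length. *)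
Lemma qdist_jacobi i j l q q' : pair_third i j l ->
 jmu i j * (normc (q i - q j) - normc (q' i - q' j)) ^+ 2 +
 jnu i j l * (normc (jy i j l q) - normc (jy i j l q')) ^+ 2 <= qdist m q q' ^+ 2.
Proof.
move=> T; have [u u1 <-] := qdist_align m q q'.
rewrite hnorm_sq// (hre_jacobi _ T).
have e1 : csub q (crot u q') i - csub q (crot u q') j = (q i - q j) - u * (q' i - q' j).
 by rewrite /csub /crot; ring.
have e2 : jy i j l (csub q (crot u q')) = jy i j l q - u * jy i j l q'.
 by rewrite /jy /csub /crot; ring.
rewrite e1 e2; apply: lerD; rewrite ler_pM2l ?jmu_gt0 ?jnu_gt0//.
 by have := normc_subsq (q i - q j) (u * (q' i - q' j)); rewrite normcM u1 mul1r.
by have := normc_subsq (jy i j l q) (u * jy i j l q'); rewrite normcM u1 mul1r.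
Qed.

(** The representative with Jacobi vectors [x] and [y] that has body [j] at the origin. *)
Definition jcfg (i j : 'I_3) (x y : R[i]) : config R := fun n =>
 if n == i then x else if n == j then 0 else y + (m i / (m i + m j))%:C * x.

Lemma jcfg_sep i j l x y : pair_third i j l -> jcfg i j x y i - jcfg i j x y j = x.
Proof. by case; rewrite /jcfg /= subr0. Qed.

Lemma jcfg_jy i j l x y : pair_third i j l -> jy i j l (jcfg i j x y) = y.
Proof. by case; rewrite /jy /jcfg /= mulr0 addr0 addrK. Qed.

Lemma jcfg_hnorm i j l x y : pair_third i j l ->
 hnorm (jcfg i j x y) ^+ 2 = jmu i j * normc x ^+ 2 + jnu i j l * normc y ^+ 2.
Proof. by move=> T; rewrite hnorm_sq// (hre_jacobi _ T) (jcfg_sep _ _ T) (jcfg_jy _ _ T). Qed.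

Lemma jcfgE i j l q : pair_third i j l -> forall n, q n = jcfg i j (q i - q j) (jy i j l q) n + q j.
Proof.
have nz (a b : 'I_3) : m a + m b != 0 by rewrite gt_eqF// addr_gt0.
have E (a b : 'I_3) : (m b / (m a + m b))%:C = 1 - (m a / (m a + m b))%:C :> R[i].
 by apply/eqP; rewrite eq_complex !ReImE /= subrr eqxx andbT; apply/eqP; field; exact: nz.
by case; apply: ord3_ind; rewrite /jcfg /jy /= ?E; ring.
Qed.

Lemma proj_jcfg i j l q u : pair_third i j l -> normc u = 1 ->
 proj (jcfg i j (u * (q i - q j)) (u * jy i j l q)) = proj q.
Proof.
move=> T u1; apply/esym/proj_congr/congruentP; exists u => //; exists (- (u * q j)) => n.
rewrite /crot (jcfgE q T n) [in RHS]mulrDr addrK.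
by case: T n => n; rewrite /jcfg; case: ifP => _; [|case: ifP => _|  |case: ifP => _| |case: ifP => _]; ring.
Qed.

Lemma jcfg_curve i j (x0 x1 x2 y0 y1 : R[i]) s :
 qcurve (jcfg i j x0 y0) (jcfg i j x1 y1) (jcfg i j x2 0) s =
 jcfg i j (x0 + (s%:C * x1 + (s ^+ 2)%:C * x2)) (y0 + s%:C * y1).
Proof.
apply/funext => n; rewrite /qcurve /cadd /cscale /jcfg.
by case: ifP => _; [|case: ifP => _]; ring.
Qed.

Lemma jcfg_speed i j (x1 x2 y1 : R[i]) (s : R) :
 cadd (jcfg i j x1 y1) (cscale s (jcfg i j x2 0)) = jcfg i j (x1 + s%:C * x2) y1.
Proof.
apply/funext => n; rewrite /cadd /cscale /jcfg.
by case: ifP => _; [|case: ifP => _]; ring.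
Qed.

Lemma Upot_pair i j l (p : reduced R) : pair_third i j l ->
 Upot m p = m i * m j / rsep i j p + m i * m l / rsep i l p + m j * m l / rsep j l p.
Proof.
have C a b : rsep a b p = rsep b a p by exact: sepC.
by case; rewrite /Upot ?(C b3 b2) ?(C b2 b1) ?(C b3 b1); ring.
Qed.

Lemma noncol_pair i j l (p : reduced R) : pair_third i j l ->
 noncol p <-> [/\ 0 < rsep i j p, 0 < rsep i l p & 0 < rsep j l p].
Proof.
have C a b : rsep a b p = rsep b a p by exact: sepC.
by case; rewrite /noncol ?(C b3 b2) ?(C b2 b1) ?(C b3 b1); split => -[].
Qed.

Lemma Upot_near_pair i j l p : pair_third i j l -> 0 < rsep i l p -> 0 < rsep j l p ->
 exists C d, [/\ 0 < C, 0 < d & forall p', rd p p' < d -> 0 < rsep i j p' ->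
  [/\ noncol p', m i * m j / rsep i j p' <= Upot m p' & Upot m p' <= m i * m j / rsep i j p' + C]].
Proof.
move=> T il jl; pose s := Num.min (rsep i l p) (rsep j l p) / 2.
have s0 : 0 < s by rewrite divr_gt0// lt_min il.
have mi : m i * m l / s + m j * m l / s > 0 by apply: addr_gt0; apply: divr_gt0 => //; apply: mulr_gt0.
have sl : 2 * s <= rsep i l p by rewrite /s mulrC divfK// ge_min lexx.
have sj : 2 * s <= rsep j l p by rewrite /s mulrC divfK// ge_min lexx orbT.
exists (m i * m l / s + m j * m l / s), (s / sepK m).
have Kp := sepK_gt0 m_gt0; split => //; first by rewrite divr_gt0.
move=> p' d ij'; have {}d : sepK m * rd p p' < s by rewrite mulrC -ltr_pdivlMr.
have := rsep_rd m_gt0 i l p p'; have := rsep_rd m_gt0 j l p p'; rewrite !ler_norml => /andP[_ k1] /andP[_ k2].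
have il' : s <= rsep i l p' by lra.
have jl' : s <= rsep j l p' by lra.
have il0 := lt_le_trans s0 il'; have jl0 := lt_le_trans s0 jl'.
have E a b X : s <= X -> 0 <= m a * m b / X <= m a * m b / s.
 move=> sX; have X0 := lt_le_trans s0 sX.
 apply/andP; split; first by rewrite divr_ge0 ?mulr_ge0 ?ltW.
 by rewrite ler_pM2l ?mulr_gt0// lef_pV2 ?posrE.
have /andP[? ?] := E i l _ il'; have /andP[? ?] := E j l _ jl'.
split; first exact/(noncol_pair _ T).
 by rewrite (Upot_pair _ T); lra.
by rewrite (Upot_pair _ T); lra.
Qed.

Definition cdot z w : R := Re z * Re w + Im z * Im w.

Lemma normc_segm z w (s : R) : normc (z + s%:C * (w - z)) ^+ 2 =
 (1 - s) ^+ 2 * normc z ^+ 2 + s ^+ 2 * normc w ^+ 2 + 2 * (s * (1 - s) * cdot z w).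
Proof. by rewrite !normcsq !ReImE /= /cdot; ring. Qed.

Lemma complex_root x : exists z, z ^+ 2 = x /\ normc z ^+ 2 = normc x.
Proof.
exists (sqrtc x); rewrite sqr_sqrtc; split => //.
by rewrite -{2}(sqr_sqrtc x) !expr2 normcM.
Qed.

(* The inequality behind the choice xi_1 = z^2 with z affine: the squared length
  of the competitor for the regularized metric is at most twice t^2 (1/al + 1/be)^2. *)
Lemma binary_ineq (mu nu al be P Q t : R) : 0 < al -> 0 < be -> 0 < mu -> 0 < nu -> 0 < t ->
 mu * (al ^+ 2) ^+ 2 + nu * P ^+ 2 <= t ^+ 2 -> mu * (be ^+ 2) ^+ 2 + nu * Q ^+ 2 <= t ^+ 2 ->
 4 * mu * (al ^+ 2 + be ^+ 2) + 2 * nu * (Q - P) ^+ 2 / (al * be) <= 2 * t ^+ 2 * (al^-1 + be^-1) ^+ 2.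
Proof.
move=> al0 be0 mu0 nu0 t0 HP HQ.
have ab0 : 0 < al * be by rewrite mulr_gt0.
have ab2 : 0 < (al * be) ^+ 2 by rewrite exprn_gt0.
rewrite -(ler_pM2r ab2).
have -> : (4 * mu * (al ^+ 2 + be ^+ 2) + 2 * nu * (Q - P) ^+ 2 / (al * be)) * (al * be) ^+ 2 =
 4 * mu * (al ^+ 2 + be ^+ 2) * (al * be) ^+ 2 + 2 * (al * be) * (nu * (Q - P) ^+ 2).
 by field; rewrite !gt_eqF.
have -> : 2 * t ^+ 2 * (al^-1 + be^-1) ^+ 2 * (al * be) ^+ 2 = 2 * t ^+ 2 * (al + be) ^+ 2.
 by field; rewrite !gt_eqF.
have k1 : nu * (Q - P) ^+ 2 <= 2 * (2 * t ^+ 2 - mu * (al ^+ 2) ^+ 2 - mu * (be ^+ 2) ^+ 2).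
 have : 0 <= nu * (Q + P) ^+ 2 by rewrite mulr_ge0 ?sqr_ge0// ltW.
 lra.
have k2 := ler_wpM2l (ltac:(lra) : 0 <= 2 * (al * be)) k1.
have k3 : 0 <= t ^+ 2 * (al - be) ^+ 2 by rewrite mulr_ge0 ?sqr_ge0.
have k4 : 0 <= mu * (al * be) * ((al - be) ^+ 2 * (al ^+ 2 + al * be + be ^+ 2)).
 apply: mulr_ge0; first by rewrite mulr_ge0 ?ltW.
 by apply: mulr_ge0; [exact: sqr_ge0|have := sqr_ge0 al; have := sqr_ge0 be; lra].
lra.
Qed.

Lemma rotate_onto (e y : R[i]) : normc e = 1 -> 0 < normc y ->
 exists2 u, normc u = 1 & u * y = e * (normc y)%:C.
Proof.
move=> e1 y0; have nC (r : R) : 0 <= r -> normc r%:C = r.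
 by move=> r0; rewrite /normc /= expr0n /= addr0 sqrtr_sqr ger0_norm.
have yy : conjc y * y = (normc y ^+ 2)%:C.
 by apply/eqP; rewrite eq_complex normcsq; case: (y) => v w /=; apply/andP; split; apply/eqP; ring.
have nconj : normc (conjc y) = normc y.
 by apply/eqP; rewrite -(eqrXn2 (n := 2)) ?normc_ge0'// !normcsq; case: (y) => v w /=; rewrite sqrrN.
exists (e * (conjc y * ((normc y)^-1)%:C)).
 by rewrite !normcM e1 mul1r nconj nC ?invr_ge0 ?ltW// divff// gt_eqF.
have -> : e * (conjc y * ((normc y)^-1)%:C) * y = e * (conjc y * y) * ((normc y)^-1)%:C by ring.
by rewrite yy -mulrA -rmorphM /= expr2 mulfK ?gt_eqF.
Qed.

Lemma jcfg_csub i j x y x' y' : csub (jcfg i j x y) (jcfg i j x' y') = jcfg i j (x - x') (y - y').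
Proof.
apply/funext => n; rewrite /csub /jcfg.
by case: ifP => _; [|case: ifP => _]; ring.
Qed.

Lemma proj_jcfg_rot i j l x y u : pair_third i j l -> normc u = 1 ->
 proj (jcfg i j (u * x) (u * y)) = proj (jcfg i j x y).
Proof.
by move=> T u1; rewrite -(proj_jcfg (jcfg i j x y) T u1) (jcfg_sep _ _ T) (jcfg_jy _ _ T).
Qed.

Lemma sq_convex (A B s : R) : 0 <= s -> s <= 1 -> ((1 - s) * A + s * B) ^+ 2 <= (1 - s) * A ^+ 2 + s * B ^+ 2.
Proof.
move=> s0 s1; have : 0 <= s * (1 - s) * (A - B) ^+ 2 by rewrite mulr_ge0 ?sqr_ge0// mulr_ge0// subr_ge0.
lra.
Qed.

(** Levi-Civita regularization: with first Jacobi vector [z^2], the factor [1 / |z|] from [om]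
    cancels the factor [2 |z|] of the speed, so [z] may move affinely. The other Jacobi vector keeps
    a common direction [e], its length being interpolated. *)
Lemma binary_competitor i j l p : pair_third i j l -> rsep i j p = 0 -> 0 < rsep i l p -> 0 < rsep j l p ->
 exists2 d, 0 < d & forall a b t, 0 < t -> t <= d ->
 rd p a <= t -> rd p b <= t -> noncol a -> noncol b ->
 exists2 L, 0 <= L & gpath a b L (19 / 10 * t * (omr a + omr b)).
Proof.
have mark : True by [].
move=> T pij pil pjl; have hp := h_gt0.
pose g := m i * m j; have g0 : 0 < g by rewrite mulr_gt0.
pose mu := jmu i j; have mu0 : 0 < mu := jmu_gt0 i j.
pose nu := jnu i j l; have nu0 : 0 < nu := jnu_gt0 i j l.
have [C0 [d1 [C00 d10 near]]] := Upot_near_pair T pil pjl.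
pose qp := repr p; pose rho := normc (jy i j l qp).
have xp : qp i - qp j = 0.
 by apply: eq0_normc; rewrite -[LHS]/(rsep i j p).
have rho0 : 0 < rho.
 have nz (a b : 'I_3) : m a + m b != 0 by rewrite gt_eqF// addr_gt0.
 have yE : jy i j l qp = qp l - qp j.
  have qij : qp i = qp j by apply/eqP; rewrite -subr_eq0 xp.
  rewrite /jy qij -mulrDl -rmorphD /= -mulrDl divff ?nz// mul1r.
  by [].
 by rewrite /rho yE -[normc _]/(rsep l j p) (_ : rsep l j p = rsep j l p)//; exact: sepC.
pose rm := (sqrt mu)^-1.
have rm0 : 0 < rm by rewrite invr_gt0 sqrtr_gt0.
have rm2 : mu * rm ^+ 2 = 1 by rewrite exprVn sqr_sqrtr ?ltW// divff// gt_eqF.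
(* Within this distance the third body stays away from the pair, the second Jacobi vector does not
   vanish, and the term of the pair is at least [10 C0] and [10 h]; this accounts for the factors
   11/10 below. *)
pose d := Num.min (d1 / 2) (Num.min (sqrt nu * rho / 2) (Num.min (g / (10 * C0 * rm)) (g / (10 * h * rm)))).
have d0 : 0 < d.
 rewrite !lt_min !divr_gt0 ?mulr_gt0 ?sqrtr_gt0//.
exists d => // a b t t0; rewrite !le_min => /and4P[td1 trho tC th] pa pb na nb.
have td1' : t < d1 by lra.
have trm : mu * (t * rm) ^+ 2 = t ^+ 2 by rewrite -[RHS]mulr1 -rm2; ring.
have sg0 : 0 < sqrt g by rewrite sqrtr_gt0.
have sg2 : sqrt g ^+ 2 = g by rewrite sqr_sqrtr// ltW.
have side (q : reduced R) : rd p q <= t -> noncol q -> exists z y, [/\ proj (jcfg i j (z ^+ 2) y) = q, 0 < normc z, 0 < normc y,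
  mu * (normc z ^+ 2) ^+ 2 + nu * (normc y - rho) ^+ 2 <= t ^+ 2 & sqrt g / normc z <= 11 / 10 * omr q].
 move=> dq nq; pose qq := repr q; have [z [z2 zn]] := complex_root (qq i - qq j).
 have J : mu * (normc z ^+ 2) ^+ 2 + nu * (normc (jy i j l qq) - rho) ^+ 2 <= t ^+ 2.
  have := qdist_jacobi qp qq T; rewrite xp normc0 sub0r sqrrN -zn -/mu -/nu -/rho.
  rewrite -[X in nu * X]sqrrN opprB => K; apply: (le_trans K).
  by rewrite -[qdist m qp qq]/(rd p q) ler_pXn2r// ?nnegrE ?rd_ge0// ltW.
 have zp : 0 < normc z ^+ 2.
  by rewrite zn -[normc _]/(rsep i j q); have [] := (noncol_pair q T).1 nq.
 have z0 : 0 < normc z.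
  by rewrite lt0r normc_ge0' andbT; apply/eqP => e; move: zp; rewrite e expr0n /= ltxx.
 have y0 : 0 < normc (jy i j l qq).
  have : nu * (normc (jy i j l qq) - rho) ^+ 2 <= nu * (rho / 2) ^+ 2.
   have : t ^+ 2 <= (sqrt nu * rho / 2) ^+ 2 by rewrite ler_pXn2r// ?nnegrE ?(ltW t0)// divr_ge0 ?mulr_ge0 ?sqrtr_ge0// ltW.
   have -> : (sqrt nu * rho / 2) ^+ 2 = nu * (rho / 2) ^+ 2 by rewrite -mulrA exprMn sqr_sqrtr// ltW.
   have : 0 <= mu * (normc z ^+ 2) ^+ 2 by rewrite mulr_ge0 ?sqr_ge0// ltW.
   lra.
  rewrite ler_pM2l// => K; rewrite ltNge; apply/negP => y0.
  by have := normc_ge0' (jy i j l qq); nra.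
 exists z, (jy i j l qq); split => //.
  rewrite z2 -[qq i - qq j]mul1r -[jy i j l qq]mul1r (proj_jcfg _ T (normc1 _)); exact: proj_repr.
 apply: ler_sqr2; first by rewrite mulr_ge0 ?sqrtr_ge0.
 have [_ Ug _] := near q (le_lt_trans dq td1') ltac:(by rewrite -[rsep i j q]/(normc (qq i - qq j)) -zn).
 rewrite -[rsep i j q]/(normc (qq i - qq j)) -zn -/g in Ug.
 rewrite expr_div_n sg2 exprMn.
 have zt : normc z ^+ 2 <= t * rm.
  apply: ler_sqr2; first by rewrite mulr_ge0 ?ltW.
  rewrite -(ler_pM2l mu0) trm; apply: le_trans J.
  by rewrite lerDl mulr_ge0 ?sqr_ge0// ltW.
 have gz : 10 * h <= g / normc z ^+ 2.
  rewrite ler_pdivlMr//; move: th; rewrite ler_pdivlMr ?mulr_gt0// => th.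
  have : 10 * h * normc z ^+ 2 <= 10 * h * (t * rm) by rewrite ler_pM2l// mulr_gt0.
  by move: th; only_lra.
 have o2 : omr q ^+ 2 = Upot m q - h by rewrite sqr_sqrtr//; have := h_gt0; move: gz Ug; only_lra.
 by rewrite o2; lra.
have [za [ya [Ea za0 ya0 Ja oa]]] := side a pa na.
have [zb' [yb [Eb zb0' yb0 Jb ob]]] := side b pb nb.
pose al := normc za; pose ea := normc ya; pose eb := normc yb.
pose e : R[i] := ya * (ea^-1)%:C.
have nC (r : R) : 0 <= r -> normc r%:C = r by move=> r0; rewrite /normc /= expr0n /= addr0 sqrtr_sqr ger0_norm.
have e1 : normc e = 1 by rewrite /e normcM nC ?invr_ge0 ?ltW// divff// gt_eqF.
have ye : ya = e * ea%:C.
 by rewrite /e -mulrA -rmorphM /= mulVf ?gt_eqF// mulr1.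
have [u u1 uy] := rotate_onto e1 yb0.
have [v v1 vy] := rotate_onto e1 rho0.
have [zb0 [zb0E zb0n]] := complex_root (u * zb' ^+ 2).
have zb0n' : normc zb0 = normc zb'.
 apply/eqP; rewrite -(eqrXn2 (n := 2)) ?normc_ge0'// zb0n normcM u1 mul1r expr2 normcM.
 by rewrite -expr2.
(* Of the two square roots the one at an angle of at most 90 degrees to [za] is taken: it keeps the
   affine path away from 0 and its displacement short. *)
have [zb [zb2 zbn zdot]] : exists zb, [/\ zb ^+ 2 = u * zb' ^+ 2, normc zb = normc zb' & 0 <= cdot za zb].
 have [le|lt] := leP 0 (cdot za zb0); first by exists zb0.
 exists (- zb0); split; [by rewrite sqrrN| |].
  rewrite -zb0n'; apply/eqP; rewrite -(eqrXn2 (n := 2)) ?normc_ge0'// !normcsq.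
  by case: (zb0) => r w /=; rewrite !sqrrN.
 by move: lt; rewrite /cdot; case: (zb0) => r w /=; only_lra.
rewrite -zbn in zb0' Jb ob.
have Eb' : proj (jcfg i j (zb ^+ 2) (e * eb%:C)) = b by rewrite zb2 -uy (proj_jcfg_rot _ _ T u1).
rewrite ye in Ea.
have Ep : proj (jcfg i j 0 (e * rho%:C)) = p.
 rewrite -vy -(mulr0 v) (proj_jcfg_rot _ _ T v1) -xp -[qp i - qp j]mul1r -[jy i j l qp]mul1r.
 by rewrite (proj_jcfg _ T (normc1 _)); exact: proj_repr.
pose be := normc zb.
rewrite -/al -/be -/ea -/eb in za0 zb0' ya0 yb0 Ja Jb oa ob.
pose dz := zb - za; pose De := eb - ea.
pose zs (s : R) := za + s%:C * dz; pose es (s : R) := ea + s * De.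
pose q0 := jcfg i j (za ^+ 2) (e * ea%:C); pose q1 := jcfg i j (za * dz + za * dz) (e * De%:C).
pose q2 := jcfg i j (dz ^+ 2) 0.
have CM (r r' : R) : (r * r')%:C = r%:C * r'%:C :> R[i].
 by apply/eqP; rewrite eq_complex !ReImE /= !mul0r !mulr0 subr0 addr0 !eqxx.
have CD (r r' : R) : (r + r')%:C = r%:C + r'%:C :> R[i].
 by apply/eqP; rewrite eq_complex !ReImE /= addr0 !eqxx.
have CB (r r' : R) : r%:C - r'%:C = (r - r')%:C :> R[i].
 by apply/eqP; rewrite eq_complex !ReImE /= subrr !eqxx.
have nX (z : R[i]) : normc (z ^+ 2) = normc z ^+ 2 by rewrite expr2 normcM -expr2.
have QE s : qcurve q0 q1 q2 s = jcfg i j (zs s ^+ 2) (e * (es s)%:C).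
 rewrite jcfg_curve; congr (jcfg i j _ _).
  by rewrite /zs (expr2 s) (CM s s); ring.
 by rewrite /es (CD ea (s * De)) (CM s De); ring.
have VE s : cadd q1 (cscale (2 * s) q2) = jcfg i j (zs s * dz + zs s * dz) (e * De%:C).
 rewrite jcfg_speed; congr (jcfg i j _ _).
 have -> : (2 * s)%:C = s%:C + s%:C :> R[i] by rewrite -CD; congr (_%:C); ring.
 by rewrite /zs; ring.
pose N2 s := normc (zs s) ^+ 2.
have N2E s : N2 s = (1 - s) ^+ 2 * al ^+ 2 + s ^+ 2 * be ^+ 2 + 2 * (s * (1 - s) * cdot za zb) by exact: normc_segm.
have cle : cdot za zb <= (al ^+ 2 + be ^+ 2) / 2.
 rewrite /al /be !normcsq /cdot; have := sqr_ge0 (Re za - Re zb); have := sqr_ge0 (Im za - Im zb); only_lra.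
pose ls s := (1 - s) * al + s * be.
have t1s (s : R) : 0 <= s -> s <= 1 -> 0 <= s * (1 - s) by move=> ? ?; rewrite mulr_ge0// subr_ge0.
have lowN s : 0 <= s -> s <= 1 -> ls s ^+ 2 / 2 <= N2 s.
 move=> s0 s1; have := mulr_ge0 (t1s s s0 s1) zdot; rewrite N2E /ls.
 have := sqr_ge0 ((1 - s) * al - s * be); move: (s * (1 - s) * cdot za zb) => X; only_lra.
have upN s : 0 <= s -> s <= 1 -> N2 s <= (1 - s) * al ^+ 2 + s * be ^+ 2.
 by move=> s0 s1; have := ler_wpM2l (t1s s s0 s1) cle; rewrite N2E; move: (s * (1 - s) * cdot za zb) => X; only_lra.
have ls0 s : 0 <= s -> s <= 1 -> 0 < ls s.
 by move=> s0 s1; have [] := inv_convex za0 zb0' s0 s1.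
have N20 s : 0 <= s -> s <= 1 -> 0 < N2 s.
 by move=> s0 s1; apply: lt_le_trans (lowN s s0 s1); rewrite divr_gt0// exprn_gt0// ls0.
have J s : 0 <= s -> s <= 1 -> mu * N2 s ^+ 2 + nu * (es s - rho) ^+ 2 <= t ^+ 2.
 move=> s0 s1.
 have c1 : N2 s ^+ 2 <= (1 - s) * (al ^+ 2) ^+ 2 + s * (be ^+ 2) ^+ 2.
  apply: le_trans (sq_convex _ _ s0 s1); rewrite ler_pXn2r// ?nnegrE ?upN ?(ltW (N20 s s0 s1))//.
  by rewrite addr_ge0// mulr_ge0 ?sqr_ge0// subr_ge0.
 have c2 : (es s - rho) ^+ 2 <= (1 - s) * (ea - rho) ^+ 2 + s * (eb - rho) ^+ 2.
  have -> : es s - rho = (1 - s) * (ea - rho) + s * (eb - rho) by rewrite /es /De; ring.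
  exact: sq_convex.
 have := ler_wpM2l (ltW mu0) c1; have := ler_wpM2l (ltW nu0) c2.
 have s1' : 0 <= 1 - s by rewrite subr_ge0.
 by have := ler_wpM2l s1' Ja; have := ler_wpM2l s0 Jb; only_lra.
have ds s : 0 <= s -> s <= 1 -> rd p (proj (jcfg i j (zs s ^+ 2) (e * (es s)%:C))) <= t.
 move=> s0 s1; rewrite -Ep rd_proj; apply: (@le_trans _ _ (hnorm (csub (jcfg i j 0 (e * rho%:C)) (jcfg i j (zs s ^+ 2) (e * (es s)%:C))))).
  exact: qdist_le_hnorm.
 apply: ler_sqr2; first exact: ltW.
 apply: le_trans (J s s0 s1); rewrite jcfg_csub (jcfg_hnorm _ _ T) -/mu -/nu.
 have -> : normc (0 - zs s ^+ 2) ^+ 2 = N2 s ^+ 2.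
  by rewrite sub0r normcN nX.
 rewrite -mulrBr CB normcM e1 mul1r.
 have -> : normc (rho - es s)%:C ^+ 2 = (es s - rho) ^+ 2 by rewrite normcsq /= expr0n /= addr0; ring.
 by [].
have sepQ s : rsep i j (proj (jcfg i j (zs s ^+ 2) (e * (es s)%:C))) = N2 s.
 by rewrite rsep_proj /sep (jcfg_sep _ _ T) /N2 nX.
have nrQ s : 0 <= s -> s <= 1 -> [/\ noncol (proj (jcfg i j (zs s ^+ 2) (e * (es s)%:C))),
  g / N2 s <= Upot m (proj (jcfg i j (zs s ^+ 2) (e * (es s)%:C))) &
  Upot m (proj (jcfg i j (zs s ^+ 2) (e * (es s)%:C))) <= g / N2 s + C0].
 by move=> s0 s1; have := near _ (le_lt_trans (ds s s0 s1) td1'); rewrite sepQ; apply; exact: N20.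
have Nt s : 0 <= s -> s <= 1 -> N2 s <= t * rm.
 move=> s0 s1; apply: ler_sqr2; first by rewrite mulr_ge0 ?ltW.
 rewrite -(ler_pM2l mu0) trm; apply: le_trans (J s s0 s1).
 by rewrite lerDl mulr_ge0 ?sqr_ge0// ltW.
have gN s : 0 <= s -> s <= 1 -> 10 * h <= g / N2 s /\ 10 * C0 <= g / N2 s.
 move=> s0 s1; have n0 := N20 s s0 s1; have nt := Nt s s0 s1.
 rewrite !ler_pdivlMr//; split.
  move: th; rewrite ler_pdivlMr ?mulr_gt0// => th.
  have : 10 * h * N2 s <= 10 * h * (t * rm) by rewrite ler_pM2l// mulr_gt0.
  by move: th; only_lra.
 move: tC; rewrite ler_pdivlMr ?mulr_gt0// => tC.
 have : 10 * C0 * N2 s <= 10 * C0 * (t * rm) by rewrite ler_pM2l// mulr_gt0.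
 by move: tC; only_lra.
have hQ s : 0 <= s -> s <= 1 -> hill (proj (qcurve q0 q1 q2 s)).
 move=> s0 s1; rewrite QE; have [nc lo hi] := nrQ s s0 s1; have [g1 g2] := gN s s0 s1.
 by apply/hill_noncol => //; have := h_gt0; move: lo g1; only_lra.
pose S := al^-1 + be^-1; have S0 : 0 < S by rewrite addr_gt0 ?invr_gt0.
(* The weight in the arithmetic-geometric mean inequality; 3/2 stands for [sqrt 2], since
   [binary_ineq] bounds the mean squared speed by [2 t^2 S^2]. *)
pose lam := 3 / 2 * (t * S); have lam0 : 0 < lam by rewrite !mulr_gt0.
pose XA := 4 * mu * (al ^+ 2 + be ^+ 2); pose XB := 2 * nu * De ^+ 2.
(* Half of the constant in the bound [11/10 * sqrt g / normc (zs s)] for [om]. *)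
pose c := 11 / 20 * sqrt g; have c0 : 0 < c by rewrite mulr_gt0//; lra.
pose phi s := c * lam + c * XA / lam + c * XB / lam * (ls s ^+ 2)^-1.
(* [s / (al * ls s)] is the primitive of [1 / ls^2] that vanishes at 0. *)
pose Phi s := (c * lam + c * XA / lam) * s + c * XB / lam / al * (s * (ls s)^-1).
have dls (s : R) : is_derive s 1 ls (be - al).
 have id1 := is_derive_id s (1 : R).
 have D1 := is_derive_add (is_derive_cst al s (1 : R)) (is_derive_scal (be - al) id1).
 have E : ls = (fun x : R => al + (be - al) * x) by apply/funext => x; rewrite /ls; ring.
 by rewrite E; apply: (is_derive_eq D1); rewrite add0r mulr1.
have dPhi (s : R) : 0 <= s -> s <= 1 -> is_derive s 1 Phi (phi s).
 move=> s0 s1; have id1 := is_derive_id s (1 : R); have l0 := ls0 s s0 s1.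
 have nl : ls s != 0 by rewrite gt_eqF.
 have DV : is_derive s 1 (fun x : R => (ls x)^-1) (- (ls s ^- 2) * (be - al)).
  exact: (@is_deriveV R ls s (be - al) 1 nl (dls s)).
 have D1 := is_derive_scal (c * lam + c * XA / lam) id1.
 have D2 := is_derive_scal (c * XB / lam / al) (is_derive_mul id1 DV).
 have e2 : al = ls s - s * (be - al) by rewrite /ls; ring.
 have K : s * (- (ls s ^- 2) * (be - al)) + (ls s)^-1 * 1 = al * (ls s ^+ 2)^-1.
  by rewrite {2}e2; field.
 apply: (is_derive_eq (is_derive_add D1 D2)); rewrite K /phi.
 by field; rewrite nl !gt_eqF.
have Hc : {within `[0, 1], continuous Phi}.
 apply: continuous_in_subspaceT => x; rewrite inE /= in_itv /= => /andP[x0 x1].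
 exact: is_derive_cvg (dPhi x x0 x1).
have He s : 0 < s -> s < 1 -> exists2 c', (om (proj (qcurve q0 q1 q2 s)) <= c'%:E)%E &
  c' * hnorm (cadd q1 (cscale (2 * s) q2)) <= phi s.
 move=> /ltW s0 /ltW s1; rewrite QE VE; have [nc lo hi] := nrQ s s0 s1; have [g1 g2] := gN s s0 s1.
 have n0 := N20 s s0 s1; have l0 := ls0 s s0 s1.
 have nz0 : 0 < normc (zs s).
  by rewrite lt0r normc_ge0' andbT; apply/eqP => e0; move: n0; rewrite /N2 e0 expr0n /= ltxx.
 have c'2 : (11 / 10 * sqrt g / normc (zs s)) ^+ 2 = 121 / 100 * (g / N2 s).
  by rewrite expr_div_n exprMn sg2 -/(N2 s); field; rewrite gt_eqF.
 have c'0 : 0 <= 11 / 10 * sqrt g / normc (zs s).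
  by rewrite divr_ge0 ?mulr_ge0 ?divr_ge0 ?sqrtr_ge0// ltW.
 exists (11 / 10 * sqrt g / normc (zs s)).
  rewrite (om_noncol m h nc) lee_fin; apply: ler_sqr2 => //.
  by rewrite c'2 sqr_sqrtr; have := h_gt0; move: lo hi g1 g2; only_lra.
 pose X := XA + XB * (ls s ^+ 2)^-1.
 have X0 : 0 <= X.
  apply: addr_ge0; apply: mulr_ge0; rewrite ?invr_ge0 ?sqr_ge0//.
  - by rewrite mulr_ge0// ltW.
  - by rewrite addr_ge0 ?sqr_ge0.
  - by apply: mulr_ge0; [rewrite mulr_ge0// ltW|exact: sqr_ge0].
 have pE : phi s = c * (lam + X / lam) by rewrite /phi /X; ring.
 rewrite pE; apply: ler_sqr2.
  by apply: mulr_ge0; [exact: ltW|apply: addr_ge0; [exact: ltW|apply: divr_ge0 => //; exact: ltW]].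
 rewrite exprMn c'2 (jcfg_hnorm _ _ T) -/mu -/nu.
 have -> : normc (zs s * dz + zs s * dz) ^+ 2 = 4 * (N2 s * normc dz ^+ 2).
  by rewrite /N2; move: (zs s) (dz) => a' b'; rewrite -exprMn -normcM !normcsq !ReImE; ring.
 have -> : normc (e * De%:C) ^+ 2 = De ^+ 2.
  by rewrite normcM e1 mul1r normcsq /= expr0n /= addr0.
 have d2 : normc dz ^+ 2 <= al ^+ 2 + be ^+ 2.
  rewrite /dz /al /be !normcsq !reB !imB; move: zdot; rewrite /cdot; only_lra.
 have E1 : 121 / 100 * (g / N2 s) * (mu * (4 * (N2 s * normc dz ^+ 2)) + nu * De ^+ 2) =
   121 / 100 * g * (4 * mu * normc dz ^+ 2 + nu * De ^+ 2 * (N2 s)^-1).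
  by field; rewrite gt_eqF.
 rewrite E1.
 have k1 : 4 * mu * normc dz ^+ 2 <= XA by rewrite /XA ler_pM2l// mulr_gt0.
 have k2 : nu * De ^+ 2 * (N2 s)^-1 <= XB * (ls s ^+ 2)^-1.
  have -> : XB * (ls s ^+ 2)^-1 = nu * De ^+ 2 * (ls s ^+ 2 / 2)^-1.
   by rewrite /XB; field; rewrite gt_eqF.
  apply: ler_wpM2l; first by rewrite mulr_ge0 ?sqr_ge0// ltW.
  by rewrite lef_pV2 ?posrE ?lowN// divr_gt0// exprn_gt0.
 apply: (@le_trans _ _ (121 / 100 * g * X)); first by rewrite ler_pM2l; [rewrite /X; move: k1 k2; only_lra|rewrite mulr_gt0// divr_gt0].
 have E2 : (c * (lam + X / lam)) ^+ 2 = 121 / 400 * g * ((lam - X / lam) ^+ 2 + 4 * X).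
  have -> : 121 / 400 * g = c ^+ 2 by rewrite /c exprMn sg2; field.
  by field; rewrite gt_eqF.
 rewrite E2; have := sqr_ge0 (lam - X / lam) => F.
 have := mulr_ge0 (ltW g0) F; only_lra.
have [L L0 HL] := @gpath_qcurve q0 q1 q2 1 Phi phi ler01 (lexx _) hQ Hc
 (fun s a b => dPhi s (ltW a) (ltW b)) He.
have z1 : zs 1 = zb by rewrite /zs /dz mul1r addrC subrK.
have es1 : es 1 = eb by rewrite /es /De mul1r addrC subrK.
rewrite QE z1 es1 Eb' Ea in HL; exists L => //; apply: gpath_le HL.
have l1 : ls 1 = be by rewrite /ls subrr mul0r mul1r add0r.
have -> : Phi 1 - Phi 0 = c * (lam + (XA + XB / (al * be)) / lam).
 by rewrite /Phi l1 !mulr0 mul0r mulr0; field; rewrite !gt_eqF.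
have := @binary_ineq mu nu al be (ea - rho) (eb - rho) t za0 zb0' mu0 nu0 t0 Ja Jb.
have -> : eb - rho - (ea - rho) = De by rewrite /De; ring.
rewrite -/XA -/XB -/S => Xb.
have Xl : (XA + XB / (al * be)) / lam <= 4 / 3 * (t * S).
 rewrite ler_pdivrMr//; apply: (le_trans Xb); rewrite le_eqVlt; apply/orP; left; apply/eqP.
 by rewrite /lam; field.
have gS : sqrt g * S <= 11 / 10 * (omr a + omr b) by rewrite /S mulrDr; move: oa ob; only_lra.
(* 17/6 is 3/2 + 4/3, and [11/20 * 17/6 * 11/10 = 2057/1200] is below 19/10. *)
apply: (@le_trans _ _ (c * (17 / 6 * (t * S)))).
 have lE : lam = 3 / 2 * (t * S) by [].
 by rewrite ler_pM2l//; move: Xl lE; only_lra.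
have -> : c * (17 / 6 * (t * S)) = 187 / 120 * t * (sqrt g * S) by rewrite /c; field.
have := ler_wpM2l (mulr_ge0 (divr_ge0 (ler0n R 187) (ler0n R 120)) (ltW t0) : 0 <= 187 / 120 * t) gS.
have : 0 <= t * (omr a + omr b) by apply: mulr_ge0; [exact: ltW|apply: addr_ge0; exact: sqrtr_ge0].
only_lra.
Qed.

End BinaryCollision.

End Paths.

(** * Lifting a curve of the reduced space to centered configurations *)

Section HorizontalLift.
Context {R : realType}.
Variable m : 'I_3 -> R.
Hypothesis m_gt0 : forall i, 0 < m i.
Local Notation proj := (@reduced_proj R).
Local Notation rd := (rd m).
Local Notation hnorm := (hnorm m).

Lemma align_to (q : config R) (p : reduced R) : exists q', proj q' = p /\ hnorm (csub q q') = rd (proj q) p.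
Proof.
have [u u1 e] := qdist_align m q (repr p); exists (crot u (repr p)); split.
 rewrite -[RHS]proj_repr; apply/esym/proj_congr/congruentP; exists u => //.
 by exists 0 => i; rewrite addr0.
by rewrite e -rd_proj proj_repr.
Qed.

Lemma hnorm_csub_triangle (q p r : config R) : hnorm (csub q r) <= hnorm (csub q p) + hnorm (csub p r).
Proof.
have -> : csub q r = cadd (csub q p) (csub p r) by apply/funext => i; rewrite /cadd /csub addrA subrK.
exact: hnormD.
Qed.

Lemma proj_translate (q : config R) c : proj (fun i => q i - c) = proj q.
Proof.
apply/esym/proj_congr/asboolP; exists 1, (- c); split; first exact: normc1.
by move=> i; rewrite mul1r.
Qed.

Lemma sum3E (T : nmodType) (F : 'I_3 -> T) : \sum_(i < 3) F i = F b1 + F b2 + F b3.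
Proof. by rewrite !big_ord_recr big_ord0 /= add0r; congr (F _ + F _ + F _); apply: val_inj. Qed.

Lemma centered_coord (X : config R) : \sum_(i < 3) (m i)%:C * X i = 0 ->
 m b1 * Re (X b1) + m b2 * Re (X b2) + m b3 * Re (X b3) = 0 /\
 m b1 * Im (X b1) + m b2 * Im (X b2) + m b3 * Im (X b3) = 0.
Proof.
rewrite sum3E => c0; split.
 by have := congr1 (@complex.Re R) c0; rewrite !reD !reZ.
by have := congr1 (@complex.Im R) c0; rewrite !imD !imZ.
Qed.

Lemma coord_b3 (X : config R) : \sum_(i < 3) (m i)%:C * X i = 0 ->
 Re (X b3) = - (m b1 * Re (X b1) + m b2 * Re (X b2)) / m b3 /\
 Im (X b3) = - (m b1 * Im (X b1) + m b2 * Im (X b2)) / m b3.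
Proof.
move=> /centered_coord[r0 i0]; have m3 : m b3 != 0 by rewrite gt_eqF.
by split; apply: (mulfI m3); rewrite [RHS]mulrC divfK//; lra.
Qed.

Definition centroid (q : config R) : R[i] :=
 ((m b1)%:C * q b1 + (m b2)%:C * q b2 + (m b3)%:C * q b3) * ((m b1 + m b2 + m b3)^-1)%:C.

Definition centered (q : config R) : config R := fun i => q i - centroid q.

Lemma centered_sum (q : config R) : \sum_(i < 3) (m i)%:C * centered q i = 0.
Proof.
have M0 : m b1 + m b2 + m b3 != 0 by rewrite gt_eqF// !addr_gt0.
rewrite sum3E /centered; set M := m b1 + m b2 + m b3 in M0 *.
have MC : (m b1)%:C + (m b2)%:C + (m b3)%:C = M%:C by rewrite !rmorphD.
have MV : M%:C * (M^-1)%:C = 1 :> R[i] by rewrite -rmorphM /= divff.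
set S := (m b1)%:C * q b1 + (m b2)%:C * q b2 + (m b3)%:C * q b3.
have -> : (m b1)%:C * (q b1 - centroid q) + (m b2)%:C * (q b2 - centroid q) + (m b3)%:C * (q b3 - centroid q) =
 S - ((m b1)%:C + (m b2)%:C + (m b3)%:C) * centroid q by rewrite /S; ring.
by rewrite MC /centroid -/S -/M mulrCA MV mulr1 subrr.
Qed.

Lemma hnorm_translate (q p : config R) c d : hnorm (csub (fun i => q i - c) (fun i => p i - d)) = hnorm (csub q p).
Proof. by congr (sqrt _); rewrite /hre /sepr /sepi /csub !ReImE; ring. Qed.

(** On a grid of mesh [2^-n] each representative is aligned with the previous one, so the steps
    upstairs are as short as those downstairs. The limit along an ultrafilter is a lift that is
    still 1-Lipschitz, which is the horizontality used later. *)
Lemma horizontal_lift k : lip1 m k -> exists Q : R -> config R,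
 [/\ (forall s t, 0 <= s -> s <= t -> hnorm (csub (Q s) (Q t)) <= t - s),
   (forall t, 0 <= t -> proj (Q t) = k t) &
   forall t, \sum_(i < 3) (m i)%:C * Q t i = 0].
Proof.
move=> klip.
have /choice[F HF] : forall qp : config R * reduced R, exists q', proj q' = qp.2 /\ hnorm (csub qp.1 q') = rd (proj qp.1) qp.2.
 by move=> [q p]; exact: align_to.
have p2 n : 0 < (2 ^+ n : R)^-1 by rewrite invr_gt0 exprn_gt0.
pose x (n i : nat) : R := i%:R * (2 ^+ n)^-1.
pose c n := fix c (i : nat) : config R := if i is i'.+1 then F (c i', k (x n i)) else repr (k 0).
have cproj n i : proj (c n i) = k (x n i).
 case: i => [|i] /=; first by rewrite proj_repr /x mul0r.
 by have [] := HF (c n i, k (x n i.+1)).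
have cstep n i : hnorm (csub (c n i) (c n i.+1)) <= (2 ^+ n)^-1.
 have [_ /= ->] := HF (c n i, k (x n i.+1)); rewrite cproj; apply: (le_trans (klip _ _ _)).
  by rewrite /x ler_pM2r// ler_nat.
 by rewrite /x -mulrBl -natrB// subSnn mul1r.
have cdist n i j : (i <= j)%N -> hnorm (csub (c n i) (c n j)) <= (j - i)%:R * (2 ^+ n)^-1.
 move=> ij; rewrite -{1}(subnKC ij); elim: (j - i)%N => [|l IH].
  rewrite addn0 mul0r; have -> : csub (c n i) (c n i) = cscale 0 (c n i).
   by apply/funext => a; rewrite /csub /cscale subrr; apply/eqP; rewrite eq_complex !ReImE /= !mul0r subr0 addr0 !eqxx.
  by rewrite hnorm_cscale// mul0r.
 apply: (le_trans (hnorm_csub_triangle _ (c n (i + l)%N) _)).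
 rewrite addnS; have := cstep n (i + l)%N; have -> : l.+1%:R = l%:R + 1 :> R by rewrite -natr1.
 by rewrite mulrDl mul1r; lra.
pose fl n (t : R) := Num.truncn (t * 2 ^+ n).
have flP n t : 0 <= t -> x n (fl n t) <= t /\ t < x n (fl n t) + (2 ^+ n)^-1.
 move=> t0; have e2 : 0 < (2 ^+ n : R) by rewrite exprn_gt0.
 have := @truncn_itv R (t * 2 ^+ n) ltac:(by rewrite mulr_ge0// ltW); rewrite -/(fl n t) => /andP[h1 h2].
 split; first by rewrite /x ler_pdivrMr.
 by rewrite /x -{2}[(2 ^+ n)^-1]mul1r -mulrDl natr1 ltr_pdivlMr.
(* Body 1 is put at the origin, so that all coordinates stay bounded. *)
pose q n t : config R := fun i => c n (fl n t) i - c n (fl n t) b1.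
have [U UF UN] := ultra_nat; have FF : ProperFilter U := @ultra_proper _ _ UF.
have small (e : R) : 0 < e -> U [set n | (2 ^+ n)^-1 < e].
 by move=> e0; have [N HN] := pow2_small e0; apply: filterS (UN N) => n /= Nn; exact: HN.
have qproj n t : proj (q n t) = k (x n (fl n t)) by rewrite /q proj_translate cproj.
have qk n t : 0 <= t -> rd (proj (q n t)) (k t) <= (2 ^+ n)^-1.
 move=> t0; have [h1 h2] := flP n t t0; rewrite qproj.
 by apply: (le_trans (klip _ _ h1)); lra.
have qq n s t : 0 <= s -> s <= t -> hnorm (csub (q n s) (q n t)) <= t - s + (2 ^+ n)^-1.
 move=> s0 st; have [a1 a2] := flP n s s0; have [a3 a4] := flP n t (le_trans s0 st).
 have ij : (fl n s <= fl n t)%N.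
  by apply: le_truncn; rewrite ler_wpM2r// exprn_ge0.
 rewrite /q hnorm_translate; apply: (le_trans (cdist n _ _ ij)).
 rewrite natrB// mulrBl -/(x n (fl n s)) -/(x n (fl n t)); lra.
have Kp := sepK_gt0 m_gt0.
have qb n t i : 0 <= t -> `|Re (q n t i)| <= sepK m * (rsize m (k 0) + t) /\
  `|Im (q n t i)| <= sepK m * (rsize m (k 0) + t).
 move=> t0; have [a1 a2] := flP n t t0.
 have x0 : 0 <= x n (fl n t) by rewrite /x mulr_ge0// ltW.
 have B : sepK m * hnorm (c n (fl n t)) <= sepK m * (rsize m (k 0) + t).
  rewrite ler_pM2l// -[hnorm _]rsize_proj cproj.
  by apply: (le_trans (size_along m_gt0 klip (erefl _) x0)); rewrite lerD2l.
 rewrite /q reB imB; split; apply: le_trans B.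
  apply: le_trans (sep_le_hnorm m_gt0 _ i b1); exact: (abs_sepr (c n (fl n t)) i b1).
 apply: le_trans (sep_le_hnorm m_gt0 _ i b1); exact: (abs_sepi (c n (fl n t)) i b1).
have lims (ti : R * 'I_3) : exists z : R[i], 0 <= ti.1 -> forall e, 0 < e ->
  U [set n | `|Re (q n ti.1 ti.2 - z)| < e /\ `|Im (q n ti.1 ti.2 - z)| < e].
 case: ti => t i /=; have [t0|t0] := leP 0 t; last by exists 0.
 have [lr Hr] := @ultra_lim R nat U UF (fun n => Re (q n t i)) (sepK m * (rsize m (k 0) + t))
  ltac:(by apply: filterE => n /=; exact: (qb n t i t0).1).
 have [li Hi] := @ultra_lim R nat U UF (fun n => Im (q n t i)) (sepK m * (rsize m (k 0) + t))
  ltac:(by apply: filterE => n /=; exact: (qb n t i t0).2).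
 exists (lr +i* li) => _ e e0; apply: filterS (filterI (Hr e e0) (Hi e e0)) => n [/= r1 r2].
 by rewrite reB imB.
have [Z HZ] := choice lims.
pose Q0 t : config R := fun i => Z (t, i).
have hK0 : 0 <= hK m by exact: sqrtr_ge0.
have Q0lim t e : 0 <= t -> 0 < e -> U [set n | hnorm (csub (q n t) (Q0 t)) < e].
 move=> t0 e0; pose e' := e / (hK m + 1).
 have e'0 : 0 < e' by rewrite divr_gt0//; lra.
 have FA i := HZ (t, i) t0 e' e'0.
 apply: filterS (filterI (FA b1) (filterI (FA b2) (FA b3))) => n [h1 [h2 h3]] /=.
 apply: (@le_lt_trans _ _ (hK m * e')).
  apply: (hnorm_le_coord m_gt0 (ltW e'0)); rewrite /csub /Q0.
  by apply: ord3_ind; split; apply/ltW; [exact: h1.1|exact: h1.2|exact: h2.1|exact: h2.2|exact: h3.1|exact: h3.2].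
 by rewrite /e' mulrA ltr_pdivrMr; [nra|lra].
have hsym (a b : config R) : hnorm (csub a b) = hnorm (csub b a).
 by congr (sqrt _); rewrite /hre /sepr /sepi /csub !ReImE; ring.
exists (fun t => centered (Q0 t)); split.
- move=> s t s0 st; rewrite /centered hnorm_translate; have t0 := le_trans s0 st.
 apply/ler_addgt0Pr => e e0; have e30 : 0 < e / 3 by rewrite divr_gt0.
 have [n [/= n1 [n2 n3]]] := filter_ex (filterI (Q0lim s _ s0 e30) (filterI (Q0lim t _ t0 e30) (small _ e30))).
 have := hnorm_csub_triangle (Q0 s) (q n s) (Q0 t); have := hnorm_csub_triangle (q n s) (q n t) (Q0 t).
 by have := qq n s t s0 st; rewrite (hsym (Q0 s) (q n s)); move: n1 n2 n3 => /=; lra.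
- move=> t t0; rewrite /centered proj_translate; apply: (rd_eq0 m_gt0); apply/eqP; rewrite eq_le rd_ge0 andbT.
 apply/ler_addgt0Pr => e e0; have e30 : 0 < e / 2 by rewrite divr_gt0.
 have [n [/= n1 n2]] := filter_ex (filterI (Q0lim t _ t0 e30) (small _ e30)).
 have := rd_triangle m_gt0 (proj (Q0 t)) (proj (q n t)) (k t).
 have : rd (proj (Q0 t)) (proj (q n t)) <= hnorm (csub (q n t) (Q0 t)).
  by rewrite rdC rd_proj; exact: qdist_le_hnorm.
 by have := qk n t t0; move: n1 n2 => /=; lra.
- by move=> t; exact: centered_sum.
Qed.

End HorizontalLift.

(** * Antiderivatives, midpoint identities and finiteness of time *)

Section RealCalculus.
Context {R : realType}.
Local Notation mu := (@lebesgue_measure R).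

Lemma small_factor (A c b : R) : 0 < A -> 0 < c -> 0 < b -> exists2 e, 0 < e & e <= b /\ e * c <= A.
Proof.
move=> A0 c0 b0; exists (Num.min b (A / c)); first by rewrite lt_min b0 divr_gt0.
by rewrite -ler_pdivlMr// !ge_min !lexx orbT.
Qed.

Lemma mean_value (f df : R -> R) (x y : R) : x <= y ->
 (forall t : R, x <= t -> t <= y -> is_derive t 1 f (df t)) ->
 exists c : R, [/\ x <= c, c <= y & f y - f x = df c * (y - x)].
Proof.
move=> xy D; have [|| c /itvP cI E] := @MVT_segment R f df x y xy.
- by move=> t /itvP tI; apply: D; rewrite tI.
- apply: continuous_in_subspaceT => t /set_mem /=; rewrite in_itv /= => /andP[xt ty].
 exact: is_derive_cvg (D t xt ty).
by exists c; rewrite !cI.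
Qed.

Lemma derive_nondecreasing (f df : R -> R) (x y : R) : x <= y ->
 (forall t : R, x <= t -> t <= y -> is_derive t 1 f (df t) /\ 0 <= df t) -> f x <= f y.
Proof.
move=> xy H; have [c [xc cy E]] := mean_value xy (fun t a b => (H t a b).1).
by rewrite -subr_ge0 E mulr_ge0 ?subr_ge0//; have [] := H c xc cy.
Qed.

Lemma derive_increasing (f df : R -> R) (x y : R) : x < y ->
 (forall t : R, x <= t -> t <= y -> is_derive t 1 f (df t) /\ 0 < df t) -> f x < f y.
Proof.
move=> xy H; have [c [xc cy E]] := mean_value (ltW xy) (fun t a b => (H t a b).1).
by rewrite -subr_gt0 E mulr_gt0 ?subr_gt0//; have [] := H c xc cy.
Qed.

Lemma increment_unique (f g df : R -> R) (a b : R) :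
 (forall x : R, Num.min a b <= x -> x <= Num.max a b -> is_derive x 1 f (df x) /\ is_derive x 1 g (df x)) ->
 f b - f a = g b - g a.
Proof.
have W (c d : R) : c <= d -> (forall x : R, c <= x -> x <= d -> is_derive x 1 f (df x) /\ is_derive x 1 g (df x)) ->
  f d - f c = g d - g c.
 move=> cd H; have [x cx xd|e [_ _]] := mean_value (f := fun y => f y - g y) (df := fun x => df x - df x) cd.
  by have [? ?] := H x cx xd; exact: is_derive_sub.
 by rewrite subrr mul0r; lra.
have [ab|ba] := leP a b => H; first exact: W.
by have := W b a (ltW ba) H; lra.
Qed.

(** [F] may be unbounded near the ends, so the integral is formed on a segment around [c] that
    depends on the point; [increment_unique] shows that the choices agree. *)
Lemma antiderivative (F : R -> R) (p q : R) : p < q ->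
 (forall x : R, p < x -> x < q -> {for x, continuous F}) ->
 exists T : R -> R, forall x : R, p < x -> x < q -> is_derive x 1 T (F x).
Proof.
move=> pq Fc; pose c := (p + q) / 2; have pc : p < c by rewrite /c; lra.
have cq : c < q by rewrite /c; lra.
pose al (x : R) := (p + Num.min x c) / 2; pose be (x : R) := (q + Num.max x c) / 2.
have alP (x : R) : p < x -> [/\ p < al x, al x < x & al x < c].
 move=> px; have : Num.min x c <= x by rewrite ge_min lexx.
 have : Num.min x c <= c by rewrite ge_min lexx orbT.
 have : p < Num.min x c by rewrite lt_min px.
 by rewrite /al; split; lra.
have beP (x : R) : x < q -> [/\ be x < q, x < be x & c < be x].
 move=> xq; have : x <= Num.max x c by rewrite le_max lexx.
 have : c <= Num.max x c by rewrite le_max lexx orbT.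
 have : Num.max x c < q by rewrite gt_max xq.
 by rewrite /be; split; lra.
pose A (x y : R) : R := (\int[mu]_(t in `[al x, y]) F t)%R.
have AP (x y : R) : p < x -> x < q -> al x < y -> y < be x -> is_derive y 1 (A x) (F y).
 move=> px xq ay yb; have [a1 a2 a3] := alP x px; have [e1 e2 e3] := beP x xq.
 have Fi : mu.-integrable `[al x, be x] (EFin \o F).
  apply: continuous_compact_integrable; first exact: segment_compact.
  apply: continuous_in_subspaceT => z /set_mem /=; rewrite in_itv /= => /andP[az zb].
  by apply: Fc; lra.
 have [d e] := continuous_FTC1_closed yb Fi ay (Fc y ltac:(lra) ltac:(lra)).
 by rewrite -e; exact: derivable_is_derive.
exists (fun x => A x x - A x c) => x px xq.
have [a1 a2 a3] := alP x px; have [e1 e2 e3] := beP x xq.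
have near_in : \forall y \near x, al x < y /\ y < be x.
 by near=> y; split; near: y; [exact: lt_nbhsr|exact: lt_nbhsl].
apply: (@is_derive_near R (fun y => A x y - A x c)).
 apply: filterS near_in => y [ay yb].
 have py : p < y by lra. have yq : y < q by lra.
 have [a1' a2' a3'] := alP y py; have [e1' e2' e3'] := beP y yq.
 apply: (@increment_unique _ _ F) => z; rewrite ge_min le_max => h1 h2.
 have z1 : al x < z by case/orP: h1; lra.
 have z2 : al y < z by case/orP: h1; lra.
 have z3 : z < be x by case/orP: h2; lra.
 have z4 : z < be y by case/orP: h2; lra.
 by split; exact: AP.
have := is_derive_sub (AP x x px xq a2 e2) (is_derive_cst (A x c) x 1).
by rewrite subr0.
Unshelve. all: by end_near.
Qed.

(** Strong differentiability, from continuity of the derivative: the small intervals that occur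
    later lie near [s] without containing it. *)
Lemma strong_difference (f df : R -> R) (p q s k : R) : p < s -> s < q ->
 (forall x : R, p < x -> x < q -> is_derive x 1 f (df x)) -> {for s, continuous df} -> 0 < k ->
 exists2 e, 0 < e & forall x y : R, s - e < x -> x <= y -> y < s + e ->
  `|f y - f x - df s * (y - x)| <= k * (y - x).
Proof.
move=> ps sq fd dc k0.
have := dc _ (nbhsx_ballx (df s) k k0) => /nbhs_ballP[d /= d0 Hd].
pose e := Num.min d (Num.min (s - p) (q - s)).
have e0 : 0 < e by rewrite !lt_min d0 !subr_gt0 ps.
have : e <= e by []; rewrite {2}/e !le_min => /andP[ed /andP[e1 e2]].
exists e => // x y sx xy ys.
have D (z : R) : x <= z -> z <= y -> is_derive z 1 f (df z) by move=> xz zy; apply: fd; lra.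
have [z [zx zy E]] := mean_value xy D.
rewrite E -mulrBl normrM (ger0_norm (x := y - x)) ?subr_ge0// ler_wpM2r ?subr_ge0//.
have : ball s d z by rewrite /ball /= ltr_norml; split_lra.
by move=> /Hd; rewrite /= /ball /= distrC => /ltW.
Qed.

(** Subtract the chord and suppose the maximum positive. Reflecting the nearer end at the maximum
    point, the two values average to the maximum, although one is 0 and the other at most the
    maximum. *)
Lemma three_point_affine (x : R -> R) (a b s : R) : a < b -> a <= s -> s <= b ->
 (forall t : R, a <= t -> t <= b -> {for t, continuous x}) ->
 (forall t r : R, 0 < r -> a <= t - r -> t + r <= b -> x (t + r) + x (t - r) = 2 * x t) ->
 x s <= x a + (x b - x a) / (b - a) * (s - a).
Proof.
move=> ab as_ sb xc xm; pose g := (x b - x a) / (b - a).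
pose y (t : R) := x t - (x a + g * (t - a)).
have ya : y a = 0 by rewrite /y; ring.
have yb : y b = 0 by rewrite /y /g divfK ?subr_eq0 ?gt_eqF//; ring.
have yc : {within `[a, b], continuous y}.
 apply: continuous_in_subspaceT => z /set_mem /=; rewrite in_itv /= => /andP[az zb].
 apply: cvgB; first exact: xc.
 apply: cvgD; first exact: cvg_cst.
 by apply: cvgM; [exact: cvg_cst|apply: cvgB; [exact: cvg_id|exact: cvg_cst]].
have [c /itvP cab M] := EVT_max (ltW ab) yc.
have ac : a <= c by rewrite cab. have cb : c <= b by rewrite cab.
have Ms (t : R) : a <= t -> t <= b -> y t <= y c by move=> at_ tb; apply: M; rewrite in_itv /= at_.
suff : y c <= 0 by have := Ms s as_ sb; rewrite /y -/g; lra.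
rewrite leNgt; apply/negP => yc0.
have ac' : a < c by rewrite lt_neqAle ac andbT; apply/eqP => e; move: yc0; rewrite -e ya ltxx.
have cb' : c < b by rewrite lt_neqAle cb andbT; apply/eqP => e; move: yc0; rewrite e yb ltxx.
have ym r : 0 < r -> a <= c - r -> c + r <= b -> y (c + r) + y (c - r) = 2 * y c.
 by move=> r0 h1 h2; have := xm c r r0 h1 h2; rewrite /y; lra.
have [h|h] := leP (c - a) (b - c).
 have := ym (c - a) ltac:(lra) ltac:(lra) ltac:(lra).
 have -> : c - (c - a) = a by ring.
 by rewrite ya; have := Ms (c + (c - a)) ltac:(lra) ltac:(lra); lra.
have := ym (b - c) ltac:(lra) ltac:(lra) ltac:(lra).
have -> : c + (b - c) = b by ring.
by rewrite yb; have := Ms (c - (b - c)) ltac:(lra) ltac:(lra); lra.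
Qed.

Lemma midpoint_affine (x : R -> R) (p q : R) : p < q ->
 (forall t : R, p < t -> t < q -> {for t, continuous x}) ->
 (forall t r : R, 0 < r -> p < t - r -> t + r < q -> x (t + r) + x (t - r) = 2 * x t) ->
 exists u v : R, forall s, p < s -> s < q -> x s = u * s + v.
Proof.
move=> pq xc xm.
have K (a b s : R) : p < a -> a < b -> b < q -> a <= s -> s <= b ->
  x s = x a + (x b - x a) / (b - a) * (s - a).
 move=> pa ab bq as_ sb; apply/eqP; rewrite eq_le; apply/andP; split.
  apply: three_point_affine => //.
   by move=> t at_ tb; apply: xc; lra.
  by move=> t r r0 h1 h2; apply: xm => //; lra.
 have := @three_point_affine (fun t => - x t) a b s ab as_ sb _ _.
 have -> : - x a + (- x b - - x a) / (b - a) * (s - a) = - (x a + (x b - x a) / (b - a) * (s - a)) by ring.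
 rewrite lerN2; apply.
  by move=> t at_ tb; apply: cvgN; apply: xc; lra.
 by move=> t r r0 h1 h2; have := xm t r r0 ltac:(lra) ltac:(lra); lra.
have K3 (a b s : R) : p < a -> a < b -> b < q -> a <= s -> s <= b -> (x s - x a) * (b - a) = (x b - x a) * (s - a).
 move=> pa ab bq as_ sb; rewrite (K a b s pa ab bq as_ sb).
 by field; rewrite subr_eq0 gt_eqF.
pose c := p + (q - p) / 3; pose d := p + 2 * (q - p) / 3.
have pc : p < c by rewrite /c; lra. have cd : c < d by rewrite /c /d; lra. have dq : d < q by rewrite /d; lra.
exists ((x d - x c) / (d - c)), (x c - (x d - x c) / (d - c) * c) => s ps sq.
have dc0 : d - c != 0 by rewrite subr_eq0 gt_eqF.
apply: (mulIf dc0).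
have -> : ((x d - x c) / (d - c) * s + (x c - (x d - x c) / (d - c) * c)) * (d - c) =
 (x d - x c) * (s - c) + x c * (d - c) by field.
have [sc|cs] := ltP s c; first by have := K3 s d c ps ltac:(lra) dq ltac:(lra) ltac:(lra); lra.
have [sd|ds] := leP s d; first by have := K3 c d s pc cd dq cs sd; lra.
by have := K3 c s d pc ltac:(lra) sq ltac:(lra) ltac:(lra); lra.
Qed.

Lemma mono_surj_continuous (f : R -> R) (lo hi : R) :
 (forall s t, s <= t -> f s <= f t) -> (forall t, lo <= f t /\ f t <= hi) ->
 (forall y, lo <= y -> y <= hi -> exists t, f t = y) -> continuous f.
Proof.
move=> fm fb fs t; apply/cvgrPdist_lt => e e0.
have low : \forall s \near t, f t - e < f s.
 have [h|h] := ltP (f t - e) lo.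
  by apply: filterE => s; apply: lt_le_trans h _; exact: (fb s).1.
 have [u fu] := fs (f t - e / 2) ltac:(lra) ltac:(have := (fb t).2; lra).
 have ut : u < t by rewrite ltNge; apply/negP => /fm; lra.
 near=> s; have us : u <= s by apply: ltW; near: s; exact: lt_nbhsr.
 by have := fm _ _ us; lra.
have high : \forall s \near t, f s < f t + e.
 have [h|h] := ltP hi (f t + e).
  by apply: filterE => s; apply: le_lt_trans h; exact: (fb s).2.
 have [u fu] := fs (f t + e / 2) ltac:(have := (fb t).1; lra) ltac:(lra).
 have ut : t < u by rewrite ltNge; apply/negP => /fm; lra.
 near=> s; have us : s <= u by apply: ltW; near: s; exact: lt_nbhsl.
 by have := fm _ _ us; lra.
apply: filterS (filterI low high) => s [h1 h2]; rewrite ltr_norml; split_lra.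
Unshelve. all: by end_near.
Qed.

(** [J] is the action still to come. Since [om] is at least of order [J^(1/3)], the time element is
    at most of order [J^(-2/3) dJ], which is integrable at 0. *)
Lemma finite_time (L h B : R) (om J T : R -> R) : 0 < L -> 0 < h -> 0 < B ->
 (forall t : R, 0 < t -> t < L -> [/\ 0 < om t, 0 <= J t, h * J t <= B * om t ^+ 3,
   is_derive t 1 J (- om t) & is_derive t 1 T (sqrt 2 * om t)^-1]) ->
 exists M, forall t, 0 < t -> t < L -> T t <= M.
Proof.
move=> L0 h0 B0 H; pose c0 := L / 2.
have c0L : c0 < L by rewrite /c0; lra. have c00 : 0 < c0 by rewrite /c0; lra.
(* A fourth root instead of a cube root: for bounded [J], a lower bound for [om^2] of order
   [J^(2/3)] implies one of order [J^(3/4)], and [J^(-3/4) dJ] is [4 dG]. *)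
pose G (t : R) := sqrt (sqrt (J t)).
have Jp t : 0 < t -> t < L -> 0 < J t.
 move=> t0 tL; have [_ J0 _ _ _] := H ((t + L) / 2) ltac:(lra) ltac:(lra); apply: (le_lt_trans J0).
 rewrite -ltrN2; apply: (derive_increasing (f := fun t => - J t) (df := fun t => - - om t)); first lra.
 move=> z tz zt; have [wz _ _ D _] := H z ltac:(lra) ltac:(lra); rewrite {2}opprK; split => //.
 exact: (@is_deriveN R R R J z 1 _ D).
have G4 t : 0 < t -> t < L -> 0 < G t /\ G t ^+ 4 = J t.
 move=> t0 tL; have J0 := Jp t t0 tL; split; first by rewrite !sqrtr_gt0.
 by rewrite -[4%N]/(2 * 2)%N exprM !sqr_sqrtr// ?sqrtr_ge0// ltW.
have s20 : 0 < sqrt 2 :> R by rewrite sqrtr_gt0.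
have Gd t : 0 < t -> t < L -> is_derive t 1 G (- om t / (4 * G t ^+ 3)).
 move=> t0 tL; have [pm0 _ _ Jd _] := H t t0 tL; have J0 := Jp t t0 tL; have [Gp _] := G4 t t0 tL.
 have S0 : 0 < sqrt (J t) by rewrite sqrtr_gt0.
 have D1 : is_derive t 1 (fun t => sqrt (J t)) ((2 * sqrt (J t))^-1 * (- om t)).
  have := @is_derive1_comp R (@Num.sqrt R) J t _ _ (is_derive_sqrt J0) Jd.
  by [].
 have D2 := @is_derive1_comp R (@Num.sqrt R) (fun t => sqrt (J t)) t _ _ (is_derive_sqrt S0) D1.
 suff -> : - om t / (4 * G t ^+ 3) = (2 * sqrt (sqrt (J t)))^-1 * ((2 * sqrt (J t))^-1 * (- om t)) by exact: D2.
 rewrite -/(G t); have -> : sqrt (J t) = G t ^+ 2 by rewrite /G sqr_sqrtr// sqrtr_ge0.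
 by field; rewrite gt_eqF.
have Tm s t : 0 < s -> s <= t -> t < L -> T s <= T t.
 move=> s0 st tL; apply: (derive_nondecreasing (df := fun t => (sqrt 2 * om t)^-1) st) => z sz zt.
 have [pm0 _ _ _ D] := H z ltac:(lra) ltac:(lra).
 by split; rewrite // invr_ge0 mulr_ge0// ltW.
have Gm s t : 0 < s -> s <= t -> t < L -> G t <= G s.
 move=> s0 st tL; rewrite -lerN2.
 apply: (derive_nondecreasing (f := fun t => - G t) (df := fun t => - (- om t / (4 * G t ^+ 3))) st) => z sz zt.
 have [pm0 _ _ _ _] := H z ltac:(lra) ltac:(lra); have [Gp _] := G4 z ltac:(lra) ltac:(lra).
 split; first by have := @is_deriveN R R R G z 1 _ (Gd z ltac:(lra) ltac:(lra)).
 by rewrite mulNr opprK divr_ge0// ?mulr_ge0 ?exprn_ge0// ltW.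
have [g00 _] := G4 c0 c00 c0L; pose g0 := G c0.
have cb0 : 0 < B ^+ 2 * g0 by rewrite mulr_gt0// exprn_gt0.
have [c cp [c1 c2']] := small_factor (exprn_gt0 2 h0) cb0 ltr01.
have c2 : B ^+ 2 * (c * g0) <= h ^+ 2 by lra.
have key t : c0 <= t -> t < L -> c * G t ^+ 3 <= om t ^+ 2.
 move=> ct tL; have t0 : 0 < t by lra.
 have [pm0 _ hJ _ _] := H t t0 tL; have [Gp E] := G4 t t0 tL; have Gle := Gm c0 t c00 ct tL.
 rewrite leNgt; apply/negP => lt; rewrite -E in hJ.
 have l1 : (om t ^+ 2) ^+ 3 < (c * G t ^+ 3) ^+ 3 by rewrite ltr_pXn2r// nnegrE ?sqr_ge0// mulr_ge0 ?exprn_ge0// ltW.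
 have l2 : (h * G t ^+ 4) ^+ 2 <= (B * om t ^+ 3) ^+ 2.
  by rewrite lerXn2r// nnegrE mulr_ge0 ?exprn_ge0// ltW.
 have l3 : (B * om t ^+ 3) ^+ 2 < B ^+ 2 * (c * G t ^+ 3) ^+ 3.
  have -> : (B * om t ^+ 3) ^+ 2 = B ^+ 2 * (om t ^+ 2) ^+ 3 by ring.
  by rewrite ltr_pM2l// exprn_gt0.
 have := le_lt_trans l2 l3.
 have -> : (h * G t ^+ 4) ^+ 2 = G t ^+ 8 * h ^+ 2 by ring.
 have -> : B ^+ 2 * (c * G t ^+ 3) ^+ 3 = G t ^+ 8 * (c ^+ 2 * (B ^+ 2 * (c * G t))) by ring.
 rewrite ltr_pM2l ?exprn_gt0// ltNge => /negP; apply.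
 apply: le_trans c2; rewrite -[leRHS]mul1r; apply: ler_pM.
 - exact: sqr_ge0.
 - by rewrite !mulr_ge0// ?sqr_ge0// ltW.
 - by rewrite expr_le1// ltW.
 - by rewrite ler_pM2l ?exprn_gt0// ler_pM2l.
pose C := 4 / (c * sqrt 2).
have C0 : 0 < C by rewrite divr_gt0// mulr_gt0.
have TG t : c0 <= t -> t < L -> T t + C * G t <= T c0 + C * G c0.
 move=> ct tL; rewrite -lerN2.
 apply: (derive_nondecreasing (f := fun t => - (T t + C * G t))
  (df := fun t => - ((sqrt 2 * om t)^-1 + C * (- om t / (4 * G t ^+ 3)))) ct) => z sz zt; split.
  have [_ _ _ _ D] := H z ltac:(lra) ltac:(lra).
  have := is_derive_add D (is_derive_scal C (Gd z ltac:(lra) ltac:(lra))).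
  by move=> D'; exact: (@is_deriveN R R R _ z 1 _ D').
 have [pm0 _ _ _ _] := H z ltac:(lra) ltac:(lra); have [Gp _] := G4 z ltac:(lra) ltac:(lra).
 have := key z ltac:(lra) ltac:(lra) => kz.
 have -> : - ((sqrt 2 * om z)^-1 + C * (- om z / (4 * G z ^+ 3))) =
   (om z ^+ 2 - c * G z ^+ 3) * (c * sqrt 2 * om z * G z ^+ 3)^-1.
  by rewrite /C; field; rewrite !gt_eqF.
 by rewrite mulr_ge0 ?subr_ge0// invr_ge0 !mulr_ge0 ?exprn_ge0// ltW.
exists (T c0 + C * G c0) => t t0 tL.
have [ct|tc] := leP c0 t.
 by have := TG t ct tL; have [? _] := G4 t t0 tL; have := mulr_gt0 C0 (G4 t t0 tL).1; lra.
by have := Tm t c0 t0 (ltW tc) c0L; have := mulr_gt0 C0 g00; lra.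
Qed.

End RealCalculus.

(** [Th] inverts the bounded increasing [T], and [Tb] is [T] itself, both extended by constants. A
    monotone map onto an interval is continuous, which settles the ends. *)
Lemma time_change (R : realType) (L M : R) (w T : R -> R) : 0 < L ->
 (forall t : R, 0 < t -> t < L -> [/\ 0 < w t, is_derive t 1 T (w t) & `|T t| <= M]) ->
 exists (lo hi : R) (Th Tb : R -> R), [/\ lo < hi,
  [/\ (forall s t, s <= t -> Th s <= Th t), continuous Th,
    (forall s, s <= lo -> Th s = 0), (forall s, hi <= s -> Th s = L) &
    (forall s : R, lo < s -> s < hi -> [/\ 0 < Th s, Th s < L & is_derive s 1 Th (w (Th s))^-1])] &
  [/\ (forall s t, s <= t -> Tb s <= Tb t), continuous Tb, Tb 0 = lo, Tb L = hi &
    forall t, 0 <= t -> t <= L -> Th (Tb t) = t]].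
Proof.
move=> L0 H.
pose S : set R := [set y | exists t, [/\ 0 < t, t < L & T t = y]].
have cS : S (T (L / 2)) by exists (L / 2); split => //; lra.
have Sb y : S y -> - M <= y /\ y <= M.
 by move=> [t [t0 tL <-]]; have [_ _] := H t t0 tL; rewrite ler_norml => /andP[].
have Sub : has_sup S by split; [by exists (T (L / 2))|by exists M => y /Sb[]].
have Slb : has_inf S by split; [by exists (T (L / 2))|by exists (- M) => y /Sb[]].
have Tc (t : R) : 0 < t -> t < L -> {for t, continuous T}.
 by move=> t0 tL; have [_ D _] := H t t0 tL; exact: is_derive_cvg D.
have Tlt s t : 0 < s -> s < t -> t < L -> T s < T t.
 move=> s0 st tL; apply: (derive_increasing (df := w) st) => z sz zt.
 by have [] := H z ltac:(lra) ltac:(lra).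
have Tle s t : 0 < s -> s <= t -> t < L -> T s <= T t.
 by move=> s0; rewrite le_eqVlt => /orP[/eqP->//|st tL]; apply/ltW/Tlt.
pose lo := inf S; pose hi := sup S.
have loT t : 0 < t -> t < L -> lo < T t.
 move=> t0 tL; apply: (@le_lt_trans _ _ (T (t / 2))); last by apply: Tlt; lra.
 by apply: (ge_inf Slb.2); exists (t / 2); split => //; lra.
have Thi t : 0 < t -> t < L -> T t < hi.
 move=> t0 tL; apply: (@lt_le_trans _ _ (T ((t + L) / 2))); first by apply: Tlt; lra.
 by apply: (ub_le_sup Sub.2); exists ((t + L) / 2); split => //; lra.
have mid0 : 0 < L / 2 by lra. have midL : L / 2 < L by lra.
have lohi : lo < hi by apply: lt_trans (Thi _ mid0 midL); exact: loT.
have surj y : lo < y -> y < hi -> exists t, [/\ 0 < t, t < L & T t = y].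
 move=> ly yh.
 have [z1 [t1 [t10 t1L <-]] e1] := inf_adherent (eps := y - lo) ltac:(by rewrite subr_gt0) Slb.
 have [z2 [t2 [t20 t2L <-]] e2] := sup_adherent (eps := hi - y) ltac:(by rewrite subr_gt0) Sub.
 have t1y : T t1 < y by move: e1; rewrite -/lo; lra.
 have yt2 : y < T t2 by move: e2; rewrite -/hi; lra.
 have t12 : t1 <= t2 by rewrite leNgt; apply/negP => t21; have := Tlt t2 t1 t20 t21 t1L; lra.
 have [|| c /itvP cI E] := @IVT R T t1 t2 y t12.
 - apply: continuous_in_subspaceT => x /set_mem /=; rewrite in_itv /= => /andP[sx xt].
  by apply: Tc; lra.
 - by rewrite ge_min le_max (ltW t1y) (ltW yt2) orbT.
 by exists c; split => //; [apply: (lt_le_trans t10)|apply: le_lt_trans t2L]; rewrite cI.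
pose Tb t := if t <= 0 then lo else if L <= t then hi else T t.
pose Th s := if s <= lo then 0 else if hi <= s then L else xget 0 [set t | [/\ 0 < t, t < L & T t = s]].
have ThP s : lo < s -> s < hi -> [/\ 0 < Th s, Th s < L & T (Th s) = s].
 move=> ls sh; rewrite /Th leNgt ls /= leNgt sh /=.
 by have [t tP] := surj s ls sh; exact: (@xgetPex _ 0 [set t | [/\ 0 < t, t < L & T t = s]]) (ex_intro _ t tP).
have Thlo s : s <= lo -> Th s = 0 by rewrite /Th => ->.
have Thhi s : hi <= s -> Th s = L.
 by move=> hs; rewrite /Th leNgt (lt_le_trans lohi hs) hs.
have Tb0 t : t <= 0 -> Tb t = lo by rewrite /Tb => ->.
have TbL t : L <= t -> Tb t = hi by move=> Lt; rewrite /Tb leNgt (lt_le_trans L0 Lt) Lt.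
have Tbin t : 0 < t -> t < L -> Tb t = T t by move=> t0 tL; rewrite /Tb !leNgt t0 tL.
have ThT t : 0 < t -> t < L -> Th (T t) = t.
 move=> t0 tL; have [a1 a2 a3] := ThP (T t) (loT t t0 tL) (Thi t t0 tL).
 by have [l|l|//] := ltgtP (Th (T t)) t; [have := Tlt _ _ a1 l tL|have := Tlt _ _ t0 l a2]; rewrite a3 ltxx.
have Thb s : 0 <= Th s /\ Th s <= L.
 have [h1|h1] := leP s lo; first by rewrite Thlo// lexx ltW.
 have [h2|h2] := leP hi s; first by rewrite Thhi// lexx ltW.
 by have [? ? _] := ThP s h1 h2; split; exact: ltW.
have Tbb t : lo <= Tb t /\ Tb t <= hi.
 have [h1|h1] := leP t 0; first by rewrite Tb0// lexx ltW.
 have [h2|h2] := leP L t; first by rewrite TbL// lexx ltW.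
 by rewrite Tbin//; split; apply: ltW; [exact: loT|exact: Thi].
have Thm s t : s <= t -> Th s <= Th t.
 move=> st; have [h1|h1] := leP s lo; first by rewrite Thlo//; exact: (Thb t).1.
 have [h2|h2] := leP hi t; first by rewrite (Thhi t)//; exact: (Thb s).2.
 have [a1 a2 a3] := ThP s h1 ltac:(lra); have [e1 e2 e3] := ThP t ltac:(lra) h2.
 by rewrite leNgt; apply/negP => l; have := Tlt _ _ e1 l a2; rewrite a3 e3; lra.
have Tbm s t : s <= t -> Tb s <= Tb t.
 move=> st; have [h1|h1] := leP s 0; first by rewrite Tb0//; exact: (Tbb t).1.
 have [h2|h2] := leP L t; first by rewrite (TbL t)//; exact: (Tbb s).2.
 by rewrite !Tbin//; [apply: Tle|lra|lra].
have ThTb t : 0 <= t -> t <= L -> Th (Tb t) = t.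
 rewrite le_eqVlt => /orP[/eqP<- _|t0]; first by rewrite Tb0// Thlo.
 rewrite le_eqVlt => /orP[/eqP->|tL]; first by rewrite TbL// Thhi.
 by rewrite Tbin// ThT.
exists lo, hi, Th, Tb; split => //; split => //.
- apply: (mono_surj_continuous Thm Thb) => t t0 tL; exists (Tb t); exact: ThTb.
- move=> s ls sh; have [a1 a2 a3] := ThP s ls sh; split => //.
 have [w0 D _] := H (Th s) a1 a2.
 have near_in : \forall y \near Th s, 0 < y /\ y < L.
  by near=> y; split; near: y; [exact: lt_nbhsr|exact: lt_nbhsl].
 rewrite -{1}a3; apply: (@is_derive_inverse R T Th (w (Th s)) (Th s)) => //.
 + by apply: filterS near_in => y [y0 yL]; exact: ThT.
 + by apply: filterS near_in => y [y0 yL]; exact: Tc.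
 + by rewrite gt_eqF.
- apply: (mono_surj_continuous Tbm Tbb) => y ly yh.
 move: ly; rewrite le_eqVlt => /orP[/eqP<-|ly]; first by exists 0; rewrite Tb0.
 move: yh; rewrite le_eqVlt => /orP[/eqP->|yh]; first by exists L; rewrite TbL.
 by have [t [t0 tL E]] := surj y ly yh; exists t; rewrite Tbin.
- by rewrite Tb0.
- by rewrite TbL.
Unshelve. all: by end_near.
Qed.

(** * Taylor expansion and gradient of the potential *)

Section PotentialCalculus.
Context {R : realType}.
Variable m : 'I_3 -> R.
Hypothesis m_gt0 : forall i, 0 < m i.
Local Notation proj := (@reduced_proj R).
Local Notation hre := (hre m).
Local Notation hnorm := (hnorm m).

(** The expansion of an inverse distance when a side is changed by a vector of squared length [n]
    and inner product [d] with it; the error is uniform in terms of [r] and [n]. *)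
Lemma inv_taylor (r r' d n : R) : 0 < r -> 0 < r' -> r' ^+ 2 = r ^+ 2 + 2 * d + n ->
 d ^+ 2 <= r ^+ 2 * n -> 4 * n <= r ^+ 2 ->
 r / 2 <= r' /\ `|r'^-1 - r^-1 + d / r ^+ 3| <= 2 * n / r ^+ 3.
Proof.
move=> r0 r'0 e dn nr.
have n0 : 0 <= n by rewrite -(pmulr_rge0 _ (exprn_gt0 2 r0)); apply: le_trans dn; exact: sqr_ge0.
have h1 : (r - r') ^+ 2 <= n.
 have : r ^+ 2 + d <= r * r'.
  have [neg|pos] := leP (r ^+ 2 + d) 0; first by apply: (le_trans neg); rewrite mulr_ge0// ltW.
  rewrite -(@ler_pXn2r _ 2) ?nnegrE ?mulr_ge0 ?(ltW pos) ?(ltW r0) ?(ltW r'0)//.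
  by rewrite exprMn e; have -> : (r ^+ 2 + d) ^+ 2 = r ^+ 2 * (r ^+ 2 + 2 * d) + d ^+ 2 by [ring]; lra.
 by have -> : (r - r') ^+ 2 = r ^+ 2 + r' ^+ 2 - 2 * (r * r') by [ring]; rewrite e; lra.
have h2 : r / 2 <= r'.
 rewrite leNgt; apply/negP => lt.
 have : (r / 2) ^+ 2 < (r - r') ^+ 2 by rewrite ltr_pXn2r// ?nnegrE; lra.
 by rewrite expr_div_n; lra.
split => //.
have E : r'^-1 - r^-1 + d / r ^+ 3 = ((r - r') ^+ 2 * (2 * (r / r') + 1) - n) / (2 * r ^+ 3).
 have -> : d = (r' ^+ 2 - r ^+ 2 - n) / 2 by rewrite e; field.
 by field; rewrite !gt_eqF.
have q1 : 0 <= r / r' by rewrite divr_ge0// ltW.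
have q2 : r / r' <= 2 by rewrite ler_pdivrMr//; lra.
have s0 := sqr_ge0 (r - r').
rewrite E normrM (ger0_norm (x := (2 * r ^+ 3)^-1)) ?invr_ge0 ?mulr_ge0 ?exprn_ge0 ?(ltW r0)//.
have -> : 2 * n / r ^+ 3 = 4 * n / (2 * r ^+ 3) by field; rewrite gt_eqF.
rewrite ler_wpM2r ?invr_ge0 ?mulr_ge0 ?exprn_ge0 ?(ltW r0)// ler_norml; apply/andP; split; last by nra.
by have := mulr_ge0 s0 (addr_ge0 (mulr_ge0 (ler0n _ 2) q1) ler01); lra.
Qed.

(** The directional derivative along [w] of the potential of one pair; [dpot] is that of the whole
    potential. *)
Definition dterm (q w : config R) i j : R := - (m i * m j * (dotp q w i j / sep q i j ^+ 3)).

Definition dpot (q w : config R) : R := dterm q w b1 b2 + dterm q w b1 b3 + dterm q w b2 b3.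

Lemma Upot_proj (q : config R) : Upot m (proj q) =
 m b1 * m b2 / sep q b1 b2 + m b1 * m b3 / sep q b1 b3 + m b2 * m b3 / sep q b2 b3.
Proof. by rewrite /Upot !rsep_proj. Qed.

Lemma potential_proj (q : config R) : potential m q = rpotential m (proj q).
Proof.
rewrite /rpotential /potential; apply: eq_bigr => i _; apply: eq_bigr => j _.
by rewrite -/(sep q i j) -/(sep (repr (proj q)) i j) (congruent_sep i j (repr_proj q)).
Qed.

Lemma sep_cadd_sq (q w : config R) i j : sep (cadd q w) i j ^+ 2 = sep q i j ^+ 2 + 2 * dotp q w i j + sep w i j ^+ 2.
Proof. by rewrite !sepE /dotp /sepr /sepi /cadd !ReImE; ring. Qed.

Lemma dotp_sq_le (q w : config R) i j : dotp q w i j ^+ 2 <= sep q i j ^+ 2 * sep w i j ^+ 2.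
Proof.
rewrite !sepE /dotp -subr_ge0.
set a := sepr q i j; set b := sepi q i j; set c := sepr w i j; set d := sepi w i j.
have -> : (a ^+ 2 + b ^+ 2) * (c ^+ 2 + d ^+ 2) - (a * c + b * d) ^+ 2 = (a * d - b * c) ^+ 2 by ring.
exact: sqr_ge0.
Qed.

Lemma Upot_taylor (q w : config R) (sg B : R) : 0 < sg -> 0 <= B -> 2 * B < sg ->
 sep_above sg (proj q) -> sep w b1 b2 <= B -> sep w b1 b3 <= B -> sep w b2 b3 <= B ->
 sep_above (sg / 2) (proj (cadd q w)) /\
 `|Upot m (proj (cadd q w)) - Upot m (proj q) - dpot q w| <= 2 * mmsum m / sg ^+ 3 * B ^+ 2.
Proof.
move=> s0 B0 Bs; rewrite /sep_above !rsep_proj => -[q12 q13 q23] w12 w13 w23.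
have K i j : sg <= sep q i j -> sep w i j <= B -> sg / 2 <= sep (cadd q w) i j /\
  `|m i * m j / sep (cadd q w) i j - m i * m j / sep q i j - dterm q w i j| <= m i * m j * (2 / sg ^+ 3 * B ^+ 2).
 move=> qs wB; have r0 : 0 < sep q i j by apply: lt_le_trans qs.
 have wB2 : sep w i j ^+ 2 <= B ^+ 2 by rewrite ler_pXn2r// nnegrE// sep_ge0.
 have n4 : 4 * sep w i j ^+ 2 < sep q i j ^+ 2.
  have : (2 * sep w i j) ^+ 2 < sep q i j ^+ 2 by rewrite ltr_pXn2r// ?nnegrE ?mulr_ge0 ?sep_ge0//; lra.
  by rewrite exprMn; lra.
 have r'0 : 0 < sep (cadd q w) i j.
  rewrite lt0r sep_ge0 andbT; apply/eqP => z.
  have := dotp_sq_le q w i j; have := sep_cadd_sq q w i j; rewrite z expr0n /=.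
  set d := dotp _ _ _ _; set n := sep w i j ^+ 2 in n4 *; set r := sep q i j ^+ 2 in n4 * => e.
  have -> : d = - ((r + n) / 2) by lra.
  have n0 : 0 <= n by exact: sqr_ge0.
  by rewrite sqrrN expr_div_n; nra.
 have [h1 h2] := inv_taylor r0 r'0 (sep_cadd_sq q w i j) (dotp_sq_le q w i j) (ltW n4).
 split; first lra.
 have -> : m i * m j / sep (cadd q w) i j - m i * m j / sep q i j - dterm q w i j =
  m i * m j * ((sep (cadd q w) i j)^-1 - (sep q i j)^-1 + dotp q w i j / sep q i j ^+ 3) by rewrite /dterm; ring.
 rewrite normrM gtr0_norm ?mulr_gt0// ler_pM2l ?mulr_gt0//; apply: (le_trans h2).
 have : sep w i j ^+ 2 * (sep q i j ^+ 3)^-1 <= B ^+ 2 * (sg ^+ 3)^-1; last by lra.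
 apply: ler_pM => //.
 - exact: sqr_ge0.
 - by rewrite invr_ge0 exprn_ge0// sep_ge0.
 - by rewrite lef_pV2 ?posrE ?exprn_gt0// ler_pXn2r// nnegrE ltW.
have [a1 k1] := K _ _ q12 w12; have [a2 k2] := K _ _ q13 w13; have [a3 k3] := K _ _ q23 w23.
split => //; rewrite !Upot_proj /dpot /mmsum.
have -> : 2 * (m b1 * m b2 + m b1 * m b3 + m b2 * m b3) / sg ^+ 3 * B ^+ 2 =
 m b1 * m b2 * (2 / sg ^+ 3 * B ^+ 2) + m b1 * m b3 * (2 / sg ^+ 3 * B ^+ 2) + m b2 * m b3 * (2 / sg ^+ 3 * B ^+ 2) by ring.
move: k1 k2 k3; rewrite !ler_norml => /andP[? ?] /andP[? ?] /andP[? ?].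
by split_lra.
Qed.

Lemma dpotZ (q w : config R) (c : R) : dpot q (cscale c w) = c * dpot q w.
Proof. by rewrite /dpot /dterm /dotp /sepr /sepi /cscale !reZ !imZ; ring. Qed.

Lemma sep_cscale (w : config R) (c : R) i j : sep (cscale c w) i j = `|c| * sep w i j.
Proof.
rewrite /sep /cscale -mulrBr normcM; congr (_ * _).
by rewrite /= expr0n addr0 sqrtr_sqr.
Qed.

Lemma quadratic_derive (f : R -> R) (l C d : R) : 0 < d -> 0 <= C ->
 (forall x, `|x| < d -> `|f x - f 0 - x * l| <= C * x ^+ 2) -> is_derive (0 : R) 1 f l.
Proof.
move=> d0 C0 H.
apply/is_derive1_caratheodory.
exists (fun x => if x == 0 then l else (f x - f 0) / x); rewrite eqxx; split => //.
- move=> x; rewrite subr0; case: eqP => [->|/eqP x0]; first by rewrite subrr mulr0.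
 by rewrite divfK.
- apply/cvgrPdist_le => e e0; rewrite eqxx.
 have d'0 : 0 < Num.min d (e / (C + 1)) by rewrite lt_min d0 divr_gt0//; lra.
 near=> x; case: eqP => [_|/eqP x0]; first by rewrite subrr normr0 ltW.
 have xd : `|x| < Num.min d (e / (C + 1)) by near: x; apply/nbhs_ballP; exists (Num.min d (e / (C + 1))) => //= y; rewrite /ball /= sub0r normrN.
 have [x1 x2] : `|x| < d /\ `|x| < e / (C + 1) by move: xd; rewrite lt_min => /andP[].
 have -> : l - (f x - f 0) / x = - ((f x - f 0 - x * l) / x) by field.
 rewrite normrN normrM normfV ler_pdivrMr ?normr_gt0//; apply: (le_trans (H x x1)).
 rewrite -[x ^+ 2]real_normK ?num_real// expr2 mulrA ler_wpM2r ?normr_ge0//.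
 move: x2; rewrite ltr_pdivlMr; [|lra].
 by have := normr_ge0 x; nra.
Unshelve. all: by end_near.
Qed.

Definition unitc (i : 'I_3) (z : R[i]) : config R := fun j => if j == i then z else 0.

Lemma Upot_line_derive (q E : config R) : noncol (proj q) ->
 is_derive (0 : R) 1 (fun x : R => Upot m (proj (cadd q (cscale x E)))) (dpot q E).
Proof.
move=> [n1 n2 n3].
pose sg := Num.min (rsep b1 b2 (proj q)) (Num.min (rsep b1 b3 (proj q)) (rsep b2 b3 (proj q))).
have s0 : 0 < sg by rewrite !lt_min n1 n2.
have sA : sep_above sg (proj q) by rewrite /sep_above /sg !ge_min !lexx !orbT.
pose B := sep E b1 b2 + sep E b1 b3 + sep E b2 b3.
have := sep_ge0 E b1 b2; have := sep_ge0 E b1 b3; have := sep_ge0 E b2 b3 => z1 z2 z3.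
have B0 : 0 <= B by rewrite /B; lra.
have d0 : 0 < sg / (2 * B + 1) by rewrite divr_gt0//; lra.
apply: (quadratic_derive (C := 2 * mmsum m / sg ^+ 3 * B ^+ 2) d0).
 by rewrite !mulr_ge0 ?invr_ge0 ?exprn_ge0// ?(ltW s0)// ltW// mmsum_gt0.
move=> x; rewrite ltr_pdivlMr; [|lra] => xd.
have e0 : cadd q (cscale 0 E) = q by apply/funext => i; rewrite /cadd /cscale mul0r addr0.
have xB : 2 * (`|x| * B) < sg by have := normr_ge0 x; lra.
have S i j : sep E i j <= B -> sep (cscale x E) i j <= `|x| * B.
 by move=> h; rewrite sep_cscale ler_wpM2l.
have [_] := Upot_taylor s0 (mulr_ge0 (normr_ge0 x) B0) xB sA (S b1 b2 ltac:(rewrite /B; lra))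
 (S b1 b3 ltac:(rewrite /B; lra)) (S b2 b3 ltac:(rewrite /B; lra)).
rewrite e0 dpotZ => H; apply: (le_trans H); rewrite exprMn real_normK ?num_real//; lra.
Qed.

Lemma grad_potential_dpot (q : config R) i : noncol (proj q) ->
 grad_potential m q i = dpot q (unitc i 1) +i* dpot q (unitc i 'i).
Proof.
move=> nq.
have key (z : R[i]) (f : R -> R[i]) : (forall x, f x = x%:C * z) ->
  derive1 (fun x : R => fine (potential m (fun j => if j == i then q j + f x else q j))) 0 = dpot q (unitc i z).
 move=> fz; apply: is_derive_derive1.
 have := Upot_line_derive (unitc i z) nq; apply: is_derive_near.
 have [d d0 Hd] := Upot_close m_gt0 nq ltr01.
 have E0 := hnorm_ge0 m (unitc i z).
 have d'0 : 0 < d / (hnorm (unitc i z) + 1) by rewrite divr_gt0//; lra.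
 near=> x.
 have -> : (fun j => if j == i then q j + f x else q j) = cadd q (cscale x (unitc i z)).
  by apply/funext => j; rewrite /cadd /cscale /unitc fz; case: eqP => _; rewrite ?mulr0 ?addr0.
 rewrite potential_proj rpot_noncol//.
 suff : rd m (proj q) (proj (cadd q (cscale x (unitc i z)))) < d by case/Hd.
 rewrite rd_proj; apply: (@le_lt_trans _ _ (hnorm (csub q (cadd q (cscale x (unitc i z)))))); first exact: qdist_le_hnorm.
 have -> : csub q (cadd q (cscale x (unitc i z))) = cscale (- x) (unitc i z).
  by apply/funext => j; rewrite /csub /cadd /cscale rmorphN /= opprD addrA subrr add0r mulNr.
 rewrite hnormZ normrN.
 have : `|x| < d / (hnorm (unitc i z) + 1).
  near: x; apply/nbhs_ballP; exists (d / (hnorm (unitc i z) + 1)) => //= y.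
  by rewrite /ball /= sub0r normrN.
 rewrite ltr_pdivlMr; [|lra].
 by have := normr_ge0 x; lra.
rewrite /grad_potential; congr (_ +i* _).
 by apply: key => x; rewrite mulr1.
by apply: key => x; apply/eqP; rewrite eq_complex; apply/andP; split; apply/eqP => /=; ring.
Unshelve. all: by end_near.
Qed.

(** For a centered configuration, pairing with a coordinate direction reads off one coordinate times
    its mass. This translates statements on [hre] into statements on coordinates. *)
Lemma hre_unitc (X : config R) i (z : R[i]) : \sum_(j < 3) (m j)%:C * X j = 0 ->
 hre X (unitc i z) = m i * (Re (X i) * Re z + Im (X i) * Im z).
Proof.
move=> c0; have [r0 i0] := coord_b3 m_gt0 c0; have mi k : m k != 0 by rewrite gt_eqF.
have M0 : m b1 + m b2 + m b3 != 0 by rewrite gt_eqF// !addr_gt0.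
by rewrite /hre /sepr /sepi /wgt; move: i; apply: ord3_ind; rewrite /unitc /= r0 i0; field; rewrite M0 mi.
Qed.

End PotentialCalculus.

Lemma bounded_speed (R : realType) (L e C : R) (v T : R -> R) : 0 < L -> 0 < e ->
 (forall t : R, 0 < t -> t < L -> is_derive t 1 T (v t) /\ 0 <= v t) ->
 (forall t : R, 0 < t -> t < L -> L - e < t -> v t <= C) ->
 exists M, forall t, 0 < t -> t < L -> T t <= M.
Proof.
move=> L0 e0 H vC; pose c := Num.max (L / 2) (L - e / 2).
have cL : c < L by rewrite gt_max; split_lra.
have c1 : L / 2 <= c by rewrite le_max lexx.
have c2 : L - e / 2 <= c by rewrite le_max lexx orbT.
have Cc : 0 <= C by apply: le_trans (vC c ltac:(lra) ltac:(lra) ltac:(lra)); have [] := H c ltac:(lra) ltac:(lra).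
have Tm s t : 0 < s -> s <= t -> t < L -> T s <= T t.
 by move=> s0 st tL; apply: (derive_nondecreasing (df := v) st) => z sz zt; apply: H; lra.
exists (T c + C * L) => t t0 tL.
have CL : 0 <= C * L by rewrite mulr_ge0// ltW.
have [ct|tc] := leP c t; last by have := Tm t c t0 (ltW tc) cL; lra.
have : C * c - T c <= C * t - T t.
 apply: (derive_nondecreasing (f := fun t => C * t - T t) (df := fun t => C * 1 - v t) ct) => z cz zt.
 have [D _] := H z ltac:(lra) ltac:(lra); split; last by rewrite mulr1 subr_ge0; apply: vC; lra.
 exact: (is_derive_sub (is_derive_scal C (is_derive_id z (1 : R))) D).
have : C * t <= C * L by rewrite ler_wpM2l// ltW.
have : 0 <= C * c by rewrite mulr_ge0//; lra.
by lra.
Qed.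

(* Th is the arc length as a function of time and G is the primitive of twice
  the kinetic energy. *)
Definition motion (R : realType) (m : 'I_3 -> R) (h : R) (X : R -> config R) (Th G : R -> R) (lo hi : R) : Prop :=
 let p s := reduced_proj (X s) in
 [/\ (forall s, \sum_(i < 3) (m i)%:C * X s i = 0) /\
    (forall s t, s <= t -> hnorm m (csub (X s) (X t)) <= Th t - Th s),
   (forall s : R, lo < s -> s < hi -> [/\ noncol (p s), h < Upot m (p s),
     is_derive s 1 Th (sqrt 2 * omr m h (p s)) & is_derive s 1 G (2 * (Upot m (p s) - h))]),
   (forall s t, lo < s -> s <= t -> t < hi -> wlen (rd m) one_weight p s t = (Th t - Th s)%:E),
   (forall s t, lo < s -> s <= t -> t < hi -> wlen (rd m) (om m h) p s t = ((G t - G s) / sqrt 2)%:E) &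
   (forall s t L' M, lo < s -> s <= t -> t < hi -> 0 <= L' -> gpath m h (p s) (p t) L' M ->
     (wlen (rd m) (om m h) p s t <= M%:E)%E)].

(** * Minimal arcs: absence of interior collisions and parametrization by time *)

Section MinimalArcs.
Context {R : realType}.
Variable m : 'I_3 -> R.
Hypothesis m_gt0 : forall i, 0 < m i.
Variable h : R.
Hypothesis h_gt0 : 0 < h.
Local Notation proj := (@reduced_proj R).
Local Notation rd := (rd m).
Local Notation om := (om m h).
Local Notation hill := (hill_region m h).
Local Notation W := (wlen rd om).
Local Notation gpath := (gpath m h).

Let rd0 := @rd_ge0 R m.
Let rdC' := rdC m.
Let rdx := rdxx m_gt0.
Let rdt := rd_triangle m_gt0.
Let om0 := @om_ge0' R m h.

Definition minimal_arc k L := [/\ arc m k L, (forall t, 0 <= t -> t <= L -> hill (k t)),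
 W k 0 L \is a fin_num &
 forall L' M, 0 <= L' -> gpath (k 0) (k L) L' M -> (W k 0 L <= M%:E)%E].

Variables (k : R -> reduced R) (L : R).
Hypothesis kmin : minimal_arc k L.

Lemma minimal_fin s t : 0 <= s -> s <= t -> t <= L -> W k s t \is a fin_num.
Proof.
have [_ _ f _] := kmin => s0 st tL.
by apply: (@wlen_fin R m m_gt0 h k L (fine (W k 0 L))); rewrite // fineK.
Qed.

Lemma minimal_local s t L' M : 0 <= s -> s <= t -> t <= L -> 0 <= L' -> gpath (k s) (k t) L' M ->
 (W k s t <= M%:E)%E.
Proof.
move=> s0 st tL L'0 P; have [[_ klip _] hk _ H] := kmin.
have f1 := minimal_fin (lexx 0) s0 (le_trans st tL); have f2 := minimal_fin s0 st tL.
have f3 := minimal_fin (le_trans s0 st) tL (lexx L).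
have P1 : gpath (k 0) (k s) (s - 0) (fine (W k 0 s)).
 by apply: (gpath_sub m_gt0 (L := L)) => //; [exact: le_trans st tL|rewrite fineK].
have P2 : gpath (k t) (k L) (L - t) (fine (W k t L)).
 by apply: (gpath_sub m_gt0 (L := L)) => //; [exact: le_trans s0 st|rewrite fineK].
have s0' : 0 <= s - 0 by rewrite subr0.
have Lt : 0 <= L - t by rewrite subr_ge0.
have P3 := gpath_cat m_gt0 s0' (addr_ge0 L'0 Lt) P1 (gpath_cat m_gt0 L'0 Lt P P2).
have := H _ _ (addr_ge0 s0' (addr_ge0 L'0 Lt)) P3.
rewrite (wlenD rd0 rdx rdt k s0 (le_trans st tL) om0) (wlenD rd0 rdx rdt k st tL om0).
by rewrite -(fineK f1) -(fineK f2) -(fineK f3) -!EFinD !lee_fin; lra.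
Qed.

Lemma noncol_eq_pair i j l (p : reduced R) : rsep i j p = 0 -> rsep j l p = rsep i l p.
Proof.
move=> e; have /eqP := eq0_normc e; rewrite subr_eq0 => /eqP E.
by rewrite /rsep /sep E.
Qed.

Lemma competitor_exists p : ~ noncol p -> exists2 d, 0 < d & forall a b t, 0 < t -> t <= d ->
 rd p a <= t -> rd p b <= t -> noncol a -> noncol b ->
 exists2 L, 0 <= L & gpath a b L (19 / 10 * t * (omr m h a + omr m h b)).
Proof.
move=> np; have [r0|r0] := eqVneq (rsize m p) 0; first exact: triple_competitor.
have C a b : rsep a b p = rsep b a p by exact: sepC.
have nz : ~ (rsep b1 b2 p = 0 /\ rsep b1 b3 p = 0 /\ rsep b2 b3 p = 0).
 move=> [z1 [z2 z3]]; move/eqP: r0; apply.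
 have : rsize m p ^+ 2 = 0.
  by rewrite /rsize hnorm_sq// hre_sep// -/(rsep b1 b2 p) -/(rsep b1 b3 p) -/(rsep b2 b3 p) z1 z2 z3; ring.
 by move/eqP; rewrite sqrf_eq0 => /eqP.
have pos a b : rsep a b p <> 0 -> 0 < rsep a b p by move=> /eqP ne; rewrite lt0r ne rsep_ge0.
have [z12|n12] := eqVneq (rsep b1 b2 p) 0.
 have e := noncol_eq_pair b3 z12.
 have n13 : 0 < rsep b1 b3 p by apply: pos => z; apply: nz; rewrite e z.
 by apply: (binary_competitor m_gt0 h_gt0 (pair123)) => //; rewrite e.
have [z13|n13] := eqVneq (rsep b1 b3 p) 0.
 have e := noncol_eq_pair b2 z13.
 have n12' : 0 < rsep b1 b2 p by apply: pos => z; move: n12; rewrite z eqxx.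
 by apply: (binary_competitor m_gt0 h_gt0 (pair132)) => //; rewrite e.
have [z23|n23] := eqVneq (rsep b2 b3 p) 0; last first.
 by exfalso; apply: np; split; rewrite lt0r ?n12 ?n13 ?n23 rsep_ge0.
have p12 : 0 < rsep b2 b1 p by rewrite C lt0r n12 rsep_ge0.
have e := noncol_eq_pair b1 z23.
by apply: (binary_competitor m_gt0 h_gt0 (pair231)) => //; rewrite e.
Qed.

(** All conditions of [collision_contradiction] hold on a small symmetric interval: every subarc is
    minimal, [collision_om] gives the initial constant, and the competitors come from the triple or
    the binary case. *)
Lemma minimal_noncol th : 0 < th -> th < L -> noncol (k th).
Proof.
move=> th0 thL; apply: contrapT => nc; have [A hk _ _] := kmin; have [L0 klip _] := A.
have [d d0 Hd] := competitor_exists nc.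
have [c [d' [c0 d'0 Hc]]] := collision_om m_gt0 h_gt0 nc.
pose t0 := Num.min (Num.min d d') (Num.min th (L - th)).
have t00 : 0 < t0 by rewrite !lt_min d0 d'0 th0 subr_gt0.
have : t0 <= t0 by []; rewrite {2}/t0 !le_min => /andP[/andP[td td'] /andP[tth tL]].
have tl : 0 <= th - t0 by lra.
have tr : th + t0 <= L by lra.
have dl s : 0 < s -> rd (k th) (k (th - s)) <= s.
 by move=> s0; rewrite rdC'; apply: (le_trans (klip _ _ _)); lra.
have dr s : 0 < s -> rd (k th) (k (th + s)) <= s.
 by move=> s0; apply: (le_trans (klip _ _ _)); lra.
apply: (@collision_contradiction R m m_gt0 h k L th t0 A t00 tl tr _ _ _ c c0).
- by apply: minimal_fin; lra.
- by move=> t M L' t_ge0 tt L'0 P; apply: (minimal_local _ _ _ L'0 P); lra.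
- move=> t t_gt0 tt n1 n2; apply: Hd => //; [lra|exact: dl|exact: dr].
- move=> s s0 st; apply: (@le_trans _ _ (om (k (th - s)))); last by rewrite leeDl.
 by apply: Hc => //; [lra|exact: dl].
Qed.

Hypothesis L_gt0 : 0 < L.
Hypothesis kint : forall t, 0 < t -> t < L -> ~ hill_boundary m h (k t).

Let kw t := omr m h (k t).

Lemma int_noncol t : 0 < t -> t < L -> noncol (k t) /\ h < Upot m (k t).
Proof.
move=> t0 tL; have nc := minimal_noncol t0 tL; split => //.
have [_ hk _ _] := kmin; have /(hill_noncol m h nc) := hk t (ltW t0) (ltW tL).
rewrite le_eqVlt => /orP[/eqP e|//]; exfalso; apply: (kint t0 tL).
by apply/(bdry_noncol m h nc).
Qed.

Lemma kw_gt0 t : 0 < t -> t < L -> 0 < kw t.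
Proof. by move=> t0 tL; have [_ h1] := int_noncol t0 tL; rewrite sqrtr_gt0 subr_gt0. Qed.

Lemma om_kw t : 0 < t -> t < L -> om (k t) = (kw t)%:E.
Proof. by move=> t0 tL; have [nc _] := int_noncol t0 tL; rewrite om_noncol. Qed.

Lemma lip1_abs s t : rd (k s) (k t) <= `|s - t|.
Proof.
have [[_ klip _] _ _ _] := kmin; have [st|/ltW ts] := leP s t.
 by rewrite distrC ger0_norm ?subr_ge0//; exact: klip.
by rewrite rdC' ger0_norm ?subr_ge0//; exact: klip.
Qed.

Lemma kw_continuous (t : R) : 0 < t -> t < L -> {for t, continuous kw}.
Proof.
move=> t0 tL; have [nc _] := int_noncol t0 tL.
apply: (@continuous_comp _ _ _ (fun t => Upot m (k t) - h) (@Num.sqrt R)); last exact: sqrt_continuous.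
apply: cvgB; last exact: cvg_cst.
apply/cvgrPdist_lt => e e0; have [d d0 Hd] := Upot_close m_gt0 nc e0.
apply/nbhs_ballP; exists d => //= s; rewrite /ball /= => ts.
by have [] := Hd (k s) (le_lt_trans (lip1_abs t s) ts).
Qed.

(** In the interior [om] is finite and continuous, so on short subarcs the cost is [om] times the
    length up to a small relative error; local estimates are joined with an error proportional to
    time. *)
Lemma action_primitive : exists Om : R -> R,
 (forall t : R, 0 < t -> t < L -> is_derive t 1 Om (kw t)) /\
 (forall x y, 0 < x -> x <= y -> y < L -> W k x y = (Om y - Om x)%:E).
Proof.
have [A _ _ _] := kmin.
have [Om HOm] := antiderivative L_gt0 kw_continuous.
exists Om; split => // x y x0 xy yL.
have loc (z e : R) : 0 < e -> x <= z -> z <= y -> exists2 d, 0 < d & forall a b : R, x <= a -> a <= z -> z <= b -> b <= y ->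
  z - d < a -> b < z + d -> (W k a b <= (Om b - Om a + e * (b - a))%:E)%E /\ ((Om b - Om a - e * (b - a))%:E <= W k a b)%E.
 move=> e0 xz zy; have z0 : 0 < z by lra. have zL : z < L by lra.
 pose e2 := Num.min (e / 2) (kw z); have e20 : 0 < e2 by rewrite lt_min kw_gt0// andbT; lra.
 have e2e : e2 <= e / 2 by rewrite ge_min lexx.
 have e2k : e2 <= kw z by rewrite ge_min lexx orbT.
 have [d d0 Hd] := strong_difference z0 zL HOm (kw_continuous z0 zL) e20.
 have := kw_continuous z0 zL (nbhsx_ballx (kw z) e2 e20) => /nbhs_ballP[d' /= d'0 Hd'].
 exists (Num.min d d') => [|a b xa az zb by_]; first by rewrite lt_min d0.
 move=> ad bd; have md : Num.min d d' <= d by rewrite ge_min lexx.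
 have md' : Num.min d d' <= d' by rewrite ge_min lexx orbT.
 have a1 : z - d < a by lra. have a2 : z - d' < a by lra.
 have c1 : b < z + d by lra. have c2 : b < z + d' by lra.
 have ab : a <= b by lra.
 have := Hd a b a1 ab c1; rewrite ler_norml => /andP[h1 h2].
 have near_kw (s : R) : a <= s -> s <= b -> kw z - e2 < kw s /\ kw s < kw z + e2.
  move=> as_ sb; have : ball z d' s by rewrite /ball /= ltr_norml; split_lra.
  by move/Hd'; rewrite /= /ball /= ltr_norml => /andP[]; split; lra.
 have a0 : 0 <= a by lra. have bL : b <= L by lra.
 have ba0 : 0 <= b - a by lra.
 split.
  apply: (@le_trans _ _ ((kw z + e2) * (b - a))%:E); last by rewrite lee_fin; nra.
  apply: (arc_le A a0 ab bL); first by have := kw_gt0 z0 zL; lra.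
  move=> s as_ sb; rewrite om_kw ?lee_fin; [|lra|lra].
  by have [_ /ltW] := near_kw s as_ sb.
 apply: (@le_trans _ _ ((kw z - e2) * (b - a))%:E); first by rewrite lee_fin; nra.
 apply: (arc_ge A a0 ab bL); first by lra.
 move=> s as_ sb; rewrite om_kw ?lee_fin; [|lra|lra].
 by have [/ltW] := near_kw s as_ sb.
apply/eqP; rewrite eq_le; apply/andP; split.
 apply/lee_addgt0Pr => e e0; pose e' := e / (y - x + 1).
 have e'0 : 0 < e' by rewrite divr_gt0//; lra.
 have := @wlen_primitive R _ rd rd0 rdx rdt om k (fun s => Om s + e' * s) x y xy om0 _.
 move=> /(_ _)/le_trans; apply; last first.
  rewrite -EFinD lee_fin; have : e' * (y - x) <= e by rewrite /e' mulrAC ler_pdivrMr; [nra|lra].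
  by lra.
 move=> z xz zy; have [d d0 Hd] := loc z e' e'0 xz zy; exists d => // a b h1 h2 h3 h4 h5 h6.
 have [+ _] := Hd a b h1 h2 h3 h4 h5 h6; move/le_trans; apply; rewrite lee_fin; lra.
apply/lee_addgt0Pr => e e0; pose e' := e / (y - x + 1).
have e'0 : 0 < e' by rewrite divr_gt0//; lra.
rewrite -leeBlDr// -EFinB.
have := @wlen_ge_primitive R _ rd rd0 rdx rdt om k (fun s => Om s - e' * s) x y xy om0 _.
move=> P; apply: (@le_trans _ _ (Om y - e' * y - (Om x - e' * x))%:E); last apply: P.
 rewrite lee_fin; have : e' * (y - x) <= e by rewrite /e' mulrAC ler_pdivrMr; [nra|lra].
 by lra.
move=> z xz zy; have [d d0 Hd] := loc z e' e'0 xz zy; exists d => // a b h1 h2 h3 h4 h5 h6.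
have [_ +] := Hd a b h1 h2 h3 h4 h5 h6; apply: le_trans; rewrite lee_fin; lra.
Qed.

(** Motion inside the boundary is free, so any boundary point is reached at the cost of the radial
    exit. Applied to an endpoint on the boundary, this is the hypothesis of [finite_time]. *)
Lemma exit_pair t q M : 0 < t -> t < L -> hill_boundary m h q ->
 rsize m (k t) <= M -> exists2 L', 0 <= L' & gpath (k t) q L' (M * kw t ^+ 3 / h).
Proof.
move=> t0 tL hq rM; have [nc _] := int_noncol t0 tL; have [_ hk _ _] := kmin.
have [p' [L1 [hp' L10 P1]]] := radial_exit m_gt0 h_gt0 nc (hk t (ltW t0) (ltW tL)).
have [L2 L20 P2] := boundary_run m_gt0 h_gt0 hp' hq.
exists (L1 + L2); first exact: addr_ge0.
apply: gpath_le (gpath_cat m_gt0 L10 L20 P1 P2); rewrite addr0.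
by rewrite ler_pM2r ?invr_gt0// ler_wpM2r// exprn_ge0// sqrtr_ge0.
Qed.

(** At an end off the boundary, collisions included, [om] is bounded below nearby, so time advances
    at a bounded rate there. *)
Lemma om_end_bound p : hill p -> ~ hill_boundary m h p -> exists c e : R, [/\ 0 < c, 0 < e &
 forall t, 0 < t -> t < L -> rd p (k t) < e -> (sqrt 2 * kw t)^-1 <= c].
Proof.
move=> hp nb.
have [c c0 cl] : exists2 c, 0 < c & (c%:E < om p)%E.
 have [nc|nc] := pselect (noncol p); last by exists 1; rewrite // om_col// ltry.
 have hU : h < Upot m p.
  rewrite lt_neqAle; have /(hill_noncol m h nc) -> := hp; rewrite andbT; apply/eqP => e.
  by apply: nb; apply/(bdry_noncol m h nc).
 have s0 : 0 < sqrt (Upot m p - h) by rewrite sqrtr_gt0 subr_gt0.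
 by exists (sqrt (Upot m p - h) / 2); rewrite ?om_noncol ?lte_fin//; lra.
have [e e0 He] := om_lsc m_gt0 cl.
have s2 : 0 < sqrt 2 :> R by rewrite sqrtr_gt0.
exists (sqrt 2 * c)^-1, e; split => //; first by rewrite invr_gt0 mulr_gt0.
move=> t t0 tL /He; rewrite om_kw// lte_fin => ck.
by rewrite lef_pV2 ?posrE ?mulr_gt0// ?kw_gt0// ler_pM2l// ltW.
Qed.

(** At each end one of two reasons applies: [finite_time] if the end lies on the boundary, a bounded
    rate otherwise. The starting point is treated by reversing the arc. *)
Lemma time_bounded (T : R -> R) : (forall t : R, 0 < t -> t < L -> is_derive t 1 T (sqrt 2 * kw t)^-1) ->
 exists M, forall t, 0 < t -> t < L -> `|T t| <= M.
Proof.
have L0 := L_gt0; move=> TD; have [A hk Wf _] := kmin; have [_ klip _] := A.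
have s2 : 0 < sqrt 2 :> R by rewrite sqrtr_gt0.
have [Om [OmD OmW]] := action_primitive.
have v0 t : 0 < t -> t < L -> 0 <= (sqrt 2 * kw t)^-1.
 by move=> t0 tL; rewrite invr_ge0 mulr_ge0 ?sqrtr_ge0.
pose B := rsize m (k 0) + L.
have B0 : 0 < B by have := rsize_ge0 m (k 0); rewrite /B; lra.
have kB t : 0 < t -> t < L -> rsize m (k t) <= B.
 by move=> t0 tL; apply: (le_trans (size_along m_gt0 klip (erefl _) (ltW t0))); rewrite /B lerD2l ltW.
pose c0 := L / 2; have c00 : 0 < c0 by rewrite /c0; lra. have c0L : c0 < L by rewrite /c0; lra.
have wf s t : 0 <= s -> s <= t -> t <= L -> W k s t \is a fin_num by exact: minimal_fin.
have wE s t : 0 <= s -> s <= t -> t <= L -> W k s t = (fine (W k s t))%:E by move=> s0 st tL; rewrite fineK ?wf.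
have J1 t : 0 < t -> t < L -> W k t L = (fine (W k c0 L) + Om c0 - Om t)%:E.
 move=> t0 tL; have E := wE c0 L (ltW c00) (ltW c0L) (lexx L); set a := fine (W k c0 L) in E *.
 have [tc|/ltW ct] := leP t c0.
  rewrite (wlenD rd0 rdx rdt k tc (ltW c0L) om0) (OmW t c0 t0 tc c0L) E -EFinD.
  by congr (_%:E); ring.
 have := wlenD rd0 rdx rdt k ct (ltW tL) om0; rewrite (OmW c0 t c00 ct tL) E.
 rewrite (wE t L (ltW t0) (ltW tL) (lexx L)) -EFinD => -[] ->.
 by congr (_%:E); ring.
have J2 t : 0 < t -> t < L -> W k 0 t = (fine (W k 0 c0) - Om c0 + Om t)%:E.
 move=> t0 tL; have E := wE 0 c0 (lexx 0) (ltW c00) (ltW c0L); set a := fine (W k 0 c0) in E *.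
 have [tc|/ltW ct] := leP t c0.
  have := wlenD rd0 rdx rdt k (ltW t0) tc om0; rewrite (OmW t c0 t0 tc c0L) E.
  rewrite (wE 0 t (lexx 0) (ltW t0) (ltW tL)) -EFinD => -[] ->.
  by congr (_%:E); ring.
 rewrite (wlenD rd0 rdx rdt k (ltW c00) ct om0) (OmW c0 t c00 ct tL) E -EFinD.
 by congr (_%:E); ring.
have up : exists M, forall t, 0 < t -> t < L -> T t <= M.
 have [bL|nbL] := pselect (hill_boundary m h (k L)); last first.
  have [c [e [_ e0 He]]] := om_end_bound (hk L (ltW L_gt0) (lexx L)) nbL.
  apply: (@bounded_speed R L e c (fun t => (sqrt 2 * kw t)^-1)) => //.
   by move=> t t0 tL; split; [exact: TD|exact: v0].
  move=> t t0 tL Let; apply: He => //; apply: (le_lt_trans (lip1_abs _ _)).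
  by rewrite ger0_norm; lra.
 apply: (@finite_time R L h B kw (fun t => fine (W k c0 L) + Om c0 - Om t) T L_gt0 h_gt0 B0) => t t0 tL; split.
 - exact: kw_gt0.
 - have : (0 <= W k t L)%E by apply: wlen_ge0 => //; exact: ltW.
  by rewrite J1 ?lee_fin.
 - have [L' L'0 P] := exit_pair t0 tL bL (kB t t0 tL).
  have := minimal_local (ltW t0) (ltW tL) (lexx L) L'0 P.
  by rewrite (J1 t t0 tL) lee_fin ler_pdivlMr//; lra.
 - have := is_derive_sub (is_derive_cst (fine (W k c0 L) + Om c0) t 1) (OmD t t0 tL).
  by rewrite sub0r.
 - exact: TD.
have down : exists M, forall t, 0 < t -> t < L -> - T t <= M.
 have rev (f df : R -> R) t : is_derive (L - t) 1 f (df (L - t)) -> is_derive t 1 (fun s => f (L - s)) (- df (L - t)).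
  move=> D; have D1 : is_derive t 1 (fun s : R => L - s) (-1).
   by have := is_derive_sub (is_derive_cst L t 1) (is_derive_id t (1 : R)); rewrite sub0r.
  have := @is_derive1_comp R f (fun s => L - s) t _ _ D D1.
  by rewrite mulrN1.
 suff [M HM] : exists M, forall t, 0 < t -> t < L -> - T (L - t) <= M.
  by exists M => t t0 tL; have := HM (L - t) ltac:(lra) ltac:(lra); have -> : L - (L - t) = t by ring.
 have TD' (t : R) : 0 < t -> t < L -> is_derive t 1 (fun s => - T (L - s)) (sqrt 2 * kw (L - t))^-1.
  move=> t0 tL; have := rev T (fun t => (sqrt 2 * kw t)^-1) t (TD (L - t) ltac:(lra) ltac:(lra)).
  by move=> D; have := @is_deriveN R R R (fun s => T (L - s)) t 1 _ D; rewrite opprK.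
 have [bL|nbL] := pselect (hill_boundary m h (k 0)); last first.
  have [c [e [_ e0 He]]] := om_end_bound (hk 0 (lexx 0) (ltW L_gt0)) nbL.
  apply: (@bounded_speed R L e c (fun t => (sqrt 2 * kw (L - t))^-1)) => //.
   by move=> t t0 tL; split; [exact: TD'|apply: v0; lra].
  move=> t t0 tL Let; apply: He; [lra|lra|]; apply: (le_lt_trans (lip1_abs _ _)).
  by rewrite ler0_norm; lra.
 apply: (@finite_time R L h B (fun t => kw (L - t)) (fun t => fine (W k 0 c0) - Om c0 + Om (L - t)) (fun s => - T (L - s)) L_gt0 h_gt0 B0) => t t0 tL.
 have lt0 : 0 < L - t by lra. have ltL : L - t < L by lra.
 split.
 - exact: kw_gt0.
 - have : (0 <= W k 0 (L - t)%R)%E by apply: wlen_ge0 => //; exact: ltW.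
  by rewrite (J2 (L - t) lt0 ltL) lee_fin.
 - have [L' L'0 P] := exit_pair lt0 ltL bL (kB _ lt0 ltL).
  have := minimal_local (lexx 0) (ltW lt0) (ltW ltL) L'0 (gpath_sym m_gt0 L'0 P).
  by rewrite (J2 (L - t) lt0 ltL) lee_fin ler_pdivlMr//; lra.
 - have := is_derive_add (is_derive_cst (fine (W k 0 c0) - Om c0) t 1) (rev Om kw t (OmD _ lt0 ltL)).
  by rewrite add0r.
 - exact: TD'.
have [M1 H1] := up; have [M2 H2] := down; exists (Num.max M1 M2) => t t0 tL.
rewrite ler_norml; apply/andP; split.
 rewrite lerNl; apply: (le_trans (H2 t t0 tL)); by rewrite le_max lexx orbT.
by apply: (le_trans (H1 t t0 tL)); rewrite le_max lexx.
Qed.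

Lemma minimal_motion : exists (X : R -> config R) (Th Tb G : R -> R) (lo hi : R),
 [/\ lo < hi,
  [/\ (forall s t, s <= t -> Th s <= Th t), continuous Th, (forall s, s <= lo -> Th s = 0) & (forall s, hi <= s -> Th s = L)],
  [/\ (forall s t, s <= t -> Tb s <= Tb t), continuous Tb, Tb 0 = lo, Tb L = hi &
    forall t, 0 <= t -> t <= L -> Th (Tb t) = t],
  (forall s, proj (X s) = k (Th s)) & motion m h X Th G lo hi].
Proof.
have [A hk Wf _] := kmin; have [_ klip len] := A.
have s2 : 0 < sqrt 2 :> R by rewrite sqrtr_gt0.
have [Q [Qlip Qk Qc]] := horizontal_lift m_gt0 klip.
have [Om [OmD OmW]] := action_primitive.
have wc (t : R) : 0 < t -> t < L -> {for t, continuous (fun t => (sqrt 2 * kw t)^-1)}.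
 move=> t0 tL; apply: cvg_inv; last by rewrite mulf_neq0 ?gt_eqF// kw_gt0.
 by apply: cvg_scal; exact: kw_continuous.
have [T TD] := antiderivative L_gt0 wc.
have [M HM] := time_bounded TD.
have [|lo [hi [Th [Tb [lohi [Thm Thc Thlo Thhi ThD] TbP]]]]] := @time_change R L M (fun t => (sqrt 2 * kw t)^-1) T L_gt0.
 by move=> t t0 tL; split; [rewrite invr_gt0 mulr_gt0// kw_gt0|exact: TD|exact: HM].
have Th0 s : 0 <= Th s.
 have [h1|h1] := leP s lo; first by rewrite Thlo.
 by rewrite -(Thlo lo (lexx _)); apply: Thm; exact: ltW.
have ThL s : Th s <= L.
 have [h1|h1] := leP hi s; first by rewrite Thhi.
 by rewrite -(Thhi hi (lexx _)); apply: Thm; exact: ltW.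
pose X s := Q (Th s).
have Xk s : proj (X s) = k (Th s) by exact: Qk.
have rep w s t : (forall p, (0 <= w p)%E) -> s <= t -> wlen rd w (fun s => proj (X s)) s t = wlen rd w k (Th s) (Th t).
 move=> w0 st; apply: (wlen_reparam rdx st) => //.
 - by move=> x y _ xy _; exact: Thm.
 - move=> y y1 y2; have [||z] := @IVT R Th s t y st.
  + by apply: continuous_subspaceT => z; exact: Thc.
  + by rewrite ge_min le_max y1 y2 orbT.
  by rewrite in_itv /= => zst <-; exists z.
exists X, Th, Tb, (fun s => sqrt 2 * Om (Th s)), lo, hi; split => //; split.
- split; first by move=> s; exact: Qc.
 by move=> s t st; apply: Qlip => //; exact: Thm.
- move=> s ls sh; have [t0 tL D] := ThD s ls sh; have [nc hU] := int_noncol t0 tL.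
 have D' : is_derive s 1 Th (sqrt 2 * kw (Th s)) by rewrite -[_ * _]invrK.
 rewrite Xk; split => //.
 have := @is_derive1_comp R Om Th s _ _ (OmD _ t0 tL) D' => /(is_derive_scal (sqrt 2)).
 suff -> : 2 * (Upot m (k (Th s)) - h) = sqrt 2 * (kw (Th s) * (sqrt 2 * kw (Th s))) by [].
 have -> : sqrt 2 * (kw (Th s) * (sqrt 2 * kw (Th s))) = (sqrt 2) ^+ 2 * (kw (Th s)) ^+ 2 by ring.
 by rewrite !sqr_sqrtr// subr_ge0 ltW.
- by move=> s t ls st th; rewrite rep// len//; [exact: Thm].
- move=> s t ls st th; rewrite rep//.
 have [s0 sL _] := ThD s ls (le_lt_trans st th); have [t0 tL _] := ThD t (lt_le_trans ls st) th.
 rewrite OmW//; [|exact: Thm]; congr (_%:E); field; by rewrite gt_eqF.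
- move=> s t L' M' ls st th L'0; rewrite !Xk => P; rewrite rep//.
 apply: (minimal_local _ _ _ L'0 P) => //; exact: Thm.
Qed.

End MinimalArcs.

Lemma is_derive_locally_zero (R : realType) (f : R -> R) (s l lo hi : R) : lo < s -> s < hi ->
 (forall t, lo < t -> t < hi -> f t = 0) -> is_derive s 1 f l -> l = 0.
Proof.
move=> ls sh H D; rewrite -(is_derive_derive1 D).
apply: is_derive_derive1; apply: is_derive_near (is_derive_cst (0 : R) s 1).
near=> t; apply: H; near: t; [exact: lt_nbhsr|exact: lt_nbhsl].
Unshelve. all: by end_near.
Qed.

Lemma closure_zero (R : realType) (f : R -> R) (s lo hi : R) : lo < hi -> lo <= s -> s <= hi ->
 {for s, continuous f} -> (forall t, lo < t -> t < hi -> f t = 0) -> f s = 0.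
Proof.
move=> lohi ls sh fc H; apply/eqP; rewrite -normr_le0; apply/ler_addgt0Pr => e e0; rewrite add0r.
have := fc _ (nbhsx_ballx (f s) e e0) => /nbhs_ballP[d /= d0 Hd].
have nm := normr_ge0 ((lo + hi) / 2 - s).
have c0 : 0 < 2 * (`|(lo + hi) / 2 - s| + 1) by lra.
have [r r0 [r1 rd]] := small_factor d0 c0 ltr01.
pose t := s + r * ((lo + hi) / 2 - s).
have lt : lo < t by rewrite /t; nra.
have th : t < hi by rewrite /t; nra.
have ts : `|s - t| < d.
 by rewrite /t opprD addrA subrr sub0r normrN normrM gtr0_norm//; have := mulr_ge0 (ltW r0) nm; lra.
by have := Hd t ts; rewrite /= /ball /= (H t lt th) subr0 => /ltW.
Qed.

Lemma continuous_sum3 (R : realType) (F : 'I_3 -> R -> R) (s : R) : (forall i, {for s, continuous (F i)}) ->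
 {for s, continuous (fun t => \sum_(i < 3) F i t)}.
Proof.
move=> Fc; have -> : (fun t => \sum_(i < 3) F i t) = (fun t => F b1 t + F b2 t + F b3 t).
 by apply/funext => t; rewrite sum3E.
by apply: cvgD; [apply: cvgD|]; exact: Fc.
Qed.

(** A one-sided derivative at an endpoint of [J] is obtained from the two-sided derivative of a
    function that agrees with [f] on [J] only. *)
Lemma within_difference_quotient (R : realType) (J : set R) (f F : R -> R) (s l : R) :
 J s -> (forall t, J t -> f t = F t) -> is_derive s 1 F l ->
 (f u - f s) / (u - s) @[u --> within J s^'] --> l.
Proof.
move=> Js fF /is_derive1_caratheodory[g [gE gc <-]].
apply/cvgrPdist_lt => e e0; rewrite near_withinE.
have gn : \forall u \near s, `|g s - g u| < e by exact: ((cvgrPdist_lt _ _).1 gc e e0).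
near=> u => Ju.
have us : u - s != 0 by rewrite subr_eq0; near: u; exact: nbhs_dnbhs_neq.
rewrite !fF// gE mulfK//; near: u; exact: nbhs_dnbhs.
Unshelve. all: by end_near.
Qed.

(** * Angular momentum, kinetic energy and the gain of an alignment *)

Section CenteredForms.
Context {R : realType}.
Variable m : 'I_3 -> R.
Hypothesis m_gt0 : forall i, 0 < m i.
Local Notation hre := (hre m).
Local Notation him := (him m).
Local Notation hnorm := (hnorm m).

Lemma him_centered (X V : config R) : \sum_(i < 3) (m i)%:C * X i = 0 ->
 \sum_(i < 3) m i * Im (conjc (X i) * V i) = - him X V.
Proof.
move=> c0; have [r0 i0] := coord_b3 m_gt0 c0; have mi i : m i != 0 by rewrite gt_eqF.
have M0 : m b1 + m b2 + m b3 != 0 by rewrite gt_eqF// !addr_gt0.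
have imc (z w : R[i]) : Im (conjc z * w) = Re z * Im w - Im z * Re w by case: z w => ? ? [? ?] /=; ring.
by rewrite sum3E !imc /him /sepr /sepi /wgt r0 i0; field; rewrite M0 mi.
Qed.

Lemma hre_centered (V : config R) : \sum_(i < 3) (m i)%:C * V i = 0 ->
 \sum_(i < 3) m i * normc (V i) ^+ 2 = hre V V.
Proof.
move=> c0; have [r0 i0] := coord_b3 m_gt0 c0; have mi i : m i != 0 by rewrite gt_eqF.
have M0 : m b1 + m b2 + m b3 != 0 by rewrite gt_eqF// !addr_gt0.
by rewrite sum3E !normcsq /hre /sepr /sepi /wgt r0 i0; field; rewrite M0 mi.
Qed.

Lemma him_le (q p : config R) : `|him q p| <= hnorm q * hnorm p.
Proof.
apply: le_trans (cauchy_schwarz m_gt0 q p).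
rewrite -(@ler_pXn2r _ 2) ?nnegrE ?normr_ge0 ?habs_ge0// real_normK ?num_real// habs_sq.
by have := sqr_ge0 (hre q p); lra.
Qed.

(** Aligning gains [2 (habs - hre)], and [(habs - hre) (habs + hre)] is the square of [him]. A
    nonzero [him] thus shortens the step by a definite amount. *)
Lemma qdist_le_him (q p : config R) : 0 < hnorm q -> 0 < hnorm p ->
 qdist m q p ^+ 2 <= hnorm (csub q p) ^+ 2 - him q p ^+ 2 / (hnorm q * hnorm p).
Proof.
move=> q0 p0; rewrite qdist_sq// hnorm_sq// hre_csub.
have H := habs_sq m q p; have A0 := habs_ge0 m q p.
have CS := cauchy_schwarz m_gt0 q p.
have le : hre q p <= habs m q p.
 have [n|n] := leP (hre q p) 0; first exact: le_trans A0.
 rewrite -(@ler_pXn2r _ 2) ?nnegrE ?(ltW n)// H; have := sqr_ge0 (him q p); lra.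
have : him q p ^+ 2 / (hnorm q * hnorm p) <= 2 * (habs m q p - hre q p).
 rewrite ler_pdivrMr ?mulr_gt0//.
 have -> : him q p ^+ 2 = (habs m q p - hre q p) * (habs m q p + hre q p).
  have -> : (habs m q p - hre q p) * (habs m q p + hre q p) = habs m q p ^+ 2 - hre q p ^+ 2 by ring.
  by rewrite H; ring.
 have -> : 2 * (habs m q p - hre q p) * (hnorm q * hnorm p) = (habs m q p - hre q p) * (2 * (hnorm q * hnorm p)) by ring.
 by rewrite ler_wpM2l ?subr_ge0//; lra.
lra.
Qed.

Lemma himBl (q q' d : config R) : him (csub q q') d = him q d - him q' d.
Proof. by rewrite /him /sepr /sepi /csub !ReImE; ring. Qed.

Lemma himZr (q d : config R) a : him q (cscale a d) = a * him q d.
Proof. by rewrite /him /sepr /sepi /cscale !reZ !imZ; ring. Qed.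

Lemma himBr (q q' d : config R) : him d (csub q q') = him d q - him d q'.
Proof. by rewrite himC himBl (himC m d q) (himC m d q'); ring. Qed.

End CenteredForms.

Lemma linear_quadratic_zero (R : realType) (D C e0 : R) : 0 < e0 -> 0 <= C ->
 (forall e, `|e| <= e0 -> 0 <= e * D + e ^+ 2 * C) -> D = 0.
Proof.
move=> e00 C0 H.
have K (D' : R) : (forall e, `|e| <= e0 -> 0 <= e * D' + e ^+ 2 * C) -> D' <= 0.
 move=> H'; rewrite leNgt; apply/negP => D0.
 have C1 : 0 < 2 * (C + 1) by lra.
 have [e e1 [e2 e3]] := small_factor D0 C1 e00.
 have := H' (- e); rewrite normrN gtr0_norm// => /(_ e2); rewrite sqrrN.
 have -> : - e * D' + e ^+ 2 * C = - (e * (D' - e * C)) by ring.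
 rewrite oppr_ge0 pmulr_rle0//; nra.
apply/eqP; rewrite eq_le K//= -oppr_le0; apply: K => e ee.
have -> : e * - D + e ^+ 2 * C = (- e) * D + (- e) ^+ 2 * C by ring.
by apply: H; rewrite normrN.
Qed.

(** * First variation of the action in a fixed direction *)

Section Variation.
Context {R : realType}.
Variable m : 'I_3 -> R.
Hypothesis m_gt0 : forall i, 0 < m i.
Variable h : R.
Local Notation proj := (@reduced_proj R).
Local Notation rd := (rd m).
Local Notation om := (om m h).
Local Notation hill := (hill_region m h).
Local Notation W := (wlen rd om).
Local Notation gpath := (gpath m h).
Local Notation hre := (hre m).
Local Notation him := (him m).
Local Notation hnorm := (hnorm m).

Let rd0 := @rd_ge0 R m.
Let rdx := rdxx m_gt0.
Let rdt := rd_triangle m_gt0.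
Let om0 := @om_ge0' R m h.

Variables (X : R -> config R) (Th G : R -> R) (lo hi : R).
Hypothesis Thc : continuous Th.
Hypothesis mot : motion m h X Th G lo hi.

Let p s := proj (X s).

Lemma hnorm_sq_perturb (q q' E : config R) (a : R) : hnorm (cadd (csub q q') (cscale (- a) E)) ^+ 2 =
 hnorm (csub q q') ^+ 2 + 2 * a * (hre q' E - hre q E) + a ^+ 2 * hnorm E ^+ 2.
Proof.
have sq w v : hre (cadd w v) (cadd w v) = hre w w + 2 * hre w v + hre v v.
 by rewrite hreDl (hreC m w (cadd w v)) (hreC m v (cadd w v)) !hreDl (hreC m v w); ring.
have Z w : hre w (cscale (- a) E) = - a * hre w E by rewrite hreC hreZl hreC.
rewrite !hnorm_sq// sq !Z (hreBl m q q' E) hreZl.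
by ring.
Qed.

Lemma X_step s t : s <= t -> hnorm (csub (X s) (X t)) <= Th t - Th s.
Proof. by have [[_ H] _ _ _ _] := mot; exact: H. Qed.

Lemma X_close s (e : R) : 0 < e -> \forall t \near s, hnorm (csub (X s) (X t)) < e.
Proof.
move=> e0; have := Thc (nbhsx_ballx (Th s) e e0) => /nbhs_ballP[d /= d0 Hd].
apply/nbhs_ballP; exists d => //= t st'; have := Hd t st'; rewrite /= /ball /= => H.
have [st|/ltW ts] := leP s t.
 apply: le_lt_trans H; apply: (le_trans (X_step st)); rewrite distrC; exact: ler_norm.
rewrite hnormN; apply: le_lt_trans H; apply: (le_trans (X_step ts)); exact: ler_norm.
Qed.

Lemma X_continuous (F : config R -> R) (C s : R) : 0 <= C ->
 (forall q q', `|F q - F q'| <= C * hnorm (csub q q')) -> {for s, continuous (fun t => F (X t))}.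
Proof.
move=> C0 FC; apply/cvgrPdist_lt => e e0.
have := @X_close s (e / (C + 1)) ltac:(by rewrite divr_gt0//; lra).
apply: filterS => t; rewrite ltr_pdivlMr; [|lra] => H.
by apply: (le_lt_trans (FC _ _)); have := hnorm_ge0 m (csub (X s) (X t)); lra.
Qed.

Let K0 : 0 <= sepK m. Proof. exact: ltW (sepK_gt0 m_gt0). Qed.

Lemma sepr_X_continuous i j s : {for s, continuous (fun t => sepr (X t) i j)}.
Proof.
apply: (@X_continuous (fun q => sepr q i j) _ s K0) => q q'.
have -> : sepr q i j - sepr q' i j = sepr (csub q q') i j by rewrite /sepr /csub !ReImE; ring.
by apply: le_trans (sep_le_hnorm m_gt0 _ i j); exact: abs_sepr.
Qed.

Lemma sepi_X_continuous i j s : {for s, continuous (fun t => sepi (X t) i j)}.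
Proof.
apply: (@X_continuous (fun q => sepi q i j) _ s K0) => q q'.
have -> : sepi q i j - sepi q' i j = sepi (csub q q') i j by rewrite /sepi /csub !ReImE; ring.
by apply: le_trans (sep_le_hnorm m_gt0 _ i j); exact: abs_sepi.
Qed.

Lemma sep_X_continuous i j s : {for s, continuous (fun t => sep (X t) i j)}.
Proof.
apply: (@X_continuous (fun q => sep q i j) _ s K0) => q q'.
by apply: (le_trans (sep_qdist m_gt0 q q' i j)); rewrite ler_wpM2l// qdist_le_hnorm.
Qed.

Lemma hre_X_continuous E s : {for s, continuous (fun t => hre (X t) E)}.
Proof.
apply: (@X_continuous (fun q => hre q E) _ s (hnorm_ge0 m E)) => q q'.
rewrite -hreBl mulrC ler_norml; apply/andP; split; last exact: hre_le.
rewrite lerNl; have -> : - hre (csub q q') E = hre (csub q' q) E by rewrite !hreBl; ring.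
by rewrite hnormN; exact: hre_le.
Qed.

Lemma dpot_X_continuous E s : noncol (p s) -> {for s, continuous (fun t => dpot m (X t) E)}.
Proof.
rewrite /noncol /p !rsep_proj => -[n1 n2 n3].
have D i j : 0 < sep (X s) i j -> {for s, continuous (fun t => dterm m (X t) E i j)}.
 move=> s0; apply: cvgN; apply: cvgM; first exact: cvg_cst.
 apply: cvgM.
  by apply: cvgD; apply: cvgM; [exact: sepr_X_continuous|exact: cvg_cst|exact: sepi_X_continuous|exact: cvg_cst].
 apply: cvg_inv; last by rewrite expf_neq0// gt_eqF.
 rewrite (_ : (fun t => sep (X t) i j ^+ 3) = (fun t => sep (X t) i j * (sep (X t) i j * sep (X t) i j))).
  by rewrite exprS expr2; apply: cvgM; [|apply: cvgM]; exact: sep_X_continuous.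
 by apply/funext => t; rewrite exprS expr2.
by apply: cvgD; [apply: cvgD|]; exact: D.
Qed.

Lemma rd_X s t : rd (p s) (p t) <= hnorm (csub (X s) (X t)).
Proof. by rewrite rd_proj; exact: qdist_le_hnorm. Qed.

Lemma Upot_X_continuous s : noncol (p s) -> {for s, continuous (fun t => Upot m (p t))}.
Proof.
move=> nc; apply/cvgrPdist_lt => e e0; have [d d0 Hd] := Upot_close m_gt0 nc e0.
have := X_close s d0; apply: filterS => t H.
by have [] := Hd (p t) (le_lt_trans (rd_X s t) H).
Qed.

Lemma motion_at s : lo < s -> s < hi -> [/\ noncol (p s), h < Upot m (p s),
 is_derive s 1 Th (sqrt 2 * omr m h (p s)) & is_derive s 1 G (2 * (Upot m (p s) - h))].
Proof. by have [_ H _ _ _] := mot; exact: H. Qed.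

Let f s := sqrt 2 * omr m h (p s).
Let u s := Upot m (p s) - h.

Lemma u_continuous s : noncol (p s) -> {for s, continuous u}.
Proof. by move=> nc; apply: cvgB; [exact: Upot_X_continuous|exact: cvg_cst]. Qed.

Lemma f_continuous s : noncol (p s) -> {for s, continuous f}.
Proof.
move=> nc; apply: cvg_scal.
apply: (@continuous_comp _ _ _ u (@Num.sqrt R)); last exact: sqrt_continuous.
exact: u_continuous.
Qed.

Lemma f_sq s : lo < s -> s < hi -> 0 < f s /\ f s ^+ 2 = 2 * u s.
Proof.
move=> ls sh; have [_ hU _ _] := motion_at ls sh.
have u0 : 0 < Upot m (p s) - h by rewrite subr_gt0.
split; first by rewrite mulr_gt0// sqrtr_gt0.
by rewrite exprMn !sqr_sqrtr// ltW.
Qed.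

Lemma motion_compact c d : lo < c -> c <= d -> d < hi -> exists sg et F : R, [/\ 0 < sg, 0 < et, 0 <= F &
 forall s, c <= s -> s <= d -> [/\ sep_above sg (p s), h + et <= Upot m (p s) & f s <= F]].
Proof.
move=> lc cd dh.
have wc (g : R -> R) : (forall s, noncol (p s) -> {for s, continuous g}) -> {within `[c, d], continuous g}.
 move=> H; apply: continuous_in_subspaceT => x /set_mem /=; rewrite in_itv /= => /andP[cx xd].
 by apply: H; have [] := motion_at (lt_le_trans lc cx) (le_lt_trans xd dh).
have I x : c <= x -> x <= d -> x \in `[c, d]%R by move=> cx xd; rewrite in_itv /= cx.
have minsep i j : (forall s, noncol (p s) -> 0 < sep (X s) i j) -> exists2 r, 0 < r & forall s, c <= s -> s <= d -> r <= sep (X s) i j.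
 move=> pos; have [|x] := @EVT_min R (fun s => sep (X s) i j) c d cd.
  by apply: wc => s _; exact: sep_X_continuous.
 rewrite in_itv /= => /andP[cx xd] H; exists (sep (X x) i j); last by move=> s cs sd; exact/H/I.
 by apply: pos; have [] := motion_at (lt_le_trans lc cx) (le_lt_trans xd dh).
have [r1 r10 H1] := minsep b1 b2 ltac:(by move=> s []; rewrite /p rsep_proj).
have [r2 r20 H2] := minsep b1 b3 ltac:(by move=> s []; rewrite /p !rsep_proj).
have [r3 r30 H3] := minsep b2 b3 ltac:(by move=> s []; rewrite /p !rsep_proj).
have [x xI Hu] := EVT_min cd (wc u u_continuous).
have [y yI Hf] := EVT_max cd (wc f f_continuous).
move: xI yI; rewrite !in_itv /= => /andP[cx xd] /andP[cy yd].
have [_ hU _ _] := motion_at (lt_le_trans lc cx) (le_lt_trans xd dh).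
have [f0 _] := f_sq (lt_le_trans lc cy) (le_lt_trans yd dh).
exists (Num.min r1 (Num.min r2 r3)), (u x), (f y); split.
- by rewrite !lt_min r10 r20.
- by rewrite subr_gt0.
- exact: ltW.
move=> s cs sd; split; last exact/Hf/I.
- by rewrite /sep_above /p !rsep_proj !ge_min H1// H2// H3// !orbT.
- by have := Hu s (I s cs sd); rewrite /u; lra.
Qed.

Section AffineVariation.
Variables (E : config R) (P P' : R -> R).
(** [P] is a second primitive of the directional derivative of the potential along [X]. As
    [phi * P' - sl * P] has derivative [phi] times that derivative, the first order change of the
    potential becomes a boundary term. *)
Hypothesis PD : forall s : R, lo < s -> s < hi -> is_derive s 1 P (P' s) /\ is_derive s 1 P' (dpot m (X s) E).
Variables (c d e b sl sg B : R).
Hypothesis lc : lo < c.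
Hypothesis cd : c <= d.
Hypothesis dh : d < hi.
Let phi s : R := b + sl * s.
Hypothesis phi1 : forall s, c <= s -> s <= d -> `|phi s| <= 1.
Hypothesis sg0 : 0 < sg.
Hypothesis sgX : forall s, c <= s -> s <= d -> sep_above sg (p s).
Hypothesis B0 : 0 <= B.
Hypothesis BE : [/\ sep E b1 b2 <= B, sep E b1 b3 <= B & sep E b2 b3 <= B].
Hypothesis eB : 2 * (`|e| * B) < sg.
Let Y s : config R := cadd (X s) (cscale (e * phi s) E).
Hypothesis Yhill : forall s, c <= s -> s <= d -> hill (proj (Y s)).

Let C0 : R := 2 * mmsum m / sg ^+ 3 * B ^+ 2.

Lemma affine_taylor s : c <= s -> s <= d -> sep_above (sg / 2) (proj (Y s)) /\
 Upot m (proj (Y s)) <= Upot m (p s) + e * phi s * dpot m (X s) E + e ^+ 2 * C0.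
Proof.
move=> cs sd; have ph := phi1 cs sd.
have ep : `|e * phi s| <= `|e| by rewrite normrM; rewrite -[leRHS]mulr1 ler_wpM2l.
have S i j : sep E i j <= B -> sep (cscale (e * phi s) E) i j <= `|e| * B.
 by move=> H; rewrite sep_cscale; apply: ler_pM => //; exact: sep_ge0.
have [h1 h2 h3] := BE.
have [S1 S2] := Upot_taylor m_gt0 sg0 (mulr_ge0 (normr_ge0 e) B0) eB (sgX cs sd) (S _ _ h1) (S _ _ h2) (S _ _ h3).
split=> //; move: S2; rewrite dpotZ ler_norml => /andP[_].
rewrite exprMn real_normK ?num_real// /C0 -/(Y s) -/(p s); lra.
Qed.

Let C : R := C0 + sl ^+ 2 * hnorm E ^+ 2 / 2.

(** Each term of a lower sum is bounded by a piece of the time dependent action. To first order in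
    [e], the kinetic part changes by [sl] times an increment of [hre (X s) E], which telescopes, and
    the potential part by the boundary term; the rest is of order [e^2]. *)
Lemma affine_action : (W (fun s => proj (Y s)) c d <=
 ((G d - G c + e * (phi d * P' d - sl * P d - (phi c * P' c - sl * P c)) + e ^+ 2 * C * (d - c)
  + e * sl * (hre (X d) E - hre (X c) E)) / sqrt 2)%:E)%E.
Proof.
have mark : True by [].
have lc' := lc; have cd' := cd; have dh' := dh; have sg0' := sg0.
have s2 : 0 < sqrt 2 :> R by rewrite sqrtr_gt0.
have s22 : sqrt 2 ^+ 2 = 2 :> R by rewrite sqr_sqrtr.
pose g1 s := G s + e * (phi s * P' s - sl * P s).
pose a s := dpot m (X s) E.
have g1D (s : R) : lo < s -> s < hi -> is_derive s 1 g1 (2 * u s + e * (phi s * a s)).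
 move=> ls sh; have [_ _ _ GD] := motion_at ls sh; have [D1 D2] := PD ls sh.
 have phD : is_derive s 1 phi sl.
  have := is_derive_add (is_derive_cst b s 1) (is_derive_scal sl (is_derive_id s (1 : R))).
  by rewrite add0r mulr1.
 have D3 : is_derive s 1 (fun s => phi s * P' s - sl * P s) (phi s * a s).
  have := is_derive_sub (is_derive_mul phD D2) (is_derive_scal sl D1).
  by have -> : phi s * dpot m (X s) E + P' s * sl - sl * P' s = phi s * a s by rewrite /a; ring.
 exact: (is_derive_add GD (is_derive_scal e D3)).
have phc (s : R) : {for s, continuous phi}.
 by apply: cvgD; [exact: cvg_cst|apply: cvgM; [exact: cvg_cst|exact: cvg_id]].
have g1c (s : R) : lo < s -> s < hi -> {for s, continuous (fun s => 2 * u s + e * (phi s * a s))}.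
 move=> ls sh; have [nc _ _ _] := motion_at ls sh.
 apply: cvgD; first by apply: cvg_scal; exact: u_continuous.
 by apply: cvg_scal; apply: cvgM; [exact: phc|exact: dpot_X_continuous].
have vc (s : R) : lo < s -> s < hi -> {for s, continuous (fun s => u s + e * (phi s * a s))}.
 move=> ls sh; have [nc _ _ _] := motion_at ls sh.
 apply: cvgD; first exact: u_continuous.
 by apply: cvg_scal; apply: cvgM; [exact: phc|exact: dpot_X_continuous].
have loc (kap z : R) : 0 < kap -> c <= z -> z <= d -> exists2 r, 0 < r & forall x y : R, c <= x -> x <= z -> z <= y -> y <= d ->
  z - r < x -> y < z + r -> (W (fun s => proj (Y s)) x y <=
   ((g1 y - g1 x + (e ^+ 2 * C + kap) * (y - x) + e * sl * (hre (X y) E - hre (X x) E)) / sqrt 2)%:E)%E.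
 move=> kap0 cz zd; have lz : lo < z by lra. have zh : z < hi by lra.
 have [f0 f2] := f_sq lz zh; have [nc _ _ _] := motion_at lz zh.
 have k4 : 0 < kap / 4 by lra.
 have f1 : 0 < 4 * (f z + 1) by lra.
 have [k3 k30 [k31 k3k]] := small_factor kap0 f1 ltr01.
 have [r1 r10 H1] := strong_difference lz zh g1D (g1c z lz zh) k4.
 have [r2 r20 H2] := strong_difference lz zh (fun s ls sh => let: And4 _ _ D _ := motion_at ls sh in D) (f_continuous nc) k30.
 have := vc z lz zh _ (nbhsx_ballx (u z + e * (phi z * a z)) (kap / 4) k4) => /nbhs_ballP[r3 /= r30 H3].
 exists (Num.min r1 (Num.min r2 r3)); first by rewrite !lt_min r10 r20.
 set r := Num.min r1 _; have rr1 : r <= r1 by rewrite ge_min lexx.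
 have rr2 : r <= r2 by rewrite !ge_min lexx orbT.
 have rr3 : r <= r3 by rewrite !ge_min lexx !orbT.
 move=> x y cx xz zy yd xr yr; have xy : x <= y by lra.
 have := H1 x y ltac:(lra) xy ltac:(lra); rewrite ler_norml => /andP[g1l _].
 pose K := 2 * u z + e * (phi z * a z) + e ^+ 2 * C + kap / 2.
 pose F s := K * s + e * sl * hre (X s) E.
 apply: wlen_le => n xs cs Hp.
 have term i : (i < n)%N -> sqrt 2 * (cs i * rd (proj (Y (xs i))) (proj (Y (xs i.+1)))) <= F (xs i.+1) - F (xs i).
  move=> lin; clear g1l f1; have [_ _ Hc] := Hp; have [xx ci0 Hci] := Hc i lin.
  have [xi1 xi2] := part_in Hp (ltnW lin); have [xj1 xj2] := part_in Hp lin.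
  set s := xs i in xx Hci xi1 xi2 *; set t := xs i.+1 in xx Hci xj1 xj2 *.
  have [st|st] := eqVneq s t; first by rewrite st rdx !mulr0 subrr.
  have D0 : 0 < t - s by rewrite subr_gt0 lt_neqAle st.
  have cis : cs i ^+ 2 <= u z + e * (phi z * a z) + kap / 4 + e ^+ 2 * C0.
   have bs : ball z r3 s by rewrite /ball /= ltr_norml; apply/andP; split; move: rr3 xr yr xi1 xi2 xz zy; only_lra.
   have := Hci s (lexx _) xx; have [S1 S2] := affine_taylor (s := s) (le_trans cx xi1) (le_trans xi2 yd).
   have ncY : noncol (proj (Y s)) by apply: (sep_above_noncol _ S1); rewrite divr_gt0.
   have := Yhill (s := s) (le_trans cx xi1) (le_trans xi2 yd) => /(hill_noncol m h ncY) hY.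
   rewrite om_noncol// lee_fin => cle.
   have : cs i ^+ 2 <= sqrt (Upot m (proj (Y s)) - h) ^+ 2 by rewrite ler_pXn2r// nnegrE ?sqrtr_ge0.
   rewrite sqr_sqrtr ?subr_ge0// => cle2.
   move: bs => /H3; rewrite /= /ball /= ltr_norml /u /a => /andP[h1 h2].
   by move: cle2 S2 h1 h2; rewrite /u /a; only_lra.
  have NX : hnorm (csub (X s) (X t)) <= (f z + k3) * (t - s).
   apply: (le_trans (X_step xx)); have := H2 s t ltac:(move: xi1 xr rr2; only_lra) xx ltac:(move: xj2 yr rr2; only_lra).
   by rewrite -/(f z) ler_norml => /andP[_]; only_lra.
  set r' := rd _ _.
  have r'0 : 0 <= r' by exact: rd0.
  have dsq : r' ^+ 2 <= (f z + k3) ^+ 2 * (t - s) ^+ 2 + 2 * (e * sl * (t - s)) * (hre (X t) E - hre (X s) E) + (e * sl * (t - s)) ^+ 2 * hnorm E ^+ 2.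
   have l1 : r' <= hnorm (csub (Y s) (Y t)) by rewrite /r' rd_proj; exact: qdist_le_hnorm.
   have l2 : r' ^+ 2 <= hnorm (csub (Y s) (Y t)) ^+ 2 by rewrite ler_pXn2r// nnegrE hnorm_ge0.
   apply: (le_trans l2).
   have eY : csub (Y s) (Y t) = cadd (csub (X s) (X t)) (cscale (- (e * sl * (t - s))) E).
    apply/funext => j; rewrite /csub /Y /cadd /cscale /phi.
    have -> : (- (e * sl * (t - s)))%:C = (e * (b + sl * s))%:C - (e * (b + sl * t))%:C.
     by rewrite -rmorphB; congr (_%:C); ring.
    by ring.
   rewrite eY hnorm_sq_perturb.
   have : hnorm (csub (X s) (X t)) ^+ 2 <= ((f z + k3) * (t - s)) ^+ 2 by rewrite ler_pXn2r// nnegrE ?hnorm_ge0// mulr_ge0//; clear cis l1 l2 NX r'0; lra.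
   by rewrite exprMn; set q := hnorm E; only_lra.
  (* Length against time dependent action; little is lost because along the motion the squared speed
     is [2 (U - h)]. *)
  have amgm : sqrt 2 * (cs i * r') <= r' ^+ 2 / (2 * (t - s)) + cs i ^+ 2 * (t - s).
   rewrite -subr_ge0.
   have -> : r' ^+ 2 / (2 * (t - s)) + cs i ^+ 2 * (t - s) - sqrt 2 * (cs i * r') = (r' - sqrt 2 * (t - s) * cs i) ^+ 2 / (2 * (t - s)).
    have -> : (r' - sqrt 2 * (t - s) * cs i) ^+ 2 = r' ^+ 2 + (sqrt 2) ^+ 2 * (t - s) ^+ 2 * cs i ^+ 2 - 2 * sqrt 2 * (t - s) * cs i * r' by ring.
    by rewrite s22; field; rewrite gt_eqF.
   by rewrite divr_ge0 ?sqr_ge0// mulr_ge0// ltW.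
  apply: (le_trans amgm).
  have q1 : r' ^+ 2 / (2 * (t - s)) <= (f z + k3) ^+ 2 / 2 * (t - s) + e * sl * (hre (X t) E - hre (X s) E) + e ^+ 2 * (sl ^+ 2 * hnorm E ^+ 2 / 2) * (t - s).
   rewrite ler_pdivrMr; last by rewrite mulr_gt0.
   apply: (le_trans dsq); rewrite le_eqVlt; apply/orP; left; apply/eqP; by field.
  have q2 : cs i ^+ 2 * (t - s) <= (u z + e * (phi z * a z) + kap / 4 + e ^+ 2 * C0) * (t - s) by rewrite ler_wpM2r// ltW.
  have q3 : (f z + k3) ^+ 2 / 2 <= u z + kap / 4.
   have -> : (f z + k3) ^+ 2 = f z ^+ 2 + 2 * f z * k3 + k3 * k3 by ring.
   have : k3 * k3 <= k3 by rewrite -[leRHS]mulr1 ler_wpM2l// ltW.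
   by rewrite f2; clear cis NX r'0 dsq amgm q1 q2; lra.
  have q4 : (f z + k3) ^+ 2 / 2 * (t - s) <= (u z + kap / 4) * (t - s) by rewrite ler_wpM2r// ltW.
  by move: q1 q2 q4; rewrite /F /K /C; only_lra.
 have sum : sqrt 2 * psum rd (fun s => proj (Y s)) n xs cs <= F y - F x.
  have [x0 xn _] := Hp; have -> : F y - F x = \sum_(i < n) (F (xs i.+1) - F (xs i)).
   by rewrite -(big_mkord xpredT (fun i => F (xs i.+1) - F (xs i))) telescope_sumr// x0 xn.
  rewrite /psum mulr_sumr.
  by apply: ler_sum => i _; exact: term.
 rewrite lee_fin ler_pdivlMr// mulrC; apply: (le_trans sum).
 have kxy : 0 <= kap * (y - x) by rewrite mulr_ge0 ?subr_ge0// ltW.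
 by move: g1l kxy; rewrite /F /K; only_lra.
apply/lee_addgt0Pr => k0 k00; pose kap := sqrt 2 * k0 / (d - c + 1).
have kap0 : 0 < kap by rewrite divr_gt0 ?mulr_gt0//; lra.
pose Psi s := (g1 s + (e ^+ 2 * C + kap) * s + e * sl * hre (X s) E) / sqrt 2.
have := @wlen_primitive R _ rd rd0 rdx rdt om (fun s => proj (Y s)) Psi c d cd om0 _.
move=> PP; apply: (@le_trans _ _ (Psi d - Psi c)%:E); first apply: PP.
 move=> z cz zd; have [r r0 Hr] := loc kap z kap0 cz zd; exists r => // x y x1 x2 x3 x4 x5 x6.
 by apply: (le_trans (Hr x y x1 x2 x3 x4 x5 x6)); rewrite lee_fin /Psi; lra.
rewrite -EFinD lee_fin /Psi.
have kk : kap * (d - c) <= sqrt 2 * k0.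
 rewrite /kap mulrAC ler_pdivrMr; [|lra].
 by have := mulr_gt0 s2 k00; nra.
have -> : k0 = sqrt 2 * k0 / sqrt 2 by field; rewrite gt_eqF.
rewrite -mulrBl -mulrDl ler_pM2r ?invr_gt0// /g1; lra.
Qed.

End AffineVariation.

Lemma Th_lip c d F s t : lo < c -> d < hi -> (forall s, c <= s -> s <= d -> f s <= F) ->
 c <= s -> s <= t -> t <= d -> Th t - Th s <= F * (t - s).
Proof.
move=> lc dh HF cs st td; suff : F * s - Th s <= F * t - Th t by lra.
apply: (derive_nondecreasing (f := fun z => F * z - Th z) (df := fun z => F * 1 - f z) st) => z sz zt.
have [_ _ D _] := motion_at (s := z) ltac:(lra) ltac:(lra).
split; last by rewrite mulr1 subr_ge0; apply: HF; lra.
exact: (is_derive_sub (is_derive_scal F (is_derive_id z (1 : R))) D).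
Qed.

(** The competitor adds [e] times a hat function, 0 at [t - r] and [t + r] and 1 at [t], in the
    direction [E]. Minimality for both signs of [e] makes the first order term vanish, and that term
    is this second difference. *)
Lemma second_difference E (P P' : R -> R) t r :
 (forall s : R, lo < s -> s < hi -> is_derive s 1 P (P' s) /\ is_derive s 1 P' (dpot m (X s) E)) ->
 0 < r -> lo < t - r -> t + r < hi ->
 hre (X (t + r)) E - P (t + r) + (hre (X (t - r)) E - P (t - r)) = 2 * (hre (X t) E - P t).
Proof.
move=> PD r0; set c := t - r; set d := t + r => lc dh.
have ct : c <= t by rewrite /c; lra. have td : t <= d by rewrite /d; lra.
have s2 : 0 < sqrt 2 :> R by rewrite sqrtr_gt0.
have [sg [et [F [sg0 et0 F0 HK]]]] := motion_compact lc (le_trans ct td) dh.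
have N0 := hnorm_ge0 m E; set N := hnorm E in N0 *.
pose B := sep E b1 b2 + sep E b1 b3 + sep E b2 b3.
have := sep_ge0 E b1 b2; have := sep_ge0 E b1 b3; have := sep_ge0 E b2 b3 => z1 z2 z3.
have B0 : 0 <= B by rewrite /B; lra.
have BE : [/\ sep E b1 b2 <= B, sep E b1 b3 <= B & sep E b2 b3 <= B] by rewrite /B; split; lra.
pose K := mmsum m * sepK m / (sg / 2) ^+ 2.
have mm0 := mmsum_gt0 m_gt0.
have K0' : 0 <= K by rewrite divr_ge0 ?sqr_ge0// mulr_ge0// ltW.
have KN : 0 <= K * N by rewrite mulr_ge0.
have B41 : 0 < 4 * (B + 1) by lra. have KN1 : 0 < K * N + 1 by lra.
have [e' e'0 [_ e'1]] := small_factor sg0 B41 ltr01.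
have [e0 e00 [e0' e01]] := small_factor et0 KN1 e'0.
pose C := 2 * mmsum m / sg ^+ 3 * B ^+ 2 + r^-1 ^+ 2 * N ^+ 2 / 2.
have i3 : 0 <= (sg ^+ 3)^-1 by rewrite invr_ge0 exprn_ge0// ltW.
have c1 : 0 <= 2 * mmsum m / sg ^+ 3 * B ^+ 2 by apply: mulr_ge0; [apply: mulr_ge0 => //; lra|exact: sqr_ge0].
have c2 : 0 <= r^-1 ^+ 2 * N ^+ 2 / 2 by apply: mulr_ge0; [apply: mulr_ge0; exact: sqr_ge0|rewrite invr_ge0].
have C0 : 0 <= C by rewrite /C; lra.
(* The coefficient of [e] in [sqrt 2] times the bound for the extra cost of the hat; the slopes of
   the hat are [1 / r] and [- 1 / r]. *)
pose D := ((P c + P d - 2 * P t) - (hre (X c) E + hre (X d) E - 2 * hre (X t) E)) / r.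
suff : D = 0.
 by move=> /eqP; rewrite mulf_eq0 invr_eq0 (gt_eqF r0) orbF => /eqP; lra.
apply: (linear_quadratic_zero e00 (C := C * (2 * r))); first by rewrite mulr_ge0// mulr_ge0// ltW.
move=> e ee.
have e1 : `|e| * (4 * (B + 1)) <= sg by have := ler_pM2r B41 `|e| e'; nra.
have e2 : `|e| * (K * N + 1) <= et by nra.
have ne := normr_ge0 e.
have eB : 2 * (`|e| * B) < sg.
 have [z|nz] := eqVneq (`|e|) 0; first by rewrite z mul0r mulr0.
 have : 0 < `|e| by rewrite lt0r nz.
 have : 0 <= `|e| * B by rewrite mulr_ge0.
 lra.
clear z1 z2 z3 i3 c1 c2 e'1 e'0 e00 e0' e01 B41 KN1 KN C0 e1 ee.
have half c' d' b sl : c <= c' -> c' <= d' -> d' <= d -> (forall s, c' <= s -> s <= d' -> `|b + sl * s| <= 1) ->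
  sl ^+ 2 = r^-1 ^+ 2 ->
  exists2 L, 0 <= L & gpath (proj (cadd (X c') (cscale (e * (b + sl * c')) E))) (proj (cadd (X d') (cscale (e * (b + sl * d')) E))) L
   ((G d' - G c' + e * ((b + sl * d') * P' d' - sl * P d' - ((b + sl * c') * P' c' - sl * P c')) + e ^+ 2 * C * (d' - c')
  + e * sl * (hre (X d') E - hre (X c') E)) / sqrt 2).
 move=> cc cd' dd ph sl2; pose Y s := cadd (X s) (cscale (e * (b + sl * s)) E).
 have lc' := lt_le_trans lc cc. have dh' := le_lt_trans dd dh.
 have sgX s : c' <= s -> s <= d' -> sep_above sg (p s).
  by move=> h1 h2; have [] := HK s (le_trans cc h1) (le_trans h2 dd).
 have Yh s : c' <= s -> s <= d' -> hill (proj (Y s)).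
  move=> h1 h2; have [a1 a2 a3] := HK s (le_trans cc h1) (le_trans h2 dd).
  have sg2 : 0 < sg / 2 by rewrite divr_gt0.
  have A1' : sep_above (sg / 2) (p s) by clear a3 e2; case: a1 => [? ? ?]; split; lra.
  have ps := ph s h1 h2.
  have ep : `|e * (b + sl * s)| <= `|e| by rewrite normrM; rewrite -[leRHS]mulr1 ler_wpM2l.
  have S i j : sep E i j <= B -> sep (cscale (e * (b + sl * s)) E) i j <= `|e| * B.
   by move=> H; rewrite sep_cscale; apply: ler_pM => //; exact: sep_ge0.
  have [h3 h4 h5] := BE.
  have [S1 _] := Upot_taylor m_gt0 sg0 (mulr_ge0 ne B0) eB a1 (S _ _ h3) (S _ _ h4) (S _ _ h5).
  apply/(hill_noncol m h (sep_above_noncol sg2 S1)).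
  have := Upot_lip m_gt0 sg2 A1' S1; rewrite ler_norml => /andP[_].
  have : rd (p s) (proj (Y s)) <= `|e| * N.
   rewrite rd_proj; apply: (@le_trans _ _ (hnorm (csub (X s) (Y s)))); first exact: qdist_le_hnorm.
   have -> : csub (X s) (Y s) = cscale (- (e * (b + sl * s))) E.
    by apply/funext => j; rewrite /csub /Y /cadd /cscale rmorphN /= opprD addrA subrr add0r mulNr.
   by rewrite hnormZ normrN ler_wpM2r.
  move=> rdl; have : K * rd (p s) (proj (Y s)) <= K * (`|e| * N) by rewrite ler_wpM2l.
  rewrite -/K -/(Y s); have : 0 <= `|e| by []. lra.
 have := @gpath_of_lip R m m_gt0 h (fun s => proj (Y s)) c' d' (F + `|e * sl| * N + 1) _ cd' _ _ Yh _.
 set M := (_ / sqrt 2) => GP.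
 exists ((F + `|e * sl| * N + 1) * (d' - c')).
  by rewrite mulr_ge0 ?subr_ge0// !addr_ge0// mulr_ge0.
 apply: GP.
 - by rewrite ltr_wpDl// addr_ge0// mulr_ge0.
 - move=> s s' cs ss sd; rewrite rd_proj; apply: (@le_trans _ _ (hnorm (csub (Y s) (Y s')))); first exact: qdist_le_hnorm.
  have -> : csub (Y s) (Y s') = cadd (csub (X s) (X s')) (cscale (- (e * sl * (s' - s))) E).
   apply/funext => j; rewrite /csub /Y /cadd /cscale.
   have -> : (- (e * sl * (s' - s)))%:C = (e * (b + sl * s))%:C - (e * (b + sl * s'))%:C.
    by rewrite -rmorphB; congr (_%:C); ring.
   by ring.
  apply: (le_trans (hnormD m_gt0 _ _)); rewrite hnormZ normrN normrM (ger0_norm (x := s' - s)) ?subr_ge0//.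
  have := X_step ss; have := @Th_lip c d F s s' lc dh (fun s h1 h2 => let: And3 _ _ H := HK s h1 h2 in H) (le_trans cc cs) ss (le_trans sd dd).
  by rewrite -/N; set q := `|e * sl|; lra.
 - have := @affine_action E P P' PD c' d' e b sl sg B lc' cd' dh' ph sg0 sgX B0 BE eB Yh.
  by rewrite sl2 -/N -/C.
have ri : r^-1 * r = 1 by rewrite mulVf// gt_eqF.
have ri0 : 0 < r^-1 by rewrite invr_gt0.
have [L1 L10 P1] := half c t (- (r^-1 * c)) r^-1 (lexx c) ct td ltac:(move=> s h1 h2; rewrite ler_norml; rewrite /c in h1 h2 *; apply/andP; split; nra) (erefl _).
have [L2 L20 P2] := half t d (r^-1 * d) (- r^-1) ct td (lexx d) ltac:(move=> s h1 h2; rewrite ler_norml; rewrite /d in h1 h2 *; apply/andP; split; nra) (sqrrN _).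
have [_ _ _ _ Hmin] := mot; have [_ _ _ HW _] := mot.
have f1 : - (r^-1 * c) + r^-1 * c = 0 by ring.
have f2 : - (r^-1 * c) + r^-1 * t = 1 by rewrite /c mulrBr ri; ring.
have f3 : r^-1 * d + - r^-1 * t = 1 by rewrite /d mulrDr ri; ring.
have f4 : r^-1 * d + - r^-1 * d = 0 by ring.
have z0 q : cadd q (cscale 0 E) = q by apply/funext => i; rewrite /cadd /cscale mul0r addr0.
rewrite f1 f2 mulr0 z0 in P1; rewrite f3 f4 mulr0 z0 in P2.
have := Hmin c d _ _ lc (le_trans ct td) dh (addr_ge0 L10 L20) (gpath_cat m_gt0 L10 L20 P1 P2).
rewrite HW//; last exact: le_trans ct td.
rewrite lee_fin -mulrDl ler_pM2r ?invr_gt0//.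
have -> : D = (P c + P d - 2 * P t) * r^-1 - (hre (X c) E + hre (X d) E - 2 * hre (X t) E) * r^-1 by rewrite /D; ring.
have -> : 2 * r = (d - t) + (t - c) by rewrite /c /d; ring.
by lra.
Qed.

Hypothesis lohi : lo < hi.

Lemma motion_affine E (P P' : R -> R) :
 (forall s : R, lo < s -> s < hi -> is_derive s 1 P (P' s) /\ is_derive s 1 P' (dpot m (X s) E)) ->
 exists al be : R, forall s, lo < s -> s < hi -> hre (X s) E = P s + (al * s + be).
Proof.
move=> PD.
have [||al [be H]] := @midpoint_affine R (fun s => hre (X s) E - P s) lo hi lohi.
- move=> t lt th; apply: cvgB; first exact: hre_X_continuous.
 by have [D _] := PD t lt th; exact: is_derive_cvg D.
- by move=> t r r0 h1 h2; apply: second_difference PD r0 h1 h2.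
by exists al, be => s ls sh; have := H s ls sh; lra.
Qed.

(** * Newton's equations, energy and angular momentum *)

Section Newton.
Variables lo' hi' : R.
Hypothesis lol : lo' <= lo.
Hypothesis hih : hi <= hi'.
Hypothesis nonc : forall s, lo' < s -> s < hi' -> noncol (proj (X s)).

(** The interval []lo', hi'[] may reach beyond [[lo, hi]] across an end without collision. The
    second primitive is formed on it, so that even at such an end the coordinate agrees with a
    function having a two-sided derivative. *)
Lemma coordinate_C2 E : exists wv : (R -> R) * (R -> R),
 (forall s : R, lo' < s -> s < hi' -> is_derive s 1 wv.1 (wv.2 s) /\ is_derive s 1 wv.2 (dpot m (X s) E)) /\
 (forall s, lo' < s -> s < hi' -> lo <= s -> s <= hi -> hre (X s) E = wv.1 s).
Proof.
have l1 := lol; have l2 := lohi; have l3 := hih.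
have lh : lo' < hi' by lra.
have [P' HP'] := antiderivative lh (fun s ls sh => dpot_X_continuous (E := E) (nonc ls sh)).
have [P HP] := antiderivative lh (fun (s : R) ls sh => is_derive_cvg (HP' s ls sh)).
have [|al [be H]] := @motion_affine E P P'.
 by move=> s ls sh; split; [apply: HP|apply: HP']; lra.
exists ((fun s => P s + (al * s + be)), (fun s => P' s + al)); split => /=.
 move=> s ls sh; split.
  have := is_derive_add (HP s ls sh) (is_derive_add (is_derive_scal al (is_derive_id s (1 : R))) (is_derive_cst be s 1)).
  by rewrite mulr1 addr0.
 by have := is_derive_add (HP' s ls sh) (is_derive_cst al s 1); rewrite addr0.
move=> s ls sh lo_s s_hi.
have := @closure_zero R (fun s => hre (X s) E - (P s + (al * s + be))) s lo hi lohi lo_s s_hi _ _.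
move=> Z; apply/eqP; rewrite -subr_eq0; apply/eqP; apply: Z.
 apply: cvgB; first exact: hre_X_continuous.
 apply: cvgD; first exact: is_derive_cvg (HP s ls sh).
 by apply: cvgD; [apply: cvgM; [exact: cvg_cst|exact: cvg_id]|exact: cvg_cst].
by move=> t lt th; rewrite H// subrr.
Qed.

(** [Th] measures the length of the projected curve. If distances near [s] are at most [c] times the
    time, so are lengths, and hence the derivative of [Th] is at most [c]. *)
Lemma arc_speed_le s c r : lo < s -> s < hi -> 0 <= c -> 0 < r ->
 (forall x y, s - r < x -> x <= y -> y < s + r -> rd (p x) (p y) <= c * (y - x)) -> f s <= c.
Proof.
move=> ls sh c0 r0 H; apply/ler_addgt0Pr => e e0.
have [nc _ _ _] := motion_at ls sh.
have [r2 r20 H2] := strong_difference ls sh (fun s ls sh => let: And4 _ _ D _ := motion_at ls sh in D) (f_continuous nc) e0.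
pose d := Num.min (Num.min r r2) (Num.min (s - lo) (hi - s)).
have d0 : 0 < d by rewrite !lt_min r0 r20 !subr_gt0 ls.
have : d <= d by []; rewrite {2}/d !le_min => /andP[/andP[dr dr2] /andP[dl dh]].
have [_ _ Hlen _ _] := mot.
have lenE := Hlen (s - d / 2) (s + d / 2) ltac:(lra) ltac:(lra) ltac:(lra).
have : (wlen rd one_weight (fun s => proj (X s)) (s - d / 2) (s + d / 2) <= (c * (s + d / 2 - (s - d / 2)))%:E)%E.
 apply: wlen_le => n xs cs Hp; have [x0 xn Hc] := Hp; rewrite lee_fin.
 have -> : c * (s + d / 2 - (s - d / 2)) = \sum_(i < n) (c * xs i.+1 - c * xs i).
  by rewrite -(big_mkord xpredT (fun i => c * xs i.+1 - c * xs i)) telescope_sumr// x0 xn; ring.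
 apply: ler_sum => i _; have [xx ci0 Hci] := Hc i (ltn_ord i).
 have [i1 i2] := part_in Hp (ltnW (ltn_ord i)); have [j1 j2] := part_in Hp (ltn_ord i).
 have ci1 : cs i <= 1 by have := Hci _ (lexx _) xx; rewrite /one_weight lee_fin.
 apply: (@le_trans _ _ (rd (p (xs i)) (p (xs i.+1)))).
  by rewrite -[leRHS]mul1r ler_wpM2r.
 by rewrite -mulrBr; apply: H; lra.
rewrite lenE lee_fin.
have := H2 (s - d / 2) (s + d / 2) ltac:(lra) ltac:(lra) ltac:(lra); rewrite ler_norml => /andP[+ _].
rewrite -/(f s); have -> : s + d / 2 - (s - d / 2) = d by field.
move=> h1 h2; have : f s * d <= (c + e) * d by lra.
by rewrite ler_pM2r.
Qed.

(** [coordinate_C2] with coordinate directions for [E], divided by the masses through [hre_unitc].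
    The last clause is strong differentiability of the lift [X] itself. *)
Lemma velocity : exists V : R -> config R,
 [/\ (forall s i, lo' < s -> s < hi' ->
    is_derive s 1 (fun t => Re (V t i)) (dpot m (X s) (unitc i 1) / m i) /\
    is_derive s 1 (fun t => Im (V t i)) (dpot m (X s) (unitc i 'i) / m i)),
   (forall i, exists xr xi : R -> R, (forall s, lo' < s -> s < hi' -> lo <= s -> s <= hi -> X s i = xr s +i* xi s) /\
     forall s : R, lo' < s -> s < hi' -> is_derive s 1 xr (Re (V s i)) /\ is_derive s 1 xi (Im (V s i))) &
   (forall s k, lo < s -> s < hi -> 0 < k -> exists2 r, 0 < r & forall x y, s - r < x -> x <= y -> y < s + r ->
     hnorm (csub (csub (X y) (X x)) (cscale (y - x) (V s))) <= k * (y - x))].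
Proof.
have mark : True by [].
have l1 := lol; have l2 := lohi; have l3 := hih.
have [WV HWV] := choice coordinate_C2.
have [[Xc _] _ _ _ _] := mot.
have mi i : (m i)^-1 * m i = 1 by rewrite mulVf// gt_eqF.
pose V s : config R := fun i => ((m i)^-1 * (WV (unitc i 1)).2 s) +i* ((m i)^-1 * (WV (unitc i 'i)).2 s).
pose xr i s := (m i)^-1 * (WV (unitc i 1)).1 s; pose xi i s := (m i)^-1 * (WV (unitc i 'i)).1 s.
have xrD i (s : R) : lo' < s -> s < hi' -> is_derive s 1 (xr i) (Re (V s i)) /\ is_derive s 1 (xi i) (Im (V s i)).
 move=> ls sh; have [H1 _] := HWV (unitc i 1); have [H2 _] := HWV (unitc i 'i).
 by split; apply: is_derive_scal; [have [] := H1 s ls sh|have [] := H2 s ls sh].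
have VD i (s : R) : lo' < s -> s < hi' -> is_derive s 1 (fun t => Re (V t i)) (dpot m (X s) (unitc i 1) / m i) /\
    is_derive s 1 (fun t => Im (V t i)) (dpot m (X s) (unitc i 'i) / m i).
 move=> ls sh; have [H1 _] := HWV (unitc i 1); have [H2 _] := HWV (unitc i 'i).
 by rewrite ![_ / m i]mulrC; split; apply: is_derive_scal; [have [] := H1 s ls sh|have [] := H2 s ls sh].
have XE i s : lo' < s -> s < hi' -> lo <= s -> s <= hi -> X s i = xr i s +i* xi i s.
 move=> ls sh ls2 sh2; have [_ H1] := HWV (unitc i 1); have [_ H2] := HWV (unitc i 'i).
 apply/eqP; rewrite eq_complex /xr /xi -H1// -H2// !hre_unitc//=.
 by rewrite !mulr1 !mulr0 addr0 add0r !mulrA mi !mul1r !eqxx.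
exists V; split.
- by move=> s i; exact: VD.
- by move=> i; exists (xr i), (xi i); split; [exact: XE|exact: xrD].
move=> s k ls sh k0.
have Kh0 : 0 <= hK m by exact: sqrtr_ge0.
have k'0 : 0 < k / (hK m + 1) by rewrite divr_gt0//; lra.
have ls' : lo' < s by lra. have sh' : s < hi' by lra.
have st (i : 'I_3) : exists2 r, 0 < r & forall x y : R, s - r < x -> x <= y -> y < s + r ->
  `|xr i y - xr i x - Re (V s i) * (y - x)| <= k / (hK m + 1) * (y - x) /\
  `|xi i y - xi i x - Im (V s i) * (y - x)| <= k / (hK m + 1) * (y - x).
 have [D1 D2] := VD i s ls' sh'.
 have [ra ra0 Ha] := strong_difference ls' sh' (fun s a b => (xrD i s a b).1) (is_derive_cvg D1) k'0.
 have [rb rb0 Hb] := strong_difference ls' sh' (fun s a b => (xrD i s a b).2) (is_derive_cvg D2) k'0.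
 exists (Num.min ra rb); first by rewrite lt_min ra0.
 move=> x y xs xy ys.
 have ma : Num.min ra rb <= ra by rewrite ge_min lexx.
 have mb : Num.min ra rb <= rb by rewrite ge_min lexx orbT.
 by split; [apply: Ha|apply: Hb] => //; move: xs ys ma mb; only_lra.
have [ra ra0 Ha] := st b1; have [rb rb0 Hb] := st b2; have [rc rc0 Hc] := st b3.
pose r := Num.min (Num.min ra (Num.min rb rc)) (Num.min (s - lo) (hi - s)).
have r0 : 0 < r by rewrite !lt_min ra0 rb0 rc0 !subr_gt0 ls.
have : r <= r by []; rewrite {2}/r !le_min => /andP[/andP[m1 /andP[m2 m3]] /andP[m4 m5]].
exists r => // x y xs xy ys.
have B0 : 0 <= k / (hK m + 1) * (y - x) by rewrite mulr_ge0 ?subr_ge0// ltW.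
apply: (@le_trans _ _ (hK m * (k / (hK m + 1) * (y - x)))); last first.
 rewrite mulrA ler_wpM2r ?subr_ge0// mulrA ler_pdivrMr; [|lra].
 by have := mulr_ge0 Kh0 (ltW k0); lra.
apply: (hnorm_le_coord m_gt0 B0) => i; clear B0 k'0 Kh0 ra0 rb0 rc0 r0 k0; rewrite /csub /cscale.
rewrite !reB !imB reZ imZ (XE i y) ?(XE i x) /=; [|have := lol; have := hih; move: xs xy ys m4 m5; only_lra..].
have C j : i = j -> (forall x y : R, s - r < x -> x <= y -> y < s + r ->
  `|xr j y - xr j x - Re (V s j) * (y - x)| <= k / (hK m + 1) * (y - x) /\
  `|xi j y - xi j x - Im (V s j) * (y - x)| <= k / (hK m + 1) * (y - x)) ->
  `|xr i y - xr i x - (y - x) * Re (V s i)| <= k / (hK m + 1) * (y - x) /\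
  `|xi i y - xi i x - (y - x) * Im (V s i)| <= k / (hK m + 1) * (y - x).
 by move=> -> H; have := H x y xs xy ys; rewrite ![(y - x) * _]mulrC.
have /or3P[/eqP e|/eqP e|/eqP e] : [|| i == b1, i == b2 | i == b3].
 by move: i {C}; apply: ord3_ind.
- by apply: (C _ e) => x' y' h1 h2 h3; apply: Ha => //; move: h1 h3 m1; only_lra.
- by apply: (C _ e) => x' y' h1 h2 h3; apply: Hb => //; move: h1 h3 m2; only_lra.
- by apply: (C _ e) => x' y' h1 h2 h3; apply: Hc => //; move: h1 h3 m3; only_lra.
Qed.

Section Interior.
Variable V : R -> config R.
Hypothesis strong : forall s k, lo < s -> s < hi -> 0 < k -> exists2 r, 0 < r & forall x y, s - r < x -> x <= y -> y < s + r ->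
     hnorm (csub (csub (X y) (X x)) (cscale (y - x) (V s))) <= k * (y - x).

Lemma hnorm_csub_le (a b : config R) : hnorm a <= hnorm (csub a b) + hnorm b.
Proof.
have {1}-> : a = cadd (csub a b) b by apply/funext => i; rewrite /cadd /csub subrK.
exact: hnormD.
Qed.

(** The lift moves no faster than arc length, which gives one inequality; projecting does not
    increase distances, so [arc_speed_le] gives the other. *)
Lemma speed_eq s : lo < s -> s < hi -> hnorm (V s) = f s.
Proof.
move=> ls sh; have N0 := hnorm_ge0 m (V s); have [f0 _] := f_sq ls sh.
have [nc _ _ _] := motion_at ls sh.
apply/eqP; rewrite eq_le; apply/andP; split; apply/ler_addgt0Pr => e e0.
 have e20 : 0 < e / 2 by lra.
 have [r r0 Hr] := strong ls sh e20.
 have [r2 r20 H2] := strong_difference ls sh (fun s ls sh => let: And4 _ _ D _ := motion_at ls sh in D) (f_continuous nc) e20.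
 pose d := Num.min r r2 / 2.
 have d0 : 0 < d by rewrite divr_gt0// lt_min r0.
 have d1 : d < r by have : Num.min r r2 <= r by [rewrite ge_min lexx]; move: d0; rewrite /d; lra.
 have d2 : d < r2 by have : Num.min r r2 <= r2 by [rewrite ge_min lexx orbT]; move: d0; rewrite /d; lra.
 have := Hr s (s + d) ltac:(lra) ltac:(lra) ltac:(lra).
 have := H2 s (s + d) ltac:(lra) ltac:(lra) ltac:(lra); rewrite ler_norml => /andP[_].
 have := X_step (s := s) (t := s + d) ltac:(lra).
 have := hnorm_csub_le (cscale (s + d - s) (V s)) (csub (X (s + d)) (X s)).
 rewrite (hnormN m (cscale _ _) _) hnorm_cscale; [|lra].
 rewrite (hnormN m (X s) (X (s + d))) -/(f s); have -> : s + d - s = d by ring.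
 move=> h1 h2 h3 h4; have : d * hnorm (V s) <= d * (f s + e) by lra.
 by rewrite ler_pM2l.
have [r r0 Hr] := strong ls sh e0.
apply: (@arc_speed_le s _ r ls sh _ r0); first lra.
move=> x y xs xy ys; have := Hr x y xs xy ys.
have := hnorm_csub_le (csub (X y) (X x)) (cscale (y - x) (V s)).
rewrite hnorm_cscale ?subr_ge0// => h1 h2; rewrite /p rdC rd_proj.
by apply: (le_trans (qdist_le_hnorm _ _ _)); lra.
Qed.

Lemma noncol_hnorm q : noncol (proj q) -> 0 < hnorm q.
Proof.
move=> [+ _ _]; rewrite rsep_proj => s0; rewrite lt0r hnorm_ge0 andbT; apply/eqP => e.
by have := sep_le_hnorm m_gt0 q b1 b2; rewrite e mulr0 leNgt s0.
Qed.

(** If [him] of position and velocity were nonzero, [qdist_le_him] would make the projected steps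
    shorter than the steps of the lift by a definite factor, and [arc_speed_le] would bound the
    speed strictly below its value. *)
Lemma angular_momentum_zero s : lo < s -> s < hi -> him (X s) (V s) = 0.
Proof.
have mark : True by [].
move=> ls sh; apply/eqP/negPn/negP => J0; set j := him (X s) (V s) in J0.
have [f0 _] := f_sq ls sh; rewrite -/(p s) -/(f s) in f0.
have [nc _ _ _] := motion_at ls sh.
have j0 : 0 < `|j| by rewrite normr_gt0.
have n0 := noncol_hnorm nc; have NV := hnorm_ge0 m (V s).
pose Rs := hnorm (X s) + 1; have R0 : 0 < Rs by rewrite /Rs; lra.
pose g := j ^+ 2 / (4 * Rs ^+ 2).
have j20 : 0 < j ^+ 2 by rewrite -real_normK ?num_real// exprn_gt0.
have g0 : 0 < g by rewrite divr_gt0// mulr_gt0// exprn_gt0.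
have R4 : 0 < 4 * Rs by lra.
have [k k0 [_ kR]] := small_factor j0 R4 ltr01.
have kj : k * Rs <= `|j| / 4 by lra.
have [r1 r10 H1] := strong ls sh k0.
have f4 : 0 < 4 * (f s + 1) by lra.
have [kf kf0 [kf1 kfg]] := small_factor g0 f4 ltr01.
have [r2 r20 H2] := strong_difference ls sh (fun s ls sh => let: And4 _ _ D _ := motion_at ls sh in D) (f_continuous nc) kf0.
have V4 : 0 < 4 * (hnorm (V s) + 1) by lra.
have [e3 e30 [e31 e3j]] := small_factor j0 V4 ltr01.
have [r3 /= r30 H3] : exists2 r, 0 < r & forall t, `|s - t| < r -> hnorm (csub (X s) (X t)) < e3.
 by have /nbhs_ballP[r r0 Hr] := X_close s e30; exists r => // t st; exact: Hr.
have [r4 /= r40 H4] : exists2 r, 0 < r & forall t, `|s - t| < r -> 0 < hnorm (X t).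
 exists (Num.min (s - lo) (hi - s)); first by rewrite lt_min !subr_gt0 ls.
 move=> t; rewrite lt_min => /andP[t1 t2]; apply: noncol_hnorm.
 have [] // := motion_at (s := t).
  by move: t1; rewrite ltr_norml => /andP[]; lra.
 by move: t2; rewrite ltr_norml => /andP[]; lra.
pose r := Num.min (Num.min r1 r2) (Num.min r3 r4).
have r0 : 0 < r by rewrite !lt_min r10 r20 r30.
have : r <= r by []; rewrite {2}/r !le_min => /andP[/andP[m1 m2] /andP[m3 m4]].
(* The alignment gains at least [g] in the squared speed, and [g / 2] of it pays for the variation
   of the speed near [s]. *)
pose c2 := f s ^+ 2 - g / 2.
have key x y : s - r < x -> x <= y -> y < s + r -> rd (p x) (p y) ^+ 2 <= c2 * (y - x) ^+ 2.
 move=> xs xy ys; clear R4 f4 V4 r10 r20 r30 r40 r0; rewrite /p rd_proj.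
 have xa : `|s - x| < r by rewrite ltr_norml; apply/andP; split; move: xs xy ys; only_lra.
 have ya : `|s - y| < r by rewrite ltr_norml; apply/andP; split; move: xs xy ys; only_lra.
 have Nx := H4 x (lt_le_trans xa m4); have Ny := H4 y (lt_le_trans ya m4).
 have Cx := H3 x (lt_le_trans xa m3); have Cy := H3 y (lt_le_trans ya m3).
 have NxR : hnorm (X x) <= Rs.
  have := hnorm_csub_le (X x) (X s); rewrite (hnormN m (X x) (X s)) /Rs; move: Cx e31; only_lra.
 have NyR : hnorm (X y) <= Rs.
  have := hnorm_csub_le (X y) (X s); rewrite (hnormN m (X y) (X s)) /Rs; move: Cy e31; only_lra.
 have dx : 0 <= y - x by rewrite subr_ge0.
 apply: (le_trans (qdist_le_him m_gt0 Nx Ny)).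
 have A : hnorm (csub (X x) (X y)) ^+ 2 <= ((f s + kf) * (y - x)) ^+ 2.
  have ge : 0 <= (f s + kf) * (y - x) by rewrite mulr_ge0// addr_ge0// ltW.
  rewrite ler_pXn2r ?nnegrE ?hnorm_ge0//.
  apply: (le_trans (X_step xy)); have := H2 x y ltac:(move: xs m2; only_lra) xy ltac:(move: ys m2; only_lra).
  by rewrite ler_norml -/(f s) => /andP[_]; only_lra.
 have B : `|j| / 2 * (y - x) <= `|him (X x) (X y)|.
  have E1 : him (X x) (X y) = (y - x) * j - (y - x) * him (csub (X s) (X x)) (V s) +
    him (X x) (csub (csub (X y) (X x)) (cscale (y - x) (V s))).
   by rewrite !himBr himZr himBl him0 /j; ring.
  have b1 : `|him (csub (X s) (X x)) (V s)| <= `|j| / 4.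
   apply: (le_trans (him_le m_gt0 _ _)); apply: (@le_trans _ _ (e3 * hnorm (V s))); last by move: e30 e3j; only_lra.
   by rewrite ler_wpM2r// ltW.
  have b2 : `|him (X x) (csub (csub (X y) (X x)) (cscale (y - x) (V s)))| <= `|j| / 4 * (y - x).
   apply: (le_trans (him_le m_gt0 _ _)).
   have := H1 x y ltac:(move: xs m1; only_lra) xy ltac:(move: ys m1; only_lra) => H.
   apply: (@le_trans _ _ (Rs * (k * (y - x)))); first by apply: ler_pM => //; exact: hnorm_ge0.
   by rewrite mulrA [Rs * k]mulrC ler_wpM2r.
  rewrite E1; set z1 := him (csub (X s) (X x)) (V s) in b1 *; set z2 := him (X x) _ in b2 *.
  have t1 : `|(y - x) * j| = (y - x) * `|j| by rewrite normrM ger0_norm.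
  have t2 : `|(y - x) * z1| <= (y - x) * (`|j| / 4) by rewrite normrM ger0_norm// ler_wpM2l.
  have := ler_normB ((y - x) * j - (y - x) * z1 + z2) (z2 - (y - x) * z1).
  have -> : (y - x) * j - (y - x) * z1 + z2 - (z2 - (y - x) * z1) = (y - x) * j by ring.
  have := ler_normB z2 ((y - x) * z1).
  by rewrite t1; move: t2 b2; only_lra.
 have B2 : (`|j| / 2 * (y - x)) ^+ 2 <= him (X x) (X y) ^+ 2.
  rewrite -[leRHS]real_normK ?num_real// ler_pXn2r// nnegrE ?normr_ge0//.
  by rewrite mulr_ge0//; lra.
 have B3 : g * (y - x) ^+ 2 <= him (X x) (X y) ^+ 2 / (hnorm (X x) * hnorm (X y)).
  have RR : hnorm (X x) * hnorm (X y) <= Rs ^+ 2 by rewrite expr2; apply: ler_pM => //; exact: hnorm_ge0.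
  rewrite ler_pdivlMr ?mulr_gt0//; apply: le_trans B2.
  have -> : (`|j| / 2 * (y - x)) ^+ 2 = g * (y - x) ^+ 2 * Rs ^+ 2.
   rewrite /g !exprMn real_normK ?num_real//; field; rewrite gt_eqF//.
  by rewrite ler_wpM2l// mulr_ge0 ?sqr_ge0// ltW.
 have A2 : ((f s + kf) * (y - x)) ^+ 2 <= (f s ^+ 2 + g / 2) * (y - x) ^+ 2.
  rewrite exprMn ler_wpM2r ?sqr_ge0//.
  have -> : (f s + kf) ^+ 2 = f s ^+ 2 + 2 * f s * kf + kf * kf by ring.
  have : kf * kf <= kf by rewrite -[leRHS]mulr1 ler_wpM2l// ltW.
  by move: kfg kf0; only_lra.
 by move: A A2 B3; rewrite /c2; only_lra.
have : f s <= sqrt c2.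
 apply: (@arc_speed_le s _ r ls sh (sqrtr_ge0 _) r0) => x y xs xy ys.
 have kk := key x y xs xy ys.
 have [c2n|c2p] := ltP c2 0.
  have : rd (p x) (p y) ^+ 2 <= 0 by apply: (le_trans kk); rewrite mulr_le0_ge0 ?sqr_ge0// ltW.
  move=> z; have : rd (p x) (p y) ^+ 2 = 0 by apply/eqP; rewrite eq_le z sqr_ge0.
  by move/eqP; rewrite sqrf_eq0 => /eqP ->; rewrite mulr_ge0 ?sqrtr_ge0 ?subr_ge0.
 have : rd (p x) (p y) ^+ 2 <= (sqrt c2 * (y - x)) ^+ 2 by rewrite exprMn (sqr_sqrtr c2p).
 by rewrite ler_pXn2r// nnegrE ?rd0// mulr_ge0 ?sqrtr_ge0 ?subr_ge0.
have [c2n|c2p] := leP c2 0; first by rewrite ler0_sqrtr//; lra.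
move=> le; have : f s ^+ 2 <= sqrt c2 ^+ 2 by rewrite ler_pXn2r// nnegrE ?sqrtr_ge0// ltW.
by rewrite sqr_sqrtr ?(ltW c2p)// /c2; move: g0; only_lra.
Qed.

End Interior.

Lemma collision_congr (q q' : config R) : congruent q q' -> collision q -> collision q'.
Proof. by move=> /asboolP[w [c [_ H]]] [i [j [ij e]]]; exists i, j; split=> //; rewrite !H e. Qed.

Lemma collisionP (q : config R) : collision q <-> ~ noncol (proj q).
Proof.
rewrite -rcollisionP /rcollision; split; apply: collision_congr; last exact: repr_proj.
by rewrite congruent_sym; exact: repr_proj.
Qed.

(** Energy and angular momentum are known for [lo < s < hi] and extend by continuity to the ends in
    [J]. Differentiating the centering of [X] centers the velocity, so that its mass norm is twice
    the kinetic energy. *)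
Lemma motion_newton (J : set R) :
 (forall s, J s -> [/\ lo <= s, s <= hi, lo' < s & s < hi']) ->
 newton_solution m h J (fun i s => X s i).
Proof.
move=> HJ; have l1 := lol; have l2 := lohi; have l3 := hih.
have [V [VD Xx strong]] := velocity.
have /choice[xr /choice[xi Hx]] := Xx.
have [[Xc _] _ _ _ _] := mot.
have mi i : m i != 0 by rewrite gt_eqF.
have Vc (s : R) : lo < s -> s < hi -> \sum_(i < 3) (m i)%:C * V s i = 0.
 move=> ls sh; rewrite sum3E; apply/eqP; rewrite eq_complex !reD !imD !reZ !imZ /=.
 have D i : is_derive s 1 (xr i) (Re (V s i)) /\ is_derive s 1 (xi i) (Im (V s i)).
  by have [_ H] := Hx i; apply: H; lra.
 have C t : lo < t -> t < hi -> m b1 * xr b1 t + m b2 * xr b2 t + m b3 * xr b3 t = 0 /\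
   m b1 * xi b1 t + m b2 * xi b2 t + m b3 * xi b3 t = 0.
  move=> lt th; have [h1 h2] := centered_coord (Xc t).
  have E i : X t i = xr i t +i* xi i t by have [H _] := Hx i; apply: H; lra.
  by rewrite !E /= in h1 h2.
 apply/andP; split; apply/eqP.
  apply: (is_derive_locally_zero ls sh (fun t lt th => (C t lt th).1)).
  by apply: is_derive_add; [apply: is_derive_add|]; apply: is_derive_scal; exact: (D _).1.
 apply: (is_derive_locally_zero ls sh (fun t lt th => (C t lt th).2)).
 by apply: is_derive_add; [apply: is_derive_add|]; apply: is_derive_scal; exact: (D _).2.
have Vcont (s : R) i : lo' < s -> s < hi' -> {for s, continuous (fun t => Re (V t i))} /\ {for s, continuous (fun t => Im (V t i))}.
 by move=> ls sh; have [D1 D2] := VD s i ls sh; split; [exact: is_derive_cvg D1|exact: is_derive_cvg D2].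
have energy (s : R) : J s -> \sum_(i < 3) 2^-1 * m i * normc (V s i) ^+ 2 - u s = 0.
 move=> /HJ[ls sh ls' sh'].
 apply: (@closure_zero R (fun t => \sum_(i < 3) 2^-1 * m i * normc (V t i) ^+ 2 - u t) s lo hi lohi ls sh).
  apply: cvgB; last exact: (u_continuous (nonc ls' sh')).
  apply: continuous_sum3 => i; have [c1 c2] := Vcont s i ls' sh'.
  have -> : (fun t => 2^-1 * m i * normc (V t i) ^+ 2) =
    (fun t => 2^-1 * m i * (Re (V t i) * Re (V t i) + Im (V t i) * Im (V t i))) by apply/funext => t; rewrite normcsq !expr2.
  by apply: cvgM; [exact: cvg_cst|apply: cvgD; apply: cvgM].
 move=> t lt th; have [_ f2] := f_sq lt th.
 have -> : \sum_(i < 3) 2^-1 * m i * normc (V t i) ^+ 2 = 2^-1 * \sum_(i < 3) m i * normc (V t i) ^+ 2.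
  by rewrite mulr_sumr; apply: eq_bigr => i _; ring.
 rewrite (hre_centered m_gt0 (Vc t lt th)) -hnorm_sq// (speed_eq strong lt th) /f f2 /u.
 by rewrite mulKf ?subrr.
have angular (s : R) : J s -> \sum_(i < 3) m i * Im (conjc (X s i) * V s i) = 0.
 move=> /HJ[ls sh ls' sh'].
 have imc (z w : R[i]) : Im (conjc z * w) = Re z * Im w - Im z * Re w by case: z w => ? ? [? ?] /=; ring.
 apply: (@closure_zero R (fun t => \sum_(i < 3) m i * Im (conjc (X t i) * V t i)) s lo hi lohi ls sh).
  apply: continuous_sum3 => i; have [c1 c2] := Vcont s i ls' sh'.
  have -> : (fun t => m i * Im (conjc (X t i) * V t i)) =
    (fun t => hre (X t) (unitc i 1) * Im (V t i) - hre (X t) (unitc i 'i) * Re (V t i)).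
   by apply/funext => t; rewrite imc !hre_unitc//=; ring.
  by apply: cvgB; apply: cvgM => //; exact: hre_X_continuous.
 by move=> t lt th; rewrite him_centered// (angular_momentum_zero strong lt th) oppr0.
exists (fun i s => V s i), (fun i s => ((m i)^-1)%:C * grad_potential m (X s) i) => s Js.
have [ls sh ls' sh'] := HJ s Js; have nc := nonc ls' sh'; split.
- by move/collisionP; apply.
- move=> i; have [XE XD] := Hx i; have [D1 D2] := VD s i ls' sh'; have [E1 E2] := XD s ls' sh'; split.
 + have XJ t : J t -> X t i = xr i t +i* xi i t by move=> /HJ[? ? ? ?]; exact: XE.
  split.
   by apply: (within_difference_quotient (f := fun t => Re (X t i)) Js _ E1) => t /XJ ->.
  by apply: (within_difference_quotient (f := fun t => Im (X t i)) Js _ E2) => t /XJ ->.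
 + have gE : grad_potential m (X s) i = dpot m (X s) (unitc i 1) +i* dpot m (X s) (unitc i 'i) by exact: grad_potential_dpot.
  rewrite /deriv_within gE reZ imZ /= ![(m i)^-1 * _]mulrC; split.
   exact: (within_difference_quotient (f := fun t => Re (V t i)) Js _ D1).
  exact: (within_difference_quotient (f := fun t => Im (V t i)) Js _ D2).
 + by rewrite mulrA -rmorphM /= mulfV// mul1r.
- exact: Xc.
- exact: angular.
- rewrite potential_proj rpot_noncol// -EFinB; congr (_%:E).
 by have := energy s Js; rewrite /u /p; lra.
Qed.

End Newton.

End Variation.

(** * From minimizers to minimal arcs and back to the parametrized curve *)

Section Minimizers.
Context {R : realType}.
Variable m : 'I_3 -> R.
Hypothesis m_gt0 : forall i, 0 < m i.
Variable h : R.
Hypothesis h_gt0 : 0 < h.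
Local Notation proj := (@reduced_proj R).
Local Notation rd := (rd m).
Local Notation om := (om m h).
Local Notation hill := (hill_region m h).
Local Notation W := (wlen rd om).
Local Notation gpath := (gpath m h).

Let rdx := rdxx m_gt0.

(** The arc length reparametrization inherits minimality, because any path of finite length and cost
    is a competitor for the action; finiteness of its cost comes from [minimal_gpath]. *)
Lemma minimizer_arc q0 q1 g t0 t1 : hill q0 -> hill q1 -> q0 <> q1 -> JM_minimizer m h q0 q1 g t0 t1 ->
 exists k L (l : R -> R), [/\ 0 < L, minimal_arc m h k L,
  {within `[t0, t1], continuous l} &
  [/\ (forall s t, t0 <= s -> s <= t -> t <= t1 -> l s <= l t), l t0 = 0, l t1 = L,
    (forall t, t0 <= t -> t <= t1 -> g t = k (l t)) &
    forall x, 0 <= x -> x <= L -> exists2 t, t0 <= t <= t1 & l t = x]].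
Proof.
move=> h0 h1 ne [[t01 /(abs_continuousP m_gt0) gac gh g0 g1] gmin].
have [k [L [l [[A gk lm l0 lL] [lc WE]]]]] := arc_of_ac m_gt0 h t01 gac.
have [L0 klip len] := A.
have k0 : k 0 = q0 by rewrite -l0 -gk// ltW.
have kL : k L = q1 by rewrite -lL -gk// ltW.
have Lp : 0 < L by rewrite lt0r L0 andbT; apply/eqP => e; apply: ne; rewrite -k0 -kL e.
have surj x : 0 <= x -> x <= L -> exists2 t, t0 <= t <= t1 & l t = x.
 move=> x0 xL; have [|t] := IVT (ltW t01) lc (v := x).
  by rewrite l0 lL min_l// max_r// x0.
 by rewrite in_itv /= => tI <-; exists t.
have kmin L' M : 0 <= L' -> gpath (k 0) (k L) L' M -> (W k 0 L <= M%:E)%E.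
 rewrite k0 kL => L'0 P; have L'1 : L' <= L' + 1 by lra.
 have [k' [k'lip k'0 k'1 k'h WM]] := gpath_longer m_gt0 L'0 L'1 h1 P.
 have L'p : 0 < L' + 1 by lra.
 have ac' : rd_ac m k' 0 (L' + 1) by exact: lip1_ac.
 apply: le_trans WM; rewrite -WE -(JM_action_wlen m_gt0 h L'p ac') -(JM_action_wlen m_gt0 h t01 gac); apply: gmin; split; [exact: L'p| | |exact: k'0|exact: k'1].
 - exact/(abs_continuousP m_gt0).
 - by move=> t /andP[? ?]; exact: k'h.
exists k, L, l; split => //; split => //.
- by move=> t t_ge0 tL; have [s /andP[s1 s2] <-] := surj t t_ge0 tL; rewrite -gk//; apply: gh; rewrite s1.
- have [M [L' [L'0 P _]]] := minimal_gpath m_gt0 h_gt0 h0 h1.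
 apply: (@wlen_fin R m m_gt0 h k L M) => //; apply: (kmin L') => //; by rewrite k0 kL.
Qed.

Lemma minimizer_exists q0 q1 : hill q0 -> hill q1 -> exists g t0 t1, JM_minimizer m h q0 q1 g t0 t1.
Proof.
move=> h0 h1; have [M [L [L0 P Mmin]]] := minimal_gpath m_gt0 h_gt0 h0 h1.
have L1 : L <= L + 1 by lra. have L1p : 0 < L + 1 by lra.
have [k [klip k0 kL kh WM]] := gpath_longer m_gt0 L0 L1 h1 P.
have kac : rd_ac m k 0 (L + 1) by exact: lip1_ac.
exists k, 0, (L + 1); split.
 split => //; first exact/(abs_continuousP m_gt0).
 by move=> t /andP[? ?]; exact: kh.
move=> k' s0 s1 [s01 /(abs_continuousP m_gt0) ac' h' e0 e1].
rewrite !JM_action_wlen//; apply: (le_trans WM).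
have [k2 [L2 [l [[A gk lm l0 lL] [lc WE]]]]] := arc_of_ac m_gt0 h s01 ac'.
have [L20 k2lip _] := A.
rewrite WE; have W0 : (0 <= W k2 0 L2)%E by apply: wlen_ge0 => // q; exact: om_ge0'.
have [->|fin] := eqVneq (W k2 0 L2) +oo%E; first exact: leey.
have finW : W k2 0 L2 \is a fin_num by rewrite ge0_fin_numE// ltey.
rewrite -(fineK finW) lee_fin; apply: (Mmin L2) => //.
exists k2; split => //.
- by rewrite -l0 -gk// ltW.
- by rewrite -lL -gk// ltW.
- move=> x x0 xL; have [|t] := IVT (ltW s01) lc (v := x).
  by rewrite l0 lL min_l// max_r// x0.
 by rewrite in_itv /= => /andP[t0 t1] <-; rewrite -gk//; apply: h'; rewrite t0.
- by rewrite fineK.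
Qed.

Section OneMinimizer.
Variables (k : R -> reduced R) (L : R) (g : R -> reduced R) (l : R -> R) (t0 t1 : R).
Hypothesis Lp : 0 < L.
Hypothesis kmin : minimal_arc m h k L.
Hypothesis lc : {within `[t0, t1], continuous l}.
Hypothesis lm : forall s t, t0 <= s -> s <= t -> t <= t1 -> l s <= l t.
Hypothesis l0 : l t0 = 0.
Hypothesis lL : l t1 = L.
Hypothesis gk : forall t, t0 <= t -> t <= t1 -> g t = k (l t).
Hypothesis surj : forall x, 0 <= x -> x <= L -> exists2 t, t0 <= t <= t1 & l t = x.

Lemma minimizer_collision_free : collision_free_inside g t0 t1.
Proof.
move=> t /andP[t0t tt1]; rewrite gk// rcollisionP => nc.
have t01 := le_trans t0t tt1.
have a0 : 0 <= l t by rewrite -l0; exact: lm.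
have aL : l t <= L by rewrite -lL; exact: lm.
have [e|n0] := eqVneq (l t) 0.
 left => s /andP[s1 s2]; rewrite !gk//; last exact: le_trans tt1.
 have st1 := le_trans s2 tt1.
 by congr k; apply/eqP; rewrite eq_le l0 -{2}l0 lm// -e lm.
have [e|nL] := eqVneq (l t) L.
 right => s /andP[s1 s2]; have s0 := le_trans t0t s1; rewrite !gk//.
 by congr k; apply/eqP; rewrite eq_le lm//= lL -e lm.
exfalso; apply: nc; apply: (minimal_noncol m_gt0 h_gt0 kmin).
 by rewrite lt0r n0.
by rewrite lt_neqAle nL.
Qed.

Lemma arc_not_constant a b : 0 <= a -> a < b -> b <= L -> ~ (forall x, a <= x -> x <= b -> k x = k a).
Proof.
move=> a0 ab bL H; have [[_ _ len] _ _ _] := kmin.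
have := len a b a0 (ltW ab) bL.
have -> : wlen rd one_weight k a b = 0%E.
 rewrite (wlen_ext rdx (k := fun=> k a) (ltW ab) H); last by move=> q; rewrite /one_weight.
 by apply: (wlen_const m_gt0); [move=> q; rewrite /one_weight|exact: ltW].
by move=> [] /esym/eqP; rewrite subr_eq0 gt_eqF.
Qed.

(** A boundary point inside the arc would make the curve pause from it to one end, while an arc
    length parametrization is constant on no interval. *)
Lemma interior_off_boundary : avoids_hill_boundary m h g t0 t1 ->
 forall x, 0 < x -> x < L -> ~ hill_boundary m h (k x).
Proof.
move=> av x x0 xL hb; have [t /andP[t0t tt1] e] := surj (ltW x0) (ltW xL).
have hb' : hill_boundary m h (g t) by rewrite gk// e.
have tI : t0 <= t <= t1 by rewrite t0t.
have t01 := le_trans t0t tt1.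
case: av => [av|av].
 apply: (@arc_not_constant 0 x (lexx 0) x0 (ltW xL)) => y y0 yx.
 have [s /andP[t0s st1] es] := surj y0 (le_trans yx (ltW xL)).
 have [st|/ltW ts] := leP s t.
  by rewrite -es -gk// (av t tI hb' s) ?t0s// gk// l0.
 have -> : y = x by apply/eqP; rewrite eq_le yx -e -es lm.
 by rewrite -e -gk// (av t tI hb' t) ?t0t ?lexx// gk// l0.
apply: (@arc_not_constant x L (ltW x0) xL (lexx L)) => y xy yL.
have [s /andP[t0s st1] es] := surj (le_trans (ltW x0) xy) yL.
have Et : k x = g t1 by rewrite -e -gk// (av t tI hb' t)// lexx tt1.
have [ts|/ltW st] := leP t s.
 by rewrite Et -es -gk// (av t tI hb' s)// ts.
have -> // : y = x by apply/eqP; rewrite eq_le xy andbT -e -es lm.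
Qed.

Lemma minimizer_solution : t0 <= t1 -> avoids_hill_boundary m h g t0 t1 ->
 exists (k' : R -> reduced R) (s0 s1 : R),
  [/\ s0 < s1, reparametrization g t0 t1 k' s0 s1 & reduced_solution m h k' s0 s1].
Proof.
move=> t01 /interior_off_boundary kint.
have [X [Th [Tb [G [lo [hi [lohi [Thm Thc Thlo Thhi] [Tbm Tbc Tb0 TbL ThTb] Xk mot]]]]]]]
 := minimal_motion m_gt0 h_gt0 kmin Lp kint.
have lb t : t0 <= t -> t <= t1 -> 0 <= l t /\ l t <= L.
 by move=> t0t tt1; rewrite -{1}l0 -lL; split; apply: lm.
exists (fun s => proj (X s)), lo, hi; split => //.
 exists (Tb \o l); split.
 - apply/subspace_continuousP => x xI.
  have /subspace_continuousP/(_ x xI) lx := lc.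
  exact: (@cvg_comp _ _ _ l Tb _ _ _ lx (Tbc (l x))).
 - move=> s t; rewrite !in_itv /= => /andP[s1 s2] /andP[u1 u2] st.
  by apply: Tbm; exact: lm.
 - by rewrite /= l0.
 - by rewrite /= lL.
 - by move=> t /andP[t0t tt1]; have [? ?] := lb t t0t tt1; rewrite /= Xk ThTb// gk.
have [[Xc _] _ _ _ _] := mot.
have nci s : lo < s -> s < hi -> noncol (proj (X s)) by move=> ls sh; have [] := motion_at mot ls sh.
(* Across an end without collision the time interval is enlarged by 1: [X] rests there, so its
   potential stays smooth. A collision end is not crossed. *)
have [lo' [lo1 lo2 lo3]] : exists lo', [/\ lo' <= lo, lo' < lo -> noncol (proj (X lo)) & noncol (proj (X lo)) -> lo' < lo].
 have [n|n] := pselect (noncol (proj (X lo))); first by exists (lo - 1); split => //; lra.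
 by exists lo; split => //; rewrite ltxx.
have [hi' [hi1 hi2 hi3]] : exists hi', [/\ hi <= hi', hi < hi' -> noncol (proj (X hi)) & noncol (proj (X hi)) -> hi < hi'].
 have [n|n] := pselect (noncol (proj (X hi))); first by exists (hi + 1); split => //; lra.
 by exists hi; split => //; rewrite ltxx.
have nonc s : lo' < s -> s < hi' -> noncol (proj (X s)).
 move=> ls sh; have [slo|los] := leP s lo.
  by rewrite Xk Thlo// -(Thlo lo (lexx lo)) -Xk; apply: lo2; exact: lt_le_trans slo.
 have [his|shi] := leP hi s; last exact: nci.
 by rewrite Xk Thhi// -(Thhi hi (lexx hi)) -Xk; apply: hi2; exact: le_lt_trans sh.
exists (fun i s => X s i); split => //.
- move=> i; split; apply: continuous_subspaceT => t.
  have -> : Re \o (fun s => X s i) = (fun s => (m i)^-1 * hre m (X s) (unitc i 1)).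
   by apply/funext => s /=; rewrite hre_unitc//= mulr1 mulr0 addr0 mulKf// gt_eqF.
  by apply: cvg_scal; exact: (hre_X_continuous m_gt0 Thc mot).
 have -> : Im \o (fun s => X s i) = (fun s => (m i)^-1 * hre m (X s) (unitc i 'i)).
  by apply/funext => s /=; rewrite hre_unitc//= mulr1 mulr0 add0r mulKf// gt_eqF.
 by apply: cvg_scal; exact: (hre_X_continuous m_gt0 Thc mot).
- by move=> s /andP[ls sh] /collisionP; apply; exact: nci.
apply: (motion_newton m_gt0 Thc mot lohi lo1 hi1 nonc) => s [/andP[ls sh] nc].
have n : noncol (proj (X s)) by apply: contrapT => n; apply: nc; exact/collisionP.
split => //.
- by move: ls; rewrite le_eqVlt => /orP[/eqP e|ls]; [rewrite -e; apply: lo3; rewrite e|exact: le_lt_trans ls].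
- by move: sh; rewrite le_eqVlt => /orP[/eqP e|sh]; [rewrite e; apply: hi3; rewrite -e|exact: lt_le_trans hi1].
Qed.

End OneMinimizer.
End Minimizers.

Theorem lemma1 (R : realType) (m : 'I_3 -> R) (h : R) (q0 q1 : reduced R)
    (m_gt0 : forall i, 0 < m i) (h_gt0 : 0 < h)
    (q0_hill : hill_region m h q0) (q1_hill : hill_region m h q1)
    (q0_neq_q1 : q0 <> q1) :
  (exists (g : R -> reduced R) (t0 t1 : R), JM_minimizer m h q0 q1 g t0 t1) /\
  (forall (g : R -> reduced R) (t0 t1 : R),
     JM_minimizer m h q0 q1 g t0 t1 ->
     collision_free_inside g t0 t1 /\
     (avoids_hill_boundary m h g t0 t1 ->
      exists (k : R -> reduced R) (s0 s1 : R),
        [/\ s0 < s1, reparametrization g t0 t1 k s0 s1 &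
            reduced_solution m h k s0 s1])).
Proof.
split; first exact: minimizer_exists.
move=> g t0 t1 gmin.
have [k [L [l [L0 kmin lc [lm l0 lL gk surj]]]]] := minimizer_arc m_gt0 h_gt0 q0_hill q1_hill q0_neq_q1 gmin.
have [[t01 _ _ _ _] _] := gmin.
split; first exact: (minimizer_collision_free m_gt0 h_gt0 kmin lm l0 lL gk).
exact: (minimizer_solution m_gt0 h_gt0 L0 kmin lc lm l0 lL gk surj (ltW t01)).
Qed.
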